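(* Let $B$ be the Bergman projection of the Hartogs triangle $\mathbb{H}=\{(w_1,w_2)\in\mathbb{C}^2:|w_1|<|w_2|<1\}$. (i) For every integer $k\ge 0$, $B$ maps the unweighted Sobolev space $W^{2k+1}(\mathbb{H})$ continuously into the weighted holomorphic Sobolev space $W^k(\mathbb{H},2k\Phi)\cap\mathcal{O}(\mathbb{H})$. (ii) If $f\in\mathcal{C}^\infty(\overline{\mathbb{H}})$, then $Bf\in\mathcal{C}^\infty(\overline{\mathbb{H}}\setminus\{0\})\cap\mathcal{O}(\mathbb{H})$. (iii) $B$ does not map the space $\mathcal{C}^\infty_0(\mathbb{H})$ of smooth functions with compact support in $\mathbb{H}$ into $W^1(\mathbb{H})\cap\mathcal{O}(\mathbb{H})$.
   Context: $\mathcal{O}(\mathbb{H})$ is the space of holomorphic functions on $\mathbb{H}$. The Bergman projection $B$ is the orthogonal projection from $L^2(\mathbb{H})$ (Lebesgue measure $dV$) onto the closed subspace $L^2(\mathbb{H})\cap\mathcal{O}(\mathbb{H})$. Put $\Phi(w)=-2\log|w_2|$, so that $e^{-\ell\Phi(w)}=|w_2|^{2\ell}$. For a multi-index $\alpha=(\alpha_1,\dots,\alpha_4)$ of non-negative integers, $|\alpha|=\sum_j\alpha_j$ and $$D^\alpha=\frac{\partial^{|\alpha|}}{\partial w_1^{\alpha_1}\,\partial\overline{w_1}^{\alpha_2}\,\partial w_2^{\alpha_3}\,\partial\overline{w_2}^{\alpha_4}}.$$ For integers $k\ge0$ and $\ell$, $W^k(\mathbb{H},\ell\Phi)$ is the space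 of locally integrable $f$ on $\mathbb{H}$ (weak derivatives) with $$\|f\|^2_{W^k(\mathbb{H},\ell\Phi)}=\sum_{|\alpha|\le k}\int_{\mathbb{H}}|w_2|^{2\ell}|D^\alpha f|^2\,dV<\infty,$$ and $W^k(\mathbb{H})=W^k(\mathbb{H},0)$ is the unweighted space. $\mathcal{C}^\infty(\overline{\mathbb{H}})$ (resp. $\mathcal{C}^\infty(\overline{\mathbb{H}}\setminus\{0\})$) denotes functions smooth on $\mathbb{H}$ and smooth up to all boundary points (resp. all boundary points except the origin), i.e. all partial derivatives extend continuously to $\overline{\mathbb{H}}$ (resp. $\overline{\mathbb{H}}\setminus\{0\}$). *)

(* Defs.v *)
From HB Require Import structures.
From mathcomp Require Import all_boot all_order all_algebra.
From mathcomp Require Import all_classical all_reals all_analysis.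
From mathcomp Require Import complex.

Set Implicit Arguments.
Unset Strict Implicit.
Unset Printing Implicit Defensive.

Import Order.TTheory GRing.Theory Num.Theory.
Import numFieldNormedType.Exports.

Local Open Scope classical_set_scope.
Local Open Scope ring_scope.
Local Open Scope complex_scope.

Local Notation normc := ComplexField.Normc.normc.

(* A copy of [m1 \x m2] that carries the sigma-finite instance: in
   MathComp-Analysis 1.16 the instance attached to [\x] itself is shadowed by
   the one for products of subprobabilities. *)
Section product_sigma_finite.
Local Open Scope ereal_scope.
Context d1 d2 (T1 : measurableType d1) (T2 : measurableType d2) (R : realType).
Variables (m1 : {sigma_finite_measure set T1 -> \bar R})
          (m2 : {sigma_finite_measure set T2 -> \bar R}).

Definition sfprod : set (T1 * T2) -> \bar R := m1 \x m2.

HB.instance Definition _ := Measure.on sfprod.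

Let sigma_finite_sfprod : sigma_finite setT sfprod.
Proof.
have /sigma_finiteP[F [TF ndF Foo]] := sigma_finiteT m1.
have /sigma_finiteP[G [TG ndG Goo]] := sigma_finiteT m2.
exists (fun n => F n `*` G n).
  rewrite -setXTT TF TG predeqE => -[x y]; split.
    move=> [/= [n _ Fnx] [k _ Gky]]; exists (maxn n k) => //; split.
    - by move: x Fnx; exact/subsetPset/ndF/leq_maxl.
    - by move: y Gky; exact/subsetPset/ndG/leq_maxr.
  by move=> [n _ []/= ? ?]; split; exists n.
move=> k; have [? ?] := Foo k; have [? ?] := Goo k.
split; first exact: measurableX.
by rewrite /sfprod product_measure1E// lte_mul_pinfty// ge0_fin_numE.
Qed.

HB.instance Definition _ :=
  Measure_isSigmaFinite.Build _ _ _ sfprod sigma_finite_sfprod.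

End product_sigma_finite.

(* Points of C^2 are given by real coordinates ((x1, y1), (x2, y2)) with
   w_j = x_j + i y_j, which provides the product topology, norm and
   sigma-algebra; the values of functions are in R[i]. *)
Notation C2 R := ((R * R) * (R * R))%type.

(* The same type, with the measurable structure over which [lebesgue_measure]
   is stated. *)
Notation mC2 R := ((measurableTypeR R * measurableTypeR R) *
                   (measurableTypeR R * measurableTypeR R))%type.

Section Definitions.
Context {R : realType}.
Local Notation C := R[i].
Local Notation Re := (@complex.Re R).
Local Notation Im := (@complex.Im R).
Local Notation Cfun := (C2 R -> C).
Implicit Types (Omega A K : set (C2 R)) (f g h phi : Cfun) (w v : C2 R).

Definition dV : set (mC2 R) -> \bar R :=
  sfprod (sfprod (@lebesgue_measure R) (@lebesgue_measure R))
         (sfprod (@lebesgue_measure R) (@lebesgue_measure R)).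

HB.instance Definition _ := SigmaFiniteMeasure.on dV.

Definition w1 w : C := w.1.1 +i* w.1.2.
Definition w2 w : C := w.2.1 +i* w.2.2.

Definition hartogs : set (C2 R) := [set w | normc (w1 w) < normc (w2 w) < 1].

Definition ex1 : C2 R := ((1, 0), (0, 0)).
Definition ey1 : C2 R := ((0, 1), (0, 0)).
Definition ex2 : C2 R := ((0, 0), (1, 0)).
Definition ey2 : C2 R := ((0, 0), (0, 1)).

Definition real_basis (j : 'I_4) : C2 R := nth 0 [:: ex1; ey1; ex2; ey2] j.

Definition ccontinuous_at f w : Prop :=
  {for w, continuous (Re \o f)} /\ {for w, continuous (Im \o f)}.

Definition cderivable f w v : Prop :=
  derivable (Re \o f) w v /\ derivable (Im \o f) w v.

Definition cderive v f : Cfun :=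
  fun w => 'D_v (Re \o f) w +i* 'D_v (Im \o f) w.

Definition partials (s : seq 'I_4) f : Cfun :=
  foldr (fun j => cderive (real_basis j)) f s.

Definition Ck_on (k : nat) Omega f : Prop :=
  forall s : seq 'I_4, (size s <= k)%N -> forall w, Omega w ->
    ccontinuous_at (partials s f) w /\
    ((size s < k)%N -> forall j, cderivable (partials s f) w (real_basis j)).

Definition smooth_on Omega f : Prop := forall k, Ck_on k Omega f.

(* Functions smooth on Omega all of whose partial derivatives extend
   continuously to A, where Omega `<=` A `<=` closure Omega. *)
Definition smooth_upto Omega A f : Prop :=
  smooth_on Omega f /\
  forall s : seq 'I_4, exists g,
    [/\ {within A, continuous (Re \o g)}, {within A, continuous (Im \o g)} &
        forall w, Omega w -> g w = partials s f w].

Definition test_function Omega phi : Prop :=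
  smooth_on setT phi /\
  exists K, [/\ compact K, K `<=` Omega & forall w, ~ K w -> phi w = 0].

Definition dz (ex ey : C2 R) f : Cfun :=
  fun w => (cderive ex f w - 'i * cderive ey f w) / 2.
Definition dzbar (ex ey : C2 R) f : Cfun :=
  fun w => (cderive ex f w + 'i * cderive ey f w) / 2.

Definition dw1 := dz ex1 ey1.
Definition dw1bar := dzbar ex1 ey1.
Definition dw2 := dz ex2 ey2.
Definition dw2bar := dzbar ex2 ey2.

(* a 0, ..., a 3 are the orders in w1, conj w1, w2, conj w2. *)
Definition mdeg (a : 'I_4 -> nat) : nat := (\sum_(j < 4) a j)%N.

Definition Dmulti (a : 'I_4 -> nat) f : Cfun :=
  foldr (fun j => iter (a j) (nth id [:: dw1; dw1bar; dw2; dw2bar] j))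
        f (enum 'I_4).

Definition holomorphic Omega f : Prop :=
  Ck_on 1 Omega f /\ forall w, Omega w -> dw1bar f w = 0 /\ dw2bar f w = 0.

Definition cmeasurable Omega f : Prop :=
  measurable_fun (Omega : set (mC2 R)) (Re \o f : mC2 R -> R) /\
  measurable_fun (Omega : set (mC2 R)) (Im \o f : mC2 R -> R).

Definition cintegral Omega f : C :=
  (\int[dV]_(w in Omega) Re (f w)) +i* (\int[dV]_(w in Omega) Im (f w)).

Definition L2 Omega f : Prop :=
  cmeasurable Omega f /\
  (\int[dV]_(w in Omega) (normc (f w) ^+ 2)%:E < +oo)%E.

Definition L2inner Omega f g : C := cintegral Omega (fun w => f w * (g w)^*).

Definition bergman_space Omega : set Cfun :=
  [set h | L2 Omega h /\ holomorphic Omega h].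

Definition orthogonal_projection Omega (V : set Cfun) f h : Prop :=
  V h /\ forall g, V g -> L2inner Omega (fun w => f w - h w) g = 0.

(* Only meaningful for f in L2 Omega; the chosen function is then determined
   on Omega, and depends only on the class of f modulo null sets. *)
Definition bergman_projection Omega f : Cfun :=
  xget (fun=> 0) [set h | orthogonal_projection Omega (bergman_space Omega) f h].

Definition cloc_integrable Omega f : Prop :=
  cmeasurable Omega f /\
  forall K, K `<=` Omega -> compact K ->
    (\int[dV]_(w in K) (normc (f w))%:E < +oo)%E.

Definition weak_derivative Omega (a : 'I_4 -> nat) f g : Prop :=
  cloc_integrable Omega g /\
  forall phi, test_function Omega phi ->
    cintegral Omega (fun w => f w * Dmulti a phi w) =
    (-1) ^+ mdeg a * cintegral Omega (fun w => g w * phi w).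

(* Weak derivatives are unique up to null sets. *)
Definition weakD Omega (a : 'I_4 -> nat) f : Cfun :=
  xget (fun=> 0) [set g | weak_derivative Omega a f g].

Definition sobolev_sqnorm Omega (k : nat) (l : int) f : \bar R :=
  (\sum_(a : {ffun 'I_4 -> 'I_k.+1} | (mdeg (fun j => a j) <= k)%N)
    \int[dV]_(w in Omega)
      (normc (w2 w) ^ (2 * l) * normc (weakD Omega (fun j => a j) f w) ^+ 2)%:E)%E.

Definition sobolev_norm Omega (k : nat) (l : int) f : \bar R :=
  (sobolev_sqnorm Omega k l f `^ 2^-1)%E.

(* W^k(Omega, l Phi), with weight exp (- l Phi) = |w2|^(2 l). *)
Definition sobolev Omega (k : nat) (l : int) : set Cfun :=
  [set f | [/\ cloc_integrable Omega f,
     forall a : 'I_4 -> nat, (mdeg a <= k)%N -> exists g, weak_derivative Omega a f g &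
     (sobolev_norm Omega k l f < +oo)%E]].

Definition sobolev_continuous Omega (k : nat) (l : int) (k' : nat) (l' : int)
    (T : Cfun -> Cfun) : Prop :=
  forall f, sobolev Omega k l f -> forall e : R, 0 < e ->
  exists2 d : R, 0 < d & forall g, sobolev Omega k l g ->
    (sobolev_norm Omega k l (fun w => (g w - f w)%R) < d%:E)%E ->
    (sobolev_norm Omega k' l' (fun w => (T g w - T f w)%R) < e%:E)%E.

End Definitions.

(* Main.v *)
(** The monomials [w1 ^ a * w2 ^ b] with [0 <= a] and [0 <= m = a + b + 1] are an orthogonal
    basis of the Bergman space of the Hartogs triangle.  To see this, test the Cauchy-Riemann
    equations of [g] against conjugate monomials times cut-offs in [tau = |w1|^2 / |w2|^2] and
    [s = |w2|^2]: the pairing of [g] with [conj (w1 ^ a * w2 ^ b) A(tau) S(s)] must be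
    proportional to [(int_0^1 x^a A) (int_0^1 x^m S)].  Applied to [g = 1 / w2] this gives
    the norms of all monomials; applied to a [g] orthogonal to the basis it shows that [g]
    annihilates all polynomials in [w] and [conj w] times cut-offs, hence vanishes (peaking
    polynomials).  So [B f] is the sum of the orthogonal expansion of [f].

    The rotation fields [w_j d/dw_j - conj w_j d/d(conj w_j)] are tangential to the boundary and
    multiply the coefficients by the exponents [a] and [b].  Hence [k] derivatives of [f] bound
    the coefficients enough to differentiate [B f] up to [k] times in [L^2] after multiplication
    by [w2 ^ (2 * k)]; a function smooth up to the boundary has rapidly decreasing coefficients,
    so its series converges with all derivatives away from the origin.  Finally a cut-off
    function of [tau] and [s] divided by [w2] projects to a
    nonzero multiple of [1 / w2], whose derivative [- w2 ^ -2] is not square integrable. *)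
Require Import Defs.
From mathcomp Require Import all_boot all_order all_algebra.
From mathcomp Require Import all_classical all_reals all_analysis.
From mathcomp Require Import measurable_realfun complex.
From mathcomp Require Import ring lra.
Import Order.TTheory GRing.Theory Num.Theory.
Import numFieldNormedType.Exports.
Set Implicit Arguments.
Unset Strict Implicit.
Unset Printing Implicit Defensive.
Local Open Scope classical_set_scope.
Local Open Scope ring_scope.
Local Open Scope complex_scope.

Local Notation normc := ComplexField.Normc.normc.
Local Notation Re := (@complex.Re _).
Local Notation Im := (@complex.Im _).

(** * Real directional derivatives and Wirtinger derivatives of complex-valued functions on C^2 *)

Section Calculus.
Context {R : realType}.
Local Notation C := R[i].
Local Notation Cfun := (C2 R -> C).
Implicit Types (f g : Cfun) (w v : C2 R).

(** There is no passage to polar coordinates. Integration by parts alone shows that a pairing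
    depends on the cut-offs through two one-dimensional integrals. As [|w1^a w2^b|^2 = w2^-1
    conj(w2)^-1 tau^a sig^(a+b+1)], the norms of all monomials are instances of this law for the
    single function [1 / w2], with one common constant of which only the positivity matters. The
    obstacle is that [tau] and monomials with negative exponents are smooth only off the axes. Hence
    everything is tested against functions supported in [Ustar], and the null set [w1 = 0] is
    recovered by dominated convergence, Fatou or continuity. Since the tests do not see the axes,
    exponents with [a < 0] or [m < 0] cannot be excluded by regularity. They are excluded by growth:
    by Cauchy-Schwarz the square of such a pairing is at most linear in the cut-off integrals of
    [x^a] and [x^m], whose product is unbounded. Series are summed by total degree with explicit
    remainders and differentiated through Taylor's formula with uniform bounds on second
    derivatives, so that interior points and boundary points are treated alike. *)

Lemma ReD (x y : C) : Re (x + y) = Re x + Re y.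
Proof. by case: x y => [? ?] []. Qed.
Lemma ImD (x y : C) : Im (x + y) = Im x + Im y.
Proof. by case: x y => [? ?] []. Qed.
Lemma ReN (x : C) : Re (- x) = - Re x.
Proof. by case: x. Qed.
Lemma ImN (x : C) : Im (- x) = - Im x.
Proof. by case: x. Qed.
Lemma ReM (x y : C) : Re (x * y) = Re x * Re y - Im x * Im y.
Proof. by case: x y => [? ?] []. Qed.
Lemma ImM (x y : C) : Im (x * y) = Re x * Im y + Im x * Re y.
Proof. by case: x y => [? ?] []. Qed.
Lemma ReV (x : C) : Re x^-1 = Re x / (Re x ^+ 2 + Im x ^+ 2).
Proof. by case: x. Qed.
Lemma ImV (x : C) : Im x^-1 = - (Im x / (Re x ^+ 2 + Im x ^+ 2)).
Proof. by case: x. Qed.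
Lemma ReIm_eq (x y : C) : Re x = Re y -> Im x = Im y -> x = y.
Proof. by case: x y => [a b] [c d] /= -> ->. Qed.
Lemma sqr_ReIm_neq0 (x : C) : x != 0 -> Re x ^+ 2 + Im x ^+ 2 != 0.
Proof.
case: x => a b; rewrite eq_complex /= => /negP n0; apply/eqP => /eqP.
by rewrite paddr_eq0 ?sqr_ge0// !sqrf_eq0 => /n0.
Qed.
Definition ReImE := (ReD, ImD, ReN, ImN, ReM, ImM).

(** Existence and value are kept together, because [cderive] by itself says nothing where no
    derivative exists. *)
Definition cis_derive w v f (l : C) : Prop :=
  is_derive w v (Re \o f) (Re l) /\ is_derive w v (Im \o f) (Im l).

Lemma cis_derive_cderive w v f l : cis_derive w v f l -> cderive v f w = l.
Proof. by case=> [[_ a] [_ b]]; rewrite /cderive a b; case: l {a b}. Qed.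

Lemma cis_derive_cderivable w v f l : cis_derive w v f l -> cderivable f w v.
Proof. by case=> [[a _] [b _]]; split. Qed.

Lemma cderivableP w v f : cderivable f w v -> cis_derive w v f (cderive v f w).
Proof. by case=> a b; split; exact: derivableP. Qed.

Lemma cis_derive_near w v f g l : (\near w, f w = g w) ->
  cis_derive w v f l -> cis_derive w v g l.
Proof.
move=> fg [a b]; split.
  by apply: near_eq_is_derive a; apply: filterS fg => x /= ->.
by apply: near_eq_is_derive b; apply: filterS fg => x /= ->.
Qed.

Lemma ccontinuous_near w f g : (\near w, f w = g w) ->
  ccontinuous_at f w -> ccontinuous_at g w.
Proof.
move=> fg [a b]; have e := nbhs_singleton fg; split.
  apply: cvg_trans; last first.
    by rewrite /= -e; exact: a.
  by apply: near_eq_cvg; apply: filterS fg => x /= ->.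
apply: cvg_trans; last first.
  by rewrite /= -e; exact: b.
by apply: near_eq_cvg; apply: filterS fg => x /= ->.
Qed.

Lemma cis_derive_cst w v (c : C) : cis_derive w v (fun=> c) 0.
Proof. by split; exact: is_derive_cst. Qed.

Lemma cis_deriveD w v f g a b : cis_derive w v f a -> cis_derive w v g b ->
  cis_derive w v (fun w => f w + g w) (a + b).
Proof.
move=> [fr fi] [gr gi]; split.
  rewrite ReD (_ : _ \o _ = (Re \o f) + (Re \o g)); first exact: is_deriveD.
  by apply/funext => x /=; rewrite ReD.
rewrite ImD (_ : _ \o _ = (Im \o f) + (Im \o g)); first exact: is_deriveD.
by apply/funext => x /=; rewrite ImD.
Qed.

Lemma is_deriveM_real (r s : C2 R -> R) w v dr ds :
  is_derive w v r dr -> is_derive w v s ds ->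
  is_derive w v (fun x => r x * s x) (r w * ds + dr * s w).
Proof.
move=> hr hs; apply: is_derive_eq (is_deriveM hr hs) _.
by rewrite /GRing.scale /= [dr * _]mulrC.
Qed.

Lemma cis_deriveM w v f g a b : cis_derive w v f a -> cis_derive w v g b ->
  cis_derive w v (fun w => f w * g w) (f w * b + a * g w).
Proof.
move=> [fr fi] [gr gi]; split.
  rewrite (_ : _ \o _ = (fun x => Re (f x) * Re (g x)) - (fun x => Im (f x) * Im (g x))).
    apply: is_derive_eq (is_deriveB (is_deriveM_real fr gr) (is_deriveM_real fi gi)) _.
    by rewrite !ReImE /=; ring.
  by apply/funext => x /=; rewrite ReM.
rewrite (_ : _ \o _ = (fun x => Re (f x) * Im (g x)) + (fun x => Im (f x) * Re (g x))).
  apply: is_derive_eq (is_deriveD (is_deriveM_real fr gi) (is_deriveM_real fi gr)) _.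
  by rewrite !ReImE /=; ring.
by apply/funext => x /=; rewrite ImM.
Qed.

Lemma is_deriveV_real (r : C2 R -> R) w v dr : r w != 0 -> is_derive w v r dr ->
  is_derive w v (fun x => (r x)^-1) (- (r w) ^- 2 * dr).
Proof.
move=> r0 [d1 d2]; apply: DeriveDef; first exact: derivableV.
by rewrite deriveV// d2.
Qed.

Lemma cis_deriveV w v f a : f w != 0 -> cis_derive w v f a ->
  cis_derive w v (fun w => (f w)^-1) (- ((f w)^-1 * (f w)^-1) * a).
Proof.
move=> f0 [fr fi]; have n0 := sqr_ReIm_neq0 f0.
pose q x := Re (f x) * Re (f x) + Im (f x) * Im (f x).
have q0 : q w != 0 by move: n0; rewrite !expr2.
have dq := is_deriveV_real q0 (@is_deriveD _ _ _ _ _ _ _ _ _ (is_deriveM_real fr fr) (is_deriveM_real fi fi)).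
split.
  rewrite (_ : _ \o _ = (fun x => Re (f x) * (q x)^-1)).
    apply: is_derive_eq (is_deriveM_real fr dq) _.
    by rewrite !ReImE !(ReV, ImV) /= /q -!expr2; field.
  by apply/funext => x /=; rewrite ReV !expr2.
rewrite (_ : _ \o _ = - (fun x => Im (f x) * (q x)^-1)).
  apply: is_derive_eq (is_deriveN (is_deriveM_real fi dq)) _.
  by rewrite !ReImE !(ReV, ImV) /= /q -!expr2; field.
by apply/funext => x /=; rewrite ImV !expr2.
Qed.

Let derivable_comp_line (g A : R -> R) :
  derivable g 0 1 -> derivable A (g 0) 1 -> derivable (A \o g) 0 1.
Proof.
move=> dg dA; have dg' := iffLR (derivable1_diffP _ _) dg.
have := differentiable_comp dg' (iffLR (derivable1_diffP _ _) dA).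
exact: (iffRL (derivable1_diffP _ _)).
Qed.

Let derive_line (h : C2 R -> R) v w :
  'D_v h w = ((fun t : R => h (t *: v + w))^`())%classic 0.
Proof.
rewrite derive1E /derive.
set g1 := fun h => h^-1 *: _; set g2 := fun h => h^-1 *: _.
suff -> : g1 = g2 by [].
by rewrite funeqE /g1 /g2 => t /=; rewrite addr0 scale0r add0r [_%:A]mulr1.
Qed.

(** Only a directional derivative of [r] is at hand, so both sides are restricted to the line
    [t *: v + w], where the chain rule in one variable applies. *)
Lemma is_derive_comp1 (r : C2 R -> R) (A : R -> R) w v dr dA :
  is_derive w v r dr -> is_derive (r w) 1 A dA ->
  is_derive w v (A \o r) (dA * dr).
Proof.
move=> [dr1 dr2] [dA1 dA2].
have e0 : r (0 *: v + w) = r w by rewrite scale0r add0r.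
have l2 : derivable A (r (0 *: v + w)) 1 by rewrite e0; exact: dA1.
have l1 := iffLR (derivable1P _ _ _) dr1.
have d := derivable_comp_line l1 l2.
apply: DeriveDef; first exact: (iffRL (derivable1P _ _ _) d).
rewrite derive_line -dA2 -e0 -derive1E -dr2 derive_line.
exact: (@derive1_comp R _ A 0 l1 l2).
Qed.

Lemma cis_derive_comp w v (r : C2 R -> R) (A : R -> R) a dA :
  cis_derive w v (fun w => (r w)%:C) a -> is_derive (r w) 1 A dA ->
  cis_derive w v (fun w => (A (r w))%:C) (dA%:C * a).
Proof.
move=> [dr di] hA; rewrite /= in dr di.
have {dr} : is_derive w v r (Re a) by [].
have ia : Im a = 0.
  by case: di => _ <-; case: (is_derive_cst (0:R) w v) => _.
move=> dr; split; rewrite !ReImE /= ia mul0r ?mulr0 ?subr0 ?addr0.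
  exact: is_derive_comp1 hA.
exact: is_derive_cst.
Qed.

(** Inverts the Wirtinger formulas: [d/dx = d/dw + d/dconj w] and [d/dy = i (d/dw - d/dconj w)], for
    each of the two variables. *)
Definition rb (j : 'I_4) (d : 'I_4 -> C) : C :=
  nth 0 [:: d 0 + d 1; 'i * (d 0 - d 1); d 2 + d 3; 'i * (d 2 - d 3)] j.

(* [d] lists the derivatives of [f] at [w] in w1, conj w1, w2, conj w2. *)
Definition wder f w (d : 'I_4 -> C) : Prop :=
  ccontinuous_at f w /\ forall j, cis_derive w (real_basis j) f (rb j d).

Lemma rbP (P : 'I_4 -> Prop) : P 0 -> P 1 -> P 2 -> P 3 -> forall j, P j.
Proof.
move=> p0 p1 p2 p3; case=> [[|[|[|[|//]]]]] i.
- by rewrite (_ : Ordinal i = 0)//; exact: val_inj.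
- by rewrite (_ : Ordinal i = 1)//; exact: val_inj.
- by rewrite (_ : Ordinal i = 2)//; exact: val_inj.
- by rewrite (_ : Ordinal i = 3)//; exact: val_inj.
Qed.

Definition Dj (j : 'I_4) : Cfun -> Cfun := nth id [:: dw1; dw1bar; dw2; dw2bar] j.

Lemma sqri : 'i * 'i = -1 :> C. Proof. by rewrite -expr2 sqr_i. Qed.

Lemma half2 (x : C) : (x + x) / 2 = x.
Proof. by rewrite -mulr2n -[x *+ 2]mulr_natr mulfK// pnatr_eq0. Qed.

Let wirtinger (x y : C) : (x + y - 'i * ('i * (x - y))) / 2 = x.
Proof. by rewrite mulrA sqri mulN1r opprK addrACA subrr addr0 half2. Qed.

Let wirtinger_bar (x y : C) : (x + y + 'i * ('i * (x - y))) / 2 = y.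
Proof. by rewrite mulrA sqri mulN1r opprB addrC addrA subrK half2. Qed.

Lemma wder_Dj f w d j : wder f w d -> Dj j f w = d j.
Proof.
move=> [_ dr].
have d0 := cis_derive_cderive (dr 0); have d1 := cis_derive_cderive (dr 1).
have d2 := cis_derive_cderive (dr 2); have d3 := cis_derive_cderive (dr 3).
rewrite /rb /= in d0 d1 d2 d3.
elim/rbP: j; rewrite /Dj /= /dw1 /dw1bar /dw2 /dw2bar /dz /dzbar.
- by rewrite (_ : cderive ex1 f w = d 0 + d 1)// (_ : cderive ey1 f w = 'i * (d 0 - d 1)) ?wirtinger.
- by rewrite (_ : cderive ex1 f w = d 0 + d 1)// (_ : cderive ey1 f w = 'i * (d 0 - d 1)) ?wirtinger_bar.
- by rewrite (_ : cderive ex2 f w = d 2 + d 3)// (_ : cderive ey2 f w = 'i * (d 2 - d 3)) ?wirtinger.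
- by rewrite (_ : cderive ex2 f w = d 2 + d 3)// (_ : cderive ey2 f w = 'i * (d 2 - d 3)) ?wirtinger_bar.
Qed.

(** Pure algebra in the values of [cderive], hence valid even where [f] is not differentiable. *)
Lemma cderive_Dj (f : Cfun) w j :
  cderive (real_basis j) f w = rb j (fun k => Dj k f w).
Proof.
have e1 (x y : C) : x = ((x - y) / 2 + (x + y) / 2).
  by rewrite -mulrDl -[LHS]half2; congr (_ / _); ring.
have e2 (x y : C) : y = 'i * ((x - 'i * y) / 2 - (x + 'i * y) / 2).
  rewrite -mulrBl mulrA (_ : 'i * (x - _ - _) = - ('i * 'i) * (y + y)); last by ring.
  by rewrite sqri opprK mul1r half2.
by elim/rbP: j; rewrite /rb /Dj /= /dw1 /dw1bar /dw2 /dw2bar /dz /dzbar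
  ?(e1 _ ('i * _)) -?e1 -?e2.
Qed.

Lemma wderP f w : ccontinuous_at f w -> (forall j, cderivable f w (real_basis j)) ->
  wder f w (fun j => Dj j f w).
Proof.
by move=> cf df; split => // j; rewrite -cderive_Dj; exact: cderivableP.
Qed.

Lemma wder_near f g w d : (\near w, f w = g w) -> wder f w d -> wder g w d.
Proof.
move=> fg [a b]; split; first exact: ccontinuous_near fg a.
by move=> j; exact: cis_derive_near fg (b j).
Qed.

Lemma rb0 j : rb j (fun=> 0) = 0.
Proof. by elim/rbP: j; rewrite /rb /= ?addr0 ?subr0 ?mulr0. Qed.

Lemma rbD j d e : rb j (fun k => d k + e k) = rb j d + rb j e.
Proof. by elim/rbP: j; rewrite /rb /=; ring. Qed.

Lemma rbZ j c d : rb j (fun k => c * d k) = c * rb j d.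
Proof. by elim/rbP: j; rewrite /rb /=; ring. Qed.

Lemma ccontinuousD f g w : ccontinuous_at f w -> ccontinuous_at g w ->
  ccontinuous_at (fun w => f w + g w) w.
Proof.
move=> [fr fi] [gr gi]; split.
  rewrite (_ : _ \o _ = (fun x => (Re \o f) x + (Re \o g) x)).
    exact: continuousD.
  by apply/funext => x /=; rewrite ReD.
rewrite (_ : _ \o _ = (fun x => (Im \o f) x + (Im \o g) x)).
  exact: continuousD.
by apply/funext => x /=; rewrite ImD.
Qed.

Lemma ccontinuousM f g w : ccontinuous_at f w -> ccontinuous_at g w ->
  ccontinuous_at (fun w => f w * g w) w.
Proof.
move=> [fr fi] [gr gi]; split.
  rewrite (_ : _ \o _ = (fun x => (Re \o f) x * (Re \o g) x - (Im \o f) x * (Im \o g) x)).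
    by apply: continuousB; exact: continuousM.
  by apply/funext => x /=; rewrite ReM.
rewrite (_ : _ \o _ = (fun x => (Re \o f) x * (Im \o g) x + (Im \o f) x * (Re \o g) x)).
  by apply: continuousD; exact: continuousM.
by apply/funext => x /=; rewrite ImM.
Qed.

Lemma ccontinuous_cst (c : C) w : ccontinuous_at (fun=> c) w.
Proof. by split; exact: cvg_cst. Qed.

Lemma ccontinuousV f w : f w != 0 -> ccontinuous_at f w ->
  ccontinuous_at (fun w => (f w)^-1) w.
Proof.
move=> f0 [fr fi]; have n0 := sqr_ReIm_neq0 f0.
pose q x := (Re \o f) x * (Re \o f) x + (Im \o f) x * (Im \o f) x.
have q0 : q w != 0 by move: n0; rewrite !expr2.
have cq : {for w, continuous q}.
  by apply: continuousD; exact: continuousM.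
have cqV : {for w, continuous (fun x => (q x)^-1)} by exact: continuousV.
split.
  rewrite (_ : _ \o _ = (fun x => (Re \o f) x * (q x)^-1)); first exact: continuousM.
  by apply/funext => x /=; rewrite ReV !expr2.
rewrite (_ : _ \o _ = (fun x => - ((Im \o f) x * (q x)^-1))).
  by apply: continuousN; exact: continuousM.
by apply/funext => x /=; rewrite ImV !expr2.
Qed.

Lemma wder_cst (c : C) w : wder (fun=> c) w (fun=> 0).
Proof.
split; first exact: ccontinuous_cst.
by move=> j; rewrite rb0; exact: cis_derive_cst.
Qed.

Lemma wderD f g w d e : wder f w d -> wder g w e ->
  wder (fun w => f w + g w) w (fun k => d k + e k).
Proof.
move=> [cf df] [cg dg]; split; first exact: ccontinuousD.
by move=> j; rewrite rbD; exact: cis_deriveD.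
Qed.

Lemma wderM f g w d e : wder f w d -> wder g w e ->
  wder (fun w => f w * g w) w (fun k => f w * e k + d k * g w).
Proof.
move=> [cf df] [cg dg]; split; first exact: ccontinuousM.
move=> j; rewrite rbD rbZ (_ : rb j (fun k => d k * g w) = rb j d * g w).
  exact: cis_deriveM.
by rewrite mulrC -rbZ; congr rb; apply/funext => k; rewrite mulrC.
Qed.

Lemma wderV f w d : f w != 0 -> wder f w d ->
  wder (fun w => (f w)^-1) w (fun k => - ((f w)^-1 * (f w)^-1) * d k).
Proof.
move=> f0 [cf df]; split; first exact: ccontinuousV.
by move=> j; rewrite rbZ; exact: cis_deriveV.
Qed.

Lemma wder_comp (r : C2 R -> R) (A : R -> R) w d dA :
  wder (fun w => (r w)%:C) w d -> is_derive (r w) 1 A dA ->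
  wder (fun w => (A (r w))%:C) w (fun k => dA%:C * d k).
Proof.
move=> [[cr _] dr] hA; split; last first.
  by move=> j; rewrite rbZ; exact: cis_derive_comp.
split; last exact: cvg_cst.
have cA : {for r w, continuous A}.
  have [/derivable1_diffP h _] := hA; exact: differentiable_continuous.
have := @continuous_comp _ _ _ r A w cr cA; exact.
Qed.

End Calculus.

(** * Smooth functions of one real variable *)

Section Smooth1.
Context {R : realType}.
Implicit Types A B : R -> R.

(** Continuity is not asked at each order: in [smooth1] it follows from the existence of the next
    derivative. *)
Fixpoint C1k (k : nat) A : Prop :=
  if k is k'.+1 then exists2 A' : R -> R, (forall x : R, is_derive x 1 A (A' x)) & C1k k' A'
  else True.

Definition smooth1 A := forall k, C1k k A.

Lemma smooth1_derive A : smooth1 A ->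
  exists2 A' : R -> R, (forall x : R, is_derive x 1 A (A' x)) & smooth1 A'.
Proof.
move=> sA; have [A' dA _] := sA 1; exists A' => // k.
have [B dB sB] := sA k.+1.
(* The witnesses provided at different orders agree, since a derivative is unique. *)
suff -> : A' = B by [].
by apply/funext => x; have [_ <-] := dA x; have [_ <-] := dB x.
Qed.

(** Coinduction: smoothness is proved by exhibiting a class of functions stable under
    differentiation, without formulas for the higher derivatives. *)
Lemma smooth1_coind (P : (R -> R) -> Prop) :
  (forall A, P A -> exists2 A' : R -> R, (forall x : R, is_derive x 1 A (A' x)) & P A') ->
  forall A, P A -> smooth1 A.
Proof.
move=> h A PA k; elim: k A PA => //= k IH A /h [A' dA PA'].
by exists A' => //; exact: IH.
Qed.

(** The product and chain rules produce mixtures of sums, products and compositions. Closing under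
    all three at once yields a class stable under differentiation, to which [smooth1_coind]
    applies. *)
Inductive smooth1_gen : (R -> R) -> Prop :=
| smooth1_gen0 A : smooth1 A -> smooth1_gen A
| smooth1_genD A B : smooth1_gen A -> smooth1_gen B -> smooth1_gen (fun x => A x + B x)
| smooth1_genM A B : smooth1_gen A -> smooth1_gen B -> smooth1_gen (fun x => A x * B x)
| smooth1_gen_comp A B : smooth1_gen A -> smooth1_gen B -> smooth1_gen (fun x => A (B x)).

Lemma is_derive1M A B (x a b : R) : is_derive x 1 A a -> is_derive x 1 B b ->
  is_derive x 1 (fun x => A x * B x) (A x * b + a * B x).
Proof.
move=> hA hB; apply: is_derive_eq (is_deriveM hA hB) _.
by rewrite /GRing.scale /= [a * _]mulrC.
Qed.

Lemma is_derive1D A B (x a b : R) : is_derive x 1 A a -> is_derive x 1 B b ->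
  is_derive x 1 (fun x => A x + B x) (a + b).
Proof. by move=> hA hB; exact: is_deriveD. Qed.

Lemma is_derive1_compR A B (x a b : R) : is_derive (B x) 1 A a -> is_derive x 1 B b ->
  is_derive x 1 (fun x => A (B x)) (a * b).
Proof.
move=> [hA <-] [hB <-].
have hB' := iffLR (derivable1_diffP _ _) hB.
have := differentiable_comp hB' (iffLR (derivable1_diffP _ _) hA).
move=> /(iffRL (derivable1_diffP _ _)) h.
apply: DeriveDef; first exact: h.
rewrite -!derive1E; exact: (@derive1_comp R B A x hB hA).
Qed.

Lemma smooth1_gen_derive A : smooth1_gen A ->
  exists2 A' : R -> R, (forall x : R, is_derive x 1 A (A' x)) & smooth1_gen A'.
Proof.
elim=> {A} [A /smooth1_derive[A' dA sA]|A B sA [A' dA sA'] sB [B' dB sB']|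
  A B sA [A' dA sA'] sB [B' dB sB']|A B sA [A' dA sA'] sB [B' dB sB']].
- by exists A' => //; exact: smooth1_gen0.
- exists (fun x => A' x + B' x); last exact: smooth1_genD.
  by move=> x; exact: is_derive1D.
- exists (fun x => A x * B' x + A' x * B x).
    by move=> x; exact: is_derive1M.
  by apply: smooth1_genD; exact: smooth1_genM.
- exists (fun x => A' (B x) * B' x); first by move=> x; exact: is_derive1_compR.
  by apply: smooth1_genM => //; exact: smooth1_gen_comp.
Qed.

Lemma smooth1_genP A : smooth1_gen A -> smooth1 A.
Proof. exact: smooth1_coind smooth1_gen_derive A. Qed.

Lemma smooth1D A B : smooth1 A -> smooth1 B -> smooth1 (fun x => A x + B x).
Proof. by move=> ? ?; apply: smooth1_genP; apply: smooth1_genD; exact: smooth1_gen0. Qed.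
Lemma smooth1M A B : smooth1 A -> smooth1 B -> smooth1 (fun x => A x * B x).
Proof. by move=> ? ?; apply: smooth1_genP; apply: smooth1_genM; exact: smooth1_gen0. Qed.
Lemma smooth1_comp A B : smooth1 A -> smooth1 B -> smooth1 (fun x => A (B x)).
Proof. by move=> ? ?; apply: smooth1_genP; apply: smooth1_gen_comp; exact: smooth1_gen0. Qed.

Lemma smooth1_cst (c : R) : smooth1 (fun=> c).
Proof.
apply: (@smooth1_coind (fun A => exists c, A = fun=> c)); last by exists c.
move=> _ [d ->]; exists (fun=> 0); last by exists 0.
by move=> x; exact: is_derive_cst.
Qed.

Lemma smooth1_id : smooth1 (fun x => x).
Proof.
apply: (@smooth1_coind (fun A => A = id \/ exists c, A = fun=> c)); last by left.
move=> _ [->|[d ->]].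
  by exists (fun=> 1); [move=> x; exact: is_derive_id|right; exists 1].
exists (fun=> 0); last by right; exists 0.
by move=> x; exact: is_derive_cst.
Qed.

Lemma smooth1_continuous A : smooth1 A -> continuous A.
Proof.
move=> /smooth1_derive[A' dA _] x; have [/derivable1_diffP h _] := dA x.
exact: differentiable_continuous.
Qed.

End Smooth1.

(** * Elementary functions, and test functions built from them *)

Section Elem.
Context {R : realType}.
Local Notation C := R[i].
Local Notation Cfun := (C2 R -> C).
Implicit Types (f g : Cfun) (w : C2 R) (U Omega : set (C2 R)).

(** The difference quotient of a real-linear map is constant. *)
Lemma is_derive_coord (a : C2 R -> R) w v : (forall x y, a (x + y) = a x + a y) ->
  (forall (k : R) x, a (k *: x) = k * a x) -> is_derive w v a (a v).
Proof.
move=> aD aZ.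
have e : (fun h : R => h^-1 *: ((a \o shift w) (h *: v) - a w)) @ 0^' --> a v.
  apply: cvg_near_cst.
  near=> h; rewrite /= aD aZ addrK /GRing.scale /= mulKf//.
  by near: h; exact: nbhs_dnbhs_neq.
apply: DeriveDef; first by apply/cvg_ex; exists (a v).
exact: cvg_lim e.
Unshelve. all: by end_near. Qed.

Definition w1b w : C := (w1 w)^*.
Definition w2b w : C := (w2 w)^*.

Definition dlt (j : 'I_4) : 'I_4 -> C := fun k => (k == j)%:R.

Lemma cont_x1 : continuous (fun w : C2 R => w.1.1).
Proof. by move=> w; apply: (@continuous_comp _ _ _ fst fst); exact: cvg_fst. Qed.
Lemma cont_y1 : continuous (fun w : C2 R => w.1.2).
Proof. by move=> w; apply: (@continuous_comp _ _ _ fst snd); [exact: cvg_fst|exact: cvg_snd]. Qed.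
Lemma cont_x2 : continuous (fun w : C2 R => w.2.1).
Proof. by move=> w; apply: (@continuous_comp _ _ _ snd fst); [exact: cvg_snd|exact: cvg_fst]. Qed.
Lemma cont_y2 : continuous (fun w : C2 R => w.2.2).
Proof. by move=> w; apply: (@continuous_comp _ _ _ snd snd); exact: cvg_snd. Qed.

Let rbdlt (f : Cfun) w (j : 'I_4) :
  (forall k, cis_derive w (real_basis k) f (nth 0 (nth nil
    [:: [:: 1; 'i; 0; 0]; [:: 1; - 'i; 0; 0]; [:: 0; 0; 1; 'i]; [:: 0; 0; 1; - 'i]] j) k)) ->
  forall k, cis_derive w (real_basis k) f (rb k (dlt j)).
Proof.
move=> h k; rewrite (_ : rb k (dlt j) = nth 0 (nth nil
    [:: [:: 1; 'i; 0; 0]; [:: 1; - 'i; 0; 0]; [:: 0; 0; 1; 'i]; [:: 0; 0; 1; - 'i]] j) k)//.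
by elim/rbP: j {h}; elim/rbP: k; rewrite /rb /dlt /= ?subrr ?addr0 ?mulr0 ?subr0
  ?sub0r ?add0r ?mulr1 ?mulrN1.
Qed.

Ltac coord := apply: is_derive_eq;
  [apply: is_derive_coord => //|by rewrite //= ?oppr0].

Lemma wder_w1 w : wder w1 w (dlt 0).
Proof.
split; first by split; [exact: cont_x1|exact: cont_y1].
apply: rbdlt => k; split.
  by elim/rbP: k => /=; coord.
by elim/rbP: k => /=; coord.
Qed.

Lemma wder_w2 w : wder w2 w (dlt 2).
Proof.
split; first by split; [exact: cont_x2|exact: cont_y2].
apply: rbdlt => k; split.
  by elim/rbP: k => /=; coord.
by elim/rbP: k => /=; coord.
Qed.

Lemma wder_w1b w : wder w1b w (dlt 1).
Proof.
split; first by split; [exact: cont_x1|apply: continuousN; exact: cont_y1].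
apply: rbdlt => k; split.
  by elim/rbP: k => /=; coord.
have dN (x y : C2 R) : - (x + y).1.2 = - x.1.2 - y.1.2 by rewrite /= opprD.
have dZ (c : R) (x : C2 R) : - (c *: x).1.2 = c * - x.1.2 by rewrite /= mulrN.
by elim/rbP: k => /=; (apply: is_derive_eq; [apply: (is_derive_coord _ _ dN dZ)|rewrite //= ?oppr0]).
Qed.

Lemma wder_w2b w : wder w2b w (dlt 3).
Proof.
split; first by split; [exact: cont_x2|apply: continuousN; exact: cont_y2].
apply: rbdlt => k; split.
  by elim/rbP: k => /=; coord.
have dN (x y : C2 R) : - (x + y).2.2 = - x.2.2 - y.2.2 by rewrite /= opprD.
have dZ (c : R) (x : C2 R) : - (c *: x).2.2 = c * - x.2.2 by rewrite /= mulrN.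
by elim/rbP: k => /=; (apply: is_derive_eq; [apply: (is_derive_coord _ _ dN dZ)|rewrite //= ?oppr0]).
Qed.

(** A syntactic class closed under the four Wirtinger derivatives. Smoothness and the symmetry of
    second derivatives are then structural inductions. In the last constructor [r] is real-valued,
    since [A] is a function of a real variable. *)
Inductive elem U : Cfun -> Prop :=
| elem_cst c : elem U (fun=> c)
| elem_w1 : elem U w1
| elem_w1b : elem U w1b
| elem_w2 : elem U w2
| elem_w2b : elem U w2b
| elemD f g : elem U f -> elem U g -> elem U (fun w => f w + g w)
| elemM f g : elem U f -> elem U g -> elem U (fun w => f w * g w)
| elemV f : elem U f -> (forall w, U w -> f w != 0) -> elem U (fun w => (f w)^-1)
| elem_comp r A : elem U (fun w => (r w)%:C) -> smooth1 A ->
    elem U (fun w => (A (r w))%:C).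

Lemma elemN U f : elem U f -> elem U (fun w => - f w).
Proof.
move=> ef; rewrite (_ : (fun w => - f w) = fun w => (-1) * f w).
  by apply: elemM => //; exact: elem_cst.
by apply/funext => w; rewrite mulN1r.
Qed.

(** First and second derivatives are built in the same induction: the symmetry of the second
    derivatives of a product, inverse or composite is visible only on explicit formulas for both. *)
Lemma elem_wder U f : elem U f -> exists d (dd : 'I_4 -> 'I_4 -> Cfun),
  [/\ forall j, elem U (d j), forall i j, elem U (dd i j),
   forall w, U w -> wder f w (d^~ w),
   forall w i, U w -> wder (d i) w (fun j => dd i j w) &
   forall w i j, U w -> dd i j w = dd j i w].
Proof.
pose Q f := exists d (dd : 'I_4 -> 'I_4 -> Cfun),
  [/\ forall j, elem U (d j), forall i j, elem U (dd i j),
   forall w, U w -> wder f w (d^~ w),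
   forall w i, U w -> wder (d i) w (fun j => dd i j w) &
   forall w i j, U w -> dd i j w = dd j i w].
have c0 g l : (forall w, wder g w (dlt l)) -> Q g.
  move=> h; exists (fun j _ => dlt l j), (fun _ _ _ => 0); split => //.
  + by move=> j; exact: elem_cst.
  + by move=> i j; exact: elem_cst.
  + by move=> w i _; exact: wder_cst.
rewrite -/(Q f) => ef; elim: (ef) => {f ef}.
- move=> c; exists (fun _ _ => 0), (fun _ _ _ => 0); split => //.
  + by move=> j; exact: elem_cst.
  + by move=> i j; exact: elem_cst.
  + by move=> w _; exact: wder_cst.
  + by move=> w i _; exact: wder_cst.
- exact: c0 wder_w1.
- exact: c0 wder_w1b.
- exact: c0 wder_w2.
- exact: c0 wder_w2b.
- move=> f g ef [d [dd [e1 e2 h1 h2 s]]] eg [d' [dd' [e1' e2' h1' h2' s']]].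
  exists (fun j w => d j w + d' j w), (fun i j w => dd i j w + dd' i j w); split.
  + by move=> j; exact: elemD.
  + by move=> i j; exact: elemD.
  + by move=> w Uw; apply: wderD; [exact: h1|exact: h1'].
  + by move=> w i Uw; apply: wderD; [exact: h2|exact: h2'].
  + by move=> w i j Uw; rewrite s// s'.
- move=> f g ef [d [dd [e1 e2 h1 h2 s]]] eg [d' [dd' [e1' e2' h1' h2' s']]].
  exists (fun j w => f w * d' j w + d j w * g w),
    (fun i j w => (f w * dd' i j w + d j w * d' i w) + (d i w * d' j w + dd i j w * g w)).
  split.
  + by move=> j; apply: elemD; exact: elemM.
  + by move=> i j; do 2! [apply: elemD]; exact: elemM.
  + by move=> w Uw; apply: wderM; [exact: h1|exact: h1'].
  + move=> w i Uw; apply: wderD; apply: wderM => //.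
    * exact: h1.
    * exact: h2'.
    * exact: h2.
    * exact: h1'.
  + by move=> w i j Uw; rewrite s// s'//; ring.
- move=> f ef [d [dd [e1 e2 h1 h2 s]]] f0.
  have eV := elemV ef f0.
  pose q w := (f w)^-1.
  exists (fun j w => - (q w * q w) * d j w),
    (fun i j w => - (q w * q w) * dd i j w +
       (-1 * (q w * (- (q w * q w) * d j w) + (- (q w * q w) * d j w) * q w)) * d i w).
  have eq2 : elem U (fun w => - (q w * q w)) by apply: elemN; exact: elemM.
  split.
  + by move=> j; apply: elemM.
  + move=> i j; apply: elemD; apply: elemM => //; apply: elemM; first exact: elem_cst.
    by apply: elemD; apply: elemM => //; apply: elemM.
  + by move=> w Uw; apply: wderV; [exact: f0|exact: h1].
  + move=> w i Uw; apply: wderM; last exact: h2.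
    rewrite (_ : (fun w => - (q w * q w)) = (fun w => (-1) * (q w * q w))); last first.
      by apply/funext => x; rewrite mulN1r.
    have qd := wderV (f0 _ Uw) (h1 _ Uw).
    have := wderM (wder_cst (-1) w) (wderM qd qd).
    by congr wder; apply/funext => k; rewrite mul0r addr0.
  + by move=> w i j Uw; rewrite s//; ring.
- move=> r A er [d [dd [e1 e2 h1 h2 s]]] sA.
  have [A' dA sA'] := smooth1_derive sA; have [A'' dA' sA''] := smooth1_derive sA'.
  exists (fun j w => (A' (r w))%:C * d j w), (fun i j w =>
    (A' (r w))%:C * dd i j w + ((A'' (r w))%:C * d j w) * d i w).
  split.
  + by move=> j; apply: elemM => //; exact: elem_comp.
  + move=> i j; apply: elemD; apply: elemM => //; first exact: elem_comp.
    by apply: elemM => //; exact: elem_comp.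
  + by move=> w Uw; apply: wder_comp => //; exact: h1.
  + move=> w i Uw; apply: wderM; last exact: h2.
    by apply: wder_comp => //; exact: h1.
  + by move=> w i j Uw; rewrite s//; ring.
Qed.

Lemma partials_class (P : Cfun -> Prop) Omega : open Omega ->
  (forall f, P f -> forall j, exists2 g, P g &
     forall w, Omega w -> cis_derive w (real_basis j) f (g w)) ->
  forall f g s, P f -> (forall w, Omega w -> g w = f w) ->
  exists2 h, P h & forall w, Omega w -> partials s g w = h w.
Proof.
move=> oO Pd f g s Pf gf; elim: s => [|j s [h Ph hE]] /=; first by exists f.
have [h' Ph' h'E] := Pd _ Ph j; exists h' => // w Ow.
apply: cis_derive_cderive; apply: cis_derive_near (h'E _ Ow).
apply: filterS (open_nbhs_nbhs (conj oO Ow)) => x Ox.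
by rewrite hE.
Qed.

(** The analogue of [smooth1_coind] in several variables. The function [g] only has to agree on
    [Omega] with a member of the class, because [Omega] is open and derivatives are local. *)
Lemma smooth_class (P : Cfun -> Prop) Omega : open Omega ->
  (forall f, P f -> forall w, Omega w -> ccontinuous_at f w) ->
  (forall f, P f -> forall j, exists2 g, P g &
     forall w, Omega w -> cis_derive w (real_basis j) f (g w)) ->
  forall f g, P f -> (forall w, Omega w -> g w = f w) -> smooth_on Omega g.
Proof.
move=> oO Pc Pd f g Pf gf k s _ w Ow.
have [h Ph hE] := partials_class oO Pd s Pf gf.
have nb : \near w, h w = partials s g w.
  by apply: filterS (open_nbhs_nbhs (conj oO Ow)) => x Ox; rewrite hE.
split; first exact: ccontinuous_near nb (Pc _ Ph _ Ow).
move=> _ j; have [h' _ h'E] := Pd _ Ph j.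
exact/cis_derive_cderivable/(cis_derive_near nb (h'E _ Ow)).
Qed.

(** Two sets occur because the formula for [f] is smooth on [U] only, while its support has to lie
    in [Omega]. A compact support inside both makes [f] smooth everywhere, whatever values the
    formula takes off [U]. *)
Definition elem_test U Omega f : Prop := exists2 e, elem U e &
  (forall w, U w -> f w = e w) /\
  exists K, [/\ compact K, K `<=` U `&` Omega & forall w, ~ K w -> f w = 0].

Lemma closed_near0 (K : set (C2 R)) f w : compact K -> (forall w, ~ K w -> f w = 0) ->
  ~ K w -> \near w, 0 = f w.
Proof.
move=> cK f0 Kw; have oK : open (~` K).
  by rewrite openC; apply: compact_closed cK; exact: norm_hausdorff.
by apply: filterS (open_nbhs_nbhs (conj oK Kw)) => x Kx; rewrite f0.
Qed.

(** Near a point of the support [f] is its formula; near any other point it is zero. Local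
    statements about [f] therefore reduce to elementary functions. *)
Lemma elem_test_cases U Omega f w : open U -> elem_test U Omega f ->
  exists2 e, elem U e & (U w /\ \near w, e w = f w) \/ ((\near w, e w = f w) /\ e = fun=> 0).
Proof.
move=> oU [e ee [fe [K [cK KU K0]]]].
have [Kw|Kw] := pselect (K w).
  have Uw := (KU _ Kw).1; exists e => //; left; split => //.
  by apply: filterS (open_nbhs_nbhs (conj oU Uw)) => x Ux; rewrite fe.
exists (fun=> 0); first exact: elem_cst.
by right; split => //; exact: closed_near0 cK K0 Kw.
Qed.

Lemma elem_test_wder U Omega f w : open U -> elem_test U Omega f ->
  wder f w (fun j => Dj j f w).
Proof.
move=> oU tf; have [e ee [[Uw ef]|[ef e0]]] := elem_test_cases w oU tf.
  have [d [_ [_ _ h _ _]]] := elem_wder ee; have h' := wder_near ef (h w Uw).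
  rewrite (_ : (fun j => _) = d^~ w)//.
  by apply/funext => j; exact: wder_Dj h'.
have := wder_near ef; rewrite e0 => /(_ _ (wder_cst 0 w)) h'.
rewrite (_ : (fun j => _) = fun=> 0)//.
by apply/funext => j; exact: wder_Dj h'.
Qed.

Lemma elem_test_Dj U Omega f j : open U -> elem_test U Omega f ->
  elem_test U Omega (Dj j f).
Proof.
move=> oU tf; have [e ee [fe [K [cK KU K0]]]] := tf.
have [d [_ [de _ h _ _]]] := elem_wder ee.
exists (d j) => //; split.
  move=> w Uw; apply: (@wder_Dj _ f w (d^~ w)); apply: wder_near (h w Uw).
  by apply: filterS (open_nbhs_nbhs (conj oU Uw)) => x Ux; rewrite fe.
exists K; split => // w Kw.
apply: (@wder_Dj _ f w (fun=> 0)); apply: wder_near (wder_cst 0 w).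
exact: closed_near0 cK K0 Kw.
Qed.

(** On the support this is the symmetry recorded in [elem_wder]; off the support both sides
    vanish. *)
Lemma elem_test_DjC U Omega f i j : open U -> elem_test U Omega f ->
  Dj i (Dj j f) = Dj j (Dj i f).
Proof.
move=> oU tf; have [e ee [fe [K [cK KU K0]]]] := tf.
have [d [dd [de dde h h2 s]]] := elem_wder ee.
have nearU w : U w -> \forall x \near w, U x.
  by move=> Uw; exact: open_nbhs_nbhs.
have D1 k w : U w -> Dj k f w = d k w.
  move=> Uw; apply: (@wder_Dj _ f w (d^~ w)); apply: wder_near (h w Uw).
  by apply: filterS (nearU _ Uw) => x Ux; rewrite fe.
have D2 k l w : U w -> Dj l (Dj k f) w = dd k l w.
  move=> Uw; apply: (@wder_Dj _ _ w (fun l => dd k l w)); apply: wder_near (h2 w k Uw).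
  by apply: filterS (nearU _ Uw) => x Ux; rewrite D1.
have D0 k w : ~ K w -> Dj k f w = 0.
  move=> Kw; apply: (@wder_Dj _ f w (fun=> 0)); apply: wder_near (wder_cst 0 w).
  exact: closed_near0 cK K0 Kw.
have D00 k l w : ~ K w -> Dj l (Dj k f) w = 0.
  move=> Kw; apply: (@wder_Dj _ _ w (fun=> 0)); apply: wder_near (wder_cst 0 w).
  exact: (closed_near0 cK (D0 k) Kw).
apply/funext => w; have [Kw|Kw] := pselect (K w); last by rewrite !D00.
have Uw := (KU _ Kw).1; by rewrite !D2// s.
Qed.

Lemma elem_testM U Omega f g : elem U g -> elem_test U Omega f ->
  elem_test U Omega (fun w => g w * f w).
Proof.
move=> eg [e ee [fe [K [cK KU K0]]]]; exists (fun w => g w * e w); first exact: elemM.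
split; first by move=> w Uw; rewrite fe.
by exists K; split => // w Kw; rewrite K0// mulr0.
Qed.

Lemma elem_testD U Omega f g : elem_test U Omega f -> elem_test U Omega g ->
  elem_test U Omega (fun w => f w + g w).
Proof.
move=> [e ee [fe [K [cK KU K0]]]] [e' ee' [fe' [K' [cK' KU' K0']]]].
exists (fun w => e w + e' w); first exact: elemD.
split; first by move=> w Uw; rewrite fe// fe'.
exists (K `|` K'); split; first exact: compactU.
  by rewrite subUset.
by move=> w /not_orP[Kw Kw']; rewrite K0// K0'// addr0.
Qed.

Lemma elem_test_function U Omega f : open U -> elem_test U Omega f ->
  test_function Omega f.
Proof.
move=> oU tf; split; last first.
  have [e ee [fe [K [cK KU K0]]]] := tf.
  by exists K; split => // w Kw; exact: (KU _ Kw).2.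
apply: (@smooth_class (elem_test U Omega) setT openT _ _ f) => //.
- by move=> g tg w _; have [] := elem_test_wder w oU tg.
- move=> g tg j; exists (fun w => rb j (fun k => Dj k g w)).
    elim/rbP: j; rewrite /rb /=; first by apply: elem_testD; exact: elem_test_Dj.
    + apply/(elem_testM (elem_cst _ 'i))/elem_testD; first exact: elem_test_Dj.
      by under eq_fun do rewrite -mulN1r; apply/(elem_testM (elem_cst _ _))/elem_test_Dj.
    + by apply: elem_testD; exact: elem_test_Dj.
    + apply/(elem_testM (elem_cst _ 'i))/elem_testD; first exact: elem_test_Dj.
      by under eq_fun do rewrite -mulN1r; apply/(elem_testM (elem_cst _ _))/elem_test_Dj.
  by move=> w _; have [] := elem_test_wder w oU tg.
Qed.

End Elem.

(** * Fubini for bounded functions supported in a rectangle of finite measure *)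

Section ProductIntegral.
Context d1 d2 (T1 : measurableType d1) (T2 : measurableType d2) (R : realType).
Variables (m1 : {sigma_finite_measure set T1 -> \bar R})
          (m2 : {sigma_finite_measure set T2 -> \bar R}).

Lemma sfprodE (A : set T1) (B : set T2) : measurable A -> measurable B ->
  sfprod m1 m2 (A `*` B) = (m1 A * m2 B)%E.
Proof. exact: product_measure1E. Qed.

Lemma bounded_support_integrable d (T : measurableType d)
    (m : {measure set T -> \bar R}) (f : T -> R) (c : R) (A : set T) :
  measurable A -> (m A < +oo)%E -> measurable_fun setT f ->
  (forall z, `|f z| <= c) -> (forall z, ~ A z -> f z = 0) ->
  m.-integrable setT (EFin \o f).
Proof.
move=> mA Aoo mf fc f0.
have : m.-integrable A (EFin \o f).
  apply: measurable_bounded_integrable => //.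
    exact: measurable_funS mf.
  exists c; split; first exact: num_real.
  by move=> x cx z _ /=; apply: le_trans (fc z) (ltW cx).
move=> /(integrable_mkcond _ mA); congr (_.-integrable).
apply/funext => z /=; rewrite patchE; case: ifPn => // /negP.
by rewrite inE => /f0 ->.
Qed.

Variables (f : T1 * T2 -> R) (c : R) (A : set T1) (B : set T2).
Hypotheses (mA : measurable A) (mB : measurable B).
Hypotheses (Aoo : (m1 A < +oo)%E) (Boo : (m2 B < +oo)%E).
Hypotheses (mf : measurable_fun setT f) (fc : forall z, `|f z| <= c).
Hypothesis f0 : forall z, ~ (A `*` B) z -> f z = 0.

Lemma bounded_support_integrable_prod : (sfprod m1 m2).-integrable setT (EFin \o f).
Proof.
apply: (bounded_support_integrable (A := A `*` B) _ _ mf fc f0).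
  exact: measurableX.
by rewrite -[X in (X < _)%E]/(sfprod m1 m2 (A `*` B)) sfprodE// lte_mul_pinfty// ge0_fin_numE.
Qed.

(** A boundedly supported bounded function is integrable, and so is each of its slices, so Fubini
    reduces the double integral to slices of integral zero. *)
Lemma integral_prod_fst0 : (forall y, \int[m1]_x f (x, y) = 0) ->
  \int[sfprod m1 m2]_z f z = 0.
Proof.
move=> h; have i := bounded_support_integrable_prod.
rewrite /Rintegral -(integral21_prod_meas1 i) (eq_integral (fun=> 0%E)).
  by rewrite integral0.
(* A zero [Rintegral] could also come from an infinite integral, so the finiteness of the slice
   integral has to be supplied. *)
move=> y _; rewrite /fubini_G; have := h y; rewrite /Rintegral => /= e.
rewrite -[LHS]fineK/= ?e// ; apply: integrable_fin_num => //.
apply: (bounded_support_integrable (c := c) (A := A)) => //.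
  exact: measurableT_comp mf _.
by move=> x Ax; rewrite f0// => -[].
Qed.

Lemma integral_prod_snd0 : (forall x, \int[m2]_y f (x, y) = 0) ->
  \int[sfprod m1 m2]_z f z = 0.
Proof.
move=> h; have i := bounded_support_integrable_prod.
rewrite /Rintegral -(integral12_prod_meas1 i) (eq_integral (fun=> 0%E)).
  by rewrite integral0.
move=> y _; rewrite /fubini_F; have := h y; rewrite /Rintegral => /= e.
rewrite -[LHS]fineK/= ?e// ; apply: integrable_fin_num => //.
apply: (bounded_support_integrable (c := c) (A := B)) => //.
  exact: measurableT_comp mf _.
by move=> x Ax; rewrite f0// => -[].
Qed.

End ProductIntegral.

(** * Borel sets of C^2, and integrals of compactly supported partial derivatives *)

Section C2Measure.
Context {R : realType}.
Implicit Types (w : C2 R) (Omega K : set (C2 R)).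

Let cube (i : ((rat * rat) * (rat * rat)) * nat) : set (C2 R) :=
  (ball (ratr i.1.1.1 : R) i.2.+1%:R^-1 `*` ball (ratr i.1.1.2 : R) i.2.+1%:R^-1) `*`
  (ball (ratr i.1.2.1 : R) i.2.+1%:R^-1 `*` ball (ratr i.1.2.2 : R) i.2.+1%:R^-1).

(** The sigma-algebra is the product one, so openness has to be turned into countably many
    rectangles: an open set is the union of the cubes with rational centre and radius [1 / n.+1]
    that it contains. *)
Lemma open_measurableC2 Omega : open Omega -> measurable (Omega : set (mC2 R)).
Proof.
move=> oO.
have -> : Omega = \bigcup_i (if `[< cube i `<=` Omega >] then cube i else set0).
  apply/seteqP; split => [w Ow|w [i _]]; last by case: asboolP => // h /h.
  have /nbhs_ballP[e e0 he] : nbhs w Omega by exact: open_nbhs_nbhs.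
  have [n ne] : exists n, n.+1%:R^-1 < e / 2 :> R.
    have e20 : 0 < e / 2 by rewrite divr_gt0.
    have [n _ /(_ n (leqnn n)) h] := near_infty_natSinv_lt (PosNum e20).
    by exists n.
  have ap (x : R) : exists q, ball (ratr q : R) n.+1%:R^-1 x.
    have /rat_in_itvoo[q] : x - n.+1%:R^-1 < x + n.+1%:R^-1.
      by rewrite ltrD2l gtrN.
    rewrite in_itv /= => /andP[q1 q2]; exists q.
    move: q1 q2; rewrite /ball /= ltr_norml; move: (n.+1%:R^-1) (ratr q) => t u q1 q2.
    by apply/andP; split; lra.
  have [[[q1 h1] [q2 h2]] [[q3 h3] [q4 h4]]] :=
    ((ap w.1.1, ap w.1.2), (ap w.2.1, ap w.2.2)).
  exists (((q1, q2), (q3, q4)), n) => //.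
  have sub : cube (((q1, q2), (q3, q4)), n) `<=` Omega.
    move=> v [[a1 a2] [a3 a4]]; apply: he.
    have tri (q x y : R) : ball q n.+1%:R^-1 x -> ball q n.+1%:R^-1 y -> ball x e y.
      move=> h h'; apply: (le_ball _ (ball_triangle (ball_sym h) h')).
      by rewrite (splitr e) lerD// ltW.
    by split; split; [exact: tri h1 a1|exact: tri h2 a2|exact: tri h3 a3|exact: tri h4 a4].
  by case: asboolP.
apply: countable_bigcupT_measurable; first exact: countableP.
move=> i; case: ifP => // _.
by apply: (measurableX (T1 := (measurableTypeR R * measurableTypeR R)%type)
  (T2 := (measurableTypeR R * measurableTypeR R)%type));
  apply: measurableX; exact: measurable_ball.
Qed.

Lemma closed_measurableC2 K : closed K -> measurable (K : set (mC2 R)).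
Proof.
move=> cK; rewrite -[X in measurable X]setCK; apply: measurableC.
by apply: open_measurableC2; rewrite openC.
Qed.

Lemma compact_measurableC2 K : compact K -> measurable (K : set (mC2 R)).
Proof.
move=> cK; apply: closed_measurableC2; apply: compact_closed cK.
exact: norm_hausdorff.
Qed.

Lemma continuous_measurableC2 Omega (f : C2 R -> R) : open Omega ->
  (forall w, Omega w -> {for w, continuous f}) ->
  measurable_fun (Omega : set (mC2 R)) (f : mC2 R -> R).
Proof.
move=> oO cf; apply: (measurability _ (RGenOInfty.measurableE R)).
move=> /= _ [_ [a ->]] <-; apply: open_measurableC2.
rewrite openE => w [Ow]; rewrite /= in_itv /= andbT => aw.
rewrite /interior; apply: filterI; first exact: open_nbhs_nbhs.
have : nbhs (f w) [set x | a < x] by apply: open_nbhs_nbhs; split=> //; exact: open_gt.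
move=> /(cf _ Ow); apply: filterS => x /=.
by rewrite in_itv /= andbT.
Qed.

Lemma compact_box K : compact K -> exists2 M : R, 0 < M &
  forall w, K w -> [/\ `|w.1.1| <= M, `|w.1.2| <= M, `|w.2.1| <= M & `|w.2.2| <= M].
Proof.
move=> /compact_bounded[M [_ hM]]; exists (`|M| + 1); first by rewrite ltr_wpDl.
move=> w Kw.
have : `|w| <= `|M| + 1.
  by apply: hM => //; rewrite (le_lt_trans (ler_norm M))// ltrDl.
rewrite !prod_normE /= !ge_max.
by move=> /andP[/andP[-> ->] /andP[-> ->]].
Qed.

Definition box (M : R) : set (mC2 R) :=
  (`[- M, M]%classic `*` `[- M, M]%classic) `*` (`[- M, M]%classic `*` `[- M, M]%classic).

Lemma box_measurable (M : R) : measurable (box M).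
Proof. by apply: measurableX; apply: measurableX; exact: measurable_itv. Qed.

Definition itvM (M : R) : set (measurableTypeR R) := `[- M, M]%classic.

Lemma box_fin (M : R) : (sfprod (@lebesgue_measure R) (@lebesgue_measure R)
  (itvM M `*` itvM M) < +oo)%E.
Proof.
have h : (lebesgue_measure (itvM M) < +oo)%E.
  by rewrite lebesgue_measure_itv /=; case: ifP => // _; rewrite ltry.
by rewrite sfprodE; [rewrite lte_mul_pinfty// ge0_fin_numE|exact: measurable_itv|
  exact: measurable_itv].
Qed.

Lemma dV_box (M : R) : (dV (box M) < +oo)%E.
Proof.
have h := box_fin M; rewrite /dV /box sfprodE; first by rewrite lte_mul_pinfty// ge0_fin_numE.
  by apply: measurableX; exact: measurable_itv.
by apply: measurableX; exact: measurable_itv.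
Qed.

Lemma box_sub (M : R) w : `|w.1.1| <= M -> `|w.1.2| <= M -> `|w.2.1| <= M ->
  `|w.2.2| <= M -> box M w.
Proof. by rewrite !ler_norml /box /= => ? ? ? ?; split; split; rewrite /= in_itv. Qed.

Lemma dV_compact K : compact K -> (dV (K : set (mC2 R)) < +oo)%E.
Proof.
move=> cK; have [M _ KM] := compact_box cK.
apply: le_lt_trans (dV_box M); apply: le_measure; rewrite ?inE.
- exact: compact_measurableC2.
- exact: box_measurable.
- by move=> w /KM[? ? ? ?]; exact: box_sub.
Qed.

(** The fundamental theorem of calculus on an interval whose end points lie outside the support of
    [f]. *)
Lemma integral_derive1_0 (f f' : R -> R) (M : R) : 0 < M -> continuous f' ->
  (forall x : R, is_derive x 1 f (f' x)) ->
  (forall x, M < `|x| -> f x = 0 /\ f' x = 0) ->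
  \int[lebesgue_measure]_x f' x = 0.
Proof.
move=> M0 cf' df f0.
have fM : f (- (M + 1)) = 0 /\ f (M + 1) = 0.
  have M1 : 0 < M + 1 by lra.
  have n1 : M < `|M + 1| by rewrite gtr0_norm// ltrDl.
  by split; apply: (f0 _ _).1 => //; rewrite normrN.
(* [M + 1] instead of [M], because [f] is known to vanish only where [M < |x|]. *)
pose I : set R := `[- (M + 1), M + 1]%classic.
have e : (\int[lebesgue_measure]_(x in I) (f' x)%:E = 0)%E.
  rewrite (@continuous_FTC2 _ f' f).
  - by rewrite fM.1 fM.2 subee.
  - lra.
  - exact: continuous_subspaceT.
  - have cf : continuous f.
      move=> x; have [/derivable1_diffP h _] := df x.
      exact: differentiable_continuous.
    split.
    + by move=> x _; have [] := df x.
    + exact/cvg_at_right_filter/cf.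
    + exact/cvg_at_left_filter/cf.
  - by move=> x _; rewrite derive1E; have [_ ->] := df x.
suff -> : f' = f' \_ I by rewrite -Rintegral_mkcond /Rintegral e.
apply/funext => x; rewrite patchE; case: ifPn => //.
rewrite notin_setE /I /= in_itv /= => /negP; rewrite -ler_norml -ltNge => h.
by rewrite (f0 x _).2//; apply: lt_trans h; rewrite ltrDl.
Qed.

Lemma C2_eq (a b : C2 R) : a.1.1 = b.1.1 -> a.1.2 = b.1.2 -> a.2.1 = b.2.1 ->
  a.2.2 = b.2.2 -> a = b.
Proof. by case: a b => [[? ?] [? ?]] [[? ?] [? ?]] /= -> -> -> ->. Qed.

Lemma is_derive_line (p : R -> C2 R) v (s : R) (F : C2 R -> R) l :
  (forall t, p t = (t - s) *: v + p s) -> is_derive (p s) v F l ->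
  is_derive s 1 (F \o p) l.
Proof.
move=> pl [d1 d2].
have e : (fun h : R => h^-1 *: (((F \o p) \o shift s) (h *: 1) - (F \o p) s)) =
    (fun h : R => h^-1 *: ((F \o shift (p s)) (h *: v) - F (p s))).
  by apply/funext => h /=; rewrite (pl (_ + s)) [h *: 1]mulr1 addrK.
by apply: DeriveDef; [rewrite /derivable e|rewrite /derive e].
Qed.

(* Fubini: integrate first in the [j]-th variable. *)
Lemma integral_partial0 (F F' : C2 R -> R) (j : 'I_4) K : compact K ->
  continuous F' -> (forall w, is_derive w (real_basis j) F (F' w)) ->
  (forall w, ~ K w -> F w = 0 /\ F' w = 0) ->
  \int[dV]_w F' w = 0.
Proof.
move=> cK cF' dF F0; have [M M0 KM] := compact_box cK.
have mF' : measurable_fun (setT : set (mC2 R)) (F' : mC2 R -> R).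
  by apply: continuous_measurableC2; [exact: openT|move=> w _; exact: cF'].
have [c cb] : exists c : R, forall w, `|F' w| <= c.
  have := continuous_compact (continuous_subspaceT cF') cK.
  move=> /compact_bounded[N [_ hN]]; exists (`|N| + 1) => w.
  have [Kw|/F0[_ ->]] := pselect (K w).
    apply: hN; last by exists w.
    by rewrite (le_lt_trans (ler_norm N))// ltrDl.
  by rewrite normr0 addr_ge0.
pose I : set (measurableTypeR R) := `[- M, M]%classic.
have mI : measurable I by exact: measurable_itv.
have mII : measurable (I `*` I) by exact: measurableX.
have Ioo : (lebesgue_measure (I : set R) < +oo)%E.
  by rewrite lebesgue_measure_itv /=; case: ifP => // _; rewrite ltry.
(* On every line parallel to the [j]-th axis the integrand is an exact derivative of compact
   support. *)
have line (p : R -> C2 R) : (forall t s, p t = (t - s) *: real_basis j + p s) ->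
    (forall t, K (p t) -> `|t| <= M) -> \int[lebesgue_measure]_t F' (p t) = 0.
  move=> pl pK; apply: (@integral_derive1_0 (F \o p) (F' \o p) M) => //.
  - move=> t; apply: continuous_comp; last exact: cF'.
    rewrite (_ : p = fun t => t *: real_basis j + p 0); last first.
      by apply/funext => s; rewrite (pl s 0) subr0.
    by apply: continuousD; [exact: scalel_continuous|exact: cvg_cst].
  - by move=> t; exact: is_derive_line (pl^~ t) (dF _).
  - by move=> t Mt; apply: F0 => /pK; rewrite leNgt Mt.
have Fbox w : ~ box M w -> F' w = 0.
  by move=> nb; apply: (F0 w _).2 => /KM[? ? ? ?]; apply: nb; exact: box_sub.
have mI2 : (sfprod (@lebesgue_measure R) (@lebesgue_measure R) (I `*` I) < +oo)%E.
  exact: box_fin.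
elim/rbP: j {dF} line => line.
- apply: (integral_prod_fst0 (c := c) mII mII mI2 mI2 mF' cb Fbox) => q.
  have H := (@integral_prod_fst0 _ _ _ _ _ lebesgue_measure lebesgue_measure (fun p => F' (p, q)) c _ _ mI mI Ioo Ioo); apply: H.
  + exact: measurableT_comp mF' _.
  + by move=> z; exact: cb.
  + by move=> z nz; apply: Fbox => -[].
  move=> y; apply: (line (fun t => ((t, y), q))) => [t s|t /KM[]//].
  by apply: C2_eq; rewrite /= /GRing.scale /= ?mulr0 ?add0r ?mulr1 ?subrK.
- apply: (integral_prod_fst0 (c := c) mII mII mI2 mI2 mF' cb Fbox) => q.
  have H := (@integral_prod_snd0 _ _ _ _ _ lebesgue_measure lebesgue_measure (fun p => F' (p, q)) c _ _ mI mI Ioo Ioo); apply: H.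
  + exact: measurableT_comp mF' _.
  + by move=> z; exact: cb.
  + by move=> z nz; apply: Fbox => -[].
  move=> y; apply: (line (fun t => ((y, t), q))) => [t s|t /KM[]//].
  by apply: C2_eq; rewrite /= /GRing.scale /= ?mulr0 ?add0r ?mulr1 ?subrK.
- apply: (integral_prod_snd0 (c := c) mII mII mI2 mI2 mF' cb Fbox) => q.
  have H := (@integral_prod_fst0 _ _ _ _ _ lebesgue_measure lebesgue_measure (fun p => F' (q, p)) c _ _ mI mI Ioo Ioo); apply: H.
  + exact: measurableT_comp mF' _.
  + by move=> z; exact: cb.
  + by move=> z nz; apply: Fbox => -[].
  move=> y; apply: (line (fun t => (q, (t, y)))) => [t s|t /KM[]//].
  by apply: C2_eq; rewrite /= /GRing.scale /= ?mulr0 ?add0r ?mulr1 ?subrK.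
- apply: (integral_prod_snd0 (c := c) mII mII mI2 mI2 mF' cb Fbox) => q.
  have H := (@integral_prod_snd0 _ _ _ _ _ lebesgue_measure lebesgue_measure (fun p => F' (q, p)) c _ _ mI mI Ioo Ioo); apply: H.
  + exact: measurableT_comp mF' _.
  + by move=> z; exact: cb.
  + by move=> z nz; apply: Fbox => -[].
  move=> y; apply: (line (fun t => (q, (y, t)))) => [t s|t /KM[]//].
  by apply: C2_eq; rewrite /= /GRing.scale /= ?mulr0 ?add0r ?mulr1 ?subrK.
Qed.

End C2Measure.

(** * The modulus of complex numbers *)

Section Normc.
Context {R : realType}.
Implicit Types x y : R[i].

Lemma sqr_normcE x : normc x ^+ 2 = Re x ^+ 2 + Im x ^+ 2.
Proof. by case: x => a b; rewrite /= sqr_sqrtr// addr_ge0 ?sqr_ge0. Qed.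

Lemma normc_ge0 x : 0 <= normc x.
Proof. by case: x => a b; exact: sqrtr_ge0. Qed.

Lemma normc_gt0 x : x != 0 -> 0 < normc x.
Proof.
move=> x0; rewrite lt_neqAle normc_ge0 andbT eq_sym.
by apply: contra x0 => /eqP/ComplexField.Normc.eq0_normc ->.
Qed.

Lemma normc_eq0 x : (normc x == 0) = (x == 0).
Proof.
apply/eqP/eqP => [/ComplexField.Normc.eq0_normc//|->].
by rewrite /= expr0n addr0 sqrtr0.
Qed.

Lemma normRe_le x : `|Re x| <= normc x.
Proof.
rewrite -[leRHS]ger0_norm ?normc_ge0// -ler_sqr ?nnegrE// !real_normK ?num_real//.
by rewrite sqr_normcE lerDl sqr_ge0.
Qed.

Lemma normIm_le x : `|Im x| <= normc x.
Proof.
rewrite -[leRHS]ger0_norm ?normc_ge0// -ler_sqr ?nnegrE// !real_normK ?num_real//.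
by rewrite sqr_normcE lerDr sqr_ge0.
Qed.

Lemma normc_le x : normc x <= `|Re x| + `|Im x|.
Proof.
rewrite -ler_sqr ?nnegrE ?normc_ge0 ?addr_ge0// sqr_normcE sqrrD.
rewrite -[Re x ^+ 2]real_normK ?num_real// -[Im x ^+ 2]real_normK ?num_real//.
by rewrite lerD2r lerDl mulrn_wge0// mulr_ge0.
Qed.

Lemma normcM x y : normc (x * y) = normc x * normc y.
Proof. exact: ComplexField.Normc.normcM. Qed.

Lemma normcD x y : normc (x + y) <= normc x + normc y.
Proof. exact: le_normcD. Qed.

Lemma normcN x : normc (- x) = normc x.
Proof. by case: x => a b; rewrite /= !sqrrN. Qed.

Lemma normcB x y : normc (x - y) <= normc x + normc y.
Proof. by rewrite -(normcN y) normcD. Qed.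

Lemma normc0 : normc (0 : R[i]) = 0.
Proof. by apply/eqP; rewrite normc_eq0. Qed.

Lemma normc1 : normc (1 : R[i]) = 1.
Proof. exact: ComplexField.Normc.normc1. Qed.

Lemma normc_conj x : normc x^* = normc x.
Proof. by case: x => a b; rewrite /= sqrrN. Qed.

Lemma normc_real (a : R) : normc a%:C = `|a|.
Proof. by rewrite /= expr0n addr0 sqrtr_sqr. Qed.

Lemma normcX x n : normc (x ^+ n) = normc x ^+ n.
Proof. by elim: n => [|n IH]; rewrite ?normc1// !exprS normcM IH. Qed.

Lemma normcV x : normc x^-1 = (normc x)^-1.
Proof. exact: ComplexField.Normc.normcV. Qed.

Lemma normcXz x (n : int) : normc (x ^ n) = normc x ^ n.
Proof. by case: n => n; rewrite ?NegzE -?exprnN ?normcV normcX. Qed.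

Lemma mulcJ x : x * x^* = (normc x ^+ 2)%:C.
Proof. by rewrite sqr_normcE; case: x => a b; apply: ReIm_eq => /=; ring. Qed.

Lemma ReJ x : Re x^* = Re x. Proof. by case: x. Qed.
Lemma ImJ x : Im x^* = - Im x. Proof. by case: x. Qed.
Lemma conjcM x y : (x * y)^* = x^* * y^*. Proof. exact: rmorphM. Qed.

Lemma normc_sum (I : Type) (r : seq I) (P : pred I) (F : I -> R[i]) :
  normc (\sum_(i <- r | P i) F i) <= \sum_(i <- r | P i) normc (F i).
Proof.
elim/big_ind2: _ => [|x a y b xa yb|//]; first by rewrite normc0.
by apply: le_trans (normcD _ _) _; exact: lerD.
Qed.

Lemma normcD_sqr x y : normc (x + y) ^+ 2 <= 2 * normc x ^+ 2 + 2 * normc y ^+ 2.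
Proof.
have h := normcD x y; have h0 := normc_ge0 (x + y).
apply: (@le_trans _ _ ((normc x + normc y) ^+ 2)).
  by rewrite ler_sqr ?nnegrE// (le_trans h0).
have := sqr_ge0 (normc x - normc y); rewrite sqrrB sqrrD.
move: (normc x ^+ 2) (normc y ^+ 2) (normc x * normc y) => s t u; lra.
Qed.

End Normc.

Lemma cvg0_le (R : realType) (u v : nat -> R) : (forall n, 0 <= u n <= v n) ->
  v @ \oo --> (0 : R) -> u @ \oo --> (0 : R).
Proof.
move=> uv v0; apply: (squeeze_cvgr (f := fun=> 0) (h := v) _ _ v0).
  by near=> n; exact: uv.
exact: cvg_cst.
Unshelve. all: by end_near. Qed.

(** * Integrals of complex-valued functions *)

Section ComplexIntegral.
Context {R : realType}.
Local Notation C := R[i].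
Local Notation Cfun := (C2 R -> C).
Implicit Types (f g : Cfun) (w : C2 R).
Variable Omega : set (C2 R).
Hypothesis mO : measurable (Omega : set (mC2 R)).
Local Notation cm := (cmeasurable Omega).

Definition cintegrable (O : set (C2 R)) f :=
  dV.-integrable (O : set (mC2 R)) (EFin \o (Re \o f)) /\
  dV.-integrable (O : set (mC2 R)) (EFin \o (Im \o f)).

Lemma cmeasurable_cst c : cm (fun=> c).
Proof. by split; exact: measurable_cst. Qed.

Lemma cmeasurableD f g : cm f -> cm g -> cm (fun w => f w + g w).
Proof.
move=> [fr fi] [gr gi]; split.
  rewrite (_ : _ \o _ = (Re \o f) \+ (Re \o g)); first exact: measurable_funD.
  by apply/funext => x /=; rewrite ReD.
rewrite (_ : _ \o _ = (Im \o f) \+ (Im \o g)); first exact: measurable_funD.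
by apply/funext => x /=; rewrite ImD.
Qed.

Lemma cmeasurableM f g : cm f -> cm g -> cm (fun w => f w * g w).
Proof.
move=> [fr fi] [gr gi]; split.
  rewrite (_ : _ \o _ = ((Re \o f) \* (Re \o g)) \- ((Im \o f) \* (Im \o g))).
    by apply: measurable_funB; exact: measurable_funM.
  by apply/funext => x /=; rewrite ReM.
rewrite (_ : _ \o _ = ((Re \o f) \* (Im \o g)) \+ ((Im \o f) \* (Re \o g))).
  by apply: measurable_funD; exact: measurable_funM.
by apply/funext => x /=; rewrite ImM.
Qed.

Lemma cmeasurableN f : cm f -> cm (fun w => - f w).
Proof.
move=> mf; rewrite (_ : (fun w => - f w) = fun w => (-1) * f w).
  by apply: cmeasurableM => //; exact: cmeasurable_cst.
by apply/funext => w; rewrite mulN1r.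
Qed.

Lemma cmeasurableB f g : cm f -> cm g -> cm (fun w => f w - g w).
Proof. by move=> mf mg; apply: cmeasurableD => //; exact: cmeasurableN. Qed.

Lemma cmeasurableJ f : cm f -> cm (fun w => (f w)^*).
Proof.
move=> [fr fi]; split.
  by rewrite (_ : _ \o _ = Re \o f)//; apply/funext => x /=; rewrite ReJ.
rewrite (_ : _ \o _ = \- (Im \o f)); first exact: measurable_funN.
by apply/funext => x /=; rewrite ImJ.
Qed.

Lemma measurable_normc_sqr f : cm f ->
  measurable_fun (Omega : set (mC2 R)) ((fun w => normc (f w) ^+ 2) : mC2 R -> R).
Proof.
move=> [fr fi].
rewrite (_ : (fun w => _) = (fun w => (Re \o f) w ^+ 2 + (Im \o f) w ^+ 2)).
  by apply: measurable_funD; exact: measurable_funX.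
by apply/funext => w; rewrite sqr_normcE.
Qed.

Lemma measurable_normc f : cm f ->
  measurable_fun (Omega : set (mC2 R)) ((fun w => normc (f w)) : mC2 R -> R).
Proof.
move=> /measurable_normc_sqr mf.
rewrite (_ : (fun w => _) = (fun w => Num.sqrt (normc (f w) ^+ 2))).
  apply: (measurableT_comp (f := (@Num.sqrt R)) _ mf).
  by apply: continuous_measurable_fun; exact: sqrt_continuous.
by apply/funext => w; rewrite sqrtr_sqr ger0_norm// normc_ge0.
Qed.

Lemma cmeasurable_continuous f : open Omega ->
  (forall w, Omega w -> ccontinuous_at f w) -> cm f.
Proof.
move=> oO cf; split; apply: continuous_measurableC2 => // w Ow.
  exact: (cf w Ow).1.
exact: (cf w Ow).2.
Qed.

Lemma eq_cmeasurable f g : (forall w, Omega w -> f w = g w) -> cm f -> cm g.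
Proof.
move=> fg [fr fi]; split.
  by apply: eq_measurable_fun fr => w; rewrite inE => /fg /= ->.
by apply: eq_measurable_fun fi => w; rewrite inE => /fg /= ->.
Qed.

Lemma cintegrable_cmeasurable f : cintegrable Omega f -> cm f.
Proof.
by move=> [/measurable_int/measurable_EFinP ? /measurable_int/measurable_EFinP ?].
Qed.

Lemma cintegrable_le f (G : C2 R -> R) : cm f ->
  (forall w, Omega w -> normc (f w) <= G w) ->
  dV.-integrable (Omega : set (mC2 R)) (EFin \o G : mC2 R -> \bar R) ->
  cintegrable Omega f.
Proof.
move=> [fr fi] fG iG; split.
  apply: le_integrable iG => //; first exact/measurable_EFinP.
  move=> w Ow /=; rewrite lee_fin (le_trans (normRe_le _))//.
  by rewrite (le_trans (fG _ Ow))// ler_norm.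
apply: le_integrable iG => //; first exact/measurable_EFinP.
move=> w Ow /=; rewrite lee_fin (le_trans (normIm_le _))//.
by rewrite (le_trans (fG _ Ow))// ler_norm.
Qed.

Lemma integrable_normc f : cintegrable Omega f ->
  dV.-integrable (Omega : set (mC2 R)) (EFin \o (fun w => normc (f w)) : mC2 R -> \bar R).
Proof.
move=> hf; have mf := cintegrable_cmeasurable hf; case: hf => fr fi.
apply: (@le_integrable _ _ _ _ _ mO _
  (fun w => (`|Re (f w)| + `|Im (f w)|)%:E)).
- by apply/measurable_EFinP; exact: measurable_normc.
- move=> w _ /=; rewrite lee_fin ger0_norm ?normc_ge0// (le_trans (normc_le _))//.
  by rewrite ler_norm.
- by apply: (integrableD _ (integrable_norm fr) (integrable_norm fi)).
Qed.

Lemma cintegrable_lty f : cm f ->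
  (\int[dV]_(w in (Omega : set (mC2 R))) (normc (f w))%:E < +oo)%E -> cintegrable Omega f.
Proof.
move=> mf foo; apply: (cintegrable_le (G := fun w => normc (f w))) => //.
apply/integrableP; split; first by apply/measurable_EFinP; exact: measurable_normc.
by under eq_integral do rewrite /= ger0_norm ?normc_ge0//.
Qed.

Lemma eq_cintegrable f g : (forall w, Omega w -> f w = g w) ->
  cintegrable Omega f -> cintegrable Omega g.
Proof.
move=> fg [fr fi]; split.
  by apply: eq_integrable fr => // w; rewrite inE => /fg /= ->.
by apply: eq_integrable fi => // w; rewrite inE => /fg /= ->.
Qed.

Lemma cintegrableD f g : cintegrable Omega f -> cintegrable Omega g ->
  cintegrable Omega (fun w => f w + g w).
Proof.
move=> [fr fi] [gr gi]; split.
  rewrite (_ : _ \o _ = (EFin \o (Re \o f)) \+ (EFin \o (Re \o g)))%E.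
    exact: integrableD.
  by apply/funext => x /=; rewrite ReD EFinD.
rewrite (_ : _ \o _ = (EFin \o (Im \o f)) \+ (EFin \o (Im \o g)))%E.
  exact: integrableD.
by apply/funext => x /=; rewrite ImD EFinD.
Qed.

Lemma cintegrableZ c f : cintegrable Omega f -> cintegrable Omega (fun w => c * f w).
Proof.
move=> hf; have mf := cintegrable_cmeasurable hf.
apply: (cintegrable_le (G := fun w => normc c * normc (f w))).
- by apply: cmeasurableM => //; exact: cmeasurable_cst.
- by move=> w _; rewrite normcM.
- by have := integrableZl mO (normc c) (integrable_normc hf).
Qed.

Lemma cintegrableN f : cintegrable Omega f -> cintegrable Omega (fun w => - f w).
Proof.
by move=> /(cintegrableZ (-1)); apply: eq_cintegrable => w _; rewrite mulN1r.
Qed.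

Lemma cintegrableB f g : cintegrable Omega f -> cintegrable Omega g ->
  cintegrable Omega (fun w => f w - g w).
Proof. by move=> hf hg; apply: cintegrableD => //; exact: cintegrableN. Qed.

Lemma cintegrable0 : cintegrable Omega (fun=> 0).
Proof. by split; exact: integrable0. Qed.

Lemma cintegrable_sum (I : Type) (r : seq I) (P : pred I) (F : I -> Cfun) :
  (forall i, P i -> cintegrable Omega (F i)) ->
  cintegrable Omega (fun w => \sum_(i <- r | P i) F i w).
Proof.
move=> h; elim: r => [|i r IH].
  by under eq_fun do rewrite big_nil; exact: cintegrable0.
have [Pi|nPi] := boolP (P i).
  by under eq_fun do rewrite big_cons Pi; apply: cintegrableD => //; exact: h.
by under eq_fun do rewrite big_cons (negbTE nPi).
Qed.

Lemma eq_cintegral f g : (forall w, Omega w -> f w = g w) ->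
  cintegral Omega f = cintegral Omega g.
Proof.
move=> fg; rewrite /cintegral; congr (_ +i* _).
  by apply: eq_Rintegral => w; rewrite inE => /fg ->.
by apply: eq_Rintegral => w; rewrite inE => /fg ->.
Qed.

Lemma cintegralD f g : cintegrable Omega f -> cintegrable Omega g ->
  cintegral Omega (fun w => f w + g w) = cintegral Omega f + cintegral Omega g.
Proof.
move=> [fr fi] [gr gi]; apply: ReIm_eq.
  rewrite ReD /= -(RintegralD mO fr gr); apply: eq_Rintegral => w _.
  by rewrite ReD.
rewrite ImD /= -(RintegralD mO fi gi); apply: eq_Rintegral => w _.
by rewrite ImD.
Qed.

Lemma cintegralZ c f : cintegrable Omega f ->
  cintegral Omega (fun w => c * f w) = c * cintegral Omega f.
Proof.
move=> [fr fi]; rewrite /cintegral.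
have iZ k (h : C2 R -> R) : dV.-integrable (Omega : set (mC2 R)) (EFin \o h : mC2 R -> \bar R) ->
    dV.-integrable (Omega : set (mC2 R)) (EFin \o (fun w => k * h w) : mC2 R -> \bar R).
  by move=> /(integrableZl mO k).
apply: ReIm_eq.
  rewrite ReM /= -(RintegralZl _ mO fr) -(RintegralZl _ mO fi).
  rewrite -(RintegralB mO (iZ _ _ fr) (iZ _ _ fi)).
  by apply: eq_Rintegral => w _; rewrite ReM.
rewrite ImM /= -(RintegralZl _ mO fr) -(RintegralZl _ mO fi).
rewrite -(RintegralD mO (iZ _ _ fi) (iZ _ _ fr)).
by apply: eq_Rintegral => w _; rewrite ImM.
Qed.

Lemma cintegralN f : cintegrable Omega f ->
  cintegral Omega (fun w => - f w) = - cintegral Omega f.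
Proof.
by move=> hf; rewrite -mulN1r -cintegralZ//; apply: eq_cintegral => w _; rewrite mulN1r.
Qed.

Lemma cintegralB f g : cintegrable Omega f -> cintegrable Omega g ->
  cintegral Omega (fun w => f w - g w) = cintegral Omega f - cintegral Omega g.
Proof.
by move=> hf hg; rewrite cintegralD ?cintegralN//; exact: cintegrableN.
Qed.

Lemma cintegral0 : cintegral Omega (fun=> 0) = 0.
Proof. by rewrite /cintegral /Rintegral !integral0. Qed.

Lemma cintegral_sum (I : Type) (r : seq I) (P : pred I) (F : I -> Cfun) :
  (forall i, P i -> cintegrable Omega (F i)) ->
  cintegral Omega (fun w => \sum_(i <- r | P i) F i w) =
  \sum_(i <- r | P i) cintegral Omega (F i).
Proof.
move=> h; elim: r => [|i r IH].
  rewrite big_nil (@eq_cintegral _ (fun=> 0)) ?cintegral0// => w _.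
  by rewrite big_nil.
rewrite big_cons; case: ifPn => Pi.
  rewrite -IH -cintegralD//; [|exact: h|exact: cintegrable_sum].
  by apply: eq_cintegral => w _; rewrite big_cons Pi.
by rewrite -IH; apply: eq_cintegral => w _; rewrite big_cons (negbTE Pi).
Qed.

Lemma cintegralJ f : cintegrable Omega f ->
  cintegral Omega (fun w => (f w)^*) = (cintegral Omega f)^*.
Proof.
move=> [fr fi]; apply: ReIm_eq.
  by rewrite ReJ /=; apply: eq_Rintegral => w _; rewrite ReJ.
rewrite ImJ /= -mulN1r -(RintegralZl _ mO fi).
by apply: eq_Rintegral => w _; rewrite ImJ mulN1r.
Qed.

Lemma Re_cintegral f : Re (cintegral Omega f) = \int[dV]_(w in Omega) Re (f w).
Proof. by []. Qed.

(** With [z] the integral, [|z|^2] is the integral of [Re (conj z * f)], which is at most [|z|]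
    times the integral of [|f|]. *)
Lemma normc_cintegral_le f : cintegrable Omega f ->
  normc (cintegral Omega f) <= \int[dV]_(w in (Omega : set (mC2 R))) normc (f w).
Proof.
move=> hf; set z := cintegral Omega f.
have [->|z0] := eqVneq z 0; first by rewrite normc0 Rintegral_ge0// => w _; exact: normc_ge0.
have zp := normc_gt0 z0; rewrite -(ler_pM2l zp) -expr2.
have <- : Re (z^* * z) = normc z ^+ 2 by rewrite mulrC mulcJ.
rewrite {2}/z -cintegralZ// Re_cintegral -(RintegralZl _ mO (integrable_normc hf)).
apply: le_Rintegral => //.
- exact: (cintegrableZ z^* hf).1.
- exact: (integrableZl mO (normc z) (integrable_normc hf)).
- move=> w _; rewrite -[normc z]normc_conj -normcM.
  exact: le_trans (ler_norm _) (normRe_le _).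
Qed.

(** The limit inherits the bound [G], so real dominated convergence applies to [|F n - f|] with
    majorant [2 * G]. *)
Lemma cintegral_dominated (F : nat -> Cfun) f (G : C2 R -> R) :
  (forall n, cm (F n)) -> cm f ->
  (forall n w, Omega w -> normc (F n w) <= G w) ->
  (forall w, Omega w -> (fun n => normc (F n w - f w)) @ \oo --> (0 : R)) ->
  dV.-integrable (Omega : set (mC2 R)) (EFin \o G : mC2 R -> \bar R) ->
  cintegrable Omega f /\
  (fun n => normc (cintegral Omega (F n) - cintegral Omega f)) @ \oo --> (0 : R).
Proof.
move=> mF mf FG Ff iG.
have fG w : Omega w -> normc (f w) <= G w.
  move=> Ow; rewrite -subr_ge0.
  have c0 : (fun n => normc (F n w - f w) + (G w - normc (f w))) @ \oo -->
      0 + (G w - normc (f w)).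
    by apply: cvgD; [exact: Ff|exact: cvg_cst].
  rewrite add0r in c0; rewrite -(cvg_lim _ c0)//; apply: limr_ge.
    by apply/cvg_ex; eexists; exact: c0.
  near=> n; rewrite addrA subr_ge0.
  have h := normcD (f w - F n w) (F n w); rewrite subrK -(opprB (F n w)) normcN in h.
  by apply: le_trans h _; rewrite lerD2l FG.
have intf : cintegrable Omega f by exact: cintegrable_le iG.
have intF n : cintegrable Omega (F n).
  by apply: cintegrable_le iG => // w; exact: FG.
split => //.
have key : (fun n => \int[dV]_(w in (Omega : set (mC2 R))) normc (F n w - f w)) @ \oo --> (0 : R).
  have := @dominated_convergence _ _ _ dV (Omega : set (mC2 R)) mO
    (fun n w => (normc (F n w - f w))%:E) (fun=> 0%E) (fun w => (2 * G w)%:E).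
  case.
  - by move=> n; apply/measurable_EFinP; exact: measurable_normc (cmeasurableB (mF n) mf).
  - exact: measurable_cst.
  - apply: aeW => w Ow; apply/cvg_EFin; first by near=> n.
    exact: Ff.
  - have := integrableZl mO 2 iG; exact.
  - apply: aeW => w n Ow; rewrite gee0_abs ?lee_fin ?normc_ge0//.
    by rewrite (le_trans (normcB _ _))// mulr_natl mulr2n lerD// ?FG// fG.
  move=> _ _; rewrite integral0 => /fine_cvg; exact.
apply: cvg0_le key => n; rewrite normc_ge0 andTb -(cintegralB (intF n) intf).
by apply: normc_cintegral_le; exact: cintegrableB.
Unshelve. all: by end_near. Qed.

End ComplexIntegral.

(** * Integration by parts against compactly supported functions *)

Section IntegrationByParts.
Context {R : realType}.
Local Notation C := R[i].
Local Notation Cfun := (C2 R -> C).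
Implicit Types (f g phi F : Cfun) (w : C2 R) (K U Omega : set (C2 R)).

Lemma ccontinuous_glue Omega K F w : open Omega -> compact K -> K `<=` Omega ->
  (forall w, Omega w -> ccontinuous_at F w) -> (forall w, ~ K w -> F w = 0) ->
  ccontinuous_at F w.
Proof.
move=> oO cK KO cF F0; have [/KO Ow|Kw] := pselect (K w); first exact: cF.
apply: ccontinuous_near (ccontinuous_cst 0 w); exact: closed_near0 cK F0 Kw.
Qed.

Lemma cbounded_csupp K F : compact K -> (forall w, ccontinuous_at F w) ->
  (forall w, ~ K w -> F w = 0) -> exists c : R, forall w, normc (F w) <= c.
Proof.
move=> cK cF F0.
have bd (h : C2 R -> R) : continuous h -> exists c : R, forall w, K w -> `|h w| <= c.
  move=> ch; have := continuous_compact (continuous_subspaceT ch) cK.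
  move=> /compact_bounded[N [_ hN]]; exists (`|N| + 1) => w Kw.
  apply: hN; last by exists w.
  by rewrite (le_lt_trans (ler_norm N))// ltrDl.
have [a ha] := bd (Re \o F) (fun w => (cF w).1).
have [b hb] := bd (Im \o F) (fun w => (cF w).2).
exists (`|a| + `|b|) => w; have [Kw|Kw] := pselect (K w); last first.
  by rewrite F0// normc0 addr_ge0.
apply: le_trans (normc_le _) _; apply: lerD.
  exact: le_trans (ha _ Kw) (ler_norm _).
exact: le_trans (hb _ Kw) (ler_norm _).
Qed.

Lemma cintegrable_csupp K F Omega : measurable (Omega : set (mC2 R)) ->
  compact K -> (forall w, ccontinuous_at F w) ->
  (forall w, ~ K w -> F w = 0) -> cintegrable Omega F.
Proof.
move=> mO cK cF F0; have [c cb] := cbounded_csupp cK cF F0.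
have mF : cmeasurable setT F.
  by apply: cmeasurable_continuous; [exact: openT|move=> w _; exact: cF].
have mK := compact_measurableC2 cK.
have h : cintegrable setT F.
  split.
    apply: (bounded_support_integrable (c := c) mK (dV_compact cK) mF.1).
      by move=> w; exact: le_trans (normRe_le _) (cb w).
    by move=> w Kw; rewrite /= F0.
  apply: (bounded_support_integrable (c := c) mK (dV_compact cK) mF.2).
    by move=> w; exact: le_trans (normIm_le _) (cb w).
  by move=> w Kw; rewrite /= F0.
split.
  by apply: (integrableS measurableT mO _ h.1).
by apply: (integrableS measurableT mO _ h.2).
Qed.

Lemma cintegral_csupp K F Omega : K `<=` Omega -> (forall w, ~ K w -> F w = 0) ->
  cintegral Omega F = cintegral setT F.
Proof.
move=> KO F0; have e (h : C -> R) : h 0 = 0 ->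
    \int[dV]_(w in (Omega : set (mC2 R))) h (F w) = \int[dV]_w h (F w).
  move=> h0; rewrite Rintegral_mkcond; apply: eq_Rintegral => w _.
  rewrite patchE; case: ifPn => //; rewrite notin_setE => Ow.
  by rewrite F0// => /KO.
by rewrite /cintegral !e.
Qed.

(** Fubini gives zero for the real partial derivatives, that is [a + b = 0] and [i (a - b) = 0] for
    the integrals [a], [b] of the two Wirtinger derivatives in each variable; this system has only
    the zero solution. *)
Lemma cintegral_Dj0 K F (d : 'I_4 -> Cfun) k : compact K ->
  (forall w, wder F w (d^~ w)) -> (forall j w, ccontinuous_at (d j) w) ->
  (forall w, ~ K w -> F w = 0 /\ forall j, d j w = 0) ->
  cintegral setT (d k) = 0.
Proof.
move=> cK dF cd F0.
have id j : cintegrable setT (d j).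
  by apply: (cintegrable_csupp _ cK (cd j)) => // w /F0[_].
have crb j w : ccontinuous_at (fun w => rb j (d^~ w)) w.
  have cN (a b : Cfun) : ccontinuous_at a w -> ccontinuous_at b w ->
      ccontinuous_at (fun w => a w - b w) w.
    move=> ca cb; under eq_fun do rewrite -mulN1r.
    exact: ccontinuousD ca (ccontinuousM (ccontinuous_cst _ _) cb).
  elim/rbP: j; rewrite /rb /=; [exact: ccontinuousD| |exact: ccontinuousD|].
    by apply: ccontinuousM; [exact: ccontinuous_cst|exact: cN].
  by apply: ccontinuousM; [exact: ccontinuous_cst|exact: cN].
have z j : cintegral setT (fun w => rb j (d^~ w)) = 0.
  have rb00 w : ~ K w -> rb j (d^~ w) = 0.
    move=> /F0[_ h]; rewrite -[RHS](rb0 j); congr rb; apply/funext => i.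
    exact: h.
  rewrite /cintegral; congr (_ +i* _).
    apply: (@integral_partial0 _ (Re \o F) _ j K cK).
    - by move=> w; exact: (crb j w).1.
    - by move=> w; exact: ((dF w).2 j).1.
    - by move=> w Kw; rewrite /= (F0 _ Kw).1 rb00.
  apply: (@integral_partial0 _ (Im \o F) _ j K cK).
  - by move=> w; exact: (crb j w).2.
  - by move=> w; exact: ((dF w).2 j).2.
  - by move=> w Kw; rewrite /= (F0 _ Kw).1 rb00.
have i0 : 'i != 0 :> C by rewrite eq_complex /= oner_eq0 andbF.
have n2 : (2 : C) != 0 by rewrite pnatr_eq0.
have mT : measurable (setT : set (mC2 R)) by [].
have sol (a b : C) : a + b = 0 -> 'i * (a - b) = 0 -> a = 0 /\ b = 0.
  move=> ab /eqP; rewrite mulf_eq0 (negbTE i0) /= subr_eq0 => /eqP e.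
  by move: ab; rewrite e -mulr2n => /eqP; rewrite mulrn_eq0 /= => /eqP ->.
have z0 := z 0; have z1 := z 1; have z2 := z 2; have z3 := z 3.
rewrite /rb /= in z0 z1 z2 z3.
rewrite cintegralD// in z0; rewrite cintegralD// in z2.
rewrite cintegralZ ?cintegralB// in z1; last exact: cintegrableB.
rewrite cintegralZ ?cintegralB// in z3; last exact: cintegrableB.
have [a0 a1] := sol _ _ z0 z1; have [a2 a3] := sol _ _ z2 z3.
by elim/rbP: k.
Qed.

Definition C1_on Omega g := forall w, Omega w -> wder g w (fun j => Dj j g w) /\
  forall j, ccontinuous_at (Dj j g) w.

(** Although [g] is C^1 on [Omega] only, the product [g * phi] vanishes off [K] and is C^1 on the
    whole space, so that the integral of its derivative is zero. *)
Lemma cintegral_parts_csupp Omega K g phi k : open Omega -> compact K -> K `<=` Omega ->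
  C1_on Omega g -> C1_on setT phi -> (forall w, ~ K w -> phi w = 0) ->
  cintegral Omega (fun w => g w * Dj k phi w) =
  - cintegral Omega (fun w => Dj k g w * phi w).
Proof.
move=> oO cK KO Cg Cphi K0; have mO := open_measurableC2 oO.
have D0 j w : ~ K w -> Dj j phi w = 0.
  move=> Kw; apply: (@wder_Dj _ phi w (fun=> 0)); apply: wder_near (wder_cst 0 w).
  exact: closed_near0 cK K0 Kw.
have cphi w : ccontinuous_at phi w by have [[]] := Cphi w I.
have cDphi j w : ccontinuous_at (Dj j phi) w by have [_] := Cphi w I.
have c1 j w : ccontinuous_at (fun w => g w * Dj j phi w) w.
  apply: (ccontinuous_glue _ oO cK KO) => [v Ov|v Kv]; last by rewrite D0// mulr0.
  exact: (ccontinuousM (Cg v Ov).1.1 (cDphi j v)).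
have c2 j w : ccontinuous_at (fun w => Dj j g w * phi w) w.
  apply: (ccontinuous_glue _ oO cK KO) => [v Ov|v Kv]; last by rewrite K0// mulr0.
  exact: (ccontinuousM ((Cg v Ov).2 j) (cphi v)).
have z1 w : ~ K w -> g w * Dj k phi w = 0 by move=> Kw; rewrite D0// mulr0.
have z2 w : ~ K w -> Dj k g w * phi w = 0 by move=> Kw; rewrite K0// mulr0.
apply/eqP; rewrite -subr_eq0 opprK -cintegralD//; last first.
- exact: (cintegrable_csupp mO cK (c2 k) z2).
- exact: (cintegrable_csupp mO cK (c1 k) z1).
apply/eqP; rewrite (cintegral_csupp KO); last first.
  by move=> w Kw; rewrite z1// z2// addr0.
apply: (@cintegral_Dj0 K (fun w => g w * phi w)
  (fun j w => g w * Dj j phi w + Dj j g w * phi w) k cK).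
- move=> w; have [Kw|Kw] := pselect (K w).
    by apply: wderM; [exact: (Cg w (KO _ Kw)).1|exact: (Cphi w I).1].
  rewrite (_ : (fun j : 'I_4 => _) = fun=> 0); last first.
    apply/funext => j; rewrite -[LHS]/(g w * Dj j phi w + Dj j g w * phi w).
    by rewrite D0// K0// !mulr0 addr0.
  apply: wder_near (wder_cst 0 w).
  by apply: (closed_near0 cK _ Kw) => v Kv; rewrite K0// mulr0.
- by move=> j w; apply: ccontinuousD; [exact: c1|exact: c2].
- by move=> w Kw; rewrite K0// mulr0; split => // j; rewrite D0// !mulr0 addr0.
Qed.

Lemma cintegral_parts Omega U g phi k : open Omega -> open U -> C1_on Omega g ->
  elem_test U Omega phi ->
  cintegral Omega (fun w => g w * Dj k phi w) =
  - cintegral Omega (fun w => Dj k g w * phi w).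
Proof.
move=> oO oU Cg tphi; have [e ee [fe [K [cK KU K0]]]] := tphi.
apply: (@cintegral_parts_csupp _ K) => //; first by move=> w /KU[].
move=> w _; split; first exact: elem_test_wder oU tphi.
by move=> j; have [] := elem_test_wder w oU (elem_test_Dj j oU tphi).
Qed.

Lemma cintegrable_locM Omega K g F : open Omega -> cloc_integrable Omega g ->
  compact K -> K `<=` Omega -> (forall w, ccontinuous_at F w) ->
  (forall w, ~ K w -> F w = 0) -> cintegrable Omega (fun w => g w * F w).
Proof.
move=> oO [mg ig] cK KO cF F0; have mO := open_measurableC2 oO.
have [c cb] := cbounded_csupp cK cF F0.
have mK := compact_measurableC2 cK.
have mF : cmeasurable Omega F by apply: cmeasurable_continuous.
have igK : dV.-integrable (K : set (mC2 R)) (EFin \o (fun w => normc (g w)) : mC2 R -> \bar R).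
  apply/integrableP; split.
    apply/measurable_EFinP; apply: measurable_normc.
    by case: mg => gr gi; split; [exact: measurable_funS gr|exact: measurable_funS gi].
  by under eq_integral do rewrite /= ger0_norm ?normc_ge0//; exact: ig.
have /(integrable_mkcond _ mK) := igK => igT.
apply: (cintegrable_le mO (G := fun w => c * ((fun w => normc (g w)) \_ K) w)).
- exact: cmeasurableM.
- move=> w Ow; rewrite normcM patchE; case: ifPn => [_|]; last first.
    by rewrite notin_setE => /F0 ->; rewrite normc0 !mulr0.
  by rewrite mulrC ler_wpM2r// normc_ge0.
- have igO := integrableS measurableT mO (@subsetT _ _) igT.
  have h := integrableZl mO c igO; apply: eq_integrable h => // w _ /=.
  by rewrite !patchE; case: ifP => // _; rewrite mulr0 mule0.
Qed.

End IntegrationByParts.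

(** * Differentiability from a quadratic remainder *)

Section QuadraticDerivative.
Context {R : realType} {V : normedModType R}.

(** Used where no rule of calculus applies: for flat functions at the origin and for limits of
    series. *)
Lemma is_derive_quadratic (F : V -> R) (w v : V) (l delta M : R) : 0 < delta ->
  (forall h : R, `|h| < delta -> `|F (h *: v + w) - F w - h * l| <= M * h ^+ 2) ->
  is_derive w v F l.
Proof.
move=> d0 hF.
have e : (fun h : R => h^-1 *: ((F \o shift w) (h *: v) - F w)) @ 0^' --> l.
  apply/cvgrPdist_le => /= eps eps0; near=> h.
  have h0 : h != 0 by near: h; exact: nbhs_dnbhs_neq.
  have hd : `|h| < delta.
    near: h; apply: dnbhs0_lt; exact: d0.
  have hM : `|h| <= eps / (`|M| + 1).
    near: h; apply: dnbhs0_le; rewrite divr_gt0// ltr_wpDl//.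
  rewrite /GRing.scale /=.
  have -> : l - h^-1 * (F (h *: v + w) - F w) = - (h^-1 * (F (h *: v + w) - F w - h * l)).
    by field.
  rewrite normrN normrM normfV ler_pdivrMl ?normr_gt0//.
  apply: le_trans (hF _ hd) _.
  rewrite -[h ^+ 2]real_normK ?num_real// expr2 mulrCA ler_pM2l ?normr_gt0//.
  apply: (@le_trans _ _ ((`|M| + 1) * `|h|)).
    by rewrite ler_wpM2r// (le_trans (ler_norm M))// lerDl.
  by rewrite mulrC -ler_pdivlMr// ltr_wpDl.
apply: DeriveDef; first by apply/cvg_ex; exists l.
exact: cvg_lim e.
Unshelve. all: by end_near. Qed.

End QuadraticDerivative.

(** * Smooth bump functions on the line *)

Section Bump.
Context {R : realType}.
Implicit Types (x y : R) (p q : {poly R}).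

(** The family [p(1/x) exp(-1/x)], extended by zero, is stable under differentiation: the polynomial
    [p] becomes [X^2 (p - p')]. This is the class that makes [exp(-1/x)] smooth by coinduction. *)
Let flat p x : R := if 0 < x then p.[x^-1] * expR (- x^-1) else 0.

(** From [exp y >= y^(n+2) / (n+2)!] at [y = 1/x], where [n] bounds the growth of [p]. The two extra
    powers yield the factor [x^2] that [is_derive_quadratic] requires at the origin. *)
Let flat_bound p : exists C : R, forall x, 0 < x -> x <= 1 -> `|flat p x| <= C * x ^+ 2.
Proof.
have [C [n hp]] : exists (C : R) n, forall y, 1 <= y -> `|p.[y]| <= C * y ^+ n.
  elim/poly_ind: p => [|p c [C [n IH]]].
    by exists 0, 0 => y _; rewrite horner0 normr0 mul0r.
  exists (C + `|c|), n.+1 => y y1; rewrite hornerMXaddC mulrDl.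
  have y0 : 0 <= y by rewrite (le_trans _ y1).
  apply: le_trans (ler_normD _ _) _; apply: lerD.
    by rewrite normrM exprSr mulrA (ger0_norm y0) ler_wpM2r// IH.
  by rewrite -[leLHS]mulr1 ler_wpM2l// exprn_ege1.
exists (C * (n.+2)`!%:R) => x x0 x1; rewrite /flat x0.
have y1 : 1 <= x^-1 by rewrite invf_ge1.
have y0 : 0 <= x^-1 by rewrite invr_ge0 ltW.
have C0 : 0 <= C.
  have := le_trans (normr_ge0 _) (hp 1 (lexx _)); by rewrite expr1n mulr1.
rewrite normrM (ger0_norm (expR_ge0 _)) expRN.
apply: (@le_trans _ _ (C * x^-1 ^+ n * (expR x^-1)^-1)).
  by rewrite ler_wpM2r ?invr_ge0 ?expR_ge0// hp.
rewrite -!mulrA ler_wpM2l//.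
rewrite ler_pdivrMr ?expR_gt0//.
have : x^-1 ^+ n.+2 / n.+2`!%:R <= expR x^-1.
  by apply: le_trans (expR_ge1Dxn n.+1 y0); rewrite lerDr.
have f0 : 0 < (n.+2)`!%:R :> R by rewrite ltr0n fact_gt0.
rewrite ler_pdivrMr// [expR _ * _]mulrC => h.
have x2 : 0 < x ^+ 2 by rewrite exprn_gt0.
have -> : x^-1 ^+ n = x ^+ 2 * x^-1 ^+ n.+2.
  by rewrite -(addn2 n) exprD mulrCA -exprMn divff ?expr1n ?mulr1// gt_eqF.
by rewrite [_`!%:R * _]mulrC -[leRHS]mulrA ler_pM2l.
Qed.

Let flat_derive p x : is_derive x 1 (flat p) (flat ('X^2 * (p - p^`()))%R x).
Proof.
have [x0|x0|->] := ltgtP x 0.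
- have z q y : y <= 0 -> flat q y = 0 by rewrite /flat ltNge => ->.
  rewrite z ?ltW//.
  apply: (near_eq_is_derive (f := fun=> 0)).
  near=> y; rewrite z// ltW//; near: y.
  by apply: open_nbhs_nbhs; split => //; exact: open_lt.
- have dV : is_derive x 1 (fun y : R => y^-1) (- x ^- 2).
    have d := @derivableV _ _ (id : R -> R) x 1 (lt0r_neq0 x0) (@derivable_id _ _ x 1).
    have := @deriveV _ _ (id : R -> R) x 1 (lt0r_neq0 x0) (@derivable_id _ _ x 1).
    by rewrite derive_id /GRing.scale /= mulr1; exact: DeriveDef d.
  have dE := @is_derive1_compR _ expR (fun y => - y^-1) x _ _ (is_derive_expR (- x^-1)) (is_deriveN dV).
  have dP := @is_derive1_compR _ (horner p) (fun y => y^-1) x _ _ (is_derive_poly p x^-1) dV.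
  have d := is_derive1M dP dE.
  apply: (near_eq_is_derive (f := fun y => p.[y^-1] * expR (- y^-1))).
    near=> y; rewrite /flat ifT//; near: y.
    by apply: open_nbhs_nbhs; split => //; exact: open_gt.
  apply: is_derive_eq d _; rewrite /flat x0 /= !hornerE /=.
  by rewrite ?exprVn; ring.
have [C hC] := flat_bound p.
rewrite [X in is_derive _ _ _ X]/flat ltxx; apply: (@is_derive_quadratic _ _ _ _ _ _ 1 `|C|) => // h h1.
rewrite /flat ltxx mulr0 !subr0 addr0 [_%:A]mulr1.
have [h0|h0] := ltP 0 h; last by rewrite normr0 mulr_ge0// sqr_ge0.
have h1' : h <= 1 by apply: le_trans (ler_norm _) (ltW h1).
have := hC _ h0 h1'; rewrite /flat h0 => /le_trans; apply.
by rewrite ler_wpM2r ?sqr_ge0// ler_norm.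
Unshelve. all: by end_near. Qed.

Definition expbump x : R := if 0 < x then expR (- x^-1) else 0.

Lemma smooth1_expbump : smooth1 expbump.
Proof.
apply: (@smooth1_coind _ (fun A => exists p, A = flat p)); last first.
  exists 1; apply/funext => x; rewrite /flat /expbump; case: ifP => //.
  by rewrite hornerE mul1r.
move=> _ [p ->]; exists (flat ('X^2 * (p - p^`()))) => //.
by eexists.
Qed.

Lemma expbump_ge0 x : 0 <= expbump x.
Proof. by rewrite /expbump; case: ifP => // _; exact: expR_ge0. Qed.

Lemma expbump_le1 x : expbump x <= 1.
Proof.
rewrite /expbump; case: ifP => // x0.
by rewrite -expR0 ler_expR oppr_le0 invr_ge0 ltW.
Qed.

Lemma expbump_le0 x : x <= 0 -> expbump x = 0.
Proof. by rewrite /expbump ltNge => ->. Qed.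

Lemma expbump_cvg x : 0 < x -> (fun n : nat => expbump (n%:R * x)) @ \oo --> (1 : R).
Proof.
move=> x0; rewrite -cvg_shiftS /=.
have -> : (fun n : nat => expbump (n.+1%:R * x)) = (fun n : nat => expR (- (n.+1%:R * x)^-1)).
  by apply/funext => n; rewrite /expbump mulr_gt0// ltr0n.
have h : (fun n : nat => - (n.+1%:R^-1 * x^-1)) @ \oo --> - ((0 : R) * x^-1).
  by apply: cvgN; apply: cvgM; [exact: cvg_harmonic|exact: cvg_cst].
rewrite mul0r oppr0 in h.
have e : (fun n : nat => - (n.+1%:R^-1 * x^-1)) = (fun n : nat => - (n.+1%:R * x)^-1).
  by apply/funext => n; rewrite invfM.
rewrite e in h.
have h2 : (fun n : nat => expR (- (n.+1%:R * x)^-1)) @ \oo --> expR (0 : R).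
  exact: (@continuous_cvg _ _ _ _ _ _ expR 0 (@continuous_expR R 0) h).
by rewrite expR0 in h2; exact: h2.
Qed.

(* Converges to the indicator of ]a, b[ as [n] grows. *)
Definition smbump (a b : R) (n : nat) x : R :=
  expbump (n%:R * (x - a)) * expbump (n%:R * (b - x)).

Lemma smooth1_affine (c d : R) : smooth1 (fun x => c * x + d).
Proof.
apply: smooth1D; last exact: smooth1_cst.
by apply: smooth1M; [exact: smooth1_cst|exact: smooth1_id].
Qed.

Lemma smooth1_smbump a b n : smooth1 (smbump a b n).
Proof.
apply: smooth1M.
  have := smooth1_comp smooth1_expbump (smooth1_affine n%:R (- (n%:R * a))).
  by congr smooth1; apply/funext => x; congr expbump; ring.
have := smooth1_comp smooth1_expbump (smooth1_affine (- n%:R) (n%:R * b)).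
by congr smooth1; apply/funext => x; congr expbump; ring.
Qed.

Lemma smbump_ge0 a b n x : 0 <= smbump a b n x.
Proof. by rewrite mulr_ge0 ?expbump_ge0. Qed.

Lemma smbump_le1 a b n x : smbump a b n x <= 1.
Proof. by rewrite mulr_ile1 ?expbump_ge0 ?expbump_le1. Qed.

Lemma smbump_eq0 a b n x : ~~ (a < x < b) -> smbump a b n x = 0.
Proof.
rewrite negb_and -!leNgt => /orP[h|h].
  by rewrite /smbump expbump_le0 ?mul0r// mulr_ge0_le0// subr_le0.
by rewrite /smbump [X in _ * X]expbump_le0 ?mulr0// mulr_ge0_le0// subr_le0.
Qed.

Lemma smbump_cvg a b x : (fun n => smbump a b n x) @ \oo --> ((a < x < b)%R%:R : R).
Proof.
have [/andP[ax xb]|nx] := boolP (a < x < b); last first.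
  by under eq_fun do rewrite smbump_eq0//; exact: cvg_cst.
rewrite -[X in _ --> X]mulr1; apply: cvgM; apply: expbump_cvg; by rewrite subr_gt0.
Qed.

End Bump.

(** * A locally integrable function that annihilates all test functions vanishes almost
    everywhere *)

Section Vanishing.
Context {R : realType}.
Local Notation C := R[i].
Local Notation Cfun := (C2 R -> C).
Implicit Types (f g phi : Cfun) (a b w : C2 R) (U Omega : set (C2 R)).

Definition obox a b : set (C2 R) :=
  (`]a.1.1, b.1.1[%classic `*` `]a.1.2, b.1.2[%classic) `*`
  (`]a.2.1, b.2.1[%classic `*` `]a.2.2, b.2.2[%classic).

Definition cbox a b : set (C2 R) :=
  (`[a.1.1, b.1.1]%classic `*` `[a.1.2, b.1.2]%classic) `*`
  (`[a.2.1, b.2.1]%classic `*` `[a.2.2, b.2.2]%classic).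

Lemma oboxP a b w : obox a b w <-> [/\ a.1.1 < w.1.1 < b.1.1, a.1.2 < w.1.2 < b.1.2,
  a.2.1 < w.2.1 < b.2.1 & a.2.2 < w.2.2 < b.2.2].
Proof.
split; last by case=> ? ? ? ?; split; split; rewrite /= in_itv.
by case=> -[+ +] [+ +]; rewrite /= !in_itv.
Qed.

Lemma cboxP a b w : cbox a b w <-> [/\ a.1.1 <= w.1.1 <= b.1.1, a.1.2 <= w.1.2 <= b.1.2,
  a.2.1 <= w.2.1 <= b.2.1 & a.2.2 <= w.2.2 <= b.2.2].
Proof.
split; last by case=> ? ? ? ?; split; split; rewrite /= in_itv.
by case=> -[+ +] [+ +]; rewrite /= !in_itv.
Qed.

Lemma compact_cbox a b : compact (cbox a b).
Proof. by apply: compact_setX; apply: compact_setX; exact: segment_compact. Qed.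

Lemma obox_cbox a b : obox a b `<=` cbox a b.
Proof.
by move=> w [[h1 h2] [h3 h4]]; split; split; exact: subset_itv_oo_cc.
Qed.

Lemma measurable_obox a b : measurable (obox a b : set (mC2 R)).
Proof. by apply: measurableX; apply: measurableX; exact: measurable_itv. Qed.

(** The closed boxes are asked to lie in [Omega], because local integrability is known on compact
    sets. Codes without a suitable box are sent to a degenerate box, whose interior is empty. *)
Lemma countable_obox Omega : open Omega -> exists p : nat -> C2 R * C2 R,
  (forall n, cbox (p n).1 (p n).2 `<=` Omega \/ obox (p n).1 (p n).2 = set0) /\
  forall w, Omega w -> exists n, obox (p n).1 (p n).2 w.
Proof.
move=> oO; pose I := ((rat * rat) * (rat * rat) * nat)%type.
pose lo (i : I) : C2 R := ((ratr i.1.1.1 - i.2.+1%:R^-1, ratr i.1.1.2 - i.2.+1%:R^-1),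
  (ratr i.1.2.1 - i.2.+1%:R^-1, ratr i.1.2.2 - i.2.+1%:R^-1)).
pose hi (i : I) : C2 R := ((ratr i.1.1.1 + i.2.+1%:R^-1, ratr i.1.1.2 + i.2.+1%:R^-1),
  (ratr i.1.2.1 + i.2.+1%:R^-1, ratr i.1.2.2 + i.2.+1%:R^-1)).
pose p n : C2 R * C2 R := if unpickle n is Some i then
  if `[< cbox (lo i) (hi i) `<=` Omega >] then (lo i, hi i) else (0, 0) else (0, 0).
exists p; split.
  move=> n; have e0 : obox 0 (0 : C2 R) = set0.
    rewrite -subset0 => w [[]] /=; rewrite in_itv /= => /andP[h h'].
    by have := lt_trans h h'; rewrite ltxx.
  rewrite /p; case: unpickle => [i|]; last by right.
  by case: asboolP => h; [left|right].
move=> w Ow; have /nbhs_ballP[e e0 he] : nbhs w Omega by exact: open_nbhs_nbhs.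
have [n ne] : exists n, n.+1%:R^-1 < e / 3 :> R.
  have e20 : 0 < e / 3 by rewrite divr_gt0.
  have [n _ /(_ n (leqnn n)) h] := near_infty_natSinv_lt (PosNum e20).
  by exists n.
pose t : R := n.+1%:R^-1.
have t0 : 0 < t by rewrite invr_gt0.
have ap (x : R) : exists q, ratr q - t < x < ratr q + t.
  have /rat_in_itvoo[q] : x - t < x + t by rewrite ltrD2l gtrN.
  rewrite in_itv /= => /andP[q1 q2]; exists q.
  by apply/andP; split; lra.
have [q1 h1] := ap w.1.1; have [q2 h2] := ap w.1.2.
have [q3 h3] := ap w.2.1; have [q4 h4] := ap w.2.2.
pose i : I := (((q1, q2), (q3, q4)), n).
have sub : cbox (lo i) (hi i) `<=` Omega.
  move=> v [[a1 a2] [a3 a4]]; apply: he.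
  have tri (q x y : R) : q - t < x < q + t -> y \in `[q - t, q + t] -> ball x e y.
    rewrite in_itv /= /ball /= => /andP[u1 u2] /andP[u3 u4].
    have ht : t < e / 3 by [].
    by rewrite ltr_norml; apply/andP; split; lra.
  by split; split; [exact: tri h1 a1|exact: tri h2 a2|exact: tri h3 a3|exact: tri h4 a4].
by exists (pickle i); rewrite /p pickleK; case: asboolP.
Qed.

Lemma elem_x1 U : elem U (fun w => (w.1.1)%:C).
Proof.
rewrite (_ : (fun w => _) = (fun w => 2^-1 * (w1 w + w1b w))).
  by apply: elemM; [exact: elem_cst|apply: elemD; [exact: elem_w1|exact: elem_w1b]].
by apply/funext => w; rewrite /w1b addcJ mulrA mulVf ?mul1r// pnatr_eq0.
Qed.

Lemma elem_x2 U : elem U (fun w => (w.2.1)%:C).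
Proof.
rewrite (_ : (fun w => _) = (fun w => 2^-1 * (w2 w + w2b w))).
  by apply: elemM; [exact: elem_cst|apply: elemD; [exact: elem_w2|exact: elem_w2b]].
by apply/funext => w; rewrite /w2b addcJ mulrA mulVf ?mul1r// pnatr_eq0.
Qed.

Let imE (x y : R) : y%:C = (- 'i / 2) * ((x +i* y) - (x +i* y)^*).
Proof.
rewrite subcJ -[Im (x +i* y)]/y complexiE; have n2 : (2 : C) != 0 by rewrite pnatr_eq0.
rewrite [RHS](_ : _ = - ('i * 'i) * (2^-1 * 2) * y%:C); last by ring.
by rewrite sqri opprK mulVf// !mul1r.
Qed.

Lemma elem_y1 U : elem U (fun w => (w.1.2)%:C).
Proof.
rewrite (_ : (fun w => _) = (fun w => (- 'i / 2) * (w1 w + (-1) * w1b w))).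
  apply: elemM; [exact: elem_cst|apply: elemD; first exact: elem_w1].
  by apply: elemM; [exact: elem_cst|exact: elem_w1b].
by apply/funext => w; rewrite mulN1r; exact: imE.
Qed.

Lemma elem_y2 U : elem U (fun w => (w.2.2)%:C).
Proof.
rewrite (_ : (fun w => _) = (fun w => (- 'i / 2) * (w2 w + (-1) * w2b w))).
  apply: elemM; [exact: elem_cst|apply: elemD; first exact: elem_w2].
  by apply: elemM; [exact: elem_cst|exact: elem_w2b].
by apply/funext => w; rewrite mulN1r; exact: imE.
Qed.

Let bbump a b n w : C :=
  (smbump a.1.1 b.1.1 n w.1.1)%:C * (smbump a.1.2 b.1.2 n w.1.2)%:C *
  ((smbump a.2.1 b.2.1 n w.2.1)%:C * (smbump a.2.2 b.2.2 n w.2.2)%:C).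

Let bbump_out a b n w : ~ cbox a b w -> bbump a b n w = 0.
Proof.
move=> nw; have z (l h x : R) : ~ `[l, h]%classic x -> smbump l h n x = 0.
  move=> nx; apply: smbump_eq0; apply/negP => /andP[/ltW u /ltW v]; apply: nx.
  by rewrite /= in_itv /= u v.
rewrite /bbump; have [h1|/z ->] := pselect (`[a.1.1, b.1.1]%classic w.1.1); last by rewrite !mul0r.
have [h2|/z ->] := pselect (`[a.1.2, b.1.2]%classic w.1.2); last by rewrite mulr0 mul0r.
have [h3|/z ->] := pselect (`[a.2.1, b.2.1]%classic w.2.1); last by rewrite mul0r mulr0.
have [h4|/z ->] := pselect (`[a.2.2, b.2.2]%classic w.2.2); last by rewrite !mulr0.
by exfalso; apply: nw.
Qed.

Let bbump_test Omega a b n : cbox a b `<=` Omega -> elem_test setT Omega (bbump a b n).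
Proof.
move=> KO; exists (bbump a b n).
  apply: elemM; apply: elemM.
  - exact: (elem_comp (elem_x1 _) (smooth1_smbump _ _ _)).
  - exact: (elem_comp (elem_y1 _) (smooth1_smbump _ _ _)).
  - exact: (elem_comp (elem_x2 _) (smooth1_smbump _ _ _)).
  - exact: (elem_comp (elem_y2 _) (smooth1_smbump _ _ _)).
split => //; exists (cbox a b); split; [exact: compact_cbox|by rewrite setTI|].
exact: bbump_out.
Qed.

(** Products of one-dimensional bumps are test functions that converge to the indicator of the open
    box. The majorant is [|g|] restricted to the closed box, integrable because that box is compact
    in [Omega]. *)
Lemma integral_obox0 Omega g a b : open Omega -> cloc_integrable Omega g ->
  (forall phi, elem_test setT Omega phi -> cintegral Omega (fun w => g w * phi w) = 0) ->
  cbox a b `<=` Omega ->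
  cintegral setT (fun w => g w * (\1_(obox a b) w)%:C) = 0.
Proof.
move=> oO ig g0 KO; have mO := open_measurableC2 oO.
have KO' : obox a b `<=` Omega := subset_trans (@obox_cbox a b) KO.
rewrite -(cintegral_csupp KO'); last first.
  by move=> w nw; rewrite indicE memNset// mulr0.
have cK : compact (cbox a b) := @compact_cbox a b; have mK := compact_measurableC2 cK.
have igK : dV.-integrable (cbox a b : set (mC2 R)) (EFin \o (fun w => normc (g w)) : mC2 R -> \bar R).
  apply/integrableP; split.
    apply/measurable_EFinP; apply: measurable_normc.
    by case: ig => -[gr gi] _; split; [exact: measurable_funS gr|exact: measurable_funS gi].
  by under eq_integral do rewrite /= ger0_norm ?normc_ge0//; exact: ig.2.
have /(integrable_mkcond _ mK) igT := igK.
have igO := integrableS measurableT mO (@subsetT _ _) igT.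
have mb n : cmeasurable Omega (bbump a b n).
  apply: cmeasurable_continuous => // w _.
  by have [] := elem_test_wder w openT (bbump_test n KO).
have mi : cmeasurable Omega (fun w => (\1_(obox a b) w)%:C).
  split; last exact: measurable_cst.
  by apply: measurable_funTS; exact: measurable_indic (measurable_obox a b).
have b1 n w : normc (bbump a b n w) <= 1.
  rewrite /bbump !normcM !normc_real !ger0_norm ?smbump_ge0//.
  have m1 (x y : R) : 0 <= x -> 0 <= y -> x <= 1 -> y <= 1 -> x * y <= 1.
    by move=> *; exact: mulr_ile1.
  have q (l h x l' h' x' : R) : smbump l h n x * smbump l' h' n x' <= 1.
    by rewrite m1 ?smbump_ge0 ?smbump_le1.
  by rewrite m1 ?q// mulr_ge0 ?smbump_ge0.
have dom n w : Omega w -> normc (g w * bbump a b n w) <= ((fun w => normc (g w)) \_ (cbox a b)) w.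
  move=> Ow; rewrite normcM patchE; case: ifPn => [_|]; last first.
    by rewrite notin_setE => /bbump_out ->; rewrite normc0 mulr0.
  by rewrite -[leRHS]mulr1 ler_wpM2l// normc_ge0.
have igO' : dV.-integrable (Omega : set (mC2 R))
    (EFin \o ((fun w => normc (g w)) \_ (cbox a b)) : mC2 R -> \bar R).
  by apply: eq_integrable igO => // w _ /=; rewrite !patchE; case: ifP.
have lim w : Omega w -> (fun n => normc (g w * bbump a b n w - g w * (\1_(obox a b) w)%:C)) @ \oo --> (0 : R).
  move=> Ow.
  pose L : R := (\1_(obox a b) w).
  pose s n : R := (smbump a.1.1 b.1.1 n w.1.1) * (smbump a.1.2 b.1.2 n w.1.2) *
    ((smbump a.2.1 b.2.1 n w.2.1) * (smbump a.2.2 b.2.2 n w.2.2)).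
  have LE : L = ((a.1.1 < w.1.1 < b.1.1)%R%:R * (a.1.2 < w.1.2 < b.1.2)%R%:R *
      ((a.2.1 < w.2.1 < b.2.1)%R%:R * (a.2.2 < w.2.2 < b.2.2)%R%:R)).
    rewrite /L indicE; have [/set_mem/oboxP[-> -> -> ->]|/negP nw] := boolP (w \in obox a b).
      by rewrite !mulr1.
    case E1: (a.1.1 < w.1.1 < b.1.1)%R; last by rewrite !mul0r.
    case E2: (a.1.2 < w.1.2 < b.1.2)%R; last by rewrite mulr0 mul0r.
    case E3: (a.2.1 < w.2.1 < b.2.1)%R; last by rewrite mul0r mulr0.
    case E4: (a.2.2 < w.2.2 < b.2.2)%R; last by rewrite !mulr0.
    by exfalso; apply: nw; apply/mem_set/oboxP.
  have sL : s @ \oo --> L.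
    by rewrite LE; apply: cvgM; apply: cvgM; exact: smbump_cvg.
  have e n : normc (g w * bbump a b n w - g w * (\1_(obox a b) w)%:C) = normc (g w) * `|s n - L|.
    rewrite -mulrBr normcM -normc_real; congr (_ * normc _).
    by rewrite /bbump /s -!rmorphM -rmorphB.
  under eq_fun do rewrite e.
  have := cvgM (cvg_cst (normc (g w))) (cvg_norm (cvgB sL (cvg_cst L))).
  by rewrite subrr normr0 mulr0; exact.
have [_ h] := cintegral_dominated mO (fun n => cmeasurableM ig.1 (mb n))
  (cmeasurableM ig.1 mi) dom lim igO'.
have h0 n : normc (cintegral Omega (fun w => g w * bbump a b n w) -
    cintegral Omega (fun w => g w * (\1_(obox a b) w)%:C)) =
    normc (cintegral Omega (fun w => g w * (\1_(obox a b) w)%:C)).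
  by rewrite (g0 _ (bbump_test n KO)) sub0r normcN.
rewrite (_ : (fun n => _) = (fun=> normc (cintegral Omega (fun w => g w * (\1_(obox a b) w)%:C)))) in h; last first.
  by apply/funext => n; exact: h0.
have e := cvg_lim (@norm_hausdorff _ R) h; rewrite lim_cst// in e.
by apply/eqP; rewrite -normc_eq0; apply/eqP; exact: e.
Qed.

Definition ray a : set (C2 R) :=
  (`]a.1.1, +oo[%classic `*` `]a.1.2, +oo[%classic) `*`
  (`]a.2.1, +oo[%classic `*` `]a.2.2, +oo[%classic).

Lemma rayP a w : ray a w <-> [/\ a.1.1 < w.1.1, a.1.2 < w.1.2, a.2.1 < w.2.1 & a.2.2 < w.2.2].
Proof.
split; last by case=> ? ? ? ?; split; split; rewrite /= in_itv /= andbT.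
by case=> -[+ +] [+ +]; rewrite /= !in_itv /= !andbT.
Qed.

Let rays : set (set (mC2 R)) := [set ray a | a in [set: C2 R]].

Let rays_setI : setI_closed rays.
Proof.
move=> _ _ [a _ <-] [b _ <-].
exists ((Num.max a.1.1 b.1.1, Num.max a.1.2 b.1.2), (Num.max a.2.1 b.2.1, Num.max a.2.2 b.2.2)) => //.
apply/seteqP; split => w.
  move=> /rayP[] /=; rewrite !gt_max => /andP[h1 h1'] /andP[h2 h2'] /andP[h3 h3'] /andP[h4 h4'].
  by split; apply/rayP.
move=> [/rayP[h1 h2 h3 h4] /rayP[h1' h2' h3' h4']]; apply/rayP => /=; rewrite !gt_max.
by rewrite h1 h2 h3 h4 h1' h2' h3' h4'.
Qed.

(** The substantial inclusion: each coordinate is measurable for the sigma-algebra generated by the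
    rays, since the half-space [t < c w] is a countable union of rays whose other corner coordinates
    are [- n]. *)
Let measurable_rays : @measurable _ (mC2 R) = <<s rays >>.
Proof.
apply/seteqP; split; last first.
  apply: smallest_sub; first exact: sigma_algebra_measurable.
  by move=> _ [a _ <-]; apply: measurableX; apply: measurableX; exact: measurable_itv.
pose T := g_sigma_algebraType rays.
have ray_cover (P : nat -> C2 R) (A : set T) :
    A = \bigcup_n (ray (P n) : set T) -> measurable A.
  move=> ->; apply: bigcupT_measurable => n; apply: sub_sigma_algebra.
  by exists (P n).
have far (x y z : R) : exists n : nat, [/\ - n%:R < x, - n%:R < y & - n%:R < z].
  exists (Num.truncn (`|x| + `|y| + `|z|)).+1.
  have := truncnS_gt (`|x| + `|y| + `|z|); move: (_.+1%:R) => N hN.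
  have := ler_norm (- x); have := ler_norm (- y); have := ler_norm (- z).
  rewrite !normrN; have := normr_ge0 x; have := normr_ge0 y; have := normr_ge0 z.
  by move=> *; split; lra.
have coord (c : C2 R -> R) (P : R -> nat -> C2 R) :
    (forall t, [set w | t < c w] = \bigcup_n ray (P t n)) ->
    measurable_fun (setT : set T) (c : T -> R).
  move=> h; apply: (measurability _ (RGenOInfty.measurableE R)).
  move=> /= _ [_ [t ->]] <-; apply: (ray_cover (P t)); rewrite -h setTI.
  by apply/seteqP; split => w /=; rewrite in_itv /= andbT.
have m11 : measurable_fun (setT : set T) ((fun w => w.1.1) : T -> R).
  apply: (coord _ (fun t n => ((t, - n%:R), (- n%:R, - n%:R)))) => t.
  apply/seteqP; split => [w /= tw|w [n _] /rayP[]//].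
  by have [n [*]] := far w.1.2 w.2.1 w.2.2; exists n => //; apply/rayP.
have m12 : measurable_fun (setT : set T) ((fun w => w.1.2) : T -> R).
  apply: (coord _ (fun t n => ((- n%:R, t), (- n%:R, - n%:R)))) => t.
  apply/seteqP; split => [w /= tw|w [n _] /rayP[]//].
  by have [n [*]] := far w.1.1 w.2.1 w.2.2; exists n => //; apply/rayP.
have m21 : measurable_fun (setT : set T) ((fun w => w.2.1) : T -> R).
  apply: (coord _ (fun t n => ((- n%:R, - n%:R), (t, - n%:R)))) => t.
  apply/seteqP; split => [w /= tw|w [n _] /rayP[]//].
  by have [n [*]] := far w.1.1 w.1.2 w.2.2; exists n => //; apply/rayP.
have m22 : measurable_fun (setT : set T) ((fun w => w.2.2) : T -> R).
  apply: (coord _ (fun t n => ((- n%:R, - n%:R), (- n%:R, t)))) => t.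
  apply/seteqP; split => [w /= tw|w [n _] /rayP[]//].
  by have [n [*]] := far w.1.1 w.1.2 w.2.1; exists n => //; apply/rayP.
have mid : measurable_fun (setT : set T) (id : T -> mC2 R).
  by apply/measurable_fun_pairP; split; apply/measurable_fun_pairP; split.
by move=> A mA; have := mid measurableT A mA; rewrite setTI.
Qed.

(* The rays generate the Borel sets, so the integrals over boxes determine [g]. *)
Theorem test_vanishing_ae Omega g : open Omega -> cloc_integrable Omega g ->
  (forall phi, elem_test setT Omega phi -> cintegral Omega (fun w => g w * phi w) = 0) ->
  {ae dV, forall w : mC2 R, Omega w -> g w = 0}.
Proof.
move=> oO ig g0; have mO := open_measurableC2 oO.
have [p [pO pcover]] := countable_obox oO.
suff h n : {ae dV, forall w : mC2 R, obox (p n).1 (p n).2 w -> g w = 0}.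
  have := ae_foralln h; apply: filterS => w hw Ow.
  by have [n nw] := pcover _ Ow; exact: hw nw.
have [KO|->] := pO n; last by apply: aeW.
set a := (p n).1; set b := (p n).2; rewrite -/a -/b in KO.
have QO : obox a b `<=` Omega := subset_trans (@obox_cbox a b) KO.
have iQ a' : cbox a' b `<=` Omega -> cintegrable setT (fun w => g w * (\1_(obox a' b) w)%:C).
  move=> KO'; have cK := @compact_cbox a' b; have mK := compact_measurableC2 cK.
  have mQ := measurable_obox a' b.
  have igK : cintegrable (cbox a' b) g.
    apply: cintegrable_lty => //; last exact: ig.2.
    by case: ig => -[gr gi] _; split; [exact: measurable_funS gr|exact: measurable_funS gi].
  have i2 (h : C2 R -> R) : dV.-integrable (cbox a' b : set (mC2 R)) (EFin \o h : mC2 R -> \bar R) ->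
      dV.-integrable (setT : set (mC2 R)) (EFin \o (fun w => h w * \1_(obox a' b) w) : mC2 R -> \bar R).
    move=> /(integrableS mK mQ (@obox_cbox a' b))/(integrable_mkcond _ mQ).
    apply: eq_integrable => // w _ /=; rewrite patchE indicE; case: ifP => _ /=.
      by rewrite mulr1.
    by rewrite mulr0.
  split.
    apply: eq_integrable (i2 _ igK.1) => // w _ /=; rewrite ReM /= mulr0 subr0//.
  by apply: eq_integrable (i2 _ igK.2) => // w _ /=; rewrite ImM /= mulr0 add0r.
have igQ := iQ _ KO.
(* Cutting the box with a ray moves its lower corner only, so that the integral over the
   intersection is again the integral over a box inside [Omega]. *)
have ray_obox c : exists2 a', cbox a' b `<=` Omega & ray c `&` obox a b = obox a' b.
  exists ((Num.max c.1.1 a.1.1, Num.max c.1.2 a.1.2), (Num.max c.2.1 a.2.1, Num.max c.2.2 a.2.2)).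
    apply: subset_trans KO => w /cboxP[] /=; rewrite !ge_max.
    move=> /andP[/andP[_ h1] h1'] /andP[/andP[_ h2] h2'] /andP[/andP[_ h3] h3'] /andP[/andP[_ h4] h4'].
    by apply/cboxP; rewrite h1 h2 h3 h4.
  apply/seteqP; split => w.
    move=> [/rayP[h1 h2 h3 h4] /oboxP[h1' h2' h3' h4']]; apply/oboxP => /=; rewrite !gt_max.
    by rewrite h1 h2 h3 h4.
  move=> /oboxP[] /=; rewrite !gt_max.
  move=> /andP[/andP[h1 k1] l1] /andP[/andP[h2 k2] l2] /andP[/andP[h3 k3] l3] /andP[/andP[h4 k4] l4].
  by split; [apply/rayP|apply/oboxP; rewrite k1 k2 k3 k4].
have z a' : cbox a' b `<=` Omega -> cintegral setT (fun w => g w * (\1_(obox a' b) w)%:C) = 0.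
  by move=> h; exact: integral_obox0 oO ig g0 h.
(* Dynkin's theorem: vanishing integrals over the rays, which are stable under intersection, and
   over the whole space propagate to all measurable sets; then [u] is zero almost everywhere. *)
have key (u : C2 R -> R) : dV.-integrable (setT : set (mC2 R)) (EFin \o u : mC2 R -> \bar R) ->
    (forall c, (\int[dV]_(w in (ray c : set (mC2 R))) (u w)%:E = 0)%E) ->
    (\int[dV]_w (u w)%:E = 0)%E -> {ae dV, forall w : mC2 R, u w = 0}.
  move=> iu hray hT.
  have all0 E : measurable E -> (\int[dV]_(w in E) (u w)%:E = 0)%E.
    move=> mE; have sE : <<s rays >> E by rewrite -measurable_rays.
    apply: (@dynkin_induction _ (mC2 R) rays (fun E => (\int[dV]_(w in E) (u w)%:E = 0)%E)
      measurable_rays rays_setI hT _ _ _ E sE).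
    - by move=> _ [c _ <-]; exact: hray.
    - move=> S mS S0; have := hT; rewrite -(setUv S) integral_setU//; last 3 first.
      + exact: measurableC.
      + by rewrite setUv; exact: measurable_int iu.
      + exact/disj_setPCl.
      by rewrite S0 add0e.
    - move=> F mF tF F0.
      have h0 : semi_sigma_additive (induced_charge iu) by exact: charge_semi_sigma_additive.
      have := h0 F mF tF (bigcupT_measurable _ mF).
      rewrite /induced_charge => h; rewrite -(cvg_lim _ h)//.
      under eq_fun do under eq_bigr do rewrite F0.
      by under eq_fun do rewrite big1//; exact: lim_cst.
  have := @integral_ae_eq _ _ _ dV setT measurableT (fun=> 0%E) _ iu (measurable_cst _).
  case.
    by move=> E _ mE; rewrite all0// integral0.
  move=> N [mN N0 hN]; exists N; split => // w /= nw; apply: hN => /= h.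
  by apply: nw; have [] := h I.
have gr w : Re (g w * (\1_(obox a b) w)%:C) = Re (g w) * \1_(obox a b) w.
  by rewrite ReM /= mulr0 subr0.
have gi w : Im (g w * (\1_(obox a b) w)%:C) = Im (g w) * \1_(obox a b) w.
  by rewrite ImM /= mulr0 add0r.
have fin (u : C2 R -> R) : dV.-integrable (setT : set (mC2 R)) (EFin \o u : mC2 R -> \bar R) ->
    \int[dV]_w u w = 0 -> (\int[dV]_w (u w)%:E = 0)%E.
  by move=> iu; rewrite /Rintegral => e; rewrite -[LHS]fineK ?e// integrable_fin_num.
have rayint (u : C -> R) c a' : u 0 = 0 ->
    ray c `&` obox a b = obox a' b ->
    (\int[dV]_(w in (ray c : set (mC2 R))) (u (g w * (\1_(obox a b) w)%:C))%:E =
    \int[dV]_w (u (g w * (\1_(obox a' b) w)%:C))%:E)%E.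
  move=> u0 <-; rewrite integral_mkcond; apply: eq_integral => w _.
  rewrite patchE !indicE in_setI; case: ifPn => //= _.
  by rewrite mulr0 u0.
have aeR : {ae dV, forall w : mC2 R, Re (g w * (\1_(obox a b) w)%:C) = 0}.
  apply: (key (fun w => Re (g w * (\1_(obox a b) w)%:C)) igQ.1).
    move=> c; have [a' a'O e] := ray_obox c; rewrite (rayint (@complex.Re R) c a')//.
    by apply: fin; [exact: (iQ _ a'O).1|have := z _ a'O; move/(congr1 (@complex.Re R))].
  by apply: fin; [exact: igQ.1|have := z _ KO; move/(congr1 (@complex.Re R))].
have aeI : {ae dV, forall w : mC2 R, Im (g w * (\1_(obox a b) w)%:C) = 0}.
  apply: (key (fun w => Im (g w * (\1_(obox a b) w)%:C)) igQ.2).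
    move=> c; have [a' a'O e] := ray_obox c; rewrite (rayint (@complex.Im R) c a')//.
    by apply: fin; [exact: (iQ _ a'O).2|have := z _ a'O; move/(congr1 (@complex.Im R))].
  by apply: fin; [exact: igQ.2|have := z _ KO; move/(congr1 (@complex.Im R))].
apply: (@filterS2 _ _ (ae_filter_ringOfSetsType dV) _ _ _ _ aeR aeI) => w hR hI wQ.
have e : g w * (\1_(obox a b) w)%:C = 0 by exact: ReIm_eq.
by move: e; rewrite indicE mem_set// mulr1.
Qed.

End Vanishing.

(** * Square-integrable functions, Cauchy-Schwarz, Bessel and Fatou *)

Section SquareIntegrable.
Context {R : realType}.
Local Notation C := R[i].
Local Notation Cfun := (C2 R -> C).
Implicit Types (f g h : Cfun) (w : C2 R) (Omega : set (C2 R)).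

Definition sqnorm Omega f : R := \int[dV]_(w in (Omega : set (mC2 R))) (normc (f w) ^+ 2).

Variable Omega : set (C2 R).
Hypothesis mO : measurable (Omega : set (mC2 R)).
Local Notation L2 := (L2 Omega).
Local Notation inner := (L2inner Omega).
Local Notation sqn := (sqnorm Omega).

Lemma L2_integrable f : L2 f ->
  dV.-integrable (Omega : set (mC2 R)) (EFin \o (fun w => normc (f w) ^+ 2) : mC2 R -> \bar R).
Proof.
move=> [mf fi]; apply/integrableP; split.
  by apply/measurable_EFinP; exact: measurable_normc_sqr.
apply: le_lt_trans fi; rewrite le_eqVlt; apply/orP; left; apply/eqP.
by apply: eq_integral => w _ /=; rewrite ger0_norm// sqr_ge0.
Qed.

Lemma L2_sqn f : L2 f -> (\int[dV]_(w in (Omega : set (mC2 R))) (normc (f w) ^+ 2)%:E)%E = (sqn f)%:E.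
Proof. by move=> /L2_integrable fi; rewrite /sqnorm /Rintegral fineK// integrable_fin_num. Qed.

Lemma sqn_ge0 f : 0 <= sqn f.
Proof. by apply: fine_ge0; apply: integral_ge0 => w _; rewrite lee_fin sqr_ge0. Qed.

Lemma L2_le f (M : R) : cmeasurable Omega f ->
  (\int[dV]_(w in (Omega : set (mC2 R))) (normc (f w) ^+ 2)%:E <= M%:E)%E -> L2 f /\ sqn f <= M.
Proof.
move=> mf fM; have lf : L2 f by split => //; exact: le_lt_trans fM (ltry _).
by split => //; rewrite -lee_fin -L2_sqn.
Qed.

Lemma L2_dom f g (c : R) : cmeasurable Omega f -> L2 g ->
  (forall w, Omega w -> normc (f w) ^+ 2 <= c * normc (g w) ^+ 2) -> L2 f /\ sqn f <= c * sqn g.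
Proof.
move=> mf lg fg; apply: L2_le => //.
have ig := L2_integrable lg.
have := integrableZl mO c ig => icg.
rewrite EFinM -(L2_sqn lg) -integralZl//.
apply: ge0_le_integral => //.
- by move=> w _; rewrite lee_fin sqr_ge0.
- by apply/measurable_EFinP; exact: measurable_normc_sqr.
- by case/integrableP: icg.
Qed.

Lemma L2Z (c : C) f : L2 f -> L2 (fun w => c * f w) /\ sqn (fun w => c * f w) <= normc c ^+ 2 * sqn f.
Proof.
move=> lf; apply: L2_dom => //.
  by apply: cmeasurableM => //; [exact: cmeasurable_cst|case: lf].
by move=> w _; rewrite normcM exprMn.
Qed.

Lemma L2D f g : L2 f -> L2 g -> L2 (fun w => f w + g w) /\ sqn (fun w => f w + g w) <= 2 * sqn f + 2 * sqn g.
Proof.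
move=> lf lg; apply: L2_le.
  by apply: cmeasurableD => //; [case: lf|case: lg].
have i1 := integrableZl mO 2 (L2_integrable lf).
have i2 := integrableZl mO 2 (L2_integrable lg).
rewrite EFinD !EFinM -(L2_sqn lf) -(L2_sqn lg) -!integralZl//; try exact: L2_integrable.
rewrite -integralD//; apply: ge0_le_integral => //.
- by move=> w _; rewrite lee_fin sqr_ge0.
- apply/measurable_EFinP; apply: measurable_normc_sqr => //.
  by apply: cmeasurableD => //; [case: lf|case: lg].
- by case/integrableP: (integrableD mO i1 i2).
- by move=> w _; rewrite -!EFinM -EFinD lee_fin normcD_sqr.
Qed.

Lemma eq_L2 f g : (forall w, Omega w -> f w = g w) -> L2 f -> L2 g.
Proof.
move=> fg [mf fi]; split; first exact: eq_cmeasurable mf.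
apply: le_lt_trans fi; rewrite le_eqVlt; apply/orP; left; apply/eqP.
by apply: eq_integral => w /set_mem Ow; rewrite fg.
Qed.

Lemma eq_sqn f g : (forall w, Omega w -> f w = g w) -> sqn f = sqn g.
Proof. by move=> fg; apply: eq_Rintegral => w /set_mem Ow; rewrite fg. Qed.

Lemma L2N f : L2 f -> L2 (fun w => - f w).
Proof.
by move=> lf; apply: eq_L2 (L2Z (-1) lf).1 => w _; rewrite mulN1r.
Qed.

Lemma L2B f g : L2 f -> L2 g -> L2 (fun w => f w - g w) /\ sqn (fun w => f w - g w) <= 2 * sqn f + 2 * sqn g.
Proof.
move=> lf lg; have [h1 h2] := L2D lf (L2N lg); split => //; apply: (le_trans h2).
rewrite (_ : sqn (fun w => - g w) = sqn g)//.
by apply: eq_Rintegral => w _; rewrite normcN.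
Qed.

Lemma L2_0 : L2 (fun=> 0).
Proof.
split; first exact: cmeasurable_cst.
by rewrite integral0_eq ?ltry// => w _; rewrite normc0 expr0n.
Qed.

Lemma L2_sum (I : Type) (r : seq I) (P : pred I) (F : I -> Cfun) :
  (forall i, P i -> L2 (F i)) -> L2 (fun w => \sum_(i <- r | P i) F i w).
Proof.
move=> lF; elim: r => [|i r IH]; first by under eq_fun do rewrite big_nil; exact: L2_0.
case Pi : (P i); last by under eq_fun do rewrite big_cons Pi.
by under eq_fun do rewrite big_cons Pi; exact: (L2D (lF i Pi) IH).1.
Qed.

Lemma L2_mul f g : L2 f -> L2 g -> cintegrable Omega (fun w => f w * g w).
Proof.
move=> lf lg; have i := integrableD mO (L2_integrable lf) (L2_integrable lg).
apply: (@cintegrable_le _ _ mO _ (fun w => normc (f w) ^+ 2 + normc (g w) ^+ 2)); first by apply: cmeasurableM => //; [case: lf|case: lg].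
  move=> w _; rewrite normcM; have := sqr_ge0 (normc (f w) - normc (g w)).
  have := normc_ge0 (f w); have := normc_ge0 (g w).
  move: (normc (f w)) (normc (g w)) => x y; nra.
exact: i.
Qed.

Lemma L2J g : L2 g -> L2 (fun w => (g w)^*).
Proof.
move=> [mg ig]; split; first exact: cmeasurableJ.
by under eq_integral do rewrite normc_conj.
Qed.

Lemma L2_inner_int f g : L2 f -> L2 g -> cintegrable Omega (fun w => f w * (g w)^*).
Proof. by move=> lf /L2J lg; exact: L2_mul. Qed.

Lemma innerZ c f g : L2 f -> L2 g -> inner (fun w => c * f w) g = c * inner f g.
Proof.
move=> lf lg; rewrite /L2inner -cintegralZ//; try exact: L2_inner_int.
by apply: eq_cintegral => w _; rewrite mulrA.
Qed.

Lemma innerB f f' g : L2 f -> L2 f' -> L2 g ->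
  inner (fun w => f w - f' w) g = inner f g - inner f' g.
Proof.
move=> lf lf' lg; rewrite /L2inner -cintegralB//; try exact: L2_inner_int.
by apply: eq_cintegral => w _; rewrite mulrBl.
Qed.

Lemma inner_sum (I : Type) (r : seq I) (P : pred I) (F : I -> Cfun) g :
  (forall i, P i -> L2 (F i)) -> L2 g ->
  inner (fun w => \sum_(i <- r | P i) F i w) g = \sum_(i <- r | P i) inner (F i) g.
Proof.
move=> lF lg; rewrite /L2inner -cintegral_sum//; last by move=> i Pi; apply: L2_inner_int => //; exact: lF.
by apply: eq_cintegral => w _; rewrite mulr_suml.
Qed.

Lemma conjR (x : R) : (x%:C)^* = x%:C.
Proof. by apply: ReIm_eq => //=; rewrite oppr0. Qed.

Lemma innerJ f g : L2 f -> L2 g -> (inner f g)^* = inner g f.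
Proof.
move=> lf lg; rewrite /L2inner -cintegralJ//; last exact: L2_inner_int.
by apply: eq_cintegral => w _; rewrite conjcM mulrC; congr (_ * _); apply: ReIm_eq; rewrite ?ReJ ?ImJ ?opprK.
Qed.

Lemma inner_sqn f : inner f f = (sqn f)%:C.
Proof.
apply: ReIm_eq.
  by rewrite Re_cintegral; apply: eq_Rintegral => w _; rewrite mulcJ.
rewrite /L2inner /cintegral [LHS]/=; under eq_Rintegral do rewrite mulcJ /=.
by rewrite /Rintegral integral0.
Qed.

(** Integrates the pointwise inequality [2 |f g| <= t |f|^2 + |g|^2 / t]; the parameter [t] is
    optimised in [cauchy_schwarz]. *)
Lemma inner_le f g (t : R) : L2 f -> L2 g -> 0 < t ->
  2 * normc (inner f g) <= t * sqn f + t^-1 * sqn g.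
Proof.
move=> lf lg t0; have ii := L2_inner_int lf lg.
have i1 := integrableZl mO t (L2_integrable lf).
have i2 := integrableZl mO t^-1 (L2_integrable lg).
have h := normc_cintegral_le mO ii.
have i3 := integrable_normc mO ii.
rewrite -lee_fin EFinD !EFinM -(L2_sqn lf) -(L2_sqn lg) -!integralZl//; try exact: L2_integrable.
rewrite -integralD//; apply: (@le_trans _ _ (2%:E * (\int[dV]_(w in (Omega : set (mC2 R))) (normc (f w * (g w)^*))%:E))%E).
  rewrite lee_pmul2l// -[leRHS]fineK ?integrable_fin_num//.
rewrite -integralZl//; apply: le_integral => //.
- exact: integrableZl.
- exact: integrableD.
move=> w _; rewrite -!EFinM -EFinD lee_fin normcM normc_conj.
have tV : t * t^-1 = 1 by rewrite divff// gt_eqF.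
have tV0 : 0 < t^-1 by rewrite invr_gt0.
have := sqr_ge0 (t * normc (f w) - normc (g w)).
move=> /(mulr_ge0 (ltW tV0)); move: (normc (f w)) (normc (g w)) (t^-1) tV => x y u tu.
have -> : u * (t * x - y) ^+ 2 = (t * u) * (t * x ^+ 2) - 2 * (t * u) * (x * y) + u * y ^+ 2 by ring.
by rewrite tu; lra.
Qed.

(** With [x] the modulus of the inner product and [A], [B] the square norms, the choice [t = x / A]
    gives [2 x <= x + A B / x]. If [A = 0] and [x > 0], then [t = (B + 1) / x] gives
    [2 x <= x B / (B + 1)], which is absurd. *)
Lemma cauchy_schwarz f g : L2 f -> L2 g -> normc (inner f g) ^+ 2 <= sqn f * sqn g.
Proof.
move=> lf lg; have H t := @inner_le f g t lf lg.
move: (normc_ge0 (inner f g)) (sqn_ge0 f) (sqn_ge0 g) H.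
move: (normc _) (sqn f) (sqn g) => x A B x0 A0 B0 H.
have [->|xn] := eqVneq x 0; first by rewrite expr0n mulr_ge0.
have xp : 0 < x by rewrite lt0r xn.
have [AE|An] := eqVneq A 0.
  exfalso; have t0 : 0 < (B + 1) / x by rewrite divr_gt0// ltr_wpDl.
  have := H _ t0; rewrite AE mulr0 add0r invf_div mulrAC ler_pdivlMr; last by lra.
  nra.
have Ap : 0 < A by rewrite lt0r An.
have t0 : 0 < x / A by rewrite divr_gt0.
have := H _ t0; rewrite divfK// invf_div => h.
have : x <= A / x * B by lra.
by rewrite mulrAC ler_pdivlMr// expr2.
Qed.

Section Orthogonal.
Context {I : eqType} (r : seq I) (e : I -> Cfun).
Hypotheses (ur : uniq r) (le : forall i, L2 (e i))
  (oe : forall i j, i != j -> inner (e i) (e j) = 0).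

Lemma inner_lincomb (c : I -> C) j : inner (fun w => \sum_(i <- r) c i * e i w) (e j) =
  if j \in r then c j * (sqn (e j))%:C else 0.
Proof.
rewrite inner_sum//; last by move=> i _; exact: (L2Z _ (le i)).1.
under eq_bigr do rewrite innerZ//.
case: ifPn => jr.
  rewrite (bigD1_seq j)//= big1 ?addr0 ?inner_sqn// => i ij.
  by rewrite oe// mulr0.
rewrite big_seq big1// => i ir; rewrite oe ?mulr0//.
by apply: contraNneq jr => <-.
Qed.

Lemma sqn_lincomb (c : I -> C) : sqn (fun w => \sum_(i <- r) c i * e i w) =
  \sum_(i <- r) normc (c i) ^+ 2 * sqn (e i).
Proof.
set s : Cfun := fun w => _; have ls : L2 s by apply: L2_sum => i _; exact: (L2Z _ (le i)).1.
apply: (@complexI R); rewrite -inner_sqn {1}/s inner_sum//; last first.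
  by move=> i _; exact: (L2Z _ (le i)).1.
rewrite rmorph_sum; apply: eq_big_seq => i ir.
rewrite innerZ// -innerJ// inner_lincomb ir conjcM.
rewrite [X in _ * (_ * X) = _](conjR (sqn (e i))) mulrA mulcJ.
by rewrite -rmorphM.
Qed.

Hypothesis (e0 : forall i, 0 < sqn (e i)).

(** The finite expansion [s] satisfies [<f, s> = |s|^2], so [|f - s|^2 = |f|^2 - |s|^2], and the
    left side is nonnegative. *)
Lemma bessel f : L2 f -> \sum_(i <- r) normc (inner f (e i)) ^+ 2 / sqn (e i) <= sqn f.
Proof.
move=> lf; pose c i : C := inner f (e i) / (sqn (e i))%:C.
pose s w : C := \sum_(i <- r) c i * e i w.
have ls : L2 s by apply: L2_sum => i _; exact: (L2Z _ (le i)).1.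
have cE i : normc (c i) ^+ 2 * sqn (e i) = normc (inner f (e i)) ^+ 2 / sqn (e i).
  rewrite /c normcM normcV normc_real ger0_norm ?sqn_ge0// exprMn exprVn.
  by field; rewrite gt_eqF.
under eq_bigr do rewrite -cE; rewrite -sqn_lincomb -/s.
have fs : inner s f = (sqn s)%:C.
  rewrite [in LHS]/s inner_sum//; last by move=> i _; exact: (L2Z _ (le i)).1.
  rewrite sqn_lincomb rmorph_sum; apply: eq_bigr => i _.
  transitivity ((normc (c i) ^+ 2)%:C * (sqn (e i))%:C); last by rewrite -rmorphM.
  have iE : inner f (e i) = c i * (sqn (e i))%:C.
    by rewrite /c divfK//; apply/eqP => /(congr1 (fun x => Re x))/= h; move: (e0 i); rewrite h ltxx.
  rewrite innerZ// -innerJ// iE conjcM.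
  rewrite [X in _ * (_ * X) = _](conjR (sqn (e i))) mulrA mulcJ//.
have fs' : inner f s = (sqn s)%:C.
  by rewrite -innerJ// fs conjR.
have [ld _] := L2B lf ls.
set d := fun w => f w - s w in ld *.
have e1 : Re (inner f d) = sqn f - sqn s.
  by rewrite -(innerJ ld lf) ReJ innerB// fs inner_sqn.
have e2 : Re (inner s d) = 0.
  by rewrite -(innerJ ld ls) ReJ innerB// fs' inner_sqn subrr.
have := sqn_ge0 d; rewrite (_ : sqn d = sqn f - sqn s) ?subr_ge0//.
have := congr1 (fun x => Re x) (innerB lf ls ld).
by rewrite inner_sqn ReD ReN e1 e2 subr0.
Qed.

End Orthogonal.

(** Replaces the completeness of L^2: the limits that occur are already known pointwise, and only
    their integrability and a bound are wanted. *)
Lemma L2_fatou (F : nat -> Cfun) f (M : R) : (forall n, L2 (F n)) -> cmeasurable Omega f ->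
  (forall n, sqn (F n) <= M) ->
  (forall w, Omega w -> (fun n => normc (F n w - f w)) @ \oo --> (0 : R)) ->
  L2 f /\ sqn f <= M.
Proof.
move=> lF mf FM Ff; apply: L2_le => //.
have c2 w : Omega w -> (fun n => (normc (F n w) ^+ 2)%:E) @ \oo --> (normc (f w) ^+ 2)%:E.
  move=> Ow; apply: cvg_EFin; first by near=> n.
  have h : (fun n => normc (F n w)) @ \oo --> normc (f w).
    apply/cvgrPdist_le => /= e e0.
    have /cvgrPdist_le/(_ e e0) := Ff w Ow; apply: filterS => n.
    rewrite sub0r normrN ger0_norm ?normc_ge0// => h1.
    rewrite ler_norml; apply/andP; split.
      rewrite lerNl opprB lerBlDr (le_trans _ (lerD h1 (lexx _)))//.
      by rewrite (le_trans _ (normcD _ _))// subrK.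
    rewrite lerBlDr; apply: (le_trans _ (lerD h1 (lexx _))).
    rewrite -(normcN (F n w - f w)) opprB; apply: (le_trans _ (normcD _ _)).
    by rewrite subrK.
  have -> : (fine \o (fun n => (normc (F n w) ^+ 2)%:E)) = (fun n => normc (F n w) * normc (F n w)).
    by apply/funext => n /=; rewrite expr2.
  by rewrite expr2; exact: cvgM.
apply: (@le_trans _ _ (\int[dV]_(w in (Omega : set (mC2 R))) limn_einf (fun n => (normc (F n w) ^+ 2)%:E))%E).
  rewrite le_eqVlt; apply/orP; left; apply/eqP; apply: eq_integral => w /set_mem Ow.
  have h := c2 w Ow; have := is_cvg_limn_einfE (cvgP _ h); rewrite (cvg_lim _ h)//.
apply: (@le_trans _ _ (limn_einf (fun n => \int[dV]_(w in (Omega : set (mC2 R))) (normc (F n w) ^+ 2)%:E))%E).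
  apply: fatou => //.
    by move=> n; apply/measurable_EFinP; apply: measurable_normc_sqr => //; case: (lF n).
  by move=> n w _; rewrite lee_fin sqr_ge0.
rewrite (_ : (fun n => _) = (fun n => (sqn (F n))%:E)); last first.
  by apply/funext => n; exact: L2_sqn.
rewrite limn_einf_lim; apply: lime_le; first exact: is_cvg_einfs.
near=> n; apply: (@le_trans _ _ (sqn (F n))%:E); last by rewrite lee_fin.
by apply: ereal_inf_lbound; exists n => /=.
Unshelve. all: by end_near.
Qed.

End SquareIntegrable.

(** * Smooth functions with compact support in the open unit interval *)

Section Supported.
Context {R : realType}.
Implicit Types (A B F : R -> R) (x : R).

Definition csupp01 A := smooth1 A /\
  exists al be : R, [/\ 0 < al, be < 1 & forall x, ~~ (al <= x <= be) -> A x = 0].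

Lemma csupp01_out A x : csupp01 A -> ~~ (0 < x < 1) -> A x = 0.
Proof.
move=> [_ [al [be [al0 be1 A0]]]] nx; apply: A0; apply: contra nx => /andP[h1 h2].
by rewrite (lt_le_trans al0)// (le_lt_trans h2).
Qed.

Lemma csupp01_near0 A al be x : (forall x, ~~ (al <= x <= be) -> A x = 0) ->
  ~~ (al <= x <= be) -> \near x, A x = 0.
Proof.
move=> A0; rewrite negb_and -!ltNge => /orP[h|h].
  near=> y; apply: A0; rewrite negb_and -ltNge; apply/orP; left; near: y.
  by apply: open_nbhs_nbhs; split => //; exact: open_lt.
near=> y; apply: A0; rewrite negb_and -!ltNge; apply/orP; right; near: y.
by apply: open_nbhs_nbhs; split => //; exact: open_gt.
Unshelve. all: by end_near. Qed.

Lemma csupp01_derive A : csupp01 A -> exists2 A', (forall x, is_derive x 1 A (A' x)) & csupp01 A'.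
Proof.
move=> [/smooth1_derive[A' dA sA'] [al [be [al0 be1 A0]]]]; exists A' => //.
split => //; exists al, be; split => // x nx.
have n0 := csupp01_near0 A0 nx.
have d0 : is_derive x 1 A 0.
  by apply: (@near_eq_is_derive _ _ _ (fun=> 0)) (is_derive_cst _ _ _);
    apply: filterS n0 => y ->.
by have [_ <-] := dA x; have [_ <-] := d0.
Qed.

Lemma csupp01D A B : csupp01 A -> csupp01 B -> csupp01 (fun x => A x + B x).
Proof.
move=> [sA [al [be [al0 be1 A0]]]] [sB [al' [be' [al0' be1' B0]]]].
split; first exact: smooth1D.
exists (Num.min al al'), (Num.max be be'); split.
- by rewrite lt_min al0.
- by rewrite gt_max be1.
- move=> x; rewrite ge_min le_max => h; rewrite A0 ?B0 ?addr0//.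
    by apply: contra h => /andP[-> ->]; rewrite !orbT.
  by apply: contra h => /andP[-> ->].
Qed.

Lemma csupp01M A B : csupp01 A -> smooth1 B -> csupp01 (fun x => B x * A x).
Proof.
move=> [sA [al [be [al0 be1 A0]]]] sB; split; first exact: smooth1M.
by exists al, be; split => // x nx; rewrite A0// mulr0.
Qed.

Lemma csupp01Z (c : R) A : csupp01 A -> csupp01 (fun x => c * A x).
Proof. by move=> cA; apply: csupp01M => //; exact: smooth1_cst. Qed.

Lemma is_derive1X A n x (a : R) : is_derive x 1 A a ->
  is_derive x 1 (fun x => A x ^+ n.+1) (n.+1%:R * A x ^+ n * a).
Proof.
move=> dA; elim: n => [|n IH].
  by under eq_fun do rewrite expr1; rewrite expr0 !mul1r.
under eq_fun do rewrite exprS.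
apply: is_derive_eq (is_derive1M dA IH) _.
by rewrite -[n.+2%:R]natr1 exprS; ring.
Qed.

Lemma is_derive_exprz (z : int) x : x != 0 ->
  is_derive x 1 (fun y : R => y ^ z) (z%:~R * x ^ (z - 1)).
Proof.
move=> x0; case: z => [[|n]|n].
- by rewrite mul0r; under eq_fun do rewrite expr0z; exact: is_derive_cst.
- apply: is_derive_eq (is_derive1X n (is_derive_id x (1 : R))) _.
  by rewrite mulr1 -pmulrn; congr (_ * _); rewrite intS addrC addKr.
have h := is_derive1X n (is_derive_id x (1 : R)).
pose F y : R := y ^+ n.+1.
have F0 : F x != 0 by rewrite expf_neq0.
have d := @derivableV _ _ F x 1 F0 (@ex_derive _ _ _ _ _ _ _ h).
have e := @deriveV _ _ F x 1 F0 (@ex_derive _ _ _ _ _ _ _ h).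
apply: DeriveDef; first exact: d.
rewrite [LHS]e (@derive_val _ _ _ _ _ _ _ h) /GRing.scale /= mulr1 /F.
rewrite NegzE (_ : - n.+1%:Z - 1 = - n.+2%:Z); last first.
  by rewrite -opprD -[1]/(1%:Z) -PoszD addn1.
rewrite -exprnN mulrNz -pmulrn (_ : x ^+ n.+2 = x * x ^+ n.+1); last by rewrite exprS.
by rewrite (exprS x n); field; rewrite expf_neq0 ?x0.
Qed.

(** The coinduction class for [x ^ z * A x] with integer [z]. The support of [A] stays away from 0,
    so a negative power does no harm, and sums absorb the two terms of the product rule. *)
Inductive zmul : (R -> R) -> Prop :=
| zmul_base (z : int) A : csupp01 A -> zmul (fun x => x ^ z * A x)
| zmulD F G : zmul F -> zmul G -> zmul (fun x => F x + G x).

Let zmul_derive F : zmul F -> exists2 F', (forall x, is_derive x 1 F (F' x)) & zmul F'.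
Proof.
elim=> {F} [z A cA|F G zF [F' dF zF'] zG [G' dG zG']]; last first.
  exists (fun x => F' x + G' x); last exact: zmulD.
  by move=> x; exact: is_derive1D.
have [A' dA cA'] := csupp01_derive cA.
exists (fun x => x ^ z * A' x + x ^ (z - 1) * (z%:~R * A x)); last first.
  by apply: zmulD; apply: zmul_base => //; exact: csupp01Z.
move=> x; have [x0|x0] := eqVneq x 0.
  have [_ [al [be [al0 be1 A0]]]] := cA.
  have nx : ~~ (al <= x <= be) by rewrite x0 negb_and -ltNge al0.
  have n0 := csupp01_near0 A0 nx.
  have nx' : ~~ (0 < x < 1) by rewrite x0 ltxx.
  rewrite (csupp01_out cA' nx') (csupp01_out cA nx') !mulr0 addr0.
  apply: (@near_eq_is_derive _ _ _ (fun=> 0)) (is_derive_cst _ _ _).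
  by apply: filterS n0 => y ->; rewrite mulr0.
apply: is_derive_eq (is_derive1M (is_derive_exprz z x0) (dA x)) _.
by rewrite [z%:~R * _]mulrC mulrA.
Qed.

Lemma csupp01_exprz (z : int) A : csupp01 A -> csupp01 (fun x => x ^ z * A x).
Proof.
move=> cA; split; last first.
  have [_ [al [be [al0 be1 A0]]]] := cA; exists al, be; split => // x nx.
  by rewrite A0// mulr0.
exact: (@smooth1_coind _ zmul zmul_derive _ (zmul_base z cA)).
Qed.

Definition I01 A : R := \int[lebesgue_measure]_(x in (`[0, 1]%classic : set R)) A x.

Lemma smooth1_integrable A (a b : R) : smooth1 A ->
  (@lebesgue_measure R).-integrable (`[a, b]%classic : set R) (EFin \o A).
Proof.
move=> sA; apply: continuous_compact_integrable; first exact: segment_compact.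
exact/continuous_subspaceT/smooth1_continuous.
Qed.

Lemma I01Z (c : R) A : smooth1 A -> I01 (fun x => c * A x) = c * I01 A.
Proof. by move=> sA; rewrite /I01 RintegralZl//; exact: smooth1_integrable. Qed.

Lemma I01B A B : smooth1 A -> smooth1 B -> I01 (fun x => A x - B x) = I01 A - I01 B.
Proof. by move=> sA sB; rewrite /I01 RintegralB//; exact: smooth1_integrable. Qed.

(** The primitive vanishes to the left of the support of [B] trivially, and to the right because the
    total integral is zero. *)
Lemma csupp01_primitive B : csupp01 B -> I01 B = 0 ->
  exists2 G, csupp01 G & forall x, is_derive x 1 G (B x).
Proof.
move=> cB IB; have [sB [al [be [al0 be1 B0]]]] := cB.
(* The base point [-1] lies strictly to the left of the support, so that the fundamental theorem
   applies at every point where it is needed. *)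
pose G x : R := \int[lebesgue_measure]_(t in (`[-1, x]%classic : set R)) B t.
have sG : forall x, is_derive x 1 G (B x) /\ (~~ (al <= x <= be) -> G x = 0).
  move=> x.
  have G0 y : y < al -> G y = 0.
    move=> ya; rewrite /G (@eq_Rintegral _ _ _ _ _ (fun=> 0)); last first.
      move=> t; rewrite inE /= in_itv /= => /andP[_ ty]; apply: B0.
      by rewrite negb_and -ltNge (le_lt_trans ty).
    by rewrite /Rintegral integral0.
  have G1 y : be < y -> G y = 0.
    move=> yb; rewrite -[RHS]IB /G /I01 Rintegral_mkcond [RHS]Rintegral_mkcond.
    apply: eq_Rintegral => t _; rewrite !patchE.
    have [tin|/B0 ->] := boolP (al <= t <= be); last by do 2! case: ifP.
    have [t1 t2] := andP tin.
    rewrite !mem_set//= in_itv /=; apply/andP; split.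
    - by rewrite (le_trans _ t1)// ltW.
    - by rewrite (le_trans t2)// ltW.
    - by rewrite (le_trans _ t1)// (le_trans _ (ltW al0))// lerN10.
    - by rewrite (le_trans t2)// ltW.
  split; last by rewrite negb_and -!ltNge => /orP[/G0|/G1].
  have [xa|xa] := ltP x al.
    rewrite B0; last by rewrite negb_and -ltNge xa.
    apply: (@near_eq_is_derive _ _ _ (fun=> 0)) (is_derive_cst _ _ _).
    near=> y; rewrite G0//; near: y.
    by apply: open_nbhs_nbhs; split => //; exact: open_lt.
  have x1 : -1 < x by rewrite (lt_le_trans _ xa)// (lt_trans _ al0)// ltrN10.
  have [d e] := @continuous_FTC1_closed _ B (-1) x (x + 1) (ltr_pwDr ltr01 (lexx x))
    (smooth1_integrable (-1) (x + 1) sB) x1 (@smooth1_continuous _ _ sB x).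
  by rewrite -e derive1E; exact: derivableP.
exists G; last by move=> x; exact: (sG x).1.
split; last by exists al, be; split => // x; exact: (sG x).2.
move=> [|k] //=; exists B; last exact: sB.
by move=> x; exact: (sG x).1.
Unshelve. all: by end_near. Qed.

(* Cut-offs that converge to 1 on ]0, 1[. *)
Definition cut (n : nat) : R -> R :=
  smbump (n.+2%:R^-1) (1 - n.+2%:R^-1) (n.+2 * n.+2)%N.

Lemma csupp01_cut n : csupp01 (cut n).
Proof.
have n0 : 0 < n.+2%:R^-1 :> R by rewrite invr_gt0.
split; first exact: smooth1_smbump.
exists (n.+2%:R^-1), (1 - n.+2%:R^-1); split.
- exact: n0.
- by rewrite gtrDl oppr_lt0.
- move=> x nx; apply: smbump_eq0; apply: contra nx => /andP[h1 h2].
  by rewrite !ltW.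
Qed.

Lemma cut_ge0 n x : 0 <= cut n x. Proof. exact: smbump_ge0. Qed.
Lemma cut_le1 n x : cut n x <= 1. Proof. exact: smbump_le1. Qed.

(** The steepness [n.+2 * n.+2] outweighs the shrinking margin [1 / n.+2]: at distance [y] from an
    end point the argument of the bump is [(n + 2) ((n + 2) y - 1)], which is at least [n + 2] once
    [(n + 2) y >= 2]. *)
Lemma cut_cvg x : 0 < x < 1 -> (fun n => cut n x) @ \oo --> (1 : R).
Proof.
move=> /andP[x0 x1].
have key y : 0 < y -> (fun n : nat => expbump ((n.+2 * n.+2)%:R * (y - n.+2%:R^-1))) @ \oo --> (1 : R).
  move=> y0.
  have low : (fun n : nat => expbump (n.+2%:R * 1)) @ \oo --> (1 : R).
    have := expbump_cvg (@ltr01 R); rewrite -(cvg_shiftn 2) => h.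
    by under eq_fun do rewrite -addn2; exact: h.
  apply: (squeeze_cvgr _ low (@cvg_cst _ _ _ _ _)).
  near=> n; rewrite expbump_le1 andbT.
  have n0 : 0 < n.+2%:R :> R by rewrite ltr0n.
  have mono (s t : R) : 0 < s -> s <= t -> expbump s <= expbump t.
    move=> s0 st; rewrite /expbump s0 (lt_le_trans s0 st) ler_expR lerN2.
    by rewrite lef_pV2 ?posrE// (lt_le_trans s0 st).
  apply: mono; first by rewrite mulr1.
  rewrite natrM -mulrA ler_pM2l// mulrBr divff ?gt_eqF// lerBrDr -[1 + 1]/(2%:R).
  rewrite -ler_pdivrMr//; apply: ltW; near: n.
  have e20 : 0 < 2 / y by rewrite divr_gt0.
  exists (Num.truncn (2 / y)).+1 => // n /= hn.
  apply: (lt_trans (truncnS_gt _)); rewrite ltr_nat.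
  by rewrite ltnS (leq_trans hn).
rewrite -[X in _ --> X]mulr1 /cut /smbump; apply: cvgM; first exact: key.
have e n : expbump ((n.+2 * n.+2)%:R * (1 - n.+2%:R^-1 - x)) =
    expbump ((n.+2 * n.+2)%:R * ((1 - x) - n.+2%:R^-1)).
  by congr expbump; ring.
by under eq_fun do rewrite e; apply: key; rewrite subr_gt0.
Unshelve. all: by end_near. Qed.

Lemma smooth1X A n : smooth1 A -> smooth1 (fun x => A x ^+ n).
Proof.
move=> sA; elim: n => [|k IH]; first exact: smooth1_cst.
by under eq_fun do rewrite exprS; exact: smooth1M.
Qed.

Lemma I01_FTC F G : smooth1 F -> (forall x, is_derive x 1 G (F x)) -> I01 F = G 1 - G 0.
Proof.
move=> sF dG; have sG : smooth1 G by move=> [|k] //=; exists F.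
rewrite /I01 /Rintegral (@continuous_FTC2 _ F G) //.
- exact/continuous_subspaceT/smooth1_continuous.
- have cG := smooth1_continuous sG; split.
  + by move=> x _; have [] := dG x.
  + exact/cvg_at_right_filter/cG.
  + exact/cvg_at_left_filter/cG.
- by move=> x _; rewrite derive1E; have [_ ->] := dG x.
Qed.

Lemma I01_exprn a : I01 (fun x => x ^+ a) = a.+1%:R^-1.
Proof.
have sF : smooth1 (fun x : R => x ^+ a) by apply: smooth1X; exact: smooth1_id.
have dG x : is_derive x 1 (fun x => a.+1%:R^-1 * x ^+ a.+1) (x ^+ a).
  have d := is_derive1X a (is_derive_id x (1 : R)).
  apply: is_derive_eq (is_derive1M (is_derive_cst (a.+1%:R^-1 : R) x 1) d) _.
  by rewrite mul0r addr0 mulr1 mulrA mulVf ?mul1r// pnatr_eq0.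
by rewrite (I01_FTC sF dG) expr1n expr0n /= mulr0 mulr1 subr0.
Qed.

Lemma I01_onem_exprn a : I01 (fun x => (1 - x) ^+ a) = a.+1%:R^-1.
Proof.
have d1 x : is_derive x 1 (fun x : R => 1 - x) (-1).
  by apply: is_derive_eq (is_deriveB (is_derive_cst (1 : R) x 1) (is_derive_id x 1)) _; rewrite sub0r.
have sF : smooth1 (fun x : R => (1 - x) ^+ a).
  apply: smooth1X; have := smooth1_affine (-1) (1 : R).
  by congr smooth1; apply/funext => x; rewrite mulN1r addrC.
have dG x : is_derive x 1 (fun x => - a.+1%:R^-1 * (1 - x) ^+ a.+1) ((1 - x) ^+ a).
  have d := is_derive1X a (d1 x).
  apply: is_derive_eq (is_derive1M (is_derive_cst (- a.+1%:R^-1 : R) x 1) d) _.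
  by rewrite mul0r addr0 mulrN1 mulNr mulrN opprK mulrA mulVf ?mul1r// pnatr_eq0.
by rewrite (I01_FTC sF dG) subrr subr0 expr1n expr0n /= mulr0 mulr1 sub0r opprK.
Qed.

(** The cut-offs tend to 1 on the open interval only, so the end points are dropped before dominated
    convergence is applied. *)
Lemma I01_cut_cvg F : smooth1 F -> (fun n => I01 (fun x => F x * cut n x)) @ \oo --> I01 F.
Proof.
move=> sX.
have sF n : smooth1 (fun x => F x * cut n x) by apply: smooth1M => //; exact: (csupp01_cut n).1.
pose D : set R := `]0, 1[%classic.
have I01o G : smooth1 G -> I01 G = \int[lebesgue_measure]_(x in D) G x.
  move=> sF'; have i := @smooth1_integrable G 0 1 sF'.
  rewrite /I01 -(Rintegral_itv_obnd_cbnd (b := BRight 1)).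
    rewrite -Rintegral_itv_bndo_bndc//.
    by apply: integrableS i => //; apply: subset_itv_oo_cc.
  by apply: integrableS i => //; apply: subset_itv_oc_cc.
rewrite I01o//; under eq_fun do rewrite I01o//.
have cts (G : R -> R) : smooth1 G -> measurable_fun D (EFin \o G).
  move=> sG; apply/measurable_EFinP; apply: measurable_funTS.
  by apply: continuous_measurable_fun => x; exact: (@smooth1_continuous _ _ sG x).
have iF : (@lebesgue_measure R).-integrable D (EFin \o F).
  by have i := smooth1_integrable 0 1 sX; apply: integrableS i => //; rewrite /D; [exact: measurable_itv|exact: subset_itv_oo_cc].
have := @dominated_convergence _ _ _ (@lebesgue_measure R) D (measurable_itv _)
  (fun n x => (F x * cut n x)%:E) (fun x => (F x)%:E) (fun x => `|F x|%:E).
case.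
- by move=> n; exact: cts (sF n).
- exact: cts.
- apply: aeW => x; rewrite /D /= in_itv /= => x01; apply/cvg_EFin; first by near=> n.
  have h : (fun n => F x * cut n x) @ \oo --> F x * (1 : R).
    by apply: cvgM; [exact: cvg_cst|exact: cut_cvg].
  by rewrite mulr1 in h; exact: h.
- exact: integrable_norm iF.
- apply: aeW => x n _; rewrite lee_fin normrM (ger0_norm (cut_ge0 n x)).
  by rewrite -[leRHS]mulr1 ler_wpM2l// cut_le1.
move=> _ _ h; have e : (\int[lebesgue_measure]_(x in D) (F x)%:E =
    (\int[lebesgue_measure]_(x in D) F x)%:E)%E.
  have mD : measurable (D : set (measurableTypeR R)) by exact: measurable_itv.
  by rewrite /Rintegral fineK//; exact: (integrable_fin_num mD iF).
by rewrite e in h; exact: fine_cvg h.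
Unshelve. all: by end_near. Qed.

Lemma I01_le A B : smooth1 A -> smooth1 B -> (forall x, 0 <= x <= 1 -> A x <= B x) -> I01 A <= I01 B.
Proof.
by move=> sA sB h; apply: le_Rintegral => //; exact: smooth1_integrable.
Qed.

(** On []0, 1]] one has [x^a >= 1/x >= sum_(k < N) (1 - x)^k], and the integral of the last sum is
    the [N]-th partial sum of the harmonic series. *)
Lemma I01_exprz_unbounded (a : int) (C : R) : a < 0 -> exists n, C < I01 (fun x => x ^ a * cut n x).
Proof.
move=> a0; apply: contrapT => /forallNP hC.
have {}hC n : I01 (fun x => x ^ a * cut n x) <= C by rewrite leNgt; exact/negP/hC.
pose F N : R -> R := fun x => \sum_(k < N) (1 - x) ^+ k.
have s1 : smooth1 (fun x : R => 1 - x).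
  have := smooth1_affine (-1) (1 : R).
  by congr smooth1; apply/funext => x; rewrite mulN1r addrC.
have sF N : smooth1 (F N).
  rewrite /F; elim: N => [|N IH].
    by under eq_fun do rewrite big_ord0; exact: smooth1_cst.
  by under eq_fun do rewrite big_ord_recr; apply: smooth1D => //; exact: smooth1X.
have IF N : I01 (F N) = series harmonic N.
  rewrite seriesEord /F; elim: N => [|N IH].
    under eq_fun do rewrite big_ord0.
    by rewrite /= big_ord0 /I01 /Rintegral integral0.
  rewrite /= in IH *; rewrite big_ord_recr /= -IH -I01_onem_exprn.
  rewrite [X in _ = _ + X](_ : _ = - I01 (fun x => -1 * (1 - x) ^+ N)); last first.
    by rewrite I01Z ?mulN1r ?opprK//; exact: smooth1X.
  rewrite -I01B; last 2 first.
  - exact: sF.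
  - by apply: smooth1M; [exact: smooth1_cst|exact: smooth1X].
  by congr I01; apply/funext => x; rewrite big_ord_recr /= mulN1r opprK.
have bd N : series harmonic N <= C.
  rewrite -IF -(cvg_lim (@norm_hausdorff _ R) (I01_cut_cvg (sF N))).
  apply: limr_le; first by apply/cvg_ex; eexists; exact: I01_cut_cvg.
  near=> n; apply: le_trans (hC n); apply: I01_le.
  - by apply: smooth1M => //; exact: (csupp01_cut n).1.
  - exact: (csupp01_exprz a (csupp01_cut n)).1.
  move=> x /andP[x0 x1].
  have [->|xn0] := eqVneq x 0.
    by rewrite (csupp01_out (csupp01_cut n)) ?mulr0// ltxx.
  rewrite ler_wpM2r ?cut_ge0//; have xp : 0 < x by rewrite lt_neqAle eq_sym xn0.
  apply: (@le_trans _ _ x^-1).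
    rewrite /F -(ler_pM2l xp) divff//.
    have := subrX1 (1 - x) N; rewrite addrAC subrr sub0r => e.
    rewrite -[X in X * _]opprK mulNr -e opprB lerBlDr lerDl.
    by rewrite exprn_ge0// subr_ge0.
  have [k ->] : exists k : nat, a = - k.+1%:Z.
    by case: a a0 {hC} => // k _; exists k; rewrite NegzE.
  rewrite -exprnN exprS invfM -[leLHS]mulr1 ler_pM2l ?invr_gt0//.
  by rewrite invf_ge1 ?exprn_gt0// exprn_ile1.
have := @dvg_harmonic R; apply; apply: nondecreasing_is_cvgn.
  by apply: nondecreasing_series => n _ _; exact: harmonic_ge0.
by exists C => _ [n _ <-]; exact: bd.
Unshelve. all: by end_near. Qed.

Lemma I01_gt0 : 0 < I01 (cut 2).
Proof.
have sc := (csupp01_cut 2).1.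
pose D : set R := `[1 / 3, 2 / 3]%classic.
(* [16 / 12 = 16 (1/3 - 1/4) = 16 (3/4 - 2/3)] is the least argument of either factor of [cut 2] on
   [D]. *)
pose c : R := expR (- (16 / 12)^-1) * expR (- (16 / 12)^-1).
have c0 : 0 < c by rewrite mulr_gt0 ?expR_gt0.
have low x : 1 / 3 <= x <= 2 / 3 -> c <= cut 2 x.
  move=> /andP[x1 x2]; rewrite /cut /smbump /expbump.
  have e4 : (4 * 4)%:R = 16 :> R by [].
  rewrite e4 !ifT; [|lra|lra].
  by rewrite ler_pM ?expR_ge0// ler_expR lerN2 lef_pV2 ?posrE; lra.
have i := smooth1_integrable 0 1 sc.
have DS : D `<=` `[0, 1]%classic.
  by move=> x; rewrite /D /= !in_itv /= => /andP[x1 x2]; apply/andP; split; lra.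
have iD : (@lebesgue_measure R).-integrable D (EFin \o cut 2).
  by apply: integrableS i => //; exact: measurable_itv.
apply: (@lt_le_trans _ _ (c * (1 / 3))); first by rewrite mulr_gt0// divr_gt0.
apply: (@le_trans _ _ (\int[lebesgue_measure]_(x in D) cut 2 x)).
  have mD : fine (@lebesgue_measure R D) = 1 / 3.
    by rewrite /D lebesgue_measure_itv /= lte_fin ifT /=; lra.
  rewrite -mD -(@Rintegral_cst _ _ _ lebesgue_measure D (measurable_itv _) c).
  apply: le_Rintegral => //.
    exact: measurable_itv.
    exact: (smooth1_integrable (1 / 3) (2 / 3) (smooth1_cst c)).
rewrite /I01 /Rintegral; apply: fine_le.
- have mD : measurable (D : set (measurableTypeR R)) by exact: measurable_itv.
  exact: (integrable_fin_num mD iD).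
- have mI : measurable (`[0, 1]%classic : set (measurableTypeR R)) by exact: measurable_itv.
  exact: (integrable_fin_num mI i).
- apply: ge0_subset_integral => //; first exact: measurable_itv.
  + exact: measurable_int i.
  + by move=> x _; rewrite lee_fin cut_ge0.
Qed.

End Supported.

(** * Cut-offs depending on [tau] and [sig], monomials, and Euler operators *)

Section Radial.
Context {R : realType}.
Local Notation C := R[i].
Local Notation Cfun := (C2 R -> C).
Local Notation H := (@hartogs R).
Implicit Types (A B S G : R -> R) (f g phi X : Cfun) (w : C2 R) (a b c d : int).

(** The open set on which [tau] and all monomials with integer exponents, conjugate ones included,
    are smooth. *)
Definition Ustar : set (C2 R) := [set w | w1 w != 0 /\ w2 w != 0].

Lemma continuous_neq0_open (f : Cfun) : (forall w, ccontinuous_at f w) ->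
  open [set w | f w != 0].
Proof.
move=> cf; have e : [set w | f w != 0] = (Re \o f) @^-1` [set~ 0] `|` (Im \o f) @^-1` [set~ 0].
  apply/seteqP; split => w /=.
    move=> f0; apply: contrapT => /not_orP[/contrapT h1 /contrapT h2].
    by move/eqP: f0; apply; exact: ReIm_eq.
  by case=> h; apply/eqP => f0; apply: h; rewrite /= f0.
have o0 : open ([set~ 0] : set R) by rewrite openC; exact: closed_eq.
rewrite e; apply: openU; apply: open_comp => // w _; [exact: (cf w).1|exact: (cf w).2].
Qed.

Lemma open_Ustar : open Ustar.
Proof.
rewrite (_ : Ustar = [set w | w1 w != 0] `&` [set w | w2 w != 0])//.
apply: openI; apply: continuous_neq0_open => w; first by have [] := wder_w1 w.
by have [] := wder_w2 w.
Qed.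

(* The image of [hartogs] under [w |-> (tau w, sig w)] lies in the unit square, and the
   cut-offs [chi A S] below stay away from its four sides. *)
Definition tau w : R := normc (w1 w) ^+ 2 / normc (w2 w) ^+ 2.
Definition sig w : R := normc (w2 w) ^+ 2.

Lemma sigE w : (sig w)%:C = w2 w * w2b w.
Proof. by rewrite /w2b mulcJ. Qed.

Lemma tauE w : (tau w)%:C = (w1 w * w1b w) * (w2 w * w2b w)^-1.
Proof. by rewrite /w1b /w2b !mulcJ -fmorphV -rmorphM. Qed.

Lemma w1b_neq0 w : (w1b w != 0) = (w1 w != 0).
Proof. by rewrite conjc_eq0. Qed.
Lemma w2b_neq0 w : (w2b w != 0) = (w2 w != 0).
Proof. by rewrite conjc_eq0. Qed.

Lemma continuous_normc_sqr (f : Cfun) w : ccontinuous_at f w ->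
  {for w, continuous (fun w => normc (f w) ^+ 2)}.
Proof.
move=> [fr fi].
rewrite (_ : (fun w => _) = (fun w => (Re \o f) w * (Re \o f) w + (Im \o f) w * (Im \o f) w)).
  by apply: continuousD; exact: continuousM.
by apply/funext => x; rewrite sqr_normcE !expr2.
Qed.

Lemma continuous_sig : continuous sig.
Proof. by move=> w; apply: continuous_normc_sqr; have [] := wder_w2 w. Qed.

Lemma sig_ge0 w : 0 <= sig w. Proof. exact: sqr_ge0. Qed.

Lemma sqr_normc_lt (x y : C) : (normc x < normc y) = (normc x ^+ 2 < normc y ^+ 2).
Proof. by rewrite ltr_sqr ?nnegrE ?normc_ge0. Qed.

Lemma hartogsE w : H w <-> normc (w1 w) ^+ 2 < sig w /\ sig w < 1.
Proof.
rewrite /sig -sqr_normc_lt expr_lt1 ?normc_ge0//.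
by split => [/andP[]//|[h1 h2]]; apply/andP.
Qed.

Lemma open_hartogs : open H.
Proof.
have e : H = (fun w => sig w - normc (w1 w) ^+ 2) @^-1` [set x | 0 < x] `&`
    sig @^-1` [set x | x < 1].
  apply/seteqP; split => w; first by move=> /hartogsE[h1 h2]; split => //; rewrite /preimage /mkset /= subr_gt0.
  by case; rewrite /preimage /mkset /= subr_gt0 => h1 h2; apply/hartogsE.
rewrite e; apply: openI.
  apply: open_comp => [w _|]; last exact: open_gt.
  apply: continuousB; first exact: continuous_sig.
  by apply: continuous_normc_sqr; have [] := wder_w1 w.
by apply: open_comp => [w _|]; [exact: continuous_sig|exact: open_lt].
Qed.

Lemma hartogs_w2 w : H w -> w2 w != 0.
Proof.
move=> /andP[h _]; apply/eqP => w20; move: h.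
by rewrite w20 normc0 ltNge normc_ge0.
Qed.

Lemma hartogs_sig w : H w -> 0 < sig w < 1.
Proof.
move=> Hw; have /andP[_ h2] := Hw; rewrite /sig exprn_gt0 ?normc_gt0 ?hartogs_w2//=.
by rewrite expr_lt1 ?normc_ge0.
Qed.

Lemma hartogs_tau w : H w -> 0 <= tau w < 1.
Proof.
move=> Hw; have /andP[h1 _] := Hw; have /andP[s0 _] := hartogs_sig Hw.
rewrite /tau divr_ge0 ?sqr_ge0//= ltr_pdivrMr// mul1r.
by move: h1; rewrite sqr_normc_lt.
Qed.

Lemma hartogs_normc1 w : H w -> normc (w1 w) <= 1.
Proof. by move=> /andP[h1 h2]; exact/ltW/(lt_trans h1). Qed.
Lemma hartogs_normc2 w : H w -> normc (w2 w) <= 1.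
Proof. by move=> /andP[_ /ltW]. Qed.

Lemma elemXz U f (z : int) : elem U f -> (forall w, U w -> f w != 0) ->
  elem U (fun w => f w ^ z).
Proof.
move=> ef f0; have eX n : elem U (fun w => f w ^+ n).
  elim: n => [|n IH]; first exact: elem_cst.
  by under eq_fun do rewrite exprS; exact: elemM.
case: z => n; first exact: eX.
rewrite (_ : (fun w => _) = (fun w => (f w ^+ n.+1)^-1)).
  by apply: elemV => // w Uw; rewrite expf_neq0// f0.
by apply/funext => w; rewrite NegzE -exprnN.
Qed.

Lemma wderXz f w (e : 'I_4 -> C) (z : int) : f w != 0 -> wder f w e ->
  wder (fun w => f w ^ z) w (fun k => z%:~R * f w ^ (z - 1) * e k).
Proof.
move=> f0 df.
have dX n : wder (fun w => f w ^+ n) w (fun k => n%:R * f w ^+ n.-1 * e k).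
  elim: n => [|n IH].
    rewrite (_ : (fun k : 'I_4 => _) = fun=> 0); first exact: (wder_cst 1 w).
    by apply/funext => k; rewrite !mul0r.
  have := wderM df IH; rewrite (_ : (fun w => f w * f w ^+ n) = (fun w => f w ^+ n.+1)); last first.
    by apply/funext => v; rewrite exprS.
  congr wder; apply/funext => k; case: n {IH} => [|n] /=; first by rewrite !expr0; ring.
  by rewrite -[n.+2%:R]natr1 exprS; ring.
case: z => n.
  have := dX n; congr wder; apply/funext => k; case: n => [|n]; first by rewrite !mul0r.
  by rewrite -pmulrn intS addrC addKr.
have fn0 : f w ^+ n.+1 != 0 by rewrite expf_neq0.
have := wderV fn0 (dX n.+1).
rewrite (_ : (fun w => (f w ^+ n.+1)^-1) = (fun w => f w ^ Negz n)); last first.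
  by apply/funext => v; rewrite NegzE -exprnN.
congr wder; apply/funext => k; rewrite NegzE (_ : - n.+1%:Z - 1 = - n.+2%:Z); last first.
  by rewrite -opprD -[1]/(1%:Z) -PoszD addn1.
rewrite -exprnN mulrNz -pmulrn /= [f w ^+ n.+2]exprS !(exprS (f w) n).
by field; rewrite f0 expf_neq0.
Qed.

Definition mono a b w : C := w1 w ^ a * w2 w ^ b.
Definition monob a b w : C := w1b w ^ a * w2b w ^ b.

Lemma conjcXz (x : C) (z : int) : (x ^ z)^* = x^* ^ z.
Proof. by case: z => n; [exact: rmorphXn|rewrite NegzE -!exprnN conjc_inv rmorphXn]. Qed.

Lemma conj_mono a b w : (mono a b w)^* = monob a b w.
Proof. by rewrite /mono conjcM; congr (_ * _); exact: conjcXz. Qed.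

Definition chi A S w : C := (A (tau w))%:C * (S (sig w))%:C.

Lemma elem_tau : elem Ustar (fun w => (tau w)%:C).
Proof.
under eq_fun do rewrite tauE.
apply: elemM; first by apply: elemM; [exact: elem_w1|exact: elem_w1b].
apply: elemV; first by apply: elemM; [exact: elem_w2|exact: elem_w2b].
by move=> w [_ w20]; rewrite mulf_neq0// w2b_neq0.
Qed.

Lemma elem_sig : elem Ustar (fun w => (sig w)%:C).
Proof. by under eq_fun do rewrite sigE; apply: elemM; [exact: elem_w2|exact: elem_w2b]. Qed.

Lemma elem_chi A S : smooth1 A -> smooth1 S -> elem Ustar (chi A S).
Proof.
by move=> sA sS; apply: elemM; [exact: (elem_comp elem_tau)|exact: (elem_comp elem_sig)].
Qed.

Lemma elem_mono a b : elem Ustar (mono a b).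
Proof.
by apply: elemM; apply: elemXz; [exact: elem_w1|move=> w []|exact: elem_w2|move=> w []].
Qed.

Lemma elem_monob a b : elem Ustar (monob a b).
Proof.
apply: elemM; apply: elemXz; [exact: elem_w1b| |exact: elem_w2b|].
  by move=> w []; rewrite w1b_neq0.
by move=> w []; rewrite w2b_neq0.
Qed.

(** The bounds on [tau] are written after multiplication by [sig], because [tau] is not continuous
    at [w2 = 0]; each condition is then closed. *)
Lemma compact_radial (al be al' be' : R) : 0 < al' -> be < 1 -> be' < 1 ->
  compact [set w : C2 R | al * sig w <= normc (w1 w) ^+ 2 <= be * sig w /\ al' <= sig w <= be'].
Proof.
move=> al0 be1 be1'; set K := [set w | _].
pose p : C2 R := ((-1, -1), (-1, -1)); pose q : C2 R := ((1, 1), (1, 1)).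
apply: (@subclosed_compact _ K (cbox p q)) => //; last first.
- move=> w [/andP[_ h1] /andP[_ h2]].
  have s1 : sig w <= 1 by rewrite (le_trans h2)// ltW.
  have t1 : normc (w1 w) ^+ 2 <= 1.
    apply: (le_trans h1); have [b0|b0] := leP be 0.
      by rewrite (le_trans _ ler01)// mulr_le0_ge0 ?sig_ge0.
    by rewrite mulr_ile1 ?sig_ge0// ltW.
  have bd (x : C) : normc x ^+ 2 <= 1 -> (-1 <= Re x <= 1) /\ (-1 <= Im x <= 1).
    move=> x1; have {}x1 : normc x <= 1 by rewrite -(@expr_le1 _ 2) ?normc_ge0.
    by rewrite -!ler_norml; split; [exact: le_trans (normRe_le x) x1|exact: le_trans (normIm_le x) x1].
  have [a1 a2] := bd _ t1; have [a3 a4] := bd _ s1.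
  by apply/cboxP.
- exact: compact_cbox.
have c1 : continuous (fun w : C2 R => normc (w1 w) ^+ 2).
  by move=> w; apply: continuous_normc_sqr; have [] := wder_w1 w.
have -> : K = (fun w => normc (w1 w) ^+ 2 - al * sig w) @^-1` [set x | 0 <= x] `&`
   ((fun w => be * sig w - normc (w1 w) ^+ 2) @^-1` [set x | 0 <= x] `&`
   ((fun w => sig w) @^-1` [set x | al' <= x] `&` (fun w => sig w) @^-1` [set x | x <= be'])).
  apply/seteqP; split => w; rewrite /K /= !subr_ge0.
    by move=> [/andP[-> ->] /andP[-> ->]].
  by move=> [-> [-> [-> ->]]].
have cZ (c : R) : continuous (fun w => c * sig w).
  by move=> w; apply: continuousM; [exact: cvg_cst|exact: continuous_sig].
have c2 : continuous (fun w : C2 R => normc (w1 w) ^+ 2 - al * sig w).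
  by move=> w; exact: (cvgB (c1 w) (cZ al w)).
have c3 : continuous (fun w : C2 R => be * sig w - normc (w1 w) ^+ 2).
  by move=> w; exact: (cvgB (cZ be w) (c1 w)).
apply: closedI; [|apply: closedI; [|apply: closedI]]; apply: closed_comp.
- by apply: in1W => w; exact: c2.
- exact: closed_ge.
- by apply: in1W => w; exact: c3.
- exact: closed_ge.
- by apply: in1W => w; exact: continuous_sig.
- exact: closed_ge.
- by apply: in1W => w; exact: continuous_sig.
- exact: closed_le.
Qed.

Lemma chi_test A S : csupp01 A -> csupp01 S -> elem_test Ustar H (chi A S).
Proof.
move=> [sA [al [be [al0 be1 A0]]]] [sS [al' [be' [al0' be1' S0]]]].
exists (chi A S); first exact: elem_chi.
split => //; exists [set w : C2 R | al * sig w <= normc (w1 w) ^+ 2 <= be * sig w /\ al' <= sig w <= be'].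
split; first exact: compact_radial.
  move=> w [/andP[h1 h2] /andP[h3 h4]].
  have s0 : 0 < sig w by rewrite (lt_le_trans al0').
  have w20 : w2 w != 0.
    by apply/eqP => z; move: s0; rewrite /sig z normc0 expr0n ltxx.
  have t0 : 0 < normc (w1 w) ^+ 2 by rewrite (lt_le_trans _ h1)// mulr_gt0.
  split; first split => //.
    by apply/eqP => z; move: t0; rewrite z normc0 expr0n ltxx.
  apply/hartogsE; split; last exact: le_lt_trans h4 be1'.
  by apply: (le_lt_trans h2); rewrite gtr_pMl.
move=> w nK; rewrite /chi.
have [h|/S0 ->] := boolP (al' <= sig w <= be'); last by rewrite mulr0.
have [h'|/A0 ->] := boolP (al <= tau w <= be); last by rewrite mul0r.
exfalso; apply: nK; split => //.
have s0 : 0 < sig w by case/andP: h => h _; rewrite (lt_le_trans al0').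
by move: h'; rewrite /tau ler_pdivlMr// ler_pdivrMr.
Qed.

Definition zz (j : 'I_4) : Cfun := nth w1 [:: w1; w1b; w2; w2b] j.

Lemma elem_zz U j : elem U (zz j).
Proof.
by elim/rbP: j; [exact: elem_w1|exact: elem_w1b|exact: elem_w2|exact: elem_w2b].
Qed.

Lemma wder_zz j w : wder (zz j) w (dlt j).
Proof.
by elim/rbP: j; [exact: wder_w1|exact: wder_w1b|exact: wder_w2|exact: wder_w2b].
Qed.

(* [Dj j (Xf a b c d A S)] times the [j]-th coordinate is the monomial factor of [Xf] times
   this coefficient at [t = tau w], [s = sig w], see [euler_X]. *)
Definition eulerc (a b c d : int) (A A' S S' t s : R) (j : 'I_4) : R :=
  nth 0 [:: c%:~R * A * S + t * A' * S; a%:~R * A * S + t * A' * S;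
            d%:~R * A * S - t * A' * S + s * A * S'; b%:~R * A * S - t * A' * S + s * A * S'] j.

Definition Xf a b c d A S w : C := mono c d w * monob a b w * chi A S w.

Lemma euler_X a b c d A A' S S' j w : csupp01 A -> csupp01 S ->
  (forall x : R, is_derive x 1 A (A' x)) -> (forall x : R, is_derive x 1 S (S' x)) ->
  zz j w * Dj j (Xf a b c d A S) w = mono c d w * monob a b w *
    (eulerc a b c d (A (tau w)) (A' (tau w)) (S (sig w)) (S' (sig w)) (tau w) (sig w) j)%:C.
Proof.
move=> cA cS dA dS.
have [A'' dA'' cA'] := csupp01_derive cA; have [S'' dS'' cS'] := csupp01_derive cS.
have eA : A'' = A' by apply/funext => x; have [_ <-] := dA'' x; have [_ <-] := dA x.
have eS : S'' = S' by apply/funext => x; have [_ <-] := dS'' x; have [_ <-] := dS x.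
rewrite {}eA in dA'' cA'; rewrite {}eS in dS'' cS'.
(* Off [Ustar] the function is zero near [w], and the right-hand side vanishes since [A 0 = 0] and
   [tau w = 0]; for [w2 w = 0] the latter is the convention that 0 has inverse 0. *)
have [[w10 w20]|nU] := pselect (Ustar w); last first.
  have [e ee [_ [K [cK KU K0]]]] := elem_testM (elemM (elem_mono c d) (elem_monob a b)) (chi_test cA cS).
  have Kw : ~ K w by move=> /KU[].
  rewrite (@wder_Dj _ _ w (fun=> 0)); last first.
    exact: wder_near (closed_near0 cK K0 Kw) (wder_cst 0 w).
  have /not_andP[/negP/negPn/eqP z|/negP/negPn/eqP z] : ~ ((w1 w != 0) /\ (w2 w != 0)) by [].
    have t0 : tau w = 0 by rewrite /tau z normc0 expr0n mul0r.
    have A0 : A 0 = 0 by apply: csupp01_out cA _; rewrite ltxx.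
    rewrite t0 A0 /eulerc; elim/rbP: j => /=; by rewrite !(mulr0, mul0r, addr0, subr0).
  have t0 : tau w = 0 by rewrite /tau z normc0 expr0n invr0 mulr0.
  have A0 : A 0 = 0 by apply: csupp01_out cA _; rewrite ltxx.
  rewrite t0 A0 /eulerc; elim/rbP: j => /=; by rewrite !(mulr0, mul0r, addr0, subr0).
have w10b : w1b w != 0 by rewrite w1b_neq0.
have w20b : w2b w != 0 by rewrite w2b_neq0.
have p1 := wderXz c w10 (wder_w1 w); have p2 := wderXz d w20 (wder_w2 w).
have p3 := wderXz a w10b (wder_w1b w); have p4 := wderXz b w20b (wder_w2b w).
have ds : wder (fun w => (sig w)%:C) w (fun k => w2 w * dlt 3 k + dlt 2 k * w2b w).
  under eq_fun do rewrite sigE; exact: wderM (wder_w2 w) (wder_w2b w).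
have dt := wderM (wderM (wder_w1 w) (wder_w1b w))
  (wderV (mulf_neq0 w20 w20b) (wderM (wder_w2 w) (wder_w2b w))).
rewrite (_ : (fun w => w1 w * w1b w * (w2 w * w2b w)^-1) = (fun w => (tau w)%:C)) in dt; last first.
  by apply/funext => v; rewrite tauE.
have dchi := wderM (wder_comp dt (dA (tau w))) (wder_comp ds (dS (sig w))).
have dX := wderM (wderM (wderM p1 p2) (wderM p3 p4)) dchi.
rewrite (wder_Dj j dX) /Xf /mono /monob /chi.
have tE := tauE w; have sE := sigE w.
have ez (x : C) (z : int) : x != 0 -> x ^ (z - 1) = x ^ z / x.
  by move=> x0; rewrite expfzDr// exprN1.
rewrite !ez//.
move: (w1 w ^ c) (w2 w ^ d) (w1b w ^ a) (w2b w ^ b) => m1 m2 m3 m4.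
move: (A (tau w)) (A' (tau w)) (S (sig w)) (S' (sig w)) => A0 A1 S0 S1.
move: (tau w) tE (sig w) sE => t tE s sE.
rewrite /eulerc; elim/rbP: j; rewrite /zz /dlt /=.
- rewrite !rmorphD !rmorphM /= !rmorph_int tE; field.
  by rewrite ?w10 ?w20 ?w10b ?w20b.
- rewrite !rmorphD !rmorphM /= !rmorph_int tE; field.
  by rewrite ?w10 ?w20 ?w10b ?w20b.
- rewrite !rmorphD rmorphN !rmorphM /= !rmorph_int tE sE; field.
  by rewrite ?w10 ?w20 ?w10b ?w20b.
- rewrite !rmorphD rmorphN !rmorphM /= !rmorph_int tE sE; field.
  by rewrite ?w10 ?w20 ?w10b ?w20b.
Qed.

End Radial.

(** * Pairings of weakly holomorphic functions with conjugate monomials times cut-offs *)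

Section Laws.
Context {R : realType}.
Local Notation C := R[i].
Local Notation Cfun := (C2 R -> C).
Local Notation H := (@hartogs R).
Local Notation U := (@Ustar R).
Implicit Types (A B S : R -> R) (f g phi F : Cfun) (w : C2 R) (a b c d : int).

Lemma measurable_hartogs : measurable (H : set (mC2 R)).
Proof. exact: open_measurableC2 open_hartogs. Qed.
Let mH := measurable_hartogs.

Lemma elem_test_csupp phi : elem_test U H phi -> exists K : set (C2 R),
  [/\ compact K, K `<=` U `&` H, forall w, ~ K w -> phi w = 0 & forall w, ccontinuous_at phi w].
Proof.
move=> tp; have [e _ [_ [K [cK KU K0]]]] := tp.
by exists K; split => // w; case: (elem_test_wder w open_Ustar tp).
Qed.

Lemma dV_hartogs : (dV (H : set (mC2 R)) < +oo)%E.
Proof.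
apply: le_lt_trans (dV_box (1 : R)); apply: le_measure; rewrite ?inE//; first exact: box_measurable.
move=> w Hw; have h1 := hartogs_normc1 Hw; have h2 := hartogs_normc2 Hw.
apply: box_sub; [exact: le_trans (normRe_le _) h1|exact: le_trans (normIm_le _) h1|
  exact: le_trans (normRe_le _) h2|exact: le_trans (normIm_le _) h2].
Qed.

Lemma L2_cst (c : C) : L2 H (fun=> c).
Proof.
split; first exact: cmeasurable_cst.
rewrite integral_cst// lte_mul_pinfty ?lee_fin ?sqr_ge0//; exact: dV_hartogs.
Qed.

Lemma L2_bounded f (c : R) : cmeasurable H f -> (forall w, H w -> normc (f w) <= c) ->
  L2 H f /\ sqnorm H f <= c ^+ 2 * sqnorm H (fun=> 1).
Proof.
move=> mf fc; apply: L2_dom => //; first exact: L2_cst.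
move=> w Hw; rewrite normc1 expr1n mulr1 ler_sqr ?nnegrE ?normc_ge0 ?fc//.
exact: le_trans (normc_ge0 _) (fc w Hw).
Qed.

Lemma elem_test_L2 phi : elem_test U H phi -> L2 H phi.
Proof.
move=> /elem_test_csupp[K [cK KU K0 cp]]; have [c hc] := cbounded_csupp cK cp K0.
have mp : cmeasurable H phi by exact: (cmeasurable_continuous open_hartogs (fun w _ => cp w)).
exact: (L2_bounded mp (fun w _ => hc w)).1.
Qed.

(** Integrability against tests only, a form that square-integrable functions and functions
    continuous on the domain share. *)
Definition lint g := forall phi, elem_test U H phi -> cintegrable H (fun w => g w * phi w).

Lemma L2_lint g : L2 H g -> lint g.
Proof. by move=> lg phi tp; apply: L2_mul => //; exact: elem_test_L2. Qed.

Lemma cont_lint g : (forall w, H w -> ccontinuous_at g w) -> lint g.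
Proof.
move=> cg phi /elem_test_csupp[K [cK KU K0 cp]].
apply: (@cintegrable_csupp _ K) => //.
  move=> w; apply: (@ccontinuous_glue _ H K) => //; first exact: open_hartogs.
  - by move=> v /KU[].
  - by move=> v Hv; apply: ccontinuousM; [exact: cg|exact: cp].
  - by move=> v /K0 ->; rewrite mulr0.
by move=> v /K0 ->; rewrite mulr0.
Qed.

(* Only the equations in the conjugate variables are tested, against functions supported
   away from [w1 = 0] as well. *)
Definition whol g := lint g /\ forall phi, elem_test U H phi ->
  cintegral H (fun w => g w * Dj 1 phi w) = 0 /\ cintegral H (fun w => g w * Dj 3 phi w) = 0.

Lemma whol_C1 g : C1_on H g -> (forall w, H w -> Dj 1 g w = 0 /\ Dj 3 g w = 0) -> whol g.
Proof.
move=> cg g0; split; first by apply: cont_lint => w Hw; case: (cg w Hw) => -[].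
move=> phi tp; have z k : (forall w, H w -> Dj k g w = 0) ->
    cintegral H (fun w => g w * Dj k phi w) = 0.
  move=> k0; rewrite (cintegral_parts _ open_hartogs open_Ustar cg tp).
  rewrite (@eq_cintegral _ _ _ (fun=> 0)) ?cintegral0 ?oppr0// => w Hw.
  by rewrite k0// mul0r.
by split; apply: z => w /g0[].
Qed.

Lemma C1_wder Omega g (d : 'I_4 -> Cfun) : open Omega -> (forall w, Omega w -> wder g w (d^~ w)) ->
  (forall w j, Omega w -> ccontinuous_at (d j) w) -> C1_on Omega g.
Proof.
move=> oO dg cd w Ow; have e j v : Omega v -> Dj j g v = d j v.
  by move=> Ov; rewrite (wder_Dj j (dg v Ov)).
split; first by have := dg w Ow; congr wder; apply/funext => j; rewrite e.
move=> j; apply: ccontinuous_near (cd w j Ow).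
by near=> v; rewrite e//; near: v; exact: open_nbhs_nbhs.
Unshelve. all: by end_near.
Qed.

Lemma Ck1_C1 Omega g : Ck_on 1 Omega g -> C1_on Omega g.
Proof.
move=> cg w Ow; split.
  by have [c1 c2] := cg [::] isT w Ow; apply: wderP => // j; exact: c2.
have cb j : ccontinuous_at (cderive (real_basis j) g) w by case: (cg [:: j] isT w Ow).
have c2 := ccontinuous_cst (2 : C)^-1 w; have ci := ccontinuous_cst ('i : C) w.
have cm := ccontinuous_cst (-1 : C) w.
have dzE (x y : C) : x - y = x + -1 * y by rewrite mulN1r.
elim/rbP; rewrite /Dj /= /dw1 /dw1bar /dw2 /dw2bar /dz /dzbar.
- under eq_fun do rewrite dzE.
  exact: ccontinuousM (ccontinuousD (cb 0) (ccontinuousM cm (ccontinuousM ci (cb 1)))) c2.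
- exact: ccontinuousM (ccontinuousD (cb 0) (ccontinuousM ci (cb 1))) c2.
- under eq_fun do rewrite dzE.
  exact: ccontinuousM (ccontinuousD (cb 2) (ccontinuousM cm (ccontinuousM ci (cb 3)))) c2.
- exact: ccontinuousM (ccontinuousD (cb 2) (ccontinuousM ci (cb 3))) c2.
Qed.

Lemma holomorphic_C1 Omega g : holomorphic Omega g ->
  C1_on Omega g /\ forall w, Omega w -> Dj 1 g w = 0 /\ Dj 3 g w = 0.
Proof. by move=> [cg g0]; split; [exact: Ck1_C1|move=> w /g0]. Qed.

Lemma holomorphic_whol g : holomorphic H g -> whol g.
Proof. by move=> /holomorphic_C1[]; exact: whol_C1. Qed.

Definition Xm a b A S w : C := monob a b w * chi A S w.

Lemma Xm_test a b A S : csupp01 A -> csupp01 S -> elem_test U H (Xm a b A S).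
Proof. by move=> cA cS; exact: elem_testM (elem_monob a b) (chi_test cA cS). Qed.

Lemma Xf_test a b c d A S : csupp01 A -> csupp01 S -> elem_test U H (Xf a b c d A S).
Proof.
by move=> cA cS; exact: elem_testM (elemM (elem_mono c d) (elem_monob a b)) (chi_test cA cS).
Qed.

Lemma XfE a b A S : Xf a b 0 0 A S = Xm a b A S.
Proof. by apply/funext => w; rewrite /Xf /mono !expr0z !mul1r. Qed.

Lemma Dj_zz phi j w : elem_test U H phi ->
  Dj j (fun w => zz j w * phi w) w = phi w + zz j w * Dj j phi w.
Proof.
move=> tp; have := wderM (wder_zz j w) (elem_test_wder w open_Ustar tp).
by move=> /(wder_Dj j) ->; rewrite /dlt eqxx mul1r addrC.
Qed.

Lemma euler_Xm a b A A' S S' j w : csupp01 A -> csupp01 S ->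
  (forall x : R, is_derive x 1 A (A' x)) -> (forall x : R, is_derive x 1 S (S' x)) ->
  Dj j (fun w => zz j w * Xm a b A S w) w = monob a b w * (A (tau w) * S (sig w) +
   eulerc a b 0 0 (A (tau w)) (A' (tau w)) (S (sig w)) (S' (sig w)) (tau w) (sig w) j)%:C.
Proof.
move=> cA cS dA dS; rewrite Dj_zz; last exact: Xm_test.
rewrite -[in X in _ + X]XfE (euler_X _ _ _ _ _ _ cA cS dA dS) /mono !expr0z !mul1r.
by rewrite /Xm /chi -rmorphM -mulrDr -rmorphD.
Qed.

(** The equation says [(x^k A)' = B]. It has a solution of compact support because [B] has integral
    zero. *)
Lemma csupp01_shift (k : int) B : csupp01 B -> I01 B = 0 -> exists A A' : R -> R,
  [/\ csupp01 A, forall x : R, is_derive x 1 A (A' x) &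
      forall x : R, k%:~R * A x + x * A' x = x ^ (1 - k) * B x].
Proof.
move=> cB B0; have [G cG dG] := csupp01_primitive cB B0.
have cA := csupp01_exprz (- k) cG; have [A' dA cA'] := csupp01_derive cA.
exists (fun x => x ^ (- k) * G x), A'; split => // x.
have [->|x0] := eqVneq x 0.
  have o1 : ~~ (0 < (0 : R) < 1) by rewrite ltxx.
  by rewrite (csupp01_out cG o1) (csupp01_out cB o1) !(mulr0, mul0r, addr0).
have h := is_derive1M (is_derive_exprz (- k) x0) (dG x).
have -> : A' x = x ^ (- k) * B x + (- k)%:~R * x ^ (- k - 1) * G x.
  by have [_ <-] := dA x; have [_ <-] := h.
rewrite !expfzDr// exprN1 expr1z mulrNz; field; exact: x0.
Qed.

Definition Lw g a b A S : C := cintegral H (fun w => g w * Xm a b A S w).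

(** The equation in [conj w1] is tested with [w1b * Xm a b A S], where [(a + 1) A + t A' = t^-a B].
    The derivative of this test function is exactly [Xm] with cut-off [t^-a B]. *)
Lemma law_tau g a b B S : whol g -> csupp01 B -> csupp01 S -> I01 B = 0 ->
  Lw g a b (fun x => x ^ (- a) * B x) S = 0.
Proof.
move=> [ig wg] cB cS B0; have [A [A' [cA dA e]]] := csupp01_shift (a + 1) cB B0.
have [S' dS cS'] := csupp01_derive cS.
have [h _] := wg _ (elem_testM (elem_zz U 1) (Xm_test a b cA cS)).
rewrite -{}[RHS]h; apply: eq_cintegral => w Hw; rewrite (euler_Xm _ _ _ _ cA cS dA dS).
rewrite /Xm /chi -rmorphM /eulerc /=; congr (_ * (_ * _%:C)).
have := e (tau w); rewrite opprD addrCA subrr addr0 => <-.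
by rewrite rmorphD/=; ring.
Qed.

(** Adding the equations in [conj w1] and [conj w2], each tested with the variable times [Xm],
    cancels the terms with [A'] and leaves [A ((a + b + 2) S + s S')]. *)
Lemma law_sig g a b A B : whol g -> csupp01 A -> csupp01 B -> I01 B = 0 ->
  Lw g a b A (fun x => x ^ (- (a + b + 1)) * B x) = 0.
Proof.
move=> [ig wg] cA cB B0; have [S [S' [cS dS e]]] := csupp01_shift (a + b + 2) cB B0.
have [A' dA cA'] := csupp01_derive cA.
have t1 := elem_testM (elem_zz U 1) (Xm_test a b cA cS).
have t3 := elem_testM (elem_zz U 3) (Xm_test a b cA cS).
have [h1 _] := wg _ t1; have [_ h3] := wg _ t3.
transitivity (0 + 0 : C); last by rewrite addr0.
rewrite -{1}h1 -h3 -cintegralD//; last first.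
- by apply: ig; exact: elem_test_Dj open_Ustar t3.
- by apply: ig; exact: elem_test_Dj open_Ustar t1.
apply: eq_cintegral => w Hw; rewrite !(euler_Xm _ _ _ _ cA cS dA dS).
rewrite -mulrDr -mulrDr -rmorphD /Xm /chi -rmorphM /eulerc /=; congr (_ * (_ * _%:C)).
have := e (sig w); rewrite (_ : 1 - (a + b + 2) = - (a + b + 1)); last by ring.
by move=> <-; rewrite !rmorphD/=; ring.
Qed.

Lemma LwD g a b A A' S (x y : R) : lint g -> csupp01 A -> csupp01 A' -> csupp01 S ->
  Lw g a b (fun t => x * A t + y * A' t) S = x%:C * Lw g a b A S + y%:C * Lw g a b A' S.
Proof.
move=> ig cA cA' cS; rewrite /Lw -!cintegralZ//; try by apply: ig; exact: Xm_test.
rewrite -cintegralD//; try by apply: cintegrableZ => //; apply: ig; exact: Xm_test.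
by apply: eq_cintegral => w _; rewrite /Xm /chi !rmorphD !rmorphM /=; ring.
Qed.

Lemma LwDr g a b A S S' (x y : R) : lint g -> csupp01 A -> csupp01 S -> csupp01 S' ->
  Lw g a b A (fun t => x * S t + y * S' t) = x%:C * Lw g a b A S + y%:C * Lw g a b A S'.
Proof.
move=> ig cA cS cS'; rewrite /Lw -!cintegralZ//; try by apply: ig; exact: Xm_test.
rewrite -cintegralD//; try by apply: cintegrableZ => //; apply: ig; exact: Xm_test.
by apply: eq_cintegral => w _; rewrite /Xm /chi !rmorphD !rmorphM /=; ring.
Qed.

(** Splits off the mean of [x^k A] as a multiple of [cut 2]. A linear functional that kills [x^-k B]
    for all [B] of integral zero is therefore determined by one value, and is a multiple of the
    integral of [x^k A]. *)
Lemma csupp01_split (k : int) A : csupp01 A -> exists2 B, csupp01 B /\ I01 B = 0 &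
  A = fun x => I01 (fun x => x ^ k * A x) / I01 (cut 2) * (x ^ (- k) * cut 2 x) + 1 * (x ^ (- k) * B x).
Proof.
move=> cA; have c0 := csupp01_cut 2 : csupp01 (@cut R 2); have i0 : 0 < I01 (@cut R 2) by exact: I01_gt0.
have cB1 := csupp01_exprz k cA; set B1 := fun x => _ in cB1 *.
set r := I01 B1 / _; exists (fun x => B1 x - r * cut 2 x).
  split.
    have := csupp01D cB1 (csupp01Z (- r) c0); congr csupp01; apply/funext => x.
    by rewrite mulNr.
  rewrite I01B; [|by case: cB1|by case: (csupp01Z r c0)].
  rewrite I01Z; last by case: c0.
  by rewrite /r divfK ?subrr// gt_eqF.
apply/funext => x; rewrite mul1r mulrBr; have [->|x0] := eqVneq x 0.
  have o1 : ~~ (0 < (0 : R) < 1) by rewrite ltxx.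
  by rewrite /B1 (csupp01_out cA o1) (csupp01_out c0 o1) !mulr0 subrr addr0.
have -> : x ^ (- k) * B1 x = A x by rewrite /B1 mulrA -expfzDr// addNr expr0z mul1r.
by ring.
Qed.

(** By [law_tau] and [law_sig] the pairing kills mean-zero parts in either cut-off, so after
    [csupp01_split] in both only the reference pairing with [cut 2] survives. The constant is this
    pairing divided by the square of the integral of [cut 2]. *)
Lemma law g a b : whol g -> exists c : C, forall A S, csupp01 A -> csupp01 S ->
  Lw g a b A S = c * (I01 (fun x => x ^ a * A x) * I01 (fun x => x ^ (a + b + 1) * S x))%:C.
Proof.
move=> wg; have ig := wg.1; have c0 := csupp01_cut 2 : csupp01 (@cut R 2).
set i0 := I01 (@cut R 2).
pose c := Lw g a b (fun x => x ^ (- a) * cut 2 x) (fun x => x ^ (- (a + b + 1)) * cut 2 x).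
exists (c * (i0^-1 * i0^-1)%:C) => A S cA cS.
have [B [cB B0] {1}->] := csupp01_split a cA.
have [T [cT T0] {1}->] := csupp01_split (a + b + 1) cS.
have k1 := csupp01_exprz (- a) c0; have k2 := csupp01_exprz (- (a + b + 1)) c0.
have k3 := csupp01_exprz (- a) cB; have k4 := csupp01_exprz (- (a + b + 1)) cT.
rewrite LwD//; last by have := csupp01D (csupp01Z _ k2) (csupp01Z _ k4); exact.
rewrite (law_tau _ _ wg cB)//; last by have := csupp01D (csupp01Z _ k2) (csupp01Z _ k4); exact.
rewrite mulr0 addr0 LwDr// (law_sig _ _ wg k1 cT T0) mulr0 addr0 -/c -/i0.
rewrite !rmorphM /=; ring.
Qed.

Lemma cintegral_test_Dj phi k : elem_test U H phi -> cintegral H (Dj k phi) = 0.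
Proof.
move=> tp; have c1 : C1_on H (fun=> (1 : C)).
  apply: (@C1_wder _ _ (fun=> fun=> 0)); first exact: open_hartogs.
    by move=> w _; exact: wder_cst.
  by move=> w j _; exact: ccontinuous_cst.
have := cintegral_parts k open_hartogs open_Ustar c1 tp.
rewrite (@eq_cintegral _ _ _ (Dj k phi)) => [->|w _]; last by rewrite mul1r.
rewrite (@eq_cintegral _ _ _ (fun=> 0)) ?cintegral0 ?oppr0// => w _.
by rewrite (wder_Dj k (wder_cst 1 w)) mul0r.
Qed.

(** The rotation field in [w1], or in [w2], multiplies the integrand by the difference [c - a], or
    [d - b], of its exponents. As it is also a difference of total derivatives of test functions,
    its integral is zero. *)
Lemma Xf_orth a b c d A S : (c, d) != (a, b) -> csupp01 A -> csupp01 S ->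
  cintegral H (Xf a b c d A S) = 0.
Proof.
move=> ne cA cS; have tX := Xf_test a b c d cA cS.
have [A' dA _] := csupp01_derive cA; have [S' dS _] := csupp01_derive cS.
have key i j (z : int) : z != 0 -> (forall x0 x1 x2 x3 x4 x5 : R, eulerc a b c d x0 x1 x2 x3 x4 x5 i -
    eulerc a b c d x0 x1 x2 x3 x4 x5 j = z%:~R * (x0 * x2)) -> cintegral H (Xf a b c d A S) = 0.
  move=> z0 e; have t k := elem_testM (elem_zz U k) tX.
  have iX : cintegrable H (Xf a b c d A S).
    by have := L2_mul mH (L2_cst 1) (elem_test_L2 tX); under eq_fun do rewrite mul1r.
  apply: (mulfI (_ : z%:~R != 0 :> C)); first by rewrite intr_eq0.
  rewrite mulr0 -cintegralZ//.
  have it k : cintegrable H (Dj k (fun w => zz k w * Xf a b c d A S w)).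
    have := L2_mul mH (L2_cst 1) (elem_test_L2 (elem_test_Dj k open_Ustar (t k))).
    by under eq_fun do rewrite mul1r.
  transitivity (0 - 0 : C); last by rewrite subrr.
  rewrite -{1}(cintegral_test_Dj i (t i)) -(cintegral_test_Dj j (t j)) -cintegralB//.
  apply: eq_cintegral => w _; rewrite !Dj_zz//.
  rewrite !(euler_X _ _ _ _ _ _ cA cS dA dS) opprD addrACA subrr add0r -mulrBr -rmorphB.
  by rewrite e /Xf /chi !rmorphM /= rmorph_int; ring.
move: ne; rewrite xpair_eqE negb_and => /orP[ca|db].
  apply: (key 0 1 (c - a)); first by rewrite subr_eq0.
  by move=> *; rewrite /eulerc /= rmorphB /=; ring.
apply: (key 2 3 (d - b)); first by rewrite subr_eq0.
by move=> *; rewrite /eulerc /= rmorphB /=; ring.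
Qed.

Lemma whol_w2inv : whol (fun w => (w2 w)^-1).
Proof.
have dg w : H w -> wder (fun w => (w2 w)^-1) w
    (fun k => - ((w2 w)^-1 * (w2 w)^-1) * dlt 2 k).
  by move=> Hw; apply: wderV; [exact: hartogs_w2|exact: wder_w2].
apply: whol_C1; last first.
  by move=> w Hw; rewrite !(wder_Dj _ (dg w Hw)) /dlt /= !mulr0.
apply: (C1_wder open_hartogs dg) => w j Hw.
have c2 : ccontinuous_at (fun w => (w2 w)^-1) w by case: (dg w Hw).
have := ccontinuousM (ccontinuousM c2 c2) (ccontinuous_cst (- dlt 2 j : C) w).
by under eq_fun do rewrite mulrN -mulNr.
Qed.

Lemma rmorphXz_real (x : R) (z : int) : (x ^ z)%:C = x%:C ^ z.
Proof. by case: z => n; [exact: rmorphXn|rewrite NegzE -!exprnN fmorphV rmorphXn]. Qed.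

Lemma tau0 w : ~ U w -> tau w = 0.
Proof.
move=> nU; have [z|z] : w1 w = 0 \/ w2 w = 0.
    apply: contrapT => /not_orP[/eqP h1 /eqP h2]; exact: nU.
  by rewrite /tau z normc0 expr0n mul0r.
by rewrite /tau z normc0 expr0n invr0 mulr0.
Qed.

End Laws.

(** * Removal of the cut-offs; norms and orthogonality of the monomials *)

Section Norms.
Context {R : realType}.
Local Notation C := R[i].
Local Notation Cfun := (C2 R -> C).
Local Notation H := (@hartogs R).
Local Notation U := (@Ustar R).
Implicit Types (A B S : R -> R) (f g phi F : Cfun) (w : C2 R) (a b c d : int).
Let mH := @measurable_hartogs R.

(** Rewrites the squared modulus of any monomial, times cut-offs, as a pairing of [1 / w2] with the
    exponents [0] and [-1]; the exponents [a], [b] move into the cut-offs. *)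
Lemma mono_tau_sig a b A S w : csupp01 A ->
  Xf a b a b A S w =
  (w2 w)^-1 * Xm 0 (-1) (fun x => x ^ a * A x) (fun x => x ^ (a + b + 1) * S x) w.
Proof.
move=> cA; rewrite /Xf /Xm /chi; have [[w10 w20]|nU] := pselect (U w); last first.
  have o1 : ~~ (0 < (0 : R) < 1) by rewrite ltxx.
  by rewrite (tau0 nU) (csupp01_out cA o1) !(mulr0, mul0r).
have w10b : w1b w != 0 by rewrite w1b_neq0.
have w20b : w2b w != 0 by rewrite w2b_neq0.
have s0 : w2 w * w2b w != 0 by rewrite mulf_neq0.
rewrite [monob 0 (-1) w]/monob expr0z mul1r exprN1 !rmorphM /= !rmorphXz_real tauE sigE.
rewrite !(expfzDr _ _ s0) expr1z [(w1 w * _ / _) ^ a]expfzMl exprz_inv.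
have mm : mono a b w * monob a b w = (w1 w * w1b w) ^ a * (w2 w * w2b w) ^ b.
  by rewrite /mono /monob !expfzMl mulrACA.
transitivity ((w1 w * w1b w) ^ a * (w2 w * w2b w) ^ b * ((A (tau w))%:C * (S (sig w))%:C)).
  by congr (_ * _); exact: mm.
have e : (w2 w * w2b w) ^ (- a) * (w2 w * w2b w) ^ a = 1.
  by rewrite -expfzDr// addNr expr0z.
set p := (w2 w * w2b w) ^ (- a) in e *; set q := (w2 w * w2b w) ^ a in e *.
set r := (w1 w * w1b w) ^ a; set s := (w2 w * w2b w) ^ b.
transitivity (r * s * ((A (tau w))%:C * (S (sig w))%:C) * (p * q)).
  by rewrite e mulr1.
clear mm; clearbody p q r s; field.
by rewrite w20 w20b.
Qed.

Lemma cintegral_real (h : C2 R -> R) : Im (cintegral H (fun w => (h w)%:C)) = 0.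
Proof. by rewrite /cintegral /= /Rintegral integral0. Qed.

Lemma Xf_real a b A S w : Xf a b a b A S w = (normc (mono a b w) ^+ 2 * (A (tau w) * S (sig w)))%:C.
Proof. by rewrite /Xf /chi -conj_mono mulcJ -!rmorphM. Qed.

(** One instance of [law], for [1 / w2], serves all exponents, so the constant does not depend on
    them. It is real because the integral for the cut-offs [cut 2] is real and the product of their
    integrals is a nonzero real. *)
Lemma norm_law_ex : exists K : R, forall a b A S, csupp01 A -> csupp01 S ->
  cintegral H (Xf a b a b A S) =
  (K * (I01 (fun x => x ^ a * A x) * I01 (fun x => x ^ (a + b + 1) * S x)))%:C.
Proof.
have [c hc] := law 0 (-1) (@whol_w2inv R).
have k a b A S : csupp01 A -> csupp01 S -> cintegral H (Xf a b a b A S) =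
    c * (I01 (fun x => x ^ a * A x) * I01 (fun x => x ^ (a + b + 1) * S x))%:C.
  move=> cA cS; have := hc _ _ (csupp01_exprz a cA) (csupp01_exprz (a + b + 1) cS).
  under [X in I01 X * _]eq_fun do rewrite expr0z mul1r.
  rewrite (_ : 0 - 1 + 1 = 0 :> int)//.
  under [X in _ * I01 X]eq_fun do rewrite expr0z mul1r.
  by move=> <-; apply: eq_cintegral => w _; exact: mono_tau_sig.
have c0 := csupp01_cut 2 : csupp01 (@cut R 2).
have i0 : 0 < I01 (@cut R 2) by exact: I01_gt0.
have := k 0 (-1) _ _ c0 c0.
rewrite (_ : 0 - 1 + 1 = 0 :> int)//.
under [X in I01 X * _]eq_fun do rewrite expr0z mul1r.
under [X in _ * I01 X]eq_fun do rewrite expr0z mul1r.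
rewrite (@eq_cintegral _ _ _ _ (fun w _ => Xf_real _ _ _ _ w)).
move=> /(congr1 (fun x => Im x)); rewrite cintegral_real ImM /= mulr0 add0r => /esym/eqP.
rewrite !mulf_eq0 (gt_eqF i0) !orbF => /eqP c00.
have cE : c = (Re c)%:C by apply: ReIm_eq; rewrite /= ?c00.
by exists (Re c) => a b A S cA cS; rewrite k// {1}cE -rmorphM.
Qed.

(** Polar coordinates would give pi squared. Only its sign and its independence of the exponents are
    used. *)
Definition KH : R := projT1 (cid norm_law_ex).
Lemma norm_law a b A S : csupp01 A -> csupp01 S -> cintegral H (Xf a b a b A S) =
  (KH * (I01 (fun x => x ^ a * A x) * I01 (fun x => x ^ (a + b + 1) * S x)))%:C.
Proof. by move=> cA cS; rewrite /KH; case: cid => K /= ->. Qed.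

Lemma norm_lawR a b A S : csupp01 A -> csupp01 S ->
  \int[dV]_(w in (H : set (mC2 R))) (normc (mono a b w) ^+ 2 * (A (tau w) * S (sig w))) =
  KH * (I01 (fun x => x ^ a * A x) * I01 (fun x => x ^ (a + b + 1) * S x)).
Proof.
move=> cA cS; have := congr1 (fun x => Re x) (norm_law a b cA cS).
rewrite Re_cintegral [Re (_)%:C]/= => <-.
by apply: eq_Rintegral => w _; rewrite Xf_real.
Qed.

Lemma KH_ge0 : 0 <= KH.
Proof.
have c0 := csupp01_cut 2 : csupp01 (@cut R 2).
have i0 : 0 < I01 (@cut R 2) by exact: I01_gt0.
have := norm_lawR 0 (-1) c0 c0.
rewrite (_ : 0 - 1 + 1 = 0 :> int)//.
under [X in I01 X * _]eq_fun do rewrite expr0z mul1r.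
under [X in _ * I01 X]eq_fun do rewrite expr0z mul1r.
move=> h; have : 0 <= KH * (I01 (@cut R 2) * I01 (@cut R 2)).
  rewrite -h; apply: fine_ge0; apply: integral_ge0 => w _.
  rewrite lee_fin; exact: (mulr_ge0 (sqr_ge0 _) (mulr_ge0 (cut_ge0 _ _) (cut_ge0 _ _))).
by rewrite pmulr_lge0// mulr_gt0.
Qed.

Definition N1 : set (C2 R) := [set w | w1 w = 0].

Lemma N1E : N1 = ([set 0] `*` [set 0]) `*` [set: R * R].
Proof.
apply/seteqP; split => w; rewrite /N1 /w1 /=.
  by move=> h; split => //; split; [exact: (congr1 (fun x => Re x) h)|exact: (congr1 (fun x => Im x) h)].
by move=> [[-> ->] _].
Qed.

Lemma measurable_N1 : measurable (N1 : set (mC2 R)).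
Proof.
rewrite N1E; apply: measurableX; last exact: measurableT.
by apply: measurableX; exact: measurable_set1.
Qed.

Lemma dV_N1 : dV (N1 : set (mC2 R)) = 0%E.
Proof.
have m1 : measurable ([set 0] : set (measurableTypeR R)) by exact: measurable_set1.
rewrite N1E; rewrite /dV sfprodE; [|exact: measurableX|exact: measurableT].
have z : sfprod (@lebesgue_measure R) (@lebesgue_measure R) ([set 0] `*` [set 0]) = 0%E.
  by rewrite sfprodE//; rewrite [X in (X * _)%E](lebesgue_measure_set1 (0 : R)) mul0e.
by rewrite [X in (X * _)%E]z mul0e.
Qed.

(** The part of the domain where the cut-offs tend to 1: they vanish identically on [w1 = 0], which
    has measure zero. *)
Definition Hs : set (C2 R) := H `\` N1.

Lemma measurable_Hs : measurable (Hs : set (mC2 R)).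
Proof. by apply: measurableD => //; exact: measurable_N1. Qed.

Lemma Hs_tau w : Hs w -> 0 < tau w < 1.
Proof.
move=> [Hw n1]; have /andP[_ ->] := hartogs_tau Hw; rewrite andbT.
rewrite /tau divr_gt0 ?exprn_gt0 ?normc_gt0 ?hartogs_w2//.
by apply/eqP => z; exact: n1.
Qed.

Lemma cintegral_Hs f : cintegrable H f -> cintegral H f = cintegral Hs f.
Proof.
move=> [fr fi]; have mN := measurable_N1; have N0 := dV_N1.
rewrite /cintegral /Rintegral.
by rewrite (negligible_integral mN mH fr N0) (negligible_integral mN mH fi N0).
Qed.

Lemma cintegrable_Hs f : cintegrable H f -> cintegrable Hs f.
Proof.
by move=> [fr fi]; split; [apply: integrableS fr|apply: integrableS fi] => //;
  (exact: measurable_Hs || by move=> w []).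
Qed.

Lemma cmeasurable_Hs f : cmeasurable H f -> cmeasurable Hs f.
Proof. by move=> [m1 m2]; split; [apply: measurable_funS m1|apply: measurable_funS m2] => // w []. Qed.

Lemma L2int_Hs f : cmeasurable H f ->
  (\int[dV]_(w in (H : set (mC2 R))) (normc (f w) ^+ 2)%:E =
   \int[dV]_(w in (Hs : set (mC2 R))) (normc (f w) ^+ 2)%:E)%E.
Proof.
move=> mf; apply: ge0_negligible_integral => //; last exact: dV_N1.
- exact: measurable_N1.
- by apply/measurable_EFinP; exact: measurable_normc_sqr.
- by move=> w _; rewrite lee_fin sqr_ge0.
Qed.

Lemma sqnorm_Hs f : cmeasurable H f -> sqnorm H f = sqnorm Hs f.
Proof. by move=> mf; rewrite /sqnorm /Rintegral L2int_Hs. Qed.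

Lemma L2_Hs f : cmeasurable H f -> L2 H f <-> L2 Hs f.
Proof.
move=> mf; split => -[m i]; split => //; [exact: cmeasurable_Hs|rewrite -L2int_Hs//|rewrite L2int_Hs//].
Qed.

Definition chin n : Cfun := chi (cut n) (cut n).

Lemma chin_test n : elem_test U H (chin n).
Proof. by apply: chi_test; exact: csupp01_cut. Qed.

Lemma chin_measurable n : cmeasurable H (chin n).
Proof. by case: (elem_test_L2 (chin_test n)). Qed.

Lemma chin_le1 n w : normc (chin n w) <= 1.
Proof.
rewrite /chin /chi normcM !normc_real !ger0_norm ?cut_ge0//.
by rewrite mulr_ile1 ?cut_ge0 ?cut_le1.
Qed.

Lemma chin_cvg w : Hs w -> (fun n => normc (chin n w - 1)) @ \oo --> (0 : R).
Proof.
move=> Hw; have t := Hs_tau Hw; have s := hartogs_sig Hw.1.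
have h : (fun n => `|cut n (tau w) * cut n (sig w) - 1|) @ \oo --> (0 : R).
  rewrite -(normr0 R); apply: cvg_norm; rewrite -[X in _ --> X](subrr (1 : R)).
  apply: cvgB; last exact: cvg_cst.
  by rewrite -[X in _ --> X](mulr1 (1 : R)); apply: cvgM; exact: cut_cvg.
rewrite (_ : (fun n => _) = (fun n => `|cut n (tau w) * cut n (sig w) - 1|))//.
apply/funext => n; rewrite -normc_real; congr normc.
by apply: ReIm_eq; rewrite /chin /chi !ReImE /= ?mulr0 ?mul0r ?addr0 ?subr0 ?oppr0.
Qed.

Lemma cut_lim F : cintegrable H F ->
  (fun n => normc (cintegral H (fun w => F w * chin n w) - cintegral H F)) @ \oo --> (0 : R).
Proof.
move=> iF; have mF := cintegrable_cmeasurable iF.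
have mFn n : cmeasurable H (fun w => F w * chin n w) by apply: cmeasurableM => //; exact: chin_measurable.
have le n w : normc (F w * chin n w) <= normc (F w).
  by rewrite normcM ler_piMr ?normc_ge0 ?chin_le1.
have iFn n : cintegrable H (fun w => F w * chin n w).
  by apply: (cintegrable_le mH (mFn n) (fun w _ => le n w)); exact: integrable_normc.
have c w : Hs w -> (fun n => normc (F w * chin n w - F w)) @ \oo --> (0 : R).
  move=> Hw; rewrite (_ : (fun n => _) = (fun n => normc (F w) * normc (chin n w - 1))).
    by rewrite -(mulr0 (normc (F w))); apply: cvgM; [exact: cvg_cst|exact: chin_cvg].
  by apply/funext => n; rewrite -normcM mulrBr mulr1.
have [_ h] := cintegral_dominated measurable_Hs (fun n => cmeasurable_Hs (mFn n)) (cmeasurable_Hs mF)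
   (fun n w _ => le n w) c (integrable_normc measurable_Hs (cintegrable_Hs iF)).
rewrite (_ : (fun n => _) = (fun n => normc (cintegral Hs (fun w => F w * chin n w) - cintegral Hs F)))//.
by apply/funext => n; rewrite !cintegral_Hs.
Qed.

(** The way integrals over the domain are evaluated: the cut-off integrals are known exactly, and
    their limit is the integral once [F] is known to be integrable. *)
Lemma cut_lim_eq F (l : C) (u : nat -> C) : cintegrable H F ->
  (forall n, cintegral H (fun w => F w * chin n w) = u n) ->
  (fun n => normc (u n - l)) @ \oo --> (0 : R) -> cintegral H F = l.
Proof.
move=> iF hu ul; have h := cut_lim iF.
have {}h : (fun n => normc (u n - cintegral H F)) @ \oo --> (0 : R).
  by move: h; under eq_fun do rewrite hu.
have h2 : (fun n => normc (u n - cintegral H F) + normc (u n - l)) @ \oo --> (0 : R).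
  by rewrite -[X in _ --> X](addr0 (0 : R)); exact: cvgD h ul.
have h3 : (fun n : nat => normc (cintegral H F - l)) @ \oo --> (0 : R).
  apply: cvg0_le h2 => n; apply/andP; split; first exact: normc_ge0.
  rewrite (_ : cintegral H F - l = - (u n - cintegral H F) + (u n - l)); last by ring.
  by rewrite (le_trans (normcD _ _))// normcN.
have h4 : (fun n : nat => normc (cintegral H F - l)) @ \oo --> normc (cintegral H F - l) by exact: cvg_cst.
have e0 : normc (cintegral H F - l) = 0 by exact: (cvg_unique (@norm_hausdorff _ _) h4 h3).
by move/eqP: e0; rewrite normc_eq0 subr_eq0 => /eqP.
Qed.

(* [w1 ^ a * w2 ^ b] is square integrable on [hartogs] iff [0 <= m] for [m = a + b + 1]; its
   squared norm is then proportional to [1 / ((a + 1) * (m + 1))]. *)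
Definition Em (a m : nat) : Cfun := mono a%:Z (m%:Z - 1 - a%:Z).

Lemma ccontinuousX f n w : ccontinuous_at f w -> ccontinuous_at (fun w => f w ^+ n) w.
Proof.
move=> cf; elim: n => [|n IH]; first exact: ccontinuous_cst.
by under eq_fun do rewrite exprS; exact: ccontinuousM.
Qed.

Lemma ccontinuousXz f (z : int) w : f w != 0 -> ccontinuous_at f w -> ccontinuous_at (fun w => f w ^ z) w.
Proof.
move=> f0 cf; case: z => n; first exact: ccontinuousX.
rewrite (_ : (fun w => _) = (fun w => (f w ^+ n.+1)^-1)).
  by apply: ccontinuousV; [exact: expf_neq0|exact: ccontinuousX].
by apply/funext => v; rewrite NegzE -exprnN.
Qed.

Lemma Em_continuous (a m : nat) w : w2 w != 0 -> ccontinuous_at (Em a m) w.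
Proof.
move=> w20; apply: ccontinuousM.
  by apply: ccontinuousX; case: (wder_w1 w).
exact: (ccontinuousXz _ w20 (wder_w2 w).1).
Qed.

Lemma Em_measurable (a m : nat) : cmeasurable H (Em a m).
Proof.
apply: (cmeasurable_continuous open_hartogs) => w Hw.
by apply: Em_continuous; exact: hartogs_w2.
Qed.

Lemma Em_law (a m : nat) A S : csupp01 A -> csupp01 S ->
  \int[dV]_(w in (H : set (mC2 R))) (normc (Em a m w) ^+ 2 * (A (tau w) * S (sig w))) =
  KH * (I01 (fun x => x ^+ a * A x) * I01 (fun x => x ^+ m * S x)).
Proof.
move=> cA cS; rewrite norm_lawR//.
by rewrite (_ : a%:Z + (m%:Z - 1 - a%:Z) + 1 = m%:Z)//; ring.
Qed.

Lemma I01_cut_exprn (a n : nat) : 0 <= I01 (fun x : R => x ^+ a * cut n x) <= (a.+1%:R^-1 : R).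
Proof.
have c := (csupp01_cut n).1 : smooth1 (@cut R n).
have sX : smooth1 (fun x : R => x ^+ a) by apply: smooth1X; exact: smooth1_id.
apply/andP; split.
  have z : I01 (fun=> (0 : R)) = 0 by rewrite /I01 /Rintegral integral0.
  rewrite -[X in X <= _]z.
  apply: I01_le => //; [exact: smooth1_cst|exact: smooth1M|].
  by move=> x /andP[x0 _]; rewrite mulr_ge0 ?exprn_ge0 ?cut_ge0.
rewrite -I01_exprn; apply: I01_le => //; first exact: smooth1M.
by move=> x /andP[x0 _]; rewrite ler_piMr ?exprn_ge0 ?cut_le1.
Qed.

(** [cut_lim_eq] presupposes integrability, so Fatou comes before it:
    [|Em * chin|^2 <= |Em|^2 * chin] because [0 <= chin <= 1], and the integral of the right side is
    bounded by the norm law. *)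
Lemma Em_L2_le (a m : nat) : L2 H (Em a m) /\ sqnorm H (Em a m) <= KH * (a.+1%:R^-1 * m.+1%:R^-1).
Proof.
have mE := Em_measurable a m.
pose F n w := Em a m w * chin n w.
have tF n : elem_test U H (F n) by exact: elem_testM (elem_mono _ _) (chin_test n).
have lF n : L2 H (F n) by exact: elem_test_L2.
have FM n : sqnorm Hs (F n) <= KH * (a.+1%:R^-1 * m.+1%:R^-1).
  rewrite -sqnorm_Hs; last by case: (lF n).
  apply: (@le_trans _ _ (KH * (I01 (fun x => x ^+ a * cut n x) * I01 (fun x => x ^+ m * cut n x)))).
    have c := csupp01_cut n : csupp01 (@cut R n); rewrite -(Em_law a m c c).
    have tX : elem_test U H (Xf a%:Z (m%:Z - 1 - a%:Z) a%:Z (m%:Z - 1 - a%:Z) (cut n) (cut n)).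
      exact: Xf_test.
    have [iX _] : cintegrable H (Xf a%:Z (m%:Z - 1 - a%:Z) a%:Z (m%:Z - 1 - a%:Z) (cut n) (cut n)).
      by have := L2_mul mH (L2_cst 1) (elem_test_L2 tX); under eq_fun do rewrite mul1r.
    apply: le_Rintegral => //; first exact: L2_integrable.
      rewrite (_ : (fun w => _) = Re \o Xf a%:Z (m%:Z - 1 - a%:Z) a%:Z (m%:Z - 1 - a%:Z) (cut n) (cut n))//.
      by apply/funext => w; rewrite [RHS]/(Re (Xf _ _ _ _ _ _ w)) Xf_real.
    move=> w Hw; rewrite /F normcM exprMn ler_wpM2l ?sqr_ge0//.
    have c1 := cut_ge0 n (tau w); have c2 := cut_ge0 n (sig w).
    rewrite /chin /chi normcM !normc_real (ger0_norm c1) (ger0_norm c2) expr2.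
    by apply: ler_piMr; [exact: mulr_ge0|exact: (mulr_ile1 c1 c2 (cut_le1 _ _) (cut_le1 _ _))].
  rewrite ler_wpM2l ?KH_ge0//; have /andP[a0 a1] := I01_cut_exprn a n.
  have /andP[m0 m1] := I01_cut_exprn m n.
  by apply: ler_pM.
have Fc w : Hs w -> (fun n => normc (F n w - Em a m w)) @ \oo --> (0 : R).
  move=> Hw; rewrite (_ : (fun n => _) = (fun n => normc (Em a m w) * normc (chin n w - 1))).
    by rewrite -(mulr0 (normc (Em a m w))); apply: cvgM; [exact: cvg_cst|exact: chin_cvg].
  by apply/funext => n; rewrite -normcM mulrBr mulr1.
have [l s] := L2_fatou measurable_Hs (fun n => (L2_Hs (lF n).1).1 (lF n)) (cmeasurable_Hs mE) FM Fc.
by split; [apply/L2_Hs|rewrite sqnorm_Hs].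
Qed.

Lemma Em_L2 (a m : nat) : L2 H (Em a m). Proof. exact: (Em_L2_le a m).1. Qed.

Lemma conj_Em (a m : nat) w : (Em a m w)^* = monob a%:Z (m%:Z - 1 - a%:Z) w.
Proof. exact: conj_mono. Qed.

Lemma Em_cutE (a m a' m' n : nat) :
  cintegral H (fun w => Em a m w * (Em a' m' w)^* * chin n w) =
  cintegral H (Xf a'%:Z (m'%:Z - 1 - a'%:Z) a%:Z (m%:Z - 1 - a%:Z) (cut n) (cut n)).
Proof. by apply: eq_cintegral => w _; rewrite /Xf; congr (_ * _ * _); exact: conj_Em. Qed.

Lemma Em_orth (a m a' m' : nat) : (a, m) != (a', m') -> L2inner H (Em a m) (Em a' m') = 0.
Proof.
move=> ne; apply: (@cut_lim_eq _ 0 (fun=> 0)).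
- exact: L2_inner_int (Em_L2 _ _) (Em_L2 _ _).
- move=> n; rewrite Em_cutE; apply: Xf_orth; [|exact: csupp01_cut|exact: csupp01_cut].
  apply: contraNneq ne => -[h1 h2]; rewrite xpair_eqE; apply/andP; split; first by rewrite h1.
  by move/eqP: h2; rewrite h1 (inj_eq (addIr _)) (inj_eq (addIr _)).
- by rewrite subr0 normc0; exact: cvg_cst.
Qed.

Lemma Em_sqn (a m : nat) : sqnorm H (Em a m) = KH * (a.+1%:R^-1 * m.+1%:R^-1).
Proof.
have := inner_sqn H (Em a m) => e.
apply: (@complexI R); rewrite -e.
apply: (@cut_lim_eq _ _ (fun n => (KH * (I01 (fun x => x ^+ a * cut n x) * I01 (fun x => x ^+ m * cut n x)))%:C)).
- exact: L2_inner_int (Em_L2 _ _) (Em_L2 _ _).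
- move=> n; rewrite Em_cutE norm_law; [|exact: csupp01_cut|exact: csupp01_cut].
  by rewrite (_ : a%:Z + (m%:Z - 1 - a%:Z) + 1 = m%:Z)//; ring.
set l := KH * _.
have h : (fun n => KH * (I01 (fun x => x ^+ a * cut n x) * I01 (fun x => x ^+ m * cut n x))) @ \oo --> l.
  have sX k : smooth1 (fun x : R => x ^+ k) by apply: smooth1X; exact: smooth1_id.
  apply: cvgM; first exact: cvg_cst.
  by apply: cvgM; rewrite -I01_exprn; exact: I01_cut_cvg.
have h2 : (fun n => `|KH * (I01 (fun x => x ^+ a * cut n x) * I01 (fun x => x ^+ m * cut n x)) - l|) @ \oo --> (0 : R).
  rewrite -(normr0 R) -(subrr l); apply: cvg_norm; apply: cvgB => //; exact: cvg_cst.
move: h2; rewrite (_ : (fun n => `|_ - l|) = (fun n => normc ((KH *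
  (I01 (fun x => x ^+ a * cut n x) * I01 (fun x => x ^+ m * cut n x)))%:C - l%:C)))//.
by apply/funext => n; rewrite -rmorphB normc_real.
Qed.

Lemma dV_obox (p q : C2 R) : p.1.1 < q.1.1 -> p.1.2 < q.1.2 -> p.2.1 < q.2.1 -> p.2.2 < q.2.2 ->
  dV (obox p q : set (mC2 R)) =
  (((q.1.1 - p.1.1) * (q.1.2 - p.1.2)) * ((q.2.1 - p.2.1) * (q.2.2 - p.2.2)))%:E.
Proof.
move=> h1 h2 h3 h4.
have mi (x y : R) : measurable (`]x, y[%classic : set (measurableTypeR R)) by exact: measurable_itv.
rewrite /obox /dV sfprodE; [|by apply: measurableX; exact: mi|by apply: measurableX; exact: mi].
have li (x y : R) : x < y -> @lebesgue_measure R (`]x, y[%classic : set (measurableTypeR R)) = (y - x)%:E.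
  by move=> xy; rewrite lebesgue_measure_itv /= lte_fin xy -EFinB.
have sE (x y x' y' : R) : x < y -> x' < y' -> sfprod (@lebesgue_measure R) (@lebesgue_measure R)
    ((`]x, y[%classic : set (measurableTypeR R)) `*` (`]x', y'[%classic : set (measurableTypeR R))) = ((y - x) * (y' - x'))%:E.
  by move=> xy xy'; rewrite sfprodE// EFinM; congr (_ * _)%E; exact: li.
by rewrite [X in (X * _)%E]sE// [X in (_ * X)%E]sE.
Qed.

(** [Em 0 1] is the constant 1, so a zero constant would make the domain a null set, whereas it
    contains a box. *)
Lemma KH_gt0 : 0 < KH.
Proof.
rewrite lt0r KH_ge0 andbT; apply/eqP => K0.
have E1 : Em 0 1 = fun=> (1 : C).
  by apply/funext => w; rewrite /Em /mono (_ : 1%:Z - 1 - 0%:Z = 0)// !expr0z mulr1.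
have := Em_sqn 0 1; rewrite K0 mul0r E1 => s0.
have := L2_sqn measurable_hartogs (L2_cst (1 : C)); rewrite s0.
under eq_integral do rewrite normc1 expr1n.
rewrite integral_cst//= mul1e => V0.
pose p : C2 R := ((0, 0), (2^-1, 0)); pose q : C2 R := ((4^-1, 4^-1), (3/4, 4^-1)).
have mo := measurable_obox p q.
have oH : obox p q `<=` H.
  move=> w /oboxP /= [] /andP[x1 x1'] /andP[y1 y1'] /andP[x2 x2'] /andP[y2 y2'].
  apply/hartogsE; rewrite /sig !sqr_normcE /w1 /w2 /=.
  move: w.1.1 w.1.2 w.2.1 w.2.2 x1 x1' y1 y1' x2 x2' y2 y2' => a b c d *.
  have a2 : a ^+ 2 < 1/16 by nra.
  have b2 : b ^+ 2 < 1/16 by nra.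
  have c2 : 1/4 < c ^+ 2 < 9/16 by apply/andP; split; nra.
  have d2 : 0 <= d ^+ 2 < 1/16 by apply/andP; split; nra.
  case/andP: c2 => c2 c2'; case/andP: d2 => d2 d2'.
  by split; lra.
have : (dV (obox p q : set (mC2 R)) <= 0)%E by apply: (@le_trans _ _ (dV (H : set (mC2 R)))); [apply: le_measure; rewrite ?inE|rewrite V0].
rewrite dV_obox /p /q /=; [|lra|lra|lra|lra].
rewrite lee_fin; lra.
Qed.

End Norms.

(** * Completeness of the monomials in the Bergman space *)

Section Completeness.
Context {R : realType}.
Local Notation C := R[i].
Local Notation Cfun := (C2 R -> C).
Local Notation H := (@hartogs R).
Local Notation U := (@Ustar R).
Implicit Types (A B S : R -> R) (f g phi F P : Cfun) (w : C2 R) (a b c d : int).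
Let mH := @measurable_hartogs R.

Lemma nbhs_C2 w0 (P : set (C2 R)) : nbhs w0 P -> exists2 r : R, 0 < r &
  forall w, [/\ `|w.1.1 - w0.1.1| < r, `|w.1.2 - w0.1.2| < r,
    `|w.2.1 - w0.2.1| < r & `|w.2.2 - w0.2.2| < r] -> P w.
Proof.
move=> h; have [r /= r0 hr] := (nbhs_ballP w0 P).1 h; exists r => // w [h1 h2 h3 h4].
by apply: hr; split; split; rewrite /ball /= distrC.
Qed.

Lemma I01_exprz_pos (k : int) : exists n, 0 < I01 (fun x : R => x ^ k * cut n x).
Proof.
have [k0|k0] := ltP k 0; first exact: I01_exprz_unbounded.
case: k k0 => // k _.
have sX : smooth1 (fun x : R => x ^+ k) by apply: smooth1X; exact: smooth1_id.
have /cvgrPdist_lt/(_ k.+1%:R^-1) := I01_cut_cvg sX.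
rewrite I01_exprn invr_gt0 ltr0n => /(_ isT) [n _ /(_ n (leqnn n))] h; exists n.
by move: h; rewrite ltr_norml => /andP[_]; rewrite ltrBlDr ltrDl.
Qed.

(** One negative exponent is enough: its integral is unbounded while the other one is kept fixed at
    a positive value. *)
Lemma I01_unbounded2 (k1 k2 : int) (M : R) : (k1 < 0) || (k2 < 0) -> exists n1 n2,
  [/\ 0 < I01 (fun x : R => x ^ k1 * cut n1 x), 0 < I01 (fun x : R => x ^ k2 * cut n2 x) &
   M < I01 (fun x => x ^ k1 * cut n1 x) * I01 (fun x => x ^ k2 * cut n2 x)].
Proof.
case/orP => k0.
  have [n2 h2] := I01_exprz_pos k2.
  have [n1] := I01_exprz_unbounded (Num.max 0 (M / I01 (fun x : R => x ^ k2 * cut n2 x))) k0.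
  rewrite gt_max => /andP[h1 h3]; exists n1, n2; split => //.
  by move: h2 h3; move: (I01 _) (I01 _) => x y x0; rewrite ltr_pdivrMr.
have [n1 h1] := I01_exprz_pos k1.
have [n2] := I01_exprz_unbounded (Num.max 0 (M / I01 (fun x : R => x ^ k1 * cut n1 x))) k0.
rewrite gt_max => /andP[h2 h3]; exists n1, n2; split => //.
by move: h1 h3; move: (I01 _) (I01 _) => x y x0; rewrite ltr_pdivrMr// mulrC.
Qed.

Lemma conj_chi A S w : (chi A S w)^* = chi A S w.
Proof. by apply: ReIm_eq; rewrite /chi ?ReJ ?ImJ// ImM /= !mulr0 mul0r addr0 oppr0. Qed.

(** Cauchy-Schwarz for [g] against the monomial times the cut-offs; as these lie between 0 and 1,
    the squared norm of the second factor is at most the integral given by the norm law. *)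
Lemma Lw_bound g a b n1 n2 : L2 H g ->
  normc (Lw g a b (cut n1) (cut n2)) ^+ 2 <= sqnorm H g *
  (KH * (I01 (fun x : R => x ^ a * cut n1 x) * I01 (fun x => x ^ (a + b + 1) * cut n2 x))).
Proof.
move=> lg; have c1 := csupp01_cut n1 : csupp01 (@cut R n1).
have c2 := csupp01_cut n2 : csupp01 (@cut R n2).
pose F w := mono a b w * chi (cut n1) (cut n2) w.
have lF : L2 H F by apply: elem_test_L2; exact: elem_testM (elem_mono a b) (chi_test c1 c2).
have -> : Lw g a b (cut n1) (cut n2) = L2inner H g F.
  apply: eq_cintegral => w _; congr (_ * _); apply: esym.
  transitivity (conjc (mono a b w) * conjc (chi (cut n1) (cut n2) w)); first exact: conjcM.
  by congr (_ * _); [exact: conj_mono|exact: conj_chi].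
apply: (le_trans (cauchy_schwarz mH lg lF)); rewrite ler_wpM2l ?sqnorm_ge0//.
  exact: sqn_ge0.
rewrite -(norm_lawR a b c1 c2).
have tX : elem_test U H (Xf a b a b (cut n1) (cut n2)) by exact: Xf_test.
have [iX _] : cintegrable H (Xf a b a b (cut n1) (cut n2)).
  by have := L2_mul mH (L2_cst 1) (elem_test_L2 tX); under eq_fun do rewrite mul1r.
apply: le_Rintegral => //; first exact: L2_integrable.
  rewrite (_ : (fun w => _) = Re \o Xf a b a b (cut n1) (cut n2))//.
  by apply/funext => w; rewrite [RHS]/(Re (Xf _ _ _ _ _ _ w)) Xf_real.
move=> w Hw; rewrite /F normcM exprMn ler_wpM2l ?sqr_ge0//.
have d1 := cut_ge0 n1 (tau w); have d2 := cut_ge0 n2 (sig w).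
rewrite /chi normcM !normc_real (ger0_norm d1) (ger0_norm d2) expr2.
by apply: ler_piMr; [exact: mulr_ge0|exact: (mulr_ile1 d1 d2 (cut_le1 _ _) (cut_le1 _ _))].
Qed.

(** By [law] the pairing is [c x y], where [x] and [y] are the two cut-off integrals. If an exponent
    is negative, [Lw_bound] gives [|c|^2 (x y)^2 <= |g|^2 KH x y], impossible for [c != 0] since
    [x y] is unbounded. Otherwise [c] is a nonzero multiple of the inner product of [g] with a basis
    function. *)
Lemma Lw_eq0 g a b A S : L2 H g -> whol g -> (forall a m : nat, L2inner H g (Em a m) = 0) ->
  csupp01 A -> csupp01 S -> Lw g a b A S = 0.
Proof.
move=> lg wg g0 cA cS; have [c hc] := law a b wg.
suff c0 : c = 0 by rewrite hc// c0 mul0r.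
have [n|n] := boolP ((a < 0) || (a + b + 1 < 0)).
  apply: contrapT => /eqP c0; have cn : 0 < normc c ^+ 2 by rewrite exprn_gt0 ?normc_gt0.
  have [n1 [n2 [h1 h2]]] := I01_unbounded2 (sqnorm H g * KH / normc c ^+ 2) n.
  rewrite ltr_pdivrMr// ltNge => /negP; apply.
  have := Lw_bound a b n1 n2 lg.
  rewrite hc; [|exact: csupp01_cut|exact: csupp01_cut].
  rewrite normcM normc_real exprMn.
  move: (I01 _) (I01 _) h1 h2 => x y x0 y0.
  have yx : 0 < y * x by rewrite mulr_gt0.
  rewrite (ger0_norm (ltW yx)) => h; rewrite -(ler_pM2r yx).
  rewrite (_ : y * x * _ * _ = normc c ^+ 2 * (y * x) ^+ 2); last by ring.
  by rewrite -(mulrA (sqnorm H g)).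
move: n; rewrite negb_or -!leNgt => /andP[a0 m0].
case: a a0 m0 hc => // a _; case E : (a%:Z + b + 1) => [m|]// _ hc.
have bE : b = m%:Z - 1 - a%:Z by rewrite -E; ring.
have iF : cintegrable H (fun w => g w * (Em a m w)^*) by apply: L2_inner_int => //; exact: Em_L2.
pose I2 n := I01 (fun x : R => x ^+ a * cut n x) * I01 (fun x : R => x ^+ m * cut n x).
have I2l : I2 @ \oo --> (a.+1%:R^-1 * m.+1%:R^-1 : R).
  have sX k : smooth1 (fun x : R => x ^+ k) by apply: smooth1X; exact: smooth1_id.
  by apply: cvgM; rewrite -I01_exprn; exact: I01_cut_cvg.
have h : cintegral H (fun w => g w * (Em a m w)^*) = c * (a.+1%:R^-1 * m.+1%:R^-1)%:C.
  apply: (@cut_lim_eq _ _ _ (fun n => c * (I2 n)%:C)) => //.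
    move=> n; rewrite -hc; [|exact: csupp01_cut|exact: csupp01_cut].
    apply: eq_cintegral => w _; rewrite /Xm mulrA; congr (_ * _ * _).
    by rewrite -[LHS]/((Em a m w)^*)%C conj_Em bE.
  rewrite (_ : (fun n => _) = (fun n => normc c * `|I2 n - a.+1%:R^-1 * m.+1%:R^-1|)).
    rewrite -(mulr0 (normc c)); apply: cvgM; first exact: cvg_cst.
    rewrite -(normr0 R); apply: cvg_norm; rewrite -(subrr (a.+1%:R^-1 * m.+1%:R^-1 : R)).
    by apply: cvgB => //; exact: cvg_cst.
  by apply/funext => n; rewrite -mulrBr -rmorphB normcM normc_real.
have := g0 a m; rewrite /L2inner h => /eqP; rewrite mulf_eq0 => /orP[/eqP//|].
rewrite -normc_eq0 normc_real normr_eq0 gt_eqF// mulr_gt0// invr_gt0 ltr0n//.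
Qed.

Section Peak.
Variable g : Cfun.
Hypotheses (lg : L2 H g) (wg : whol g) (cg : forall w, H w -> ccontinuous_at g w)
  (g0 : forall a m : nat, L2inner H g (Em a m) = 0).

(** All exponents and cut-offs are quantified here, because multiplying [P] by a coordinate is
    absorbed by changing them. *)
Let annih P := elem U P /\ forall a b A S, csupp01 A -> csupp01 S ->
  cintegral H (fun w => g w * (P w * Xm a b A S w)) = 0.

Let annih_int P a b A S : annih P -> csupp01 A -> csupp01 S ->
  cintegrable H (fun w => g w * (P w * Xm a b A S w)).
Proof. by move=> [eP _] cA cS; apply: wg.1; exact: elem_testM eP (Xm_test a b cA cS). Qed.

Let annih1 : annih (fun=> 1).
Proof.
split; first exact: elem_cst.
move=> a b A S cA cS; rewrite -[RHS](Lw_eq0 a b lg wg g0 cA cS).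
by apply: eq_cintegral => w _; rewrite mul1r.
Qed.

Let annihD P Q : annih P -> annih Q -> annih (fun w => P w + Q w).
Proof.
move=> aP aQ; split; first by apply: elemD; [case: aP|case: aQ].
move=> a b A S cA cS; transitivity (0 + 0 : C); last by rewrite addr0.
rewrite -{1}(aP.2 a b A S cA cS) -(aQ.2 a b A S cA cS) -cintegralD//; try exact: annih_int.
by apply: eq_cintegral => w _; rewrite mulrDl mulrDr.
Qed.

Let annihZ (k : C) P : annih P -> annih (fun w => k * P w).
Proof.
move=> aP; split; first by apply: elemM; [exact: elem_cst|case: aP].
move=> a b A S cA cS; transitivity (k * 0 : C); last by rewrite mulr0.
rewrite -(aP.2 a b A S cA cS) -cintegralZ//; try exact: annih_int.
by apply: eq_cintegral => w _; ring.
Qed.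

Let annih_mul P q : elem U q -> annih P ->
  (forall a b A S, csupp01 A -> csupp01 S -> exists a' b' A' S', [/\ csupp01 A', csupp01 S' &
     forall w, U w -> q w * Xm a b A S w = Xm a' b' A' S' w]) -> annih (fun w => q w * P w).
Proof.
move=> eq aP h; split; first by apply: elemM => //; case: aP.
move=> a b A S cA cS; have [a' [b' [A' [S' [cA' cS' e]]]]] := h a b A S cA cS.
rewrite -[RHS](aP.2 a' b' A' S' cA' cS'); apply: eq_cintegral => w _.
have [Uw|nU] := pselect (U w); first by rewrite -e//; congr (_ * _); ring.
have o1 : ~~ (0 < (0 : R) < 1) by rewrite ltxx.
by rewrite /Xm /chi (tau0 nU) (csupp01_out cA o1) (csupp01_out cA' o1) !(mulr0, mul0r).
Qed.

Let csuppX A : csupp01 A -> csupp01 (fun x => x * A x).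
Proof. by move=> cA; apply: csupp01M => //; exact: smooth1_id. Qed.

Let annih_w1b P : annih P -> annih (fun w => w1b w * P w).
Proof.
move=> aP; apply: annih_mul => //; first exact: elem_w1b.
move=> a b A S cA cS; exists (a + 1), b, A, S; split => // w [w10 _].
have z : w1b w != 0 by rewrite w1b_neq0.
by rewrite /Xm /monob (expfzDr _ _ z) expr1z; ring.
Qed.

Let annih_w2b P : annih P -> annih (fun w => w2b w * P w).
Proof.
move=> aP; apply: annih_mul => //; first exact: elem_w2b.
move=> a b A S cA cS; exists a, (b + 1), A, S; split => // w [_ w20].
have z : w2b w != 0 by rewrite w2b_neq0.
by rewrite /Xm /monob (expfzDr _ _ z) expr1z; ring.
Qed.

(** On [Ustar], [w1 = tau * sig / w1b]: the factor lowers the exponent [a] and multiplies both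
    cut-offs by their variable. *)
Let annih_w1 P : annih P -> annih (fun w => w1 w * P w).
Proof.
move=> aP; apply: annih_mul => //; first exact: elem_w1.
move=> a b A S cA cS; exists (a - 1), b, (fun x => x * A x), (fun x => x * S x).
split; [exact: csuppX|exact: csuppX|move=> w [w10 w20]].
have z : w1b w != 0 by rewrite w1b_neq0.
have z2 : w2b w != 0 by rewrite w2b_neq0.
have m (x y : R) : (x * y)%:C = x%:C * y%:C by exact: rmorphM.
have -> : Xm (a - 1) b (fun x => x * A x) (fun x => x * S x) w =
    monob (a - 1) b w * ((tau w * A (tau w))%:C * (sig w * S (sig w))%:C) by [].
rewrite /Xm /monob (expfzDr _ _ z) exprN1 /chi.
have tE := tauE w; have sE := sigE w; move: (tau w) tE (sig w) sE => t tE s sE; rewrite !m tE sE.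
move: (w1b w ^ a) (w2b w ^ b) (A _) (S _) => p q A0 S0; field.
by rewrite z z2 w20.
Qed.

(** On [Ustar], [w2 = sig / w2b]. *)
Let annih_w2 P : annih P -> annih (fun w => w2 w * P w).
Proof.
move=> aP; apply: annih_mul => //; first exact: elem_w2.
move=> a b A S cA cS; exists a, (b - 1), A, (fun x => x * S x).
split; [by []|exact: csuppX|move=> w [w10 w20]].
have z2 : w2b w != 0 by rewrite w2b_neq0.
have m (x y : R) : (x * y)%:C = x%:C * y%:C by exact: rmorphM.
have -> : Xm a (b - 1) A (fun x => x * S x) w =
    monob a (b - 1) w * ((A (tau w))%:C * (sig w * S (sig w))%:C) by [].
rewrite /Xm /monob (expfzDr _ _ z2) exprN1 /chi.
have sE := sigE w; move: (sig w) sE => s sE; rewrite !m sE.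
move: (w1b w ^ a) (w2b w ^ b) (A _) (S _) => p q A0 S0; field.
by rewrite z2.
Qed.

Variable w0 : C2 R.
Hypothesis (Hw0 : Hs w0).

(* The powers of [q e], for small [e], concentrate at [w0]: on [hartogs], [q e] exceeds 1 only
   near [w0]. *)
Let dist2 w : R := normc (w1 w - w1 w0) ^+ 2 + normc (w2 w - w2 w0) ^+ 2.
Let q (e : R) w : R := 1 + (e - dist2 w) / 8.

Let dist2E w : (dist2 w)%:C = (w1 w * w1b w - w1b w0 * w1 w - w1 w0 * w1b w + w1 w0 * w1b w0) +
  (w2 w * w2b w - w2b w0 * w2 w - w2 w0 * w2b w + w2 w0 * w2b w0).
Proof.
have k (x y : C) : (normc (x - y) ^+ 2)%:C = x * conjc x - conjc y * x - y * conjc x + y * conjc y.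
  transitivity ((x - y) * conjc (x - y)); first by rewrite mulcJ.
  have -> : conjc (x - y) = conjc x - conjc y by exact: rmorphB.
  by ring.
by rewrite /dist2 rmorphD; congr (_ + _); exact: k.
Qed.

Let annih_q (e : R) P : annih P -> annih (fun w => (q e w)%:C * P w).
Proof.
move=> aP.
have a1 := annih_w1 (annih_w1b aP); have a2 := annihZ (- w1b w0) (annih_w1 aP).
have a3 := annihZ (- w1 w0) (annih_w1b aP).
have b1 := annih_w2 (annih_w2b aP); have b2 := annihZ (- w2b w0) (annih_w2 aP).
have b3 := annihZ (- w2 w0) (annih_w2b aP).
have c1 := annihZ (1 + e%:C / 8 - (w1 w0 * w1b w0 + w2 w0 * w2b w0) / 8) aP.
have := annihD c1 (annihZ (- 8^-1) (annihD (annihD a1 (annihD a2 a3)) (annihD b1 (annihD b2 b3)))).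
congr annih; apply/funext => w.
have -> : (q e w)%:C = 1 + (e%:C - (dist2 w)%:C) / 8.
  by rewrite /q; move: (dist2 w) => d; rewrite rmorphD rmorphM rmorphB fmorphV rmorph_nat.
by rewrite dist2E; field.
Qed.

Let annih_qX (e : R) n : annih (fun w => (q e w ^+ n)%:C).
Proof.
elim: n => [|n IH]; first exact: annih1.
by have := annih_q e IH; congr annih; apply/funext => w; rewrite exprS rmorphM.
Qed.

Let dist2_coord w (r : R) : 0 < r -> dist2 w < r ^+ 2 -> [/\ `|w.1.1 - w0.1.1| < r, `|w.1.2 - w0.1.2| < r,
  `|w.2.1 - w0.2.1| < r & `|w.2.2 - w0.2.2| < r].
Proof.
move=> r0; rewrite /dist2 !sqr_normcE /w1 /w2 /=.
have k (x : R) : x ^+ 2 < r ^+ 2 -> `|x| < r.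
  by rewrite -(real_normK (num_real x)) ltr_sqr ?nnegrE// ltW.
move: (sqr_ge0 (w.1.1 - w0.1.1)) (sqr_ge0 (w.1.2 - w0.1.2)) (sqr_ge0 (w.2.1 - w0.2.1)) (sqr_ge0 (w.2.2 - w0.2.2)).
by move=> *; split; apply: k; lra.
Qed.

Let peak_chin : exists n0, 0 < cut n0 (tau w0) * cut n0 (sig w0).
Proof.
have h : (fun n => cut n (tau w0) * cut n (sig w0)) @ \oo --> (1 : R).
  rewrite -(mulr1 (1 : R)); apply: cvgM; apply: cut_cvg; first exact: Hs_tau.
  exact: hartogs_sig Hw0.1.
move: h => /cvgrPdist_lt/(_ 1 ltr01)[n _ hn]; exists n.
by move: (hn n (leqnn n)); rewrite ltr_norml => /andP[_]; lra.
Qed.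

Let peak_int n0 (e : R) n :
  cintegrable H (fun w => (conjc (g w0) * chin n0 w * g w) * (q e w ^+ n)%:C) /\
  cintegral H (fun w => (conjc (g w0) * chin n0 w * g w) * (q e w ^+ n)%:C) = 0.
Proof.
have c : csupp01 (@cut R n0) by exact: csupp01_cut.
have a := annih_qX e n; have i := annih_int 0 0 a c c.
have E w : conjc (g w0) * chin n0 w * g w * (q e w ^+ n)%:C =
    conjc (g w0) * (g w * ((q e w ^+ n)%:C * Xm 0 0 (cut n0) (cut n0) w)).
  by rewrite /Xm /monob !expr0z !mul1r -/(chin n0 w); ring.
split; first by apply: (eq_cintegrable mH _ (cintegrableZ mH (conjc (g w0)) i)) => w _; rewrite E.
rewrite (eq_cintegral (fun w _ => E w)) cintegralZ// a.2//; exact: mulr0.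
Qed.

(** If [g w0] were nonzero, [psi] would be positive near [w0] while all integrals of [psi * q ^ n]
    are zero. On a small box the integrand grows at least linearly in [n], and everywhere else it is
    at least [- |psi|]. So [n * c] times the volume of the box stays below the integral of [|psi|]
    for all [n], which is absurd. *)
Lemma peak_vanish : g w0 = 0.
Proof.
apply: contrapT => /eqP gn; have [n0 ch0] := peak_chin.
pose Psi w : C := conjc (g w0) * chin n0 w * g w; pose psi w : R := Re (Psi w).
have p0 : 0 < psi w0.
  have -> : psi w0 = normc (g w0) ^+ 2 * (cut n0 (tau w0) * cut n0 (sig w0)).
    rewrite /psi /Psi sqr_normcE /chin /chi !ReImE /= ReJ ImJ; ring.
  by rewrite mulr_gt0// exprn_gt0// normc_gt0.
have cPsi : ccontinuous_at Psi w0.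
  apply: ccontinuousM; last exact: (cg Hw0.1).
  apply: ccontinuousM; first exact: ccontinuous_cst.
  by have [K [_ _ _ h]] := elem_test_csupp (@chin_test R n0); exact: h.
have [r r0 hr] : exists2 r : R, 0 < r & forall w, [/\ `|w.1.1 - w0.1.1| < r, `|w.1.2 - w0.1.2| < r,
    `|w.2.1 - w0.2.1| < r & `|w.2.2 - w0.2.2| < r] -> psi w0 / 2 < psi w /\ H w.
  have n1 : \forall w \near w0, psi w0 / 2 < psi w.
    have h2 : psi w0 / 2 < psi w0 by rewrite ltr_pdivrMr// ltr_pMr// ltr1n.
    exact: (cvgr_gt _ cPsi.1 _ h2).
  have n2 : \forall w \near w0, H w by apply: open_nbhs_nbhs; split; [exact: open_hartogs|exact: Hw0.1].
  by have [r r0 hr] := nbhs_C2 (filterI n1 n2); exists r.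
pose p' : C2 R := ((w0.1.1 - r / 4, w0.1.2 - r / 4), (w0.2.1 - r / 4, w0.2.2 - r / 4)).
pose q' : C2 R := ((w0.1.1 + r / 4, w0.1.2 + r / 4), (w0.2.1 + r / 4, w0.2.2 + r / 4)).
have bd w : obox p' q' w -> dist2 w < r ^+ 2 / 2.
  move=> /oboxP /= [/andP[a1 a2] /andP[a3 a4] /andP[a5 a6] /andP[a7 a8]].
  rewrite /dist2 !sqr_normcE /w1 /w2 /=.
  have k (x y : R) : x - r / 4 < y -> y < x + r / 4 -> (y - x) ^+ 2 < r ^+ 2 / 8 by move=> *; nra.
  have := k _ _ a1 a2; have := k _ _ a3 a4; have := k _ _ a5 a6; have := k _ _ a7 a8.
  by move=> *; lra.
have r2 : 0 < r ^+ 2 by rewrite exprn_gt0.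
have oH : obox p' q' `<=` H.
  by move=> w /bd h; apply: (hr _ _).2; apply: dist2_coord => //; lra.
have [iP _] := peak_int n0 (r ^+ 2) 0.
have ipsi : dV.-integrable (H : set (mC2 R)) (EFin \o psi : mC2 R -> \bar R).
  have := iP.1; congr (_.-integrable _ (EFin \o _)); apply/funext => w /=.
  by rewrite expr0 mulr1.
have Vpos : 0 < fine (dV (obox p' q' : set (mC2 R))).
  by rewrite dV_obox /p' /q' /=; [rewrite !mulr_gt0//; lra|lra|lra|lra|lra].
(* On the box [psi > psi w0 / 2], and [dist2 < r^2 / 2] gives [q - 1 >= r^2 / 16]. *)
pose c := psi w0 / 2 * (r ^+ 2 / 16).
have c0 : 0 < c by rewrite mulr_gt0// ?divr_gt0.
have iO : dV.-integrable (H : set (mC2 R)) (EFin \o (\1_(obox p' q')) : mC2 R -> \bar R).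
  have [i1 _] := L2_mul mH (L2_cst 1) (L2_cst 1).
  have mo : cmeasurable H (fun w => (\1_(obox p' q') w)%:C).
    split; last exact: measurable_cst.
    by apply: measurable_indic; exact: measurable_obox.
  have le1 w : H w -> normc ((\1_(obox p' q') w)%:C : C) <= (Re \o (fun=> 1 * 1 : C)) w.
    move=> _; rewrite [X in _ <= X]/= mulr1 normc_real mulr0 subr0 indicE.
    by case: (_ \in _); rewrite ?normr1 ?normr0.
  by have [] := cintegrable_le mH mo le1 i1.
have main n : n%:R * c * fine (dV (obox p' q' : set (mC2 R))) <= \int[dV]_(w in (H : set (mC2 R))) `|psi w|.
  have [iq q0] := peak_int n0 (r ^+ 2) n.
  have ia := integrable_norm ipsi.
  have iz := integrableZl mH (n%:R * c) iO.
  have h : \int[dV]_(w in (H : set (mC2 R))) (n%:R * c * \1_(obox p' q') w - `|psi w|) <=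
      \int[dV]_(w in (H : set (mC2 R))) (psi w * q (r ^+ 2) w ^+ n).
    apply: le_Rintegral => //.
    - exact: integrableB iz ia.
    - have := iq.1; congr (_.-integrable _ (EFin \o _)); apply/funext => w /=.
      by rewrite ReM /= mulr0 subr0.
    (* Both coordinates have modulus at most 1, so each difference is at most 2. This is the origin
       of the 8 in [q], which keeps [q] nonnegative on the domain. *)
    move=> w Hw; have d8 : dist2 w <= 8.
      rewrite /dist2; have b1 := normcB (w1 w) (w1 w0); have b2 := normcB (w2 w) (w2 w0).
      have := hartogs_normc1 Hw; have := hartogs_normc1 Hw0.1.
      have := hartogs_normc2 Hw; have := hartogs_normc2 Hw0.1.
      have := normc_ge0 (w1 w - w1 w0); have := normc_ge0 (w2 w - w2 w0).
      move: (normc (w1 w - w1 w0)) (normc (w2 w - w2 w0)) b1 b2 => x y *; nra.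
    have pa : - `|psi w| <= psi w by rewrite lerNl -normrN ler_norm.
    have [dr|dr] := ltP (dist2 w) (r ^+ 2); last first.
      have -> : \1_(obox p' q') w = 0 :> R.
        rewrite indicE; case: (boolP (w \in obox p' q')) => // /set_mem/bd.
        by move=> h; exfalso; lra.
      rewrite mulr0 sub0r; have q01 : 0 <= q (r ^+ 2) w <= 1 by rewrite /q; apply/andP; split; lra.
      case/andP: q01 => q01 q1; have qn1 := exprn_ile1 n q01 q1; have qn0 := exprn_ge0 n q01.
      have [pp|pn] := leP 0 (psi w).
        by rewrite (le_trans _ (mulr_ge0 pp qn0))// oppr_le0.
      rewrite ltr0_norm// opprK; nra.
    have [pw _] := hr w (dist2_coord r0 dr).
    have q1 : 0 <= q (r ^+ 2) w - 1 by rewrite /q; lra.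
    (* Bernoulli's inequality. *)
    have bern : 1 + n%:R * (q (r ^+ 2) w - 1) <= q (r ^+ 2) w ^+ n.
      move: (q (r ^+ 2) w) q1 => x x1; elim: (n) => [|k IH]; first by rewrite mul0r addr0 expr0.
      rewrite exprS -[k.+1%:R]natr1; have k0 := ler0n R k.
      move: (k%:R) (x ^+ k) IH k0 => z y IH k0.
      have a1 : 0 <= z * (x - 1) ^+ 2 by rewrite mulr_ge0 ?sqr_ge0.
      have a2 : 0 <= x * (y - (1 + z * (x - 1))) by rewrite mulr_ge0 ?subr_ge0//; lra.
      by rewrite -subr_ge0 (_ : _ - _ = z * (x - 1) ^+ 2 + x * (y - (1 + z * (x - 1)))) ?addr_ge0//; ring.
    have n0' : 0 <= n%:R :> R by exact: ler0n.
    rewrite indicE; case: (boolP (w \in obox p' q')) => [/set_mem/bd db|_] /=.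
      have q2 : r ^+ 2 / 16 <= q (r ^+ 2) w - 1 by rewrite /q; lra.
      have pp : 0 <= psi w by lra.
      rewrite ger0_norm// mulr1; move: bern; rewrite /c; move: (q _ w ^+ n) => Q bern.
      have e1 : n%:R * (psi w0 / 2 * (r ^+ 2 / 16)) <= psi w * (n%:R * (q (r ^+ 2) w - 1)).
        rewrite mulrCA; apply: ler_pM; [lra| |exact: ltW|].
          by rewrite mulr_ge0// ltW// divr_gt0.
        by rewrite ler_wpM2l.
      have e2 : psi w * (1 + n%:R * (q (r ^+ 2) w - 1)) <= psi w * Q by rewrite ler_wpM2l.
      by rewrite mulrDr mulr1 in e2; lra.
    rewrite mulr0 sub0r; have pp : 0 <= psi w by lra.
    rewrite (le_trans pa)// ler_peMr//.
    by rewrite (le_trans _ bern)// lerDl mulr_ge0.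
  have z : \int[dV]_(w in (H : set (mC2 R))) (psi w * q (r ^+ 2) w ^+ n) = 0.
    have := congr1 (fun x => Re x) q0; rewrite Re_cintegral [RHS]/= => z0; rewrite -[RHS]z0.
    by apply: eq_Rintegral => w _; rewrite ReM /= mulr0 subr0.
  move: h; rewrite z RintegralB// subr_le0 RintegralZl//.
  congr (_ * _ <= _); rewrite /Rintegral; congr fine.
  by rewrite integral_indic ?setIidl//; exact: measurable_obox.
set K := \int[dV]_(w in _) _ in main; set V := fine _ in Vpos main.
have K0 : 0 <= K / (c * V).
  by apply: divr_ge0; [have := main 0; rewrite !mul0r|exact/ltW/mulr_gt0].
have := archi_boundP K0; rewrite ltr_pdivrMr ?mulr_gt0// mulrA ltNge => /negP; apply.
exact: main.
Qed.

End Peak.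

(** The peak argument needs a cut-off that is nonzero at the point, hence [w1 != 0]. A point with
    [w1 = 0] is reached by continuity, through a nearby point whose first coordinate is shifted by
    [r / 2]. *)
Lemma completeness g : L2 H g -> whol g -> (forall w, H w -> ccontinuous_at g w) ->
  (forall a m : nat, L2inner H g (Em a m) = 0) -> forall w, H w -> g w = 0.
Proof.
move=> lg wg cg g0 w Hw; have [n1|n1] := pselect (N1 w); last exact: (peak_vanish lg wg cg g0).
have pt v : (H v /\ ~ N1 v) -> g v = 0 by move=> ?; exact: (peak_vanish lg wg cg g0).
apply: contrapT => /eqP gn.
have n2 : \forall v \near w, H v by apply: open_nbhs_nbhs; split; [exact: open_hartogs|].
have n3 : \forall v \near w, g v != 0.
  have [cr ci] := cg w Hw.
  have cn : {for w, continuous (fun v => normc (g v) ^+ 2)} by exact: continuous_normc_sqr.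
  have p0 : 0 < normc (g w) ^+ 2 by rewrite exprn_gt0// normc_gt0.
  have n4 : \forall v \near w, 0 < normc (g v) ^+ 2 by exact: (cvgr_gt _ cn _ p0).
  near=> v; have : 0 < normc (g v) ^+ 2 by near: v.
  apply: contraTneq => ->; by rewrite normc0 expr0n ltxx.
have [r r0 hr] := nbhs_C2 (filterI n2 n3).
pose v : C2 R := ((w.1.1 + r / 2, w.1.2), (w.2.1, w.2.2)).
have [Hv gv] : H v /\ g v != 0.
  apply: hr; rewrite /= !subrr !normr0; split => //.
  by rewrite addrAC subrr add0r ger0_norm ?ltr_pdivrMr ?ltr_pMr ?ltr1n// ltW// divr_gt0.
move/eqP: gv; apply; apply: pt; split => //.
move: n1; rewrite /N1 /w1 /= => /(congr1 (fun x => Re x)) /= e1 /(congr1 (fun x => Re x)) /=.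
by rewrite e1 add0r => /eqP; rewrite gt_eqF// divr_gt0.
Unshelve. all: by end_near.
Qed.

End Completeness.

(** * Limits with explicit rates *)

Section LimitLemmas.
Context {R : realType}.
Implicit Types (x u : nat -> R) (t s : R).

(** Writing the summable bound as a telescoping difference makes the tail explicit. Convergence
    holds because [x n - M / n.+1] is nondecreasing and bounded above. *)
Lemma telescoping_cvg x (M : R) :
  (forall n, `|x n.+1 - x n| <= M * (n.+1%:R^-1 - n.+2%:R^-1)) ->
  x @ \oo --> limn x /\ forall N, `|limn x - x N| <= M / N.+1%:R.
Proof.
move=> h.
have M0 : 0 <= M.
  have := h 0; move=> /(le_trans (normr_ge0 _)); rewrite pmulr_lge0// subr_gt0.
  by rewrite ltf_pV2 ?posrE ?ltr0n// ltr_nat.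
have up N k : `|x (N + k)%N - x N| <= M * (N.+1%:R^-1 - (N + k).+1%:R^-1).
  elim: k => [|k IH]; first by rewrite addn0 !subrr normr0 mulr0.
  have := h (N + k)%N; rewrite addnS => hk.
  rewrite (_ : x (N + k).+1 - x N = (x (N + k).+1 - x (N + k)%N) + (x (N + k)%N - x N)); last by ring.
  have := lerD hk IH; rewrite -mulrDr (_ : _ - _ + _ = N.+1%:R^-1 - (N + k).+2%:R^-1); last by ring.
  by apply: le_trans; exact: ler_normD.
have up' N k : `|x (N + k)%N - x N| <= M / N.+1%:R.
  apply: (le_trans (up N k)); rewrite ler_wpM2l// gerBl invr_ge0 ler0n//.
pose y n := x n - M / n.+1%:R.
have ynd : {homo y : n m / (n <= m)%N >-> n <= m}.
  move=> n m /subnKC <-; rewrite /y; have := up n (m - n)%N.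
  by rewrite ler_norml mulrBr => /andP[]; set b := M / n.+1%:R; set d := M * _; rewrite -/d; lra.
have yub : has_ubound (range y).
  exists (x 0 + M) => _ [n _ <-]; have := up' 0 n; rewrite add0n divr1 ler_norml => /andP[_ h1].
  rewrite /y; have : 0 <= M / n.+1%:R by rewrite divr_ge0.
  by move: (M / n.+1%:R) => b b0; lra.
have cy := nondecreasing_is_cvgn ynd yub.
have ci : (fun n => M / n.+1%:R) @ \oo --> (0 : R).
  by rewrite -(mulr0 M); apply: cvgM; [exact: cvg_cst|exact: cvg_harmonic].
have cx : cvgn x.
  apply/cvg_ex; exists (limn y + 0).
  rewrite (_ : x = y \+ (fun n => M / n.+1%:R)); first exact: cvgD.
  by apply/funext => n; rewrite /y /= subrK.
split => // N.
have : (fun k => `|x (N + k)%N - x N|) @ \oo --> `|limn x - x N|.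
  apply: cvg_norm; apply: cvgB; last exact: cvg_cst.
  rewrite (_ : (fun k => x (N + k)%N) = (fun k => x (k + N)%N)); last by apply/funext => k; rewrite addnC.
  by rewrite cvg_shiftn.
by move/cvgr_to_le; apply; near=> k; exact: up'.
Unshelve. all: by end_near.
Qed.

(** Stated for an arbitrary filter, to serve both for neighbourhoods of interior points and for
    their traces on the closed domain at boundary points. *)
Lemma uniform_limit {T : Type} (F : set_system T) {FF : Filter F} (f : T -> R)
    (s : nat -> T -> R) (l : nat -> R) (L M : R) :
  (forall N, s N @ F --> l N) -> (\forall v \near F, forall N, `|f v - s N v| <= M / N.+1%:R) ->
  (forall N, `|L - l N| <= M / N.+1%:R) -> f @ F --> L.
Proof.
move=> sl fs Ll.
suff h : forall e : R, 0 < e -> \forall v \near F, `|L - f v| <= e by apply/cvgrPdist_le.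
move=> e e0.
have M0 : 0 <= M by have := Ll 0; rewrite divr1; exact: le_trans (normr_ge0 _).
have e3 : 0 < e / 3 by rewrite divr_gt0.
have h0 : 0 <= M / (e / 3) by rewrite divr_ge0// ltW.
have [N hN] : exists N, M / N.+1%:R <= e / 3.
  exists (Num.bound (M / (e / 3))); rewrite ler_pdivrMr ?ltr0n//.
  have := archi_boundP h0; rewrite ltr_pdivrMr// => /ltW h1.
  by apply: (le_trans h1); rewrite mulrC; apply: ler_wpM2l; [exact: ltW|rewrite ler_nat].
have h2 : \forall v \near F, `|l N - s N v| <= e / 3.
  by have /cvgrPdist_le := sl N; apply.
near=> v; have h3 : `|f v - s N v| <= M / N.+1%:R by near: v; apply: filterS fs.
have h4 : `|l N - s N v| <= e / 3 by near: v.
rewrite (_ : L - f v = (L - l N) + (l N - s N v) - (f v - s N v)); last by ring.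
rewrite (le_trans (ler_normB _ _))//; have := ler_normD (L - l N) (l N - s N v).
have := le_trans (Ll N) hN; have := le_trans h3 hN; lra.
Unshelve. all: by end_near.
Qed.

Lemma mvt0 (f df : R -> R) (d t : R) : (forall x : R, `|x| < d -> is_derive x 1 f (df x)) -> `|t| < d ->
  exists2 c : R, `|c| <= `|t| & f t - f 0 = df c * t.
Proof.
move=> fd td.
have key (a b : R) : a <= b -> (forall x : R, a <= x <= b -> `|x| < d) ->
    exists2 c, c \in `[a, b]%R & f b - f a = df c * (b - a).
  move=> ab h; apply: MVT_segment => //.
    by move=> x; rewrite in_itv/= => /andP[/ltW h1 /ltW h2]; apply: fd; apply: h; rewrite h1.
  apply: derivable_within_continuous => x; rewrite in_itv/= => /h /fd xd; exact: ex_derive.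
have [t0|t0] := leP 0 t.
  have [x /andP[x0 xt]|c] := key 0 t t0.
    by rewrite (le_lt_trans _ td)// !ger0_norm.
  rewrite in_itv/= subr0 => /andP[c0 ct] e; exists c => //.
  by rewrite !ger0_norm.
have [x /andP[x0 xt]|c] := key t 0 (ltW t0).
  by rewrite (le_lt_trans _ td)// (ler0_norm xt) (ltr0_norm t0) lerN2.
rewrite in_itv/= sub0r => /andP[c0 ct] e; exists c; first by rewrite (ler0_norm ct) (ltr0_norm t0) lerN2.
by rewrite -opprB e; ring.
Qed.

(** The mean value theorem twice. The constant is not the optimal one, but any quadratic remainder
    will do for [is_derive_quadratic]. *)
Lemma taylor2 (f f1 f2 : R -> R) (d t M : R) :
  (forall x : R, `|x| < d -> is_derive x 1 f (f1 x)) ->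
  (forall x : R, `|x| < d -> is_derive x 1 f1 (f2 x)) ->
  (forall x : R, `|x| < d -> `|f2 x| <= M) -> `|t| < d ->
  `|f t - f 0 - t * f1 0| <= M * t ^+ 2.
Proof.
move=> h1 h2 hM td; have [c ct e] := mvt0 h1 td.
have [b bc e2] := mvt0 h2 (le_lt_trans ct td).
rewrite (_ : f t - f 0 - t * f1 0 = f2 b * (c * t)); last first.
  by rewrite e mulrA -e2; ring.
have M0 := hM b (le_lt_trans (le_trans bc ct) td).
rewrite normrM normrM -(real_normK (num_real t)) expr2; apply: ler_pM => //.
by rewrite ler_wpM2r.
Qed.

(** With [s = (r + 1) / 2], one factor [n.+1] is absorbed by [(r / s)^n], as their product is at
    most a geometric sum; the remaining ones are left to the induction at the ratio [s < 1]. *)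
Lemma poly_geom_bounded (k : nat) (r : R) : 0 < r < 1 -> exists M, forall n, n.+1%:R ^+ k * r ^+ n <= M.
Proof.
elim: k r => [|k IH] r /andP[r0 r1].
  by exists 1 => n; rewrite expr0 mul1r exprn_ile1// ltW.
pose s := (r + 1) / 2; have s0 : 0 < s by rewrite /s; lra.
have [M hM] : exists M, forall n, n.+1%:R ^+ k * s ^+ n <= M by apply: IH; rewrite /s; lra.
have q0 : 0 <= r / s by rewrite divr_ge0 ?ltW.
have q1 : r / s < 1 by rewrite ltr_pdivrMr// mul1r /s; lra.
have geo n : n.+1%:R * (r / s) ^+ n <= (1 - r / s)^-1.
  rewrite -[X in _ <= X]mul1r ler_pdivlMr ?subr_gt0//.
  have h : n.+1%:R * (r / s) ^+ n <= \sum_(i < n.+1) (r / s) ^+ i.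
    rewrite -[n.+1 in X in X * _]card_ord -sumr_const mulr_suml; apply: ler_sum => i _.
    by rewrite mul1r; apply: ler_wiXn2l => //; [exact: ltW|rewrite -ltnS].
  have := ler_wpM2r (_ : 0 <= 1 - r / s) h; rewrite subr_ge0 ltW// => /(_ isT) h'.
  apply: (le_trans h'); rewrite mulrC -opprB mulNr -subrX1 opprB gerBl exprn_ge0//.
exists (M * (1 - r / s)^-1) => n.
have -> : n.+1%:R ^+ k.+1 * r ^+ n = (n.+1%:R ^+ k * s ^+ n) * (n.+1%:R * (r / s) ^+ n).
  rewrite exprS -[in LHS](divfK (lt0r_neq0 s0) r) exprMn; ring.
apply: ler_pM => //; first by rewrite mulr_ge0 ?exprn_ge0// ltW.
by rewrite mulr_ge0 ?exprn_ge0.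
Qed.

End LimitLemmas.

(** * Series of monomials and their formal derivatives *)

Section Series.
Context {R : realType}.
Local Notation C := R[i].
Local Notation Cfun := (C2 R -> C).
Local Notation H := (@hartogs R).
Implicit Types (f g : Cfun) (w v : C2 R) (c : nat -> nat -> C) (rho eps : R).

(** The falling factorial of an integer, possibly negative: the coefficient of the [q]-th derivative
    of a power with exponent [b]. *)
Definition ffz (b : int) (q : nat) : C := \prod_(i < q) (b - i%:Z)%:~R.

(* [tm a m p q] is the derivative of order [p] in [w1] and [q] in [w2] of the monomial [Em a m]. *)
Definition tm (a m p q : nat) w : C := (a ^_ p)%:R * ffz (m%:Z - 1 - a%:Z) q *
  (w1 w ^+ (a - p) * w2 w ^ (m%:Z - 1 - a%:Z - q%:Z)).

(** The double series is grouped by total degree [a + m = n], which turns it into an ordinary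
    sequence of partial sums. *)
Definition layer c p q n w : C := \sum_(a < n.+1) c a (n - a)%N * tm a (n - a) p q w.
Definition ser c p q N w : C := \sum_(n < N) layer c p q n w.

Lemma tm00 a m w : tm a m 0 0 w = Em a m w.
Proof. by rewrite /tm /ffz big_ord0 ffactn0 !mul1r subn0 subr0. Qed.

Lemma wderX f w (e : 'I_4 -> C) n : wder f w e ->
  wder (fun w => f w ^+ n) w (fun k => n%:R * f w ^+ n.-1 * e k).
Proof.
move=> df; elim: n => [|n IH].
  rewrite (_ : (fun k : 'I_4 => _) = fun=> 0); first exact: (wder_cst 1 w).
  by apply/funext => k; rewrite !mul0r.
have := wderM df IH; rewrite (_ : (fun w => f w * f w ^+ n) = (fun w => f w ^+ n.+1)); last first.
  by apply/funext => v; rewrite exprS.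
congr wder; apply/funext => k; case: n {IH} => [|n] /=; first by rewrite !expr0; ring.
by rewrite -[n.+2%:R]natr1 exprS; ring.
Qed.

Lemma wderZ (k : C) f w e : wder f w e -> wder (fun w => k * f w) w (fun j => k * e j).
Proof.
move=> df; have := wderM (wder_cst k w) df; congr wder; apply/funext => j.
by rewrite mul0r addr0.
Qed.

Lemma wder_sum (n : nat) (F : 'I_n -> Cfun) w (e : 'I_n -> 'I_4 -> C) :
  (forall i, wder (F i) w (e i)) ->
  wder (fun w => \sum_(i < n) F i w) w (fun k => \sum_(i < n) e i k).
Proof.
elim: n F e => [|n IH] F e h.
  have := wder_cst (0 : C) w; congr wder; apply/funext => x; by rewrite big_ord0.
have := wderD (IH (fun i => F (widen_ord (leqnSn n) i)) (fun i => e (widen_ord (leqnSn n) i)) (fun i => h _)) (h ord_max).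
by congr wder; apply/funext => x; rewrite big_ord_recr.
Qed.

(** The four Wirtinger derivatives of a function that satisfies the Cauchy-Riemann equations. *)
Definition dsum (x y : C) : 'I_4 -> C := fun k => dlt 0 k * x + dlt 2 k * y.

Lemma wder_tm a m p q w : w2 w != 0 -> wder (tm a m p q) w (dsum (tm a m p.+1 q w) (tm a m p q.+1 w)).
Proof.
move=> w20; have h := wderZ ((a ^_ p)%:R * ffz (m%:Z - 1 - a%:Z) q)
  (wderM (wderX (a - p) (wder_w1 w)) (wderXz (m%:Z - 1 - a%:Z - q%:Z) w20 (wder_w2 w))).
move: h; congr wder; apply/funext => k; rewrite /dsum /tm ffactnSr natrM /ffz big_ord_recr /=.
have -> : m%:Z - 1 - a%:Z - q.+1%:Z = m%:Z - 1 - a%:Z - q%:Z - 1 by rewrite -addn1 PoszD; ring.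
by rewrite subnS; ring.
Qed.

Lemma wder_layer c p q n w : w2 w != 0 ->
  wder (layer c p q n) w (dsum (layer c p.+1 q n w) (layer c p q.+1 n w)).
Proof.
move=> w20; have := wder_sum (fun a : 'I_n.+1 => wderZ (c a (n - a)%N) (wder_tm a (n - a) p q w20)).
congr wder; apply/funext => k; rewrite /dsum /layer !mulr_sumr -big_split /=.
by apply: eq_bigr => a _; ring.
Qed.

Lemma wder_ser c p q N w : w2 w != 0 ->
  wder (ser c p q N) w (dsum (ser c p.+1 q N w) (ser c p q.+1 N w)).
Proof.
move=> w20; have := wder_sum (fun n : 'I_N => wder_layer c p q n w20).
congr wder; apply/funext => k; rewrite /dsum /ser !mulr_sumr -big_split /=.
by apply: eq_bigr => a _.
Qed.

(** Here [|Em a m|] is at most [rho ^ (a + m)] up to a constant depending on [eps]. With [rho < 1]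
    such sets are neighbourhoods of interior points; with [rho = 1] they cover the closed domain
    away from the origin. *)
Definition region rho eps : set (C2 R) :=
  [set w | normc (w1 w) <= rho * normc (w2 w) /\ eps <= normc (w2 w) <= rho].

(** For [rho = 1] this is rapid decrease; for [rho < 1] polynomial growth already implies it. One
    theory of convergence thus covers the interior and the boundary. *)
Definition rapid c rho := forall j, exists M : R, forall a m : nat,
  normc (c a m) * rho ^+ (a + m) * (a + m).+1%:R ^+ j <= M.

Lemma ffz_bound a m q : normc (ffz (m%:Z - 1 - a%:Z) q) <= (q.+1%:R * (a + m).+1%:R) ^+ q.
Proof.
rewrite /ffz; suff h k : (k <= q)%N -> normc (\prod_(i < k) (m%:Z - 1 - a%:Z - i%:Z)%:~R : C) <= (q.+1%:R * (a + m).+1%:R) ^+ k.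
  exact: h.
elim: k => [|k IH] kq; first by rewrite big_ord0 normc1.
rewrite big_ord_recr normcM exprSr; apply: ler_pM; rewrite ?normc_ge0 ?IH//; first exact: ltnW.
have -> : normc ((m%:Z - 1 - a%:Z - k%:Z)%:~R : C) = `|(m%:Z - 1 - a%:Z - k%:Z)%:~R| :> R.
  by rewrite -normc_real rmorph_int.
rewrite !rmorphB /= -!pmulrn -!natr1 natrD.
have := ler0n R a; have := ler0n R m; have := ler0n R k.
have : (k.+1%:R : R) <= q%:R by rewrite ler_nat.
rewrite -natr1; move: (a%:R) (m%:R) (k%:R) (q%:R) => x y z t h z0 y0 x0.
have := mulr_ge0 (_ : 0 <= t) (addr_ge0 x0 y0); move=> /(_ ltac:(lra)) h2.
by rewrite ler_norml; apply/andP; split; lra.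
Qed.

Lemma ffact_bound (a p : nat) : (a ^_ p <= a ^ p)%N.
Proof. by elim: p => [|p IH] //; rewrite ffactnSr expnSr leq_mul// leq_subr. Qed.

(** Using [|w1| <= rho |w2|] leaves [|w2|^(m - 1 - p - q)], which is at most
    [rho^m / eps^(p + q + 1)]; the factor [rho^-p] completes [rho^(a - p)], and the two falling
    factorials cost [(a + m + 1)^(p + q)]. *)
Lemma tm_bound p q rho eps : 0 < rho -> rho <= 1 -> 0 < eps -> exists2 K : R, 0 <= K &
  forall a m w, region rho eps w ->
  normc (tm a m p q w) <= K * ((a + m).+1%:R ^+ (p + q) * rho ^+ (a + m)).
Proof.
move=> r0 r1 e0; exists (q.+1%:R ^+ q * rho ^- p * eps ^- (p + q).+1).
  by rewrite !mulr_ge0 ?invr_ge0 ?exprn_ge0 ?ler0n// ltW.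
move=> a m w [h1 /andP[h2 h3]].
have w20 : 0 < normc (w2 w) by exact: lt_le_trans h2.
have n1 := normc_ge0 (w1 w).
have rhs0 : 0 <= q.+1%:R ^+ q * rho ^- p * eps ^- (p + q).+1 * ((a + m).+1%:R ^+ (p + q) * rho ^+ (a + m)).
  by rewrite !mulr_ge0 ?invr_ge0 ?exprn_ge0 ?ler0n// ltW.
have [ap|pa] := ltnP a p; first by rewrite /tm ffact_small// !mul0r normc0.
have f1 : normc ((a ^_ p)%:R : C) <= (a + m).+1%:R ^+ p.
  rewrite -(rmorph_nat (@real_complex R)) normc_real normr_nat -natrX ler_nat.
  rewrite (leq_trans (ffact_bound a p))//; case: (p) => // p'.
  by rewrite leq_exp2r// leqW// leq_addr.
have f2 := ffz_bound a m q.
have f3 : normc (w1 w ^+ (a - p) * w2 w ^ (m%:Z - 1 - a%:Z - q%:Z)) <=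
    rho ^+ (a - p) * (rho ^+ m * eps ^- (p + q).+1).
  rewrite normcM normcX normcXz; move: (normc (w1 w)) (normc (w2 w)) h1 h2 h3 w20 n1 => x y h1 h2 h3 y0 x0.
  have e1 : x ^+ (a - p) <= rho ^+ (a - p) * y ^+ (a - p).
    by rewrite -exprMn; apply: lerXn2r; rewrite ?nnegrE// mulr_ge0 ?ltW.
  have yz : 0 <= y ^ (m%:Z - 1 - a%:Z - q%:Z) by apply: exprz_ge0; exact: ltW.
  apply: (le_trans (ler_wpM2r yz e1)); rewrite -mulrA ler_wpM2l ?exprn_ge0 ?(ltW r0)//.
  have -> : y ^+ (a - p) * y ^ (m%:Z - 1 - a%:Z - q%:Z) = y ^+ m * y ^- (p + q).+1.
    rewrite -[y ^+ (a - p)]/(y ^ (a - p)%:Z) -expfzDr ?gt_eqF// -[y ^+ m]/(y ^ m%:Z).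
    rewrite -[y ^- _]/((y ^ (p + q).+1%:Z)^-1) invr_expz -expfzDr ?gt_eqF//; congr (_ ^ _).
    by rewrite -subzn// -addn1 !PoszD; ring.
  apply: ler_pM; rewrite ?invr_ge0 ?exprn_ge0 ?(ltW y0)//.
    by apply: lerXn2r; rewrite ?nnegrE ?(ltW y0) ?(ltW r0).
  rewrite lef_pV2 ?posrE ?exprn_gt0//; apply: lerXn2r; rewrite ?nnegrE ?(ltW y0) ?(ltW e0)//.
rewrite /tm 2!normcM.
have g1 : normc ((a ^_ p)%:R : C) * normc (ffz (m%:Z - 1 - a%:Z) q) <=
    (a + m).+1%:R ^+ p * (q.+1%:R * (a + m).+1%:R) ^+ q.
  by apply: ler_pM => //; exact: normc_ge0.
have g2 := ler_pM (mulr_ge0 (normc_ge0 _) (normc_ge0 _)) (normc_ge0 _) g1 f3.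
apply: (le_trans g2); rewrite le_eqVlt; apply/orP; left; apply/eqP.
have rE : rho ^+ (a + m) = rho ^+ (a - p) * rho ^+ p * rho ^+ m by rewrite -!exprD subnK.
rewrite rE exprMn exprD.
by field; rewrite !gt_eqF// exprn_gt0.
Qed.

Lemma layer_bound c p q rho eps : 0 < rho -> rho <= 1 -> 0 < eps -> rapid c rho ->
  exists2 M : R, 0 <= M & forall n w, region rho eps w ->
  normc (layer c p q n w) <= M * (n.+1%:R^-1 - n.+2%:R^-1).
Proof.
move=> r0 r1 e0 rc; have [K K0 hK] := tm_bound p q r0 r1 e0.
(* Three powers beyond those lost in [tm_bound]: one for the [n.+1] terms of the layer, two to stay
   below the telescoping difference, which is [1 / ((n + 1) (n + 2))]. *)
have [M hM] := rc (p + q + 3)%N.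
have M0 : 0 <= M.
  have := hM 0 0; rewrite addn0 expr0 mulr1 expr1n mulr1; exact: le_trans (normc_ge0 _).
exists (2 * K * M); first by rewrite !mulr_ge0.
move=> n w rw; rewrite /layer; apply: (le_trans (normc_sum _ _ _)).
have h (a : 'I_n.+1) : normc (c a (n - a)%N * tm a (n - a) p q w) <= K * M * (n.+1%:R ^+ 3)^-1.
  have an : (a + (n - a) = n)%N by rewrite subnKC// -ltnS.
  have h1 := hK a (n - a)%N w rw; have h2 := hM a (n - a)%N; rewrite an in h1 h2.
  rewrite normcM; apply: (le_trans (ler_wpM2l (normc_ge0 _) h1)).
  rewrite ler_pdivlMr ?exprn_gt0//.
  rewrite [X in X <= _](_ : _ = K * (normc (c a (n - a)%N) * rho ^+ n * n.+1%:R ^+ (p + q + 3))); last first.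
    by rewrite [in RHS]exprD; ring.
  by rewrite ler_wpM2l.
apply: (le_trans (ler_sum _ (fun i _ => h i))).
rewrite sumr_const card_ord -(mulr_natl (K * M / n.+1%:R ^+ 3) n.+1).
have n0 : 0 < n.+1%:R :> R by [].
have n2 : n.+2%:R = n.+1%:R + 1 :> R by rewrite natr1.
have x1 : 1 <= n.+1%:R :> R by rewrite ler1n.
rewrite n2; move: (n.+1%:R : R) n0 x1 => x x0 x1.
have KM : 0 <= K * M by rewrite mulr_ge0.
have -> : x^-1 - (x + 1)^-1 = (x * (x + 1))^-1 by field; rewrite !gt_eqF//; lra.
rewrite (_ : x * _ = K * M * (x ^+ 2)^-1); last by field; rewrite gt_eqF.
rewrite (_ : 2 * K * M * _ = K * M * (2 * (x * (x + 1))^-1)); last by ring.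
rewrite ler_wpM2l// ler_pdivlMr ?mulr_gt0//; last by lra.
rewrite (_ : _ * _ = 1 + x^-1); last by field; rewrite gt_eqF.
by have : x^-1 <= 1 by [rewrite invf_le1]; lra.
Qed.

(* The derivative of order [p] in [w1] and [q] in [w2] of the sum of [c a m * Em a m]. *)
Definition hser c p q w : C :=
  limn (fun N => Re (ser c p q N w)) +i* limn (fun N => Im (ser c p q N w)).

Lemma hser_approx c p q rho eps : 0 < rho -> rho <= 1 -> 0 < eps -> rapid c rho ->
  exists2 M : R, 0 <= M & forall N w, region rho eps w ->
  `|Re (hser c p q w) - Re (ser c p q N w)| <= M / N.+1%:R /\
  `|Im (hser c p q w) - Im (ser c p q N w)| <= M / N.+1%:R.
Proof.
move=> r0 r1 e0 rc; have [M M0 hM] := layer_bound p q r0 r1 e0 rc.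
exists M => // N w rw; split.
  apply: (telescoping_cvg _).2 => n.
  rewrite /ser big_ord_recr ReD addrC addKr.
  exact: le_trans (normRe_le _) (hM n w rw).
apply: (telescoping_cvg _).2 => n.
rewrite /ser big_ord_recr ImD addrC addKr.
exact: le_trans (normIm_le _) (hM n w rw).
Qed.

Lemma hser_normc c p q rho eps : 0 < rho -> rho <= 1 -> 0 < eps -> rapid c rho ->
  exists2 M : R, 0 <= M & forall N w, region rho eps w ->
  normc (hser c p q w - ser c p q N w) <= M / N.+1%:R.
Proof.
move=> r0 r1 e0 rc; have [M M0 hM] := hser_approx p q r0 r1 e0 rc.
exists (2 * M); first by rewrite mulr_ge0.
move=> N w rw; have [h1 h2] := hM N w rw; apply: (le_trans (normc_le _)).
by rewrite !ReImE -mulrA mulr_natl mulr2n lerD.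
Qed.

Lemma ser_bound c p q rho eps : 0 < rho -> rho <= 1 -> 0 < eps -> rapid c rho ->
  exists2 M : R, 0 <= M & forall N w, region rho eps w -> normc (ser c p q N w) <= M.
Proof.
move=> r0 r1 e0 rc; have [M M0 hM] := layer_bound p q r0 r1 e0 rc.
exists M => // N w rw; apply: (le_trans (normc_sum _ _ _)).
apply: (@le_trans _ _ (M * (1 - N.+1%:R^-1))); last by rewrite ler_piMr// gerBl invr_ge0.
elim: N => [|N IH]; first by rewrite big_ord0 invr1 subrr mulr0.
rewrite big_ord_recr; apply: (le_trans (lerD IH (hM N w rw))).
by rewrite -mulrDr le_eqVlt; apply/orP; left; apply/eqP; ring.
Qed.

Lemma hser_cvg c p q rho eps (F : set_system (C2 R)) {FF : Filter F} w : 0 < rho -> rho <= 1 -> 0 < eps -> rapid c rho ->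
  region rho eps w -> (\forall v \near F, region rho eps v) ->
  (forall N, (Re \o ser c p q N) @ F --> Re (ser c p q N w)) ->
  (forall N, (Im \o ser c p q N) @ F --> Im (ser c p q N w)) ->
  (Re \o hser c p q) @ F --> Re (hser c p q w) /\ (Im \o hser c p q) @ F --> Im (hser c p q w).
Proof.
move=> r0 r1 e0 rc rw rF sr si; have [M M0 hM] := hser_approx p q r0 r1 e0 rc.
split.
  apply: (uniform_limit (M := M) sr); last by move=> N; exact: (hM N w rw).1.
  by apply: filterS rF => v rv N; exact: (hM N v rv).1.
apply: (uniform_limit (M := M) si); last by move=> N; exact: (hM N w rw).2.
by apply: filterS rF => v rv N; exact: (hM N v rv).2.
Qed.

Lemma region_w2 rho eps w : 0 < eps -> region rho eps w -> w2 w != 0.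
Proof. by move=> e0 [_ /andP[h _]]; rewrite -normc_eq0 gt_eqF// (lt_le_trans e0). Qed.

Lemma hser_continuous c p q rho eps w : 0 < rho -> rho <= 1 -> 0 < eps -> rapid c rho ->
  (\forall v \near w, region rho eps v) -> ccontinuous_at (hser c p q) w.
Proof.
move=> r0 r1 e0 rc rn; have rw := nbhs_singleton rn.
have cs N : ccontinuous_at (ser c p q N) w.
  by case: (wder_ser c p q N (region_w2 e0 rw)).
have [h1 h2] := hser_cvg r0 r1 e0 rc rw rn (fun N => (cs N).1) (fun N => (cs N).2).
by split.
Qed.

(** Taylor's formula for the partial sums has a remainder [M2 * t^2] independent of [N], thanks to
    the uniform bound on second derivatives. It survives the limit in [N], and a quadratic remainder
    gives the derivative. *)
Lemma is_derive_limit (F : C2 R -> R) (s s1 s2 : nat -> C2 R -> R) w v (L M1 M2 d : R) : 0 < d ->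
  (forall N (t : R), `|t| < d -> is_derive (t *: v + w) v (s N) (s1 N (t *: v + w))) ->
  (forall N (t : R), `|t| < d -> is_derive (t *: v + w) v (s1 N) (s2 N (t *: v + w))) ->
  (forall N (t : R), `|t| < d -> `|s2 N (t *: v + w)| <= M2) ->
  (forall N (t : R), `|t| < d -> `|F (t *: v + w) - s N (t *: v + w)| <= M1 / N.+1%:R) ->
  (forall N, `|L - s1 N w| <= M1 / N.+1%:R) ->
  is_derive w v F L.
Proof.
move=> d0 h1 h2 hM hF hL; apply: (@is_derive_quadratic _ _ _ _ _ _ d M2) => // t td.
have d00 : `|0 : R| < d by rewrite normr0.
have w00 : 0 *: v + w = w by rewrite scale0r add0r.
have tE N : `|s N (t *: v + w) - s N w - t * s1 N w| <= M2 * t ^+ 2.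
  have line (f f1 : C2 R -> R) (x : R) : is_derive (x *: v + w) v f (f1 (x *: v + w)) ->
      is_derive x 1 (fun y : R => f (y *: v + w)) (f1 (x *: v + w)).
    move=> fd; apply: (@is_derive_line _ (fun y : R => y *: v + w) v x f) fd => y.
    by rewrite scalerBl addrA subrK.
  have := @taylor2 _ (fun y : R => s N (y *: v + w)) (fun y : R => s1 N (y *: v + w))
    (fun y : R => s2 N (y *: v + w)) d t M2.
  by rewrite w00; apply => // x xd; [exact/line/h1|exact/line/h2|exact: hM].
have M10 : 0 <= M1 by have := hL 0; rewrite divr1; exact: le_trans (normr_ge0 _).
have bd N : `|F (t *: v + w) - F w - t * L| <= M2 * t ^+ 2 + M1 * (2 + `|t|) / N.+1%:R.
  have a1 := hF N t td; have a2 := hF N 0 d00; rewrite w00 in a2.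
  have a3 : `|t * (L - s1 N w)| <= `|t| * (M1 / N.+1%:R) by rewrite normrM ler_wpM2l.
  rewrite (_ : F (t *: v + w) - F w - t * L = (F (t *: v + w) - s N (t *: v + w)) - (F w - s N w)
     - t * (L - s1 N w) + (s N (t *: v + w) - s N w - t * s1 N w)); last by ring.
  rewrite (_ : M1 * (2 + `|t|) / N.+1%:R = M1 / N.+1%:R + M1 / N.+1%:R + `|t| * (M1 / N.+1%:R)); last by ring.
  move: (M1 / N.+1%:R) a1 a2 a3 => e a1 a2 a3.
  apply: (le_trans (ler_normD _ _)); rewrite addrC lerD//.
  apply: (le_trans (ler_normB _ _)); apply: lerD => //.
  by apply: (le_trans (ler_normB _ _)); apply: lerD.
have lim : (fun N => M2 * t ^+ 2 + M1 * (2 + `|t|) / N.+1%:R) @ \oo --> M2 * t ^+ 2 + M1 * (2 + `|t|) * 0.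
  by apply: cvgD; [exact: cvg_cst|apply: cvgM; [exact: cvg_cst|exact: cvg_harmonic]].
rewrite mulr0 addr0 in lim.
by have := cvgr_to_ge lim; apply; near=> N; exact: bd.
Unshelve. all: by end_near.
Qed.

End Series.

(** * Differentiability and holomorphy of the sums *)

Section HolomorphicSeries.
Context {R : realType}.
Local Notation C := R[i].
Local Notation Cfun := (C2 R -> C).
Local Notation H := (@hartogs R).
Implicit Types (f g h : Cfun) (w v : C2 R) (c : nat -> nat -> C) (rho eps : R).
Let mH := @measurable_hartogs R.

Lemma rb_dsum j (x y : C) : rb j (dsum x y) = rb j (dlt 0) * x + rb j (dlt 2) * y.
Proof.
rewrite /dsum rbD; congr (_ + _); rewrite mulrC -rbZ; congr (rb j _); apply/funext => k; exact: mulrC.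
Qed.

Lemma normc_comb (x y u v X Y : R[i]) (e1 e2 : R) : normc x <= e1 -> normc y <= e2 ->
  normc (u * x + v * y) <= normc u * e1 + normc v * e2.
Proof.
move=> h1 h2; apply: (le_trans (normcD _ _)); rewrite !normcM.
by apply: lerD; rewrite ler_wpM2l ?normc_ge0.
Qed.

Lemma near_line (P : set (C2 R)) w j : nbhs w P -> exists2 d : R, 0 < d &
  forall t : R, `|t| < d -> P (t *: real_basis j + w).
Proof.
move=> /nbhs_C2[d d0 hd]; exists d => // t td; apply: hd.
have k (x y z : R) : `|x| <= 1 -> `|t * x + y - y| < d.
  by move=> x1; rewrite addrK normrM (le_lt_trans _ td)// ler_piMr.
have o : `|1 : R| <= 1 by rewrite normr1.
have z : `|0 : R| <= 1 by rewrite normr0.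
by elim/rbP: j; split; apply: k.
Qed.

(** Termwise differentiation along each real basis vector by [is_derive_limit]; [D] and [D2] are the
    first and second derivatives of the partial sums in that direction, bounded through the pure and
    mixed derivatives of order two. *)
Lemma hser_wder c p q rho eps w : 0 < rho -> rho <= 1 -> 0 < eps -> rapid c rho ->
  (\forall v \near w, region rho eps v) ->
  wder (hser c p q) w (dsum (hser c p.+1 q w) (hser c p q.+1 w)).
Proof.
move=> r0 r1 e0 rc rn; split; first exact: hser_continuous rn.
move=> j; rewrite rb_dsum; set al := rb j (dlt 0); set be := rb j (dlt 2).
have [d d0 hd] := near_line j rn.
pose D p q N v := al * ser c p.+1 q N v + be * ser c p q.+1 N v.
have dser p' q' N v : region rho eps v -> cis_derive v (real_basis j) (ser c p' q' N) (D p' q' N v).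
  by move=> rv; have [_ /(_ j)] := wder_ser c p' q' N (region_w2 e0 rv); rewrite rb_dsum.
pose D2 N v := al * D p.+1 q N v + be * D p q.+1 N v.
have dD N v : region rho eps v -> cis_derive v (real_basis j) (D p q N) (D2 N v).
  move=> rv; have h1 := cis_deriveM (cis_derive_cst v (real_basis j) al) (dser p.+1 q N v rv).
  have h2 := cis_deriveM (cis_derive_cst v (real_basis j) be) (dser p q.+1 N v rv).
  by have := cis_deriveD h1 h2; rewrite !mul0r !addr0.
have [Ma _ hMa] := ser_bound p.+2 q r0 r1 e0 rc.
have [Mb _ hMb] := ser_bound p.+1 q.+1 r0 r1 e0 rc.
have [Mc _ hMc] := ser_bound p q.+2 r0 r1 e0 rc.
have [Md Md0 hMd] := hser_approx p q r0 r1 e0 rc.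
have [Me Me0 hMe] := hser_normc p.+1 q r0 r1 e0 rc.
have [Mf Mf0 hMf] := hser_normc p q.+1 r0 r1 e0 rc.
set M2 := normc al * (normc al * Ma + normc be * Mb) + normc be * (normc al * Mb + normc be * Mc).
have bD2 N v : region rho eps v -> normc (D2 N v) <= M2.
  by move=> rv; apply: normc_comb => //; apply: normc_comb => //; [exact: hMa|exact: hMb|exact: hMb|exact: hMc].
pose L := al * hser c p.+1 q w + be * hser c p q.+1 w.
pose M1 := Md + (normc al * Me + normc be * Mf).
have bL N : normc (L - D p q N w) <= (normc al * Me + normc be * Mf) / N.+1%:R.
  rewrite (_ : L - _ = al * (hser c p.+1 q w - ser c p.+1 q N w) + be * (hser c p q.+1 w - ser c p q.+1 N w)); last first.
    by rewrite /L /D; ring.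
  rewrite mulrDl -!mulrA; apply: normc_comb => //; [exact: hMe (nbhs_singleton rn)|exact: hMf (nbhs_singleton rn)].
have x0 : 0 <= normc al * Me + normc be * Mf by rewrite addr_ge0 ?mulr_ge0 ?normc_ge0.
have b1 N : Md / N.+1%:R <= M1 / N.+1%:R by rewrite ler_wpM2r ?invr_ge0 // lerDl.
have b2 N : (normc al * Me + normc be * Mf) / N.+1%:R <= M1 / N.+1%:R by rewrite ler_wpM2r ?invr_ge0 // lerDr.
split.
  apply: (@is_derive_limit _ _ (fun N v => Re (ser c p q N v)) (fun N v => Re (D p q N v)) (fun N v => Re (D2 N v)) _ _ _ M1 M2 d d0).
  - by move=> N t td; have [] := dser p q N _ (hd t td).
  - by move=> N t td; have [] := dD N _ (hd t td).
  - by move=> N t td; apply: le_trans (normRe_le _) (bD2 N _ (hd t td)).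
  - by move=> N t td; apply: le_trans (b1 N); exact: (hMd N _ (hd t td)).1.
  - by move=> N; rewrite -ReN -ReD; apply: le_trans (normRe_le _) (le_trans (bL N) (b2 N)).
apply: (@is_derive_limit _ _ (fun N v => Im (ser c p q N v)) (fun N v => Im (D p q N v)) (fun N v => Im (D2 N v)) _ _ _ M1 M2 d d0).
- by move=> N t td; have [] := dser p q N _ (hd t td).
- by move=> N t td; have [] := dD N _ (hd t td).
- by move=> N t td; apply: le_trans (normIm_le _) (bD2 N _ (hd t td)).
- by move=> N t td; apply: le_trans (b1 N); exact: (hMd N _ (hd t td)).2.
- by move=> N; rewrite -ImN -ImD; apply: le_trans (normIm_le _) (le_trans (bL N) (b2 N)).
Qed.

Lemma region_sqr rho eps w : 0 <= rho -> 0 <= eps -> normc (w1 w) ^+ 2 <= rho ^+ 2 * sig w ->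
  eps ^+ 2 <= sig w <= rho ^+ 2 -> region rho eps w.
Proof.
move=> r0 e0 h1 /andP[h2 h3]; split.
  by rewrite -ler_sqr ?nnegrE ?mulr_ge0 ?normc_ge0// exprMn.
by apply/andP; split; rewrite -ler_sqr ?nnegrE ?normc_ge0.
Qed.

Lemma hartogs_region w : H w -> exists rho eps,
  [/\ 0 < rho < 1, 0 < eps & \forall v \near w, region rho eps v].
Proof.
move=> /hartogsE[h1 h2]; have s0 : 0 < sig w by exact: le_lt_trans (sqr_ge0 _) h1.
pose b := Num.max (sig w) (normc (w1 w) ^+ 2 / sig w).
have b0 : 0 < b by rewrite lt_max s0.
have b1 : b < 1 by rewrite gt_max h2 ltr_pdivrMr// mul1r.
(* Then [rho^2 - b = ((1 - b) / 2)^2 > 0], so both [tau] and [sig] are strictly below [rho^2] at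
   [w], and nearby as well. *)
pose rho := (1 + b) / 2.
have r01 : 0 < rho < 1 by rewrite /rho; apply/andP; split; lra.
have rb : b < rho ^+ 2.
  have : 0 < (1 - b) ^+ 2 by rewrite exprn_gt0// subr_gt0.
  by rewrite /rho; lra.
have bs : sig w <= b by rewrite le_max lexx.
have bt : normc (w1 w) ^+ 2 <= b * sig w by rewrite -ler_pdivrMr// le_max lexx orbT.
pose eps := sig w / 2; have e0 : 0 < eps by rewrite divr_gt0.
have es : eps ^+ 2 < sig w by rewrite /eps; nra.
exists rho, eps; split => //.
have c1 : {for w, continuous (fun v => rho ^+ 2 * sig v - normc (w1 v) ^+ 2)}.
  apply: cvgB; first by apply: cvgM; [exact: cvg_cst|exact: continuous_sig].
  by apply: continuous_normc_sqr; case: (wder_w1 w).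
have p1 : 0 < rho ^+ 2 * sig w - normc (w1 w) ^+ 2 by nra.
have n1 : \forall v \near w, 0 < rho ^+ 2 * sig v - normc (w1 v) ^+ 2 by exact: (cvgr_gt _ c1 _ p1).
have n2 : \forall v \near w, sig v < rho ^+ 2 by exact: (cvgr_lt _ (@continuous_sig R w) _ (le_lt_trans bs rb)).
have n3 : \forall v \near w, eps ^+ 2 < sig v by exact: (cvgr_gt _ (@continuous_sig R w) _ es).
have /andP[r0 _] := r01.
near=> v; apply: region_sqr; [exact: ltW|exact: ltW| |].
  by rewrite -subr_ge0 ltW//; near: v.
by apply/andP; split; apply: ltW; near: v.
Unshelve. all: by end_near.
Qed.

(** The growth of the coefficients of a square-integrable function: by Cauchy-Schwarz their squares
    are at most a constant times [(a + 1) (m + 1)], the inverse of the squared norms of the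
    basis. *)
Definition polyb c := exists K : R, forall a m, normc (c a m) <= K * (a + m).+1%:R.

Lemma polyb_rapid c rho : polyb c -> 0 < rho < 1 -> rapid c rho.
Proof.
move=> [K hK] r01 j; have [M hM] := poly_geom_bounded j.+1 r01.
have K0 : 0 <= K by have := hK 0 0; rewrite mulr1; exact: le_trans (normc_ge0 _).
have /andP[r0 _] := r01.
exists (K * M) => a m.
apply: (@le_trans _ _ (K * ((a + m).+1%:R ^+ j.+1 * rho ^+ (a + m)))); last by rewrite ler_wpM2l.
rewrite (_ : K * _ = K * (a + m).+1%:R * rho ^+ (a + m) * (a + m).+1%:R ^+ j); last by rewrite exprS; ring.
by rewrite !ler_wpM2r ?exprn_ge0// ltW.
Qed.

Lemma polyb_wder c p q w : polyb c -> H w ->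
  wder (hser c p q) w (dsum (hser c p.+1 q w) (hser c p q.+1 w)).
Proof.
move=> pc /hartogs_region[rho [eps [r01 e0 rn]]]; have /andP[r0 r1] := r01.
exact: (hser_wder p q r0 (ltW r1) e0 (polyb_rapid pc r01) rn).
Qed.

Lemma polyb_cvg c p q w : polyb c -> H w -> (fun N => normc (ser c p q N w - hser c p q w)) @ \oo --> (0 : R).
Proof.
move=> pc /hartogs_region[rho [eps [r01 e0 rn]]]; have /andP[r0 r1] := r01.
have [M M0 hM] := hser_normc p q r0 (ltW r1) e0 (polyb_rapid pc r01).
apply: (@cvg0_le _ _ (fun N => M / N.+1%:R)).
  move=> N; apply/andP; split; first exact: normc_ge0.
  by rewrite -normcN opprB; exact: hM (nbhs_singleton rn).
by rewrite -(mulr0 M); apply: cvgM; [exact: cvg_cst|exact: cvg_harmonic].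
Qed.

Lemma wder_holomorphic Omega f (d : 'I_4 -> Cfun) : open Omega ->
  (forall w, Omega w -> wder f w (d^~ w)) -> (forall w j, Omega w -> ccontinuous_at (d j) w) ->
  (forall w, Omega w -> d 1 w = 0 /\ d 3 w = 0) -> holomorphic Omega f.
Proof.
move=> oO df cd d0; split; last first.
  move=> w Ow; have [z1 z3] := d0 w Ow; split.
    by rewrite -[dw1bar f w]/(Dj 1 f w) (wder_Dj 1 (df w Ow)).
  by rewrite -[dw2bar f w]/(Dj 3 f w) (wder_Dj 3 (df w Ow)).
move=> [|j [|k s]] // _ w Ow; split => //.
- by case: (df w Ow).
- by move=> _ j; apply: cis_derive_cderivable; case: (df w Ow) => _; exact.
apply: (@ccontinuous_near _ w (fun v => rb j (d^~ v))).
  near=> v; have Ov : Omega v by near: v; apply: open_nbhs_nbhs.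
  by rewrite /= (cis_derive_cderive ((df v Ov).2 j)).
have c1 k := cd w k Ow; have cm := ccontinuous_cst (-1 : C) w; have ci := ccontinuous_cst ('i : C) w.
have e (x y : C) : x - y = x + -1 * y by rewrite mulN1r.
elim/rbP: j; rewrite /rb /=.
- exact: ccontinuousD.
- under eq_fun do rewrite e.
  exact: ccontinuousM ci (ccontinuousD (c1 0) (ccontinuousM cm (c1 1))).
- exact: ccontinuousD.
- under eq_fun do rewrite e.
  exact: ccontinuousM ci (ccontinuousD (c1 2) (ccontinuousM cm (c1 3))).
Unshelve. all: by end_near.
Qed.

Lemma polyb_continuous c p q w : polyb c -> H w -> ccontinuous_at (hser c p q) w.
Proof. by move=> pc Hw; case: (polyb_wder p q pc Hw). Qed.

Lemma polyb_holomorphic c p q : polyb c -> holomorphic H (hser c p q).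
Proof.
move=> pc; apply: (wder_holomorphic (@open_hartogs R) (fun w Hw => polyb_wder p q pc Hw)).
  move=> w j Hw; rewrite /dsum; apply: ccontinuousD; apply: ccontinuousM;
    by [exact: ccontinuous_cst|exact: polyb_continuous].
by move=> w Hw; rewrite /dsum /dlt /= !mul0r addr0.
Qed.

End HolomorphicSeries.

(** * The Bergman projection as an orthogonal expansion *)

Section BergmanSeries.
Context {R : realType}.
Local Notation C := R[i].
Local Notation Cfun := (C2 R -> C).
Local Notation H := (@hartogs R).
Implicit Types (f g h : Cfun) (w v : C2 R) (c : nat -> nat -> C) (rho eps : R).
Let mH := @measurable_hartogs R.

(** Lists the index pairs degree by degree, so that partial sums become sums over duplicate-free
    lists, the form in which Pythagoras and Bessel are stated. *)
Definition lay (n : nat) : seq (nat * nat) := [seq (a, (n - a)%N) | a <- iota 0 n.+1].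
Definition idx (N k : nat) : seq (nat * nat) := flatten [seq lay n | n <- iota N k].
Definition Ei (i : nat * nat) : Cfun := Em i.1 i.2.

Lemma lay_sum n i : i \in lay n -> (i.1 + i.2 = n)%N.
Proof. by move=> /mapP[a]; rewrite mem_iota add0n ltnS => an -> /=; rewrite subnKC. Qed.

Lemma mem_lay a m : (a, m) \in lay (a + m).
Proof. by apply/mapP; exists a; rewrite ?mem_iota ?add0n ?ltnS ?leq_addr// addKn. Qed.

Lemma uniq_idx N k : uniq (idx N k).
Proof.
elim: k N => // k IH N; rewrite -[idx N k.+1]/(lay N ++ idx N.+1 k) cat_uniq IH andbT.
apply/andP; split; first by rewrite /lay map_inj_uniq ?iota_uniq// => x y [].
apply/hasPn => i /flattenP[s /mapP[n]]; rewrite mem_iota => /andP[Nn _] -> /lay_sum e.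
by apply/negP => /lay_sum; rewrite e => en; rewrite en ltnn in Nn.
Qed.

Lemma idx_cat N k : idx 0 (N + k) = idx 0 N ++ idx N k.
Proof. by rewrite /idx iotaD map_cat flatten_cat add0n. Qed.

Lemma ser_tm c p q N k w :
  ser c p q (N + k) w - ser c p q N w = \sum_(i <- idx N k) c i.1 i.2 * tm i.1 i.2 p q w.
Proof.
have l n : layer c p q n w = \sum_(i <- lay n) c i.1 i.2 * tm i.1 i.2 p q w.
  by rewrite /layer /lay big_map (_ : iota 0 n.+1 = index_iota 0 n.+1) ?big_mkord; last by rewrite /index_iota subn0.
elim: k N => [|k IH] N; first by rewrite addn0 subrr big_nil.
rewrite -[idx N k.+1]/(lay N ++ idx N.+1 k) big_cat /= -IH -l addnS -addSn.
have sN : ser c p q N.+1 w = ser c p q N w + layer c p q N w by rewrite /ser big_ord_recr.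
by rewrite sN; ring.
Qed.

Lemma ser_idx c N k w : ser c 0 0 (N + k) w - ser c 0 0 N w = \sum_(i <- idx N k) c i.1 i.2 * Ei i w.
Proof. by rewrite ser_tm; apply: eq_bigr => i _; rewrite tm00. Qed.

Lemma Ei_L2 i : L2 H (Ei i). Proof. exact: Em_L2. Qed.

Lemma Ei_orth i j : i != j -> L2inner H (Ei i) (Ei j) = 0.
Proof. by case: i j => [a m] [a' m'] ne; exact: Em_orth. Qed.

Lemma Ei_gt0 i : 0 < sqnorm H (Ei i).
Proof. by rewrite Em_sqn mulr_gt0 ?KH_gt0// mulr_gt0// invr_gt0. Qed.

Lemma ser_L2 c N : L2 H (ser c 0 0 N).
Proof.
have h := L2_sum mH (idx 0 N) (P := predT) (fun i _ => (L2Z mH (c i.1 i.2) (Ei_L2 i)).1).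
by apply: (eq_L2 _ h) => w _; rewrite -ser_idx add0n /ser [X in _ - X]big_ord0 subr0.
Qed.

Definition esum2 c N : R := \sum_(i <- idx 0 N) normc (c i.1 i.2) ^+ 2 * sqnorm H (Ei i).

(** The squared norm of a difference of partial sums is a difference of the bounded nondecreasing
    sequence [esum2 c]. Fatou, applied along the pointwise convergence, transfers this to the sum
    and to its remainders. *)
Lemma hser_L2 c (B : R) : polyb c -> (forall N, esum2 c N <= B) ->
  [/\ L2 H (hser c 0 0), sqnorm H (hser c 0 0) <= B &
   exists2 T : nat -> R, T @ \oo --> (0 : R) &
     forall N, sqnorm H (fun w => hser c 0 0 w - ser c 0 0 N w) <= T N].
Proof.
move=> pc hB; set h := hser c 0 0.
have mh : cmeasurable H h.
  by apply: (cmeasurable_continuous (@open_hartogs R)) => w Hw; exact: polyb_continuous.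
have tail N k : sqnorm H (fun w => ser c 0 0 (N + k) w - ser c 0 0 N w) = esum2 c (N + k) - esum2 c N.
  rewrite (@eq_sqn _ H _ (fun w => \sum_(i <- idx N k) c i.1 i.2 * Ei i w)) => [|w _]; last exact: ser_idx.
  rewrite (sqn_lincomb mH (uniq_idx N k) Ei_L2 Ei_orth (fun i => c i.1 i.2)).
  by rewrite /esum2 idx_cat big_cat /= addrAC subrr add0r.
have mono : {homo esum2 c : n m / (n <= m)%N >-> n <= m}.
  by move=> n m /subnKC <-; rewrite -subr_ge0 -tail sqn_ge0.
have ub : has_ubound (range (esum2 c)) by exists B => _ [n _ <-].
have cE := nondecreasing_is_cvgn mono ub.
have leE N : esum2 c N <= limn (esum2 c) by exact: nondecreasing_cvgn_le.
have limB : limn (esum2 c) <= B by apply: limr_le => //; near=> n.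
have key N : L2 H (fun w => h w - ser c 0 0 N w) /\
    sqnorm H (fun w => h w - ser c 0 0 N w) <= limn (esum2 c) - esum2 c N.
  apply: (@L2_fatou _ _ mH (fun k w => ser c 0 0 (N + k) w - ser c 0 0 N w)).
  - by move=> k; exact: (L2B mH (ser_L2 _ _) (ser_L2 _ _)).1.
  - by apply: cmeasurableB => //; case: (ser_L2 c N).
  - by move=> k; rewrite tail lerB.
  move=> w Hw; rewrite (_ : (fun k => _) = (fun k => normc (ser c 0 0 (k + N) w - h w))); last first.
    by apply/funext => k; rewrite addnC; congr normc; ring.
  have pcv := polyb_cvg 0 0 pc Hw.
  by rewrite (cvg_shiftn N (fun k => normc (ser c 0 0 k w - h w))).
have s0 w : ser c 0 0 0 w = 0 by rewrite /ser big_ord0.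
have E0 : esum2 c 0 = 0 by rewrite /esum2 /idx big_nil.
have [l0 b0] := key 0.
split.
- by apply: (eq_L2 _ l0) => w _; rewrite s0 subr0.
- rewrite E0 subr0 in b0; apply: le_trans limB; apply: le_trans b0.
  by rewrite le_eqVlt; apply/orP; left; apply/eqP; apply: eq_sqn => w _; rewrite s0 subr0.
exists (fun N => limn (esum2 c) - esum2 c N); last by move=> N; exact: (key N).2.
by rewrite -(subrr (limn (esum2 c))); apply: cvgB => //; exact: cvg_cst.
Unshelve. all: by end_near.
Qed.

(** Cauchy-Schwarz bounds the error by a null sequence. The inner products are only required to be
    eventually constant, as those of partial sums with a basis function are. *)
Lemma inner_lim f g (s : nat -> Cfun) (T : nat -> R) (l : C) : L2 H f -> L2 H g -> (forall N, L2 H (s N)) ->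
  T @ \oo --> (0 : R) -> (forall N, sqnorm H (fun w => f w - s N w) <= T N) ->
  (\forall N \near \oo, L2inner H (s N) g = l) -> L2inner H f g = l.
Proof.
move=> lf lg ls T0 hT hl.
have b : \forall N \near \oo, normc (L2inner H f g - l) ^+ 2 <= T N * sqnorm H g.
  near=> N; have e : L2inner H (s N) g = l by near: N.
  rewrite -e -innerB//; apply: (le_trans (cauchy_schwarz mH (L2B mH lf (ls N)).1 lg)).
  by rewrite ler_wpM2r ?sqn_ge0.
have lim : (fun N => T N * sqnorm H g) @ \oo --> 0 * sqnorm H g by apply: cvgM => //; exact: cvg_cst.
rewrite mul0r in lim.
have := cvgr_to_ge lim b => h0.
have : normc (L2inner H f g - l) ^+ 2 = 0 by apply/eqP; rewrite eq_le h0 sqr_ge0.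
by move/eqP; rewrite expf_eq0/= normc_eq0 subr_eq0 => /eqP.
Unshelve. all: by end_near.
Qed.

Lemma hser_inner c (B : R) a m : polyb c -> (forall N, esum2 c N <= B) ->
  L2inner H (hser c 0 0) (Em a m) = c a m * (sqnorm H (Em a m))%:C.
Proof.
move=> pc hB; have [lh _ [T T0 hT]] := hser_L2 pc hB.
apply: (inner_lim lh (Em_L2 a m) (ser_L2 c) T0 hT).
near=> N; have e : L2inner H (ser c 0 0 N) (Em a m) =
    L2inner H (fun w => \sum_(i <- idx 0 N) c i.1 i.2 * Ei i w) (Ei (a, m)).
  apply: eq_cintegral => w _; congr (_ * _).
  by rewrite -ser_idx add0n /ser [X in _ - X]big_ord0 subr0.
rewrite e (inner_lincomb mH (uniq_idx 0 N) Ei_L2 Ei_orth (fun i => c i.1 i.2)) ifT//.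
apply/flattenP; exists (lay (a + m)); last exact: mem_lay.
by apply: map_f; rewrite mem_iota add0n; near: N; exists (a + m).+1.
Unshelve. all: by end_near.
Qed.

Definition coef f a m : C := L2inner H f (Em a m) / (sqnorm H (Em a m))%:C.

Lemma sqnC_neq0 a m : ((sqnorm H (Em a m))%:C : C) != 0.
Proof. by rewrite -normc_eq0 normc_real normr_eq0 gt_eqF//; exact: (Ei_gt0 (a, m)). Qed.

Lemma coef_sqr f a m : normc (coef f a m) ^+ 2 * sqnorm H (Em a m) =
  normc (L2inner H f (Em a m)) ^+ 2 / sqnorm H (Em a m).
Proof.
have E0 : 0 < sqnorm H (Em a m) by exact: (Ei_gt0 (a, m)).
rewrite /coef normcM normcV normc_real gtr0_norm//.
by field; rewrite gt_eqF.
Qed.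

Lemma coef_polyb f : L2 H f -> polyb (coef f).
Proof.
move=> lf; exists (sqnorm H f / KH + 1) => a m.
have K0 := @KH_gt0 R; have F0 := sqn_ge0 H f.
have h : normc (coef f a m) ^+ 2 <= sqnorm H f / KH * (a + m).+1%:R ^+ 2.
  have E0 : 0 < sqnorm H (Em a m) by exact: (Ei_gt0 (a, m)).
  rewrite -(ler_pM2r E0) coef_sqr ler_pdivrMr//.
  apply: (le_trans (cauchy_schwarz mH lf (Em_L2 a m))).
  rewrite -!mulrA ler_wpM2l// -[X in X <= _]mul1r mulrCA !mulrA ler_pM2r//.
  rewrite Em_sqn (_ : _ * _ * _ = (a + m).+1%:R * (a + m).+1%:R / (a.+1%:R * m.+1%:R)).
    rewrite ler_pdivlMr ?mulr_gt0// mul1r -!natrM ler_nat.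
    by rewrite leq_mul// ltnS ?leq_addr ?leq_addl.
  by field; rewrite ?pnatr_eq0 ?(gt_eqF K0)//; do ?(apply/andP; split); rewrite ?pnatr_eq0// gt_eqF.
have x0 := normc_ge0 (coef f a m); have n0 : 1 <= (a + m).+1%:R :> R by rewrite ler1n.
have q0 : 0 <= sqnorm H f / KH by rewrite divr_ge0// ltW.
move: h x0 n0 q0; move: (normc _) (_ / KH) ((a + m).+1%:R : R) => x q n h x0 n0 q0.
rewrite -ler_sqr ?nnegrE ?mulr_ge0 ?addr_ge0//; last by lra.
by apply: (le_trans h); rewrite exprMn ler_wpM2r ?sqr_ge0//; nra.
Qed.

Lemma coef_esum f N : L2 H f -> esum2 (coef f) N <= sqnorm H f.
Proof.
move=> lf; rewrite /esum2; under eq_bigr do rewrite coef_sqr.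
exact: (bessel mH (uniq_idx 0 N) Ei_L2 Ei_orth Ei_gt0 lf).
Qed.

Definition hproj f : Cfun := hser (coef f) 0 0.

Lemma tm_continuous a m p q w : w2 w != 0 -> ccontinuous_at (tm a m p q : Cfun) w.
Proof. by move=> w20; case: (wder_tm a m p q w20). Qed.

Lemma Em_holomorphic a m : holomorphic H (Em a m).
Proof.
rewrite (_ : Em a m = tm a m 0 0); last by apply/funext => w; rewrite tm00.
apply: (wder_holomorphic (@open_hartogs R) (fun w Hw => wder_tm a m 0 0 (hartogs_w2 Hw))).
  move=> w j Hw; have w20 := hartogs_w2 Hw.
  exact: (ccontinuousD (ccontinuousM (ccontinuous_cst (dlt 0 j) w) (tm_continuous a m 1 0 w20))
    (ccontinuousM (ccontinuous_cst (dlt 2 j) w) (tm_continuous a m 0 1 w20))).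
by move=> w Hw; rewrite /dsum /dlt /= !mul0r addr0.
Qed.

Lemma hproj_L2 f : L2 H f -> L2 H (hproj f).
Proof.
by move=> lf; have [] := hser_L2 (coef_polyb lf) (fun N => coef_esum N lf).
Qed.

Lemma hproj_inner f a m : L2 H f -> L2inner H (hproj f) (Em a m) = L2inner H f (Em a m).
Proof.
move=> lf; rewrite (hser_inner _ _ (coef_polyb lf) (fun N => coef_esum N lf)).
by rewrite /coef divfK// sqnC_neq0.
Qed.

Lemma hproj_holomorphic f : L2 H f -> holomorphic H (hproj f).
Proof. by move=> lf; apply: polyb_holomorphic; exact: coef_polyb. Qed.

Lemma holomorphic_continuous f w : holomorphic H f -> H w -> ccontinuous_at f w.
Proof. by move=> [cf _] Hw; case: (cf [::] isT w Hw). Qed.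

Lemma whol_sub f g : L2 H f -> L2 H g -> whol f -> whol g -> whol (fun w => f w - g w).
Proof.
move=> lf lg [_ wf] [_ wg]; have ld := (L2B mH lf lg).1; split; first exact: L2_lint.
move=> phi tp; have [f1 f3] := wf phi tp; have [g1 g3] := wg phi tp.
have sub k : cintegral H (fun w => (f w - g w) * Dj k phi w) =
    cintegral H (fun w => f w * Dj k phi w) - cintegral H (fun w => g w * Dj k phi w).
  have tk := elem_test_L2 (elem_test_Dj k (@open_Ustar R) tp).
  rewrite -cintegralB//; try exact: L2_mul.
  by apply: eq_cintegral => w _; rewrite mulrBl.
by split; rewrite sub; [rewrite f1 g1; exact: subrr|rewrite f3 g3; exact: subrr].
Qed.

Lemma completeness_sub f g : L2 H f -> L2 H g -> holomorphic H f -> holomorphic H g ->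
  (forall a m : nat, L2inner H f (Em a m) = L2inner H g (Em a m)) -> forall w, H w -> f w = g w.
Proof.
move=> lf lg hf hg e w Hw; apply/eqP; rewrite -subr_eq0; apply/eqP.
apply: (completeness (g := fun w => f w - g w)) => //.
- exact: (L2B mH lf lg).1.
- by apply: whol_sub => //; exact: holomorphic_whol.
- move=> v Hv; have e1 (x y : C) : x - y = x + -1 * y by rewrite mulN1r.
  under eq_fun do rewrite e1.
  exact: ccontinuousD (holomorphic_continuous hf Hv)
    (ccontinuousM (ccontinuous_cst (-1 : C) v) (holomorphic_continuous hg Hv)).
by move=> a m; rewrite innerB ?e ?subrr//; exact: Em_L2.
Qed.

Lemma hproj_id g : L2 H g -> holomorphic H g -> forall w, H w -> g w = hproj g w.
Proof.
move=> lg hg; apply: completeness_sub => //; [exact: hproj_L2|exact: hproj_holomorphic|].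
by move=> a m; rewrite hproj_inner.
Qed.

(** By completeness every [g] in the Bergman space is the sum of its own expansion, so orthogonality
    to the basis functions passes to [g] in the limit. *)
Lemma hproj_orthogonal f : L2 H f -> orthogonal_projection H (bergman_space H) f (hproj f).
Proof.
move=> lf; split; first by split; [exact: hproj_L2|exact: hproj_holomorphic].
move=> g [lg hg]; have ld := (L2B mH lf (hproj_L2 lf)).1.
rewrite -(innerJ mH lg ld) -[RHS](rmorph0 conjc); congr conjc.
have [lh _ [T T0 hT]] := hser_L2 (coef_polyb lg) (fun N => coef_esum N lg).
rewrite (_ : L2inner H g _ = L2inner H (hproj g) (fun w => f w - hproj f w)); last first.
  by apply: eq_cintegral => w Hw; rewrite -(hproj_id lg hg).
apply: (inner_lim lh ld (ser_L2 _) T0 hT); near=> N.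
rewrite (_ : L2inner H _ _ = L2inner H (fun w => \sum_(i <- idx 0 N) coef g i.1 i.2 * Ei i w) (fun w => f w - hproj f w)).
  rewrite inner_sum//; last by move=> i _; exact: (L2Z mH _ (Ei_L2 i)).1.
  apply: big1 => i _; rewrite innerZ//; last exact: Ei_L2.
  have e0 : L2inner H (fun w => f w - hproj f w) (Ei i) = 0.
    by rewrite (innerB mH lf (hproj_L2 lf) (Ei_L2 i)) [X in _ - X](hproj_inner _ _ lf); exact: subrr.
  have z : conjc (0 : C) = 0 by exact: rmorph0.
  rewrite -(innerJ mH ld (Ei_L2 i)) e0; transitivity (coef g i.1 i.2 * 0 : C); last exact: mulr0.
  by congr (_ * _); exact: z.
apply: eq_cintegral => w _; congr (_ * _).
by rewrite -ser_idx add0n /ser [X in _ - X]big_ord0 subr0.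
Unshelve. all: by end_near.
Qed.

(** [hproj f] shows that the set from which the projection is chosen is nonempty; the chosen
    function has the same coefficients, and completeness identifies the two at every point of the
    domain. *)
Lemma bergman_eq f w : L2 H f -> H w -> bergman_projection H f w = hproj f w.
Proof.
move=> lf; set Bf := bergman_projection H f.
have [[lB hB] oB] : orthogonal_projection H (bergman_space H) f Bf.
  exact: (@xgetPex _ (fun=> 0) _ (ex_intro _ _ (hproj_orthogonal lf))).
move: w; apply: completeness_sub => //; [exact: hproj_L2|exact: hproj_holomorphic|move=> a m].
rewrite hproj_inner//; apply/eqP; rewrite eq_sym -subr_eq0 -(innerB mH lf lB (Em_L2 a m)); apply/eqP.
by apply: oB; split; [exact: Em_L2|exact: Em_holomorphic].
Qed.

End BergmanSeries.

(** * Weak derivatives against tests off the axes, and rotation fields *)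

Section WeakClass.
Context {R : realType}.
Local Notation C := R[i].
Local Notation Cfun := (C2 R -> C).
Local Notation H := (@hartogs R).
Local Notation U := (@Ustar R).
Implicit Types (f g F : Cfun) (w : C2 R) (M N : R).
Let mH := @measurable_hartogs R.

(** A first-order notion, tested only by elementary functions supported off the axes. Both Sobolev
    derivatives and classical derivatives of functions smooth up to the boundary provide it. *)
Definition wd (j : 'I_4) f g := forall phi, elem_test U H phi ->
  cintegral H (fun w => f w * Dj j phi w) = - cintegral H (fun w => g w * phi w).

(** A single bound [M] controls all derivatives up to order [k], so that estimates linear in [M]
    yield the continuity of the projection. *)
Fixpoint WW (k : nat) M f : Prop := [/\ L2 H f, sqnorm H f <= M &
  if k is k'.+1 then forall j, exists g, wd j f g /\ WW k' M g else True].

Lemma WW_L2 k M f : WW k M f -> L2 H f /\ sqnorm H f <= M.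
Proof. by case: k => [|k] []. Qed.

Lemma WW_ge0 k M f : WW k M f -> 0 <= M.
Proof. by move=> /WW_L2[_]; apply: le_trans; exact: sqn_ge0. Qed.

Lemma WW_S k M f : WW k.+1 M f -> WW k M f.
Proof.
elim: k f => [|k IH] f [l s d]; split => // j.
by have [g [dg wg]] := d j; exists g; split => //; exact: IH.
Qed.

Lemma WW_le k M N f : M <= N -> WW k M f -> WW k N f.
Proof.
move=> MN; elim: k f => [|k IH] f [l s d]; split => //; try exact: le_trans MN.
by move=> j; have [g [dg wg]] := d j; exists g; split => //; exact: IH.
Qed.

Lemma wd_int f phi : L2 H f -> elem_test U H phi -> cintegrable H (fun w => f w * phi w).
Proof. by move=> lf /elem_test_L2; exact: L2_mul. Qed.

Lemma elem_test_D j phi : elem_test U H phi -> elem_test U H (Dj j phi).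
Proof. exact: elem_test_Dj (@open_Ustar R). Qed.

Lemma wdD j f g f' g' : L2 H f -> L2 H g -> L2 H f' -> L2 H g' -> wd j f f' -> wd j g g' ->
  wd j (fun w => f w + g w) (fun w => f' w + g' w).
Proof.
move=> lf lg lf' lg' df dg phi tp; have tD := elem_test_D j tp.
transitivity (cintegral H (fun w => f w * Dj j phi w) + cintegral H (fun w => g w * Dj j phi w)).
  rewrite -cintegralD//; try exact: wd_int.
  by apply: eq_cintegral => w _; rewrite mulrDl.
rewrite (df phi tp) (dg phi tp) -opprD -cintegralD//; try exact: wd_int.
by congr (- _); apply: eq_cintegral => w _; rewrite mulrDl.
Qed.

Lemma wdZ j (c : C) f g : L2 H f -> L2 H g -> wd j f g -> wd j (fun w => c * f w) (fun w => c * g w).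
Proof.
move=> lf lg df phi tp; have tD := elem_test_D j tp.
transitivity (c * cintegral H (fun w => f w * Dj j phi w)).
  by rewrite -cintegralZ//; [apply: eq_cintegral => w _; rewrite mulrA|exact: wd_int].
rewrite (df phi tp) mulrN -cintegralZ//; last exact: wd_int.
by congr (- _); apply: eq_cintegral => w _; rewrite mulrA.
Qed.

Lemma WW_D k M N f g : WW k M f -> WW k N g -> WW k (2 * M + 2 * N) (fun w => f w + g w).
Proof.
elim: k f g => [|k IH] f g [lf sf df] [lg sg dg]; have [ls ss] := L2D mH lf lg.
  by split => //; apply: (le_trans ss); rewrite lerD// ler_wpM2l.
split => //; first by apply: (le_trans ss); rewrite lerD// ler_wpM2l.
move=> j; have [f' [df' wf']] := df j; have [g' [dg' wg']] := dg j.
have [lf' _] := WW_L2 wf'; have [lg' _] := WW_L2 wg'.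
exists (fun w => f' w + g' w); split; [exact: wdD|exact: IH].
Qed.

Lemma WW_Z k M (c : C) f : normc c <= 1 -> WW k M f -> WW k M (fun w => c * f w).
Proof.
move=> c1.
have key g : L2 H g -> sqnorm H g <= M -> L2 H (fun w => c * g w) /\ sqnorm H (fun w => c * g w) <= M.
  move=> lg sg; have [h1 h2] := L2Z mH c lg; split => //; apply: (le_trans h2).
  by apply: le_trans sg; rewrite ler_piMl ?sqn_ge0// exprn_ile1// normc_ge0.
elim: k f => [|k IH] f [lf sf df]; have [l s] := key f lf sf; split => //.
move=> j; have [f' [df' wf']] := df j; have [lf' _] := WW_L2 wf'.
exists (fun w => c * f' w); split; [exact: wdZ|exact: IH].
Qed.

Lemma zz_le1 i w : H w -> normc (zz i w) <= 1.
Proof.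
move=> Hw; have h1 := hartogs_normc1 Hw; have h2 := hartogs_normc2 Hw.
elim/rbP: i; [exact: h1| |exact: h2|].
  by rewrite -[zz _ _]/(conjc (w1 w)) normc_conj.
by rewrite -[zz _ _]/(conjc (w2 w)) normc_conj.
Qed.

Lemma zz_cmeasurable i : cmeasurable H (zz i : Cfun).
Proof.
by apply: (cmeasurable_continuous (@open_hartogs R)) => w _; case: (wder_zz i w).
Qed.

Lemma L2_zz i f : L2 H f -> L2 H (fun w => zz i w * f w) /\ sqnorm H (fun w => zz i w * f w) <= sqnorm H f.
Proof.
move=> lf; have mf : cmeasurable H (fun w => zz i w * f w).
  by apply: cmeasurableM => //; [exact: zz_cmeasurable|case: lf].
have h w : H w -> normc (zz i w * f w) ^+ 2 <= 1 * normc (f w) ^+ 2.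
  move=> Hw; rewrite normcM exprMn ler_wpM2r ?sqr_ge0//.
  by rewrite exprn_ile1 ?normc_ge0 ?zz_le1.
by have [l s] := L2_dom mH mf lf h; rewrite mul1r in s.
Qed.

Lemma Dj_zzM i j phi w : elem_test U H phi ->
  Dj j (fun w => zz i w * phi w) w = zz i w * Dj j phi w + dlt i j * phi w.
Proof.
by move=> tp; have := wderM (wder_zz i w) (elem_test_wder w (@open_Ustar R) tp); move=> /(wder_Dj j).
Qed.

Lemma wd_zz i j f g : L2 H f -> L2 H g -> wd j f g ->
  wd j (fun w => zz i w * f w) (fun w => dlt i j * f w + zz i w * g w).
Proof.
move=> lf lg df phi tp; have tz := elem_testM (elem_zz U i) tp.
have tDz := elem_test_D j tz.
transitivity (cintegral H (fun w => f w * Dj j (fun w => zz i w * phi w) w) -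
    dlt i j * cintegral H (fun w => f w * phi w)).
  rewrite -cintegralZ//; last exact: wd_int.
  rewrite -cintegralB//; [|exact: wd_int|by apply: cintegrableZ => //; exact: wd_int].
  by apply: eq_cintegral => w _; rewrite Dj_zzM//; ring.
rewrite (df _ tz) -opprD -cintegralZ//; last exact: wd_int.
rewrite -cintegralD//; [|exact: wd_int|by apply: cintegrableZ => //; exact: wd_int].
by congr (- _); apply: eq_cintegral => w _; ring.
Qed.

(** The product rule gives [dlt i j * f + zz i * g], whose squared norms are bounded by
    [2 M + 2 * 4^k M <= 4^(k+1) M], as the coordinates have modulus at most 1. *)
Lemma WW_zz k M i f : WW k M f -> WW k (4 ^+ k * M) (fun w => zz i w * f w).
Proof.
elim: k f => [|k IH] f [lf sf df]; have [lz sz] := L2_zz i lf.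
  by split => //; rewrite expr0 mul1r; exact: le_trans sf.
have M0 : 0 <= M by exact: le_trans (sqn_ge0 _ _) sf.
have p1 : 1 <= 4 ^+ k :> R by rewrite exprn_ege1// ler1n.
split => //.
  by apply: (le_trans sz); apply: (le_trans sf); rewrite ler_peMl// exprn_ege1// ler1n.
move=> j; have [g [dg wg]] := df j; have [lg _] := WW_L2 wg.
exists (fun w => dlt i j * f w + zz i w * g w); split; first exact: wd_zz.
have wf : WW k M f by apply: WW_S; split.
have d1 : normc (dlt i j : C) <= 1 by rewrite /dlt; case: (_ == _); rewrite ?normc1 ?normc0.
apply: WW_le (WW_D (WW_Z d1 wf) (IH g wg)).
by rewrite exprS; move: (4 ^+ k) p1 => x x1; nra.
Qed.

(* Eigenvalues of the rotation fields on monomials; the fields annihilate functions of [tau] and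
   [sig], so that cut-offs produce no extra terms. *)
Definition mexp (i : 'I_4) (a m : nat) : C :=
  if (i == 0) || (i == 1) then a%:R else (m%:Z - 1 - a%:Z)%:~R.

(** [F] is the rotation field applied weakly to [f]. Both derivatives are moved onto the conjugate
    monomial times [chin n]; in the difference the derivatives of the cut-offs cancel and the
    exponent remains. Then [n] tends to infinity. *)
Lemma rotation k M f (i j : 'I_4) : (i, j) = (0, 1) \/ (i, j) = (2, 3) -> WW k.+1 M f ->
  exists2 F, WW k (4 ^+ k.+1 * M) F &
  forall a m, L2inner H F (Em a m) = mexp i a m * L2inner H f (Em a m).
Proof.
move=> ij [lf sf df]; have [g0 [d0 wg0]] := df i; have [g1 [d1 wg1]] := df j.
have [lg0 _] := WW_L2 wg0; have [lg1 _] := WW_L2 wg1.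
have z0 := WW_zz i wg0; have z1 := WW_zz j wg1.
have n1 : normc (-1 : C) <= 1 by rewrite normcN normc1.
exists (fun w => zz i w * g0 w + -1 * (zz j w * g1 w)).
  apply: WW_le (WW_D z0 (WW_Z n1 z1)).
  rewrite exprS; move: (4 ^+ k) => x; lra.
move=> a m; have lF := WW_L2 (WW_D z0 (WW_Z n1 z1)); have {}lF := lF.1.
have lE := Em_L2 a m : L2 H (Em a m).
apply: (@cut_lim_eq _ _ _ (fun n => mexp i a m * cintegral H (fun w => f w * (Em a m w)^* * chin n w))).
- exact: L2_inner_int.
- move=> n; set b := m%:Z - 1 - a%:Z.
  have cn := csupp01_cut n : csupp01 (@cut R n).
  have [A' dA _] := csupp01_derive cn.
  pose phi : Cfun := Xm a%:Z b (cut n) (cut n).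
  have tp : elem_test U H phi by exact: Xm_test.
  have phE (G : Cfun) w : G w * (Em a m w)^* * chin n w = G w * phi w.
    by rewrite /phi /Xm mulrA; congr (_ * _ * _); exact: conj_Em.
  have t0 := elem_testM (elem_zz U i) tp; have t1 := elem_testM (elem_zz U j) tp.
  transitivity (cintegral H (fun w => g0 w * (zz i w * phi w)) - cintegral H (fun w => g1 w * (zz j w * phi w))).
    rewrite -cintegralB//; try exact: wd_int.
    apply: eq_cintegral => w _.
    by rewrite (phE (fun w => zz i w * g0 w + -1 * (zz j w * g1 w))); ring.
  have e0 := d0 _ t0; have e1 := d1 _ t1.
  transitivity (cintegral H (fun w => f w * Dj j (fun w => zz j w * phi w) w) -
    cintegral H (fun w => f w * Dj i (fun w => zz i w * phi w) w)).
    by rewrite e0 e1 opprK addrC.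
  have i1 := wd_int lf (elem_test_D j t1); have i0 := wd_int lf (elem_test_D i t0).
  rewrite -cintegralB// -cintegralZ//; last first.
    by apply: (eq_cintegrable mH _ (wd_int lf tp)) => w _; rewrite phE.
  apply: eq_cintegral => w _.
  rewrite phE -mulrBr mulrCA; congr (_ * _).
  rewrite /phi !(euler_Xm _ _ _ _ cn cn dA dA) -mulrBr /Xm /chi -rmorphM -rmorphB.
  rewrite [RHS]mulrCA; congr (_ * _).
  rewrite /mexp /eulerc; case: ij => -[-> ->] /=.
    rewrite -(rmorph_nat (@real_complex R)) -rmorphM; congr (_%:C).
    by rewrite -pmulrn; ring.
  rewrite -/b -(rmorph_int (@real_complex R)) -rmorphM; congr (_%:C).
  by ring.
have il := cut_lim (L2_inner_int mH lf lE).
rewrite (_ : (fun n => _) = (fun n => normc (mexp i a m) *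
  normc (cintegral H (fun w => f w * (Em a m w)^* * chin n w) - L2inner H f (Em a m)))).
  by rewrite -(mulr0 (normc (mexp i a m))); apply: cvgM; [exact: cvg_cst|exact: il].
by apply/funext => n; rewrite -normcM mulrBr.
Qed.

Lemma rotation_iter p q k : exists2 K : R, 0 <= K & forall M f, WW (p + q + k) M f ->
  exists2 F, WW k (K * M) F &
  forall a m, L2inner H F (Em a m) = a%:R ^+ p * (m%:Z - 1 - a%:Z)%:~R ^+ q * L2inner H f (Em a m).
Proof.
elim: p k => [|p IH] k.
  elim: q k => [|q IHq] k.
    exists 1 => // M f wf; exists f; first by rewrite mul1r.
    by move=> a m; rewrite !expr0 !mul1r.
  have [K K0 hK] := IHq k.+1; exists (4 ^+ k.+1 * K); first by rewrite mulr_ge0 ?exprn_ge0.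
  move=> M f; rewrite add0n addSnnS => wf; have [G wG eG] := hK M f wf.
  have [F wF eF] := rotation (or_intror erefl : (2 : 'I_4, 3 : 'I_4) = (0, 1) \/ (2 : 'I_4, 3 : 'I_4) = (2, 3)) wG.
  exists F; first by rewrite -mulrA.
  by move=> a m; rewrite eF eG /mexp /= exprS; ring.
have [K K0 hK] := IH k.+1; exists (4 ^+ k.+1 * K); first by rewrite mulr_ge0 ?exprn_ge0.
move=> M f; rewrite !addSn -addnS => wf; have [G wG eG] := hK M f wf.
have [F wF eF] := rotation (or_introl erefl : (0 : 'I_4, 1 : 'I_4) = (0, 1) \/ (0 : 'I_4, 1 : 'I_4) = (2, 3)) wG.
exists F; first by rewrite -mulrA.
by move=> a m; rewrite eF eG /mexp /= exprS; ring.
Qed.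

End WeakClass.

(** * Weighted estimates for derivatives of the expansion; rapid decrease *)

Section SobolevEstimate.
Context {R : realType}.
Local Notation C := R[i].
Local Notation Cfun := (C2 R -> C).
Local Notation H := (@hartogs R).
Implicit Types (f g F : Cfun) (w : C2 R) (M N : R) (c : nat -> nat -> C).
Let mH := @measurable_hartogs R.

Lemma WW_leq k k' M f : (k' <= k)%N -> WW k M f -> WW k' M f.
Proof.
move=> /subnK <-; elim: (k - k')%N => [|n IH]; first by rewrite add0n.
by rewrite addSn => /WW_S.
Qed.

Definition bz (a m : nat) : R := `|(m%:Z - 1 - a%:Z)%:~R|.

Lemma normc_int (z : int) : normc (z%:~R : C) = `|z%:~R| :> R.
Proof. by rewrite -normc_real rmorph_int. Qed.

Lemma normc_nat (n : nat) : normc (n%:R : C) = n%:R :> R.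
Proof. by rewrite -(rmorph_nat (@real_complex R)) normc_real normr_nat. Qed.

(** A sharper form than [ffz_bound]: the bound involves only the exponent of [w2], which is the
    multiplier that the rotation in [w2] produces. *)
Lemma ffz_bound2 a m q : normc (ffz (m%:Z - 1 - a%:Z) q : C) <= q.+1%:R ^+ q * (1 + bz a m ^+ q).
Proof.
set x := bz a m; have x0 : 0 <= x by exact: normr_ge0.
apply: (@le_trans _ _ ((q.+1%:R * Num.max 1 x) ^+ q)); last first.
  rewrite exprMn ler_wpM2l ?exprn_ge0//; have [h|h] := leP 1 x; last by rewrite expr1n lerDl exprn_ge0.
  by rewrite lerDr.
rewrite /ffz; suff h k : (k <= q)%N -> normc (\prod_(i < k) (m%:Z - 1 - a%:Z - i%:Z)%:~R : C) <= (q.+1%:R * Num.max 1 x) ^+ k.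
  exact: h.
elim: k => [|k IH] kq; first by rewrite big_ord0 normc1.
rewrite big_ord_recr normcM exprSr; apply: ler_pM; rewrite ?normc_ge0 ?IH//; first exact: ltnW.
rewrite normc_int rmorphB/=; apply: (le_trans (ler_normB _ _)); rewrite -/(bz a m) -/x.
rewrite -pmulrn normr_nat -natr1 mulrDl mul1r addrC; apply: lerD; last by rewrite le_max lexx orbT.
apply: (@le_trans _ _ (q%:R * 1)); first by rewrite mulr1 ler_nat ltnW.
by rewrite ler_wpM2l// le_max lexx.
Qed.

Definition tcoef a m p q : C := (a ^_ p)%:R * ffz (m%:Z - 1 - a%:Z) q.

Lemma tcoef_bound a m p q : normc (tcoef a m p q) ^+ 2 <=
  2 * q.+1%:R ^+ q ^+ 2 * ((a%:R ^+ p) ^+ 2 + (a%:R ^+ p * bz a m ^+ q) ^+ 2).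
Proof.
have h1 : normc ((a ^_ p)%:R : C) <= a%:R ^+ p by rewrite normc_nat -natrX ler_nat ffact_bound.
have h2 := ffz_bound2 a m q.
have h3 : normc (tcoef a m p q) <= a%:R ^+ p * (q.+1%:R ^+ q * (1 + bz a m ^+ q)).
  by rewrite normcM; apply: ler_pM => //; exact: normc_ge0.
have a0 : 0 <= a%:R ^+ p :> R by exact: exprn_ge0.
have q0 : 0 <= q.+1%:R ^+ q :> R by exact: exprn_ge0.
have b0 : 0 <= bz a m ^+ q by rewrite exprn_ge0 ?normr_ge0.
have t0 := normc_ge0 (tcoef a m p q).
move: h3 a0 q0 b0 t0; move: (a%:R ^+ p : R) (q.+1%:R ^+ q : R) (bz a m ^+ q) (normc _) => x y z t h3 x0 y0 z0 t0.
have h4 : t ^+ 2 <= (x * (y * (1 + z))) ^+ 2.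
  by rewrite ler_sqr ?nnegrE ?mulr_ge0// addr_ge0.
apply: (le_trans h4); rewrite -subr_ge0.
rewrite (_ : _ - _ = (x * y * (1 - z)) ^+ 2); first exact: sqr_ge0.
by ring.
Qed.

(** A differentiated monomial with the weight included. For [p + q <= k] and [p <= a] it is a
    multiple of the basis function with indices [a - p] and [m + 2k - (p + q)], so that
    orthogonality is preserved. *)
Definition wtm (k p q : nat) (i : nat * nat) : Cfun := fun w => w2 w ^+ (2 * k) * tm i.1 i.2 p q w.

Lemma wtmE k p q a m w : (p + q <= k)%N -> (p <= a)%N -> w2 w != 0 ->
  wtm k p q (a, m) w = tcoef a m p q * Em (a - p) (m + (2 * k - (p + q))) w.
Proof.
move=> pq pa w20; rewrite /wtm /tm /Em /mono /tcoef.
rewrite -[w1 w ^ (a - p)%:Z]/(w1 w ^+ (a - p)).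
have -> : (m + (2 * k - (p + q)))%N%:Z - 1 - (a - p)%N%:Z = (2 * k)%N%:Z + (m%:Z - 1 - a%:Z - q%:Z).
  rewrite PoszD -!subzn//; last by rewrite (leq_trans pq)// leq_pmull.
  by rewrite PoszD; ring.
have e2 : w2 w ^ (2 * k)%N%:Z = w2 w ^+ (2 * k) by [].
by rewrite (expfzDr (2 * k)%N%:Z _ w20) e2 /=; move: (w2 w ^+ (2 * k)) (w2 w ^ _) (w1 w ^+ _) => x y z; ring.
Qed.

Lemma wtm0 k p q a m w : (a < p)%N -> wtm k p q (a, m) w = 0.
Proof. by move=> ap; rewrite /wtm /tm ffact_small// !mul0r mulr0. Qed.

(** Lowering [a] to [a - p] multiplies the squared norm by [(a + 1) / (a - p + 1) <= p + 1]; the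
    index [m] does not decrease, since [p + q <= 2 k], and this does not enlarge the norm. *)
Lemma wtm_L2 k p q i : (p + q <= k)%N -> L2 H (wtm k p q i) /\ sqnorm H (wtm k p q i) <=
  p.+1%:R * normc (tcoef i.1 i.2 p q) ^+ 2 * sqnorm H (Ei i).
Proof.
move=> pq; case: i => a m; have [ap|pa] := ltnP a p.
  split.
    by apply: (eq_L2 _ (L2_0 H)) => w _; rewrite wtm0.
  rewrite (@eq_sqn _ _ _ (fun=> 0)); last by move=> w _; rewrite wtm0.
  rewrite (_ : sqnorm H (fun=> 0) = 0); first by apply: mulr_ge0; [apply: mulr_ge0 => //; exact: sqr_ge0|exact: sqn_ge0].
  by rewrite /sqnorm; under eq_Rintegral do rewrite normc0 expr0n; rewrite /Rintegral integral0.
have [l s] := L2Z mH (tcoef a m p q) (Em_L2 (a - p) (m + (2 * k - (p + q)))).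
have e w : H w -> tcoef a m p q * Em (a - p) (m + (2 * k - (p + q))) w = wtm k p q (a, m) w.
  by move=> Hw; rewrite wtmE//; exact: hartogs_w2.
split; first exact: (eq_L2 e l).
rewrite -(eq_sqn e); apply: (le_trans s).
apply: (@le_trans _ _ (normc (tcoef a m p q) ^+ 2 * (p.+1%:R * sqnorm H (Em a m)))); last first.
  by rewrite /Ei /= mulrCA mulrA.
rewrite ler_wpM2l ?sqr_ge0// !Em_sqn [X in _ <= X]mulrCA ler_wpM2l ?KH_ge0//.
rewrite mulrA; apply: ler_pM; rewrite ?invr_ge0//.
  rewrite -[X in X <= _]mul1r ler_pdivrMr// mulrAC ler_pdivlMr// mul1r -natrM ler_nat.
  by rewrite -{1}(subnK pa); move: (a - p)%N => b; rewrite mulSn mulnS addSn ltnS leq_add2l leq_addr.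
by rewrite lef_pV2 ?posrE// ler_nat ltnS leq_addr.
Qed.

(** The shift of indices is injective on pairs with [a >= p], and the remaining functions are
    zero. *)
Lemma wtm_orth k p q i j : (p + q <= k)%N -> i != j -> L2inner H (wtm k p q i) (wtm k p q j) = 0.
Proof.
move=> pq; case: i j => a m [a' m'] ne.
have [ap|pa] := ltnP a p.
  by rewrite /L2inner (@eq_cintegral _ _ _ (fun=> 0)) ?cintegral0// => w _; rewrite wtm0// mul0r.
have [ap'|pa'] := ltnP a' p.
  rewrite /L2inner (@eq_cintegral _ _ _ (fun=> 0)) ?cintegral0// => w _.
  rewrite (wtm0 k q m' w ap'); transitivity (wtm k p q (a, m) w * conjc (0 : C)) => //.
  by rewrite (_ : conjc (0 : C) = 0) ?mulr0//; exact: rmorph0.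
have l1 := Em_L2 (a - p) (m + (2 * k - (p + q))) : L2 H _.
have l2 := Em_L2 (a' - p) (m' + (2 * k - (p + q))) : L2 H _.
have lz := (L2Z mH (tcoef a' m' p q) l2).1.
transitivity (L2inner H (fun w => tcoef a m p q * Em (a - p) (m + (2 * k - (p + q))) w)
   (fun w => tcoef a' m' p q * Em (a' - p) (m' + (2 * k - (p + q))) w)).
  by apply: eq_cintegral => w Hw; rewrite !wtmE//; exact: hartogs_w2.
rewrite innerZ// -(innerJ mH lz l1) innerZ// Em_orth.
  by rewrite mulr0 (_ : conjc (0 : C) = 0) ?mulr0//; exact: rmorph0.
apply: contra ne; rewrite !xpair_eqE eqn_add2r => /andP[/eqP e /eqP em].
by apply/andP; split; [rewrite -(subnK pa) -(subnK pa') e|rewrite em].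
Qed.

(** Rotations produce [F1] and [F2], whose coefficients are those of [f] times [a^p] and
    [a^p (m - 1 - a)^q]. By [tcoef_bound] they dominate the coefficients of the weighted derivative;
    Bessel bounds the sums for [F1] and [F2], and Fatou passes to the full series. *)
Lemma sobolev_estimate p q k : (p + q <= k)%N -> exists2 K : R, 0 <= K & forall M f, WW k M f ->
  L2 H (fun w => w2 w ^+ (2 * k) * hser (coef f) p q w) /\
  sqnorm H (fun w => w2 w ^+ (2 * k) * hser (coef f) p q w) <= K * M.
Proof.
move=> pq; have [K1 K10 h1] := @rotation_iter R p 0 0; have [K2 K20 h2] := @rotation_iter R p q 0.
pose A : R := p.+1%:R * (2 * q.+1%:R ^+ q ^+ 2).
have A0 : 0 <= A by rewrite !mulr_ge0 ?exprn_ge0.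
exists (A * (K1 + K2)); first by rewrite mulr_ge0 ?addr_ge0.
move=> M f wf; have [lf sf] := WW_L2 wf.
have wf1 : WW (p + 0 + 0) M f by apply: WW_leq wf; rewrite !addn0 (leq_trans _ pq)// leq_addr.
have wf2 : WW (p + q + 0) M f by apply: WW_leq wf; rewrite addn0.
have [F1 wF1 e1] := h1 M f wf1; have [F2 wF2 e2] := h2 M f wf2.
have [lF1 sF1] := WW_L2 wF1; have [lF2 sF2] := WW_L2 wF2.
have pc := coef_polyb lf.
have cE w : ccontinuous_at (fun w : C2 R => w2 w ^+ (2 * k)) w.
  by apply: ccontinuousX; case: (wder_w2 w).
have key a m : normc (coef f a m) ^+ 2 * sqnorm H (wtm k p q (a, m)) <=
    A * (normc (coef F1 a m) ^+ 2 * sqnorm H (Ei (a, m)) + normc (coef F2 a m) ^+ 2 * sqnorm H (Ei (a, m))).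
  have cF (F : Cfun) (z : C) : L2inner H F (Em a m) = z * L2inner H f (Em a m) ->
      normc (coef F a m) ^+ 2 = normc z ^+ 2 * normc (coef f a m) ^+ 2.
    by move=> e; rewrite /coef e -mulrA normcM exprMn.
  rewrite (cF _ _ (e1 a m)) (cF _ _ (e2 a m)) {cF}; move: (coef f a m) => cc.
  rewrite expr0 mulr1 !normcM !normcX normc_nat normc_int -/(bz a m).
  have s : sqnorm H (wtm k p q (a, m)) <= p.+1%:R * normc (tcoef a m p q) ^+ 2 * sqnorm H (Ei (a, m)).
    exact: (wtm_L2 (a, m) pq).2.
  apply: (le_trans (ler_wpM2l (sqr_ge0 _) s)).
  have t := tcoef_bound a m p q.
  have g0 : 0 <= p.+1%:R * (normc cc ^+ 2 * sqnorm H (Ei (a, m))).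
    by apply: mulr_ge0 => //; apply: mulr_ge0; [exact: sqr_ge0|exact: sqn_ge0].
  have := ler_wpM2l g0 t; rewrite /A.
  set x1 := normc cc ^+ 2; set x2 := normc (tcoef _ _ _ _) ^+ 2; set x3 := sqnorm _ _.
  set x4 := (a%:R ^+ p) ^+ 2; set x5 := (_ * bz a m ^+ q) ^+ 2; set x6 := q.+1%:R ^+ q ^+ 2.
  set x7 := p.+1%:R => h; rewrite -subr_ge0 in h; rewrite -subr_ge0; apply: le_trans h _.
  by rewrite le_eqVlt; apply/orP; left; apply/eqP; ring.
pose G : Cfun := fun w => w2 w ^+ (2 * k) * hser (coef f) p q w.
pose F (N : nat) : Cfun := fun w => w2 w ^+ (2 * k) * ser (coef f) p q N w.
suff [h3 h4 h5 h6] : [/\ forall N : nat, L2 H (F N), cmeasurable H G,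
    forall N : nat, sqnorm H (F N) <= A * (K1 + K2) * M &
    forall w, H w -> (fun n => normc (F n w - G w)) @ \oo --> (0 : R)].
  exact: (L2_fatou mH h3 h4 h5 h6).
rewrite /F /G; split.
- move=> N; have := L2_sum mH (idx 0 N) (P := predT) (fun i _ => (L2Z mH (coef f i.1 i.2) (wtm_L2 i pq).1).1).
  apply: eq_L2 => w Hw; rewrite /wtm.
  under eq_bigr do rewrite mulrCA.
  by rewrite -mulr_sumr -ser_tm add0n /ser [X in _ - X]big_ord0 subr0.
- apply: (cmeasurable_continuous (@open_hartogs R)) => w Hw.
  by apply: ccontinuousM => //; exact: polyb_continuous.
- move=> N.
  rewrite (@eq_sqn _ H _ (fun w => \sum_(i <- idx 0 N) coef f i.1 i.2 * wtm k p q i w)); last first.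
    move=> w _; rewrite /wtm; under eq_bigr do rewrite mulrCA.
    by rewrite -mulr_sumr -ser_tm add0n /ser [X in _ - X]big_ord0 subr0.
  rewrite (sqn_lincomb mH (uniq_idx 0 N) (fun i => (wtm_L2 i pq).1) (fun i j => wtm_orth pq) (fun i => coef f i.1 i.2)).
  apply: (@le_trans _ _ (A * (esum2 (coef F1) N + esum2 (coef F2) N))); last first.
    rewrite -mulrA ler_wpM2l// mulrDl; apply: lerD.
      exact: le_trans (coef_esum N lF1) sF1.
    exact: le_trans (coef_esum N lF2) sF2.
  rewrite /esum2 -big_split mulr_sumr; apply: ler_sum => -[a m] _; exact: key.
- move=> w Hw; rewrite (_ : (fun n => _) = (fun n => normc (w2 w ^+ (2 * k)) * normc (ser (coef f) p q n w - hser (coef f) p q w))).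
  rewrite -(mulr0 (normc (w2 w ^+ (2 * k)))); apply: cvgM; first exact: cvg_cst.
  exact: polyb_cvg.
by apply/funext => n; rewrite -normcM mulrBr.
Qed.

(** Powers of [a] and of [m - 1 - a] control those of [a + m + 1], because
    [a + m + 1 <= 2 + 2 a + |m - 1 - a|]. The order [j.+1] leaves one power to compensate for the
    linear growth given by [coef_polyb]. *)
Lemma rapid_coef f : (forall k, exists M, WW k M f) -> rapid (coef f) 1.
Proof.
move=> wf j; have [M0 w0] := wf j.+1; have [lf _] := WW_L2 w0.
have [K1 K10 h1] := @rotation_iter R j.+1 0 0; have [K2 K20 h2] := @rotation_iter R 0 j.+1 0.
have [M1 w1] := wf (j.+1 + 0 + 0)%N; have [M2 w2] := wf (0 + j.+1 + 0)%N.
have [F1 /WW_L2[lF1 _] e1] := h1 M1 f w1; have [F2 /WW_L2[lF2 _] e2] := h2 M2 f w2.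
have [B0 b0] := coef_polyb lf; have [B1 b1] := coef_polyb lF1; have [B2 b2] := coef_polyb lF2.
exists (6 ^+ j.+1 * (B0 + B1 + B2)) => a m.
rewrite expr1n mulr1; set n : R := (a + m).+1%:R.
have n0 : 0 < n by rewrite ltr0n.
rewrite -(ler_pM2r n0) -mulrA -exprSr.
have cF (F : Cfun) (z : C) : L2inner H F (Em a m) = z * L2inner H f (Em a m) ->
    normc (coef F a m) = normc z * normc (coef f a m).
  by move=> e; rewrite /coef e -mulrA normcM.
have c0 := b0 a m; have := b1 a m; have := b2 a m.
rewrite (cF _ _ (e1 a m)) (cF _ _ (e2 a m)) !expr0 mulr1 mul1r !normcX normc_nat normc_int -/(bz a m) -/n.
rewrite -/n in c0 => c2 c1.
have z0 : 0 <= bz a m by exact: normr_ge0.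
have nle : n <= 6 * Num.max 1 (Num.max a%:R (bz a m)).
  have h : n <= 2 + 2 * a%:R + bz a m.
    rewrite /n /bz !rmorphB /= -!pmulrn -natr1 natrD.
    have := ler_norm ((m%:R - 1%:~R - a%:R : R)); rewrite mulr1z; lra.
  have x1 : 1 <= Num.max 1 (Num.max a%:R (bz a m)) by rewrite le_max lexx.
  have x2 : a%:R <= Num.max 1 (Num.max a%:R (bz a m)) by rewrite !le_max lexx orbT.
  have x3 : bz a m <= Num.max 1 (Num.max a%:R (bz a m)) by rewrite !le_max lexx !orbT.
  move: (Num.max _ _) x1 x2 x3 => x; lra.
have nJ : n ^+ j.+1 <= 6 ^+ j.+1 * (1 + a%:R ^+ j.+1 + bz a m ^+ j.+1).
  apply: (@le_trans _ _ ((6 * Num.max 1 (Num.max a%:R (bz a m))) ^+ j.+1)).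
    by apply: lerXn2r; rewrite ?nnegrE ?(ltW n0)// mulr_ge0// le_max ler01.
  rewrite exprMn ler_wpM2l ?exprn_ge0//.
  have y1 : 0 <= a%:R ^+ j.+1 :> R by exact: exprn_ge0.
  have y2 : 0 <= bz a m ^+ j.+1 by exact: exprn_ge0.
  case: (leP 1 (Num.max a%:R (bz a m))) => _; last by rewrite expr1n; lra.
  by case: (leP a%:R (bz a m)) => _; lra.
apply: (le_trans (ler_wpM2l (normc_ge0 _) nJ)); rewrite mulrCA -mulrA ler_wpM2l ?exprn_ge0//.
by move: (normc _) (a%:R ^+ _) (bz _ _ ^+ _) c0 c1 c2 => x y z; lra.
Qed.

End SobolevEstimate.

(** * General test functions and uniqueness of weak derivatives *)

Section TestFunctions.
Context {R : realType}.
Local Notation C := R[i].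
Local Notation Cfun := (C2 R -> C).
Implicit Types (f g phi : Cfun) (w : C2 R) (Omega K : set (C2 R)).

(** Wirtinger derivatives are linear combinations of the real [partials] in terms of which
    smoothness is defined; the span is stable under both kinds of derivatives. *)
Inductive pspan phi : Cfun -> Prop :=
| pspan_partials s : pspan phi (partials s phi)
| pspanD f g : pspan phi f -> pspan phi g -> pspan phi (fun w => f w + g w)
| pspanZ c f : pspan phi f -> pspan phi (fun w => c * f w).

Lemma pspan_continuous Omega phi f w : smooth_on Omega phi -> pspan phi f -> Omega w -> ccontinuous_at f w.
Proof.
move=> sp pf Ow; elim: pf => [s|g h _ cg _ ch|c g _ cg]; first by case: (sp (size s) s (leqnn _) w Ow).
  exact: ccontinuousD.
by apply: ccontinuousM => //; exact: ccontinuous_cst.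
Qed.

Lemma pspan_derive Omega phi f j : smooth_on Omega phi -> pspan phi f ->
  exists2 g, pspan phi g & forall w, Omega w -> cis_derive w (real_basis j) f (g w).
Proof.
move=> sp; elim=> [s|g h _ [g' pg dg] _ [h' ph dh]|c g _ [g' pg dg]].
- exists (partials (j :: s) phi); first exact: pspan_partials.
  move=> w Ow; apply: cderivableP.
  by have [_] := sp (size s).+1 s (leqnSn _) w Ow; apply.
- exists (fun w => g' w + h' w); first exact: pspanD.
  by move=> w Ow; apply: cis_deriveD; [exact: dg|exact: dh].
- exists (fun w => c * g' w); first exact: pspanZ.
  move=> w Ow; have := cis_deriveM (cis_derive_cst w (real_basis j) c) (dg w Ow).
  by rewrite mul0r addr0.
Qed.

Lemma pspan_smooth Omega phi f g : open Omega -> smooth_on Omega phi -> pspan phi f ->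
  (forall w, Omega w -> g w = f w) -> smooth_on Omega g.
Proof.
move=> oO sp; apply: (smooth_class (P := pspan phi) oO).
  by move=> h ph w; exact: pspan_continuous.
by move=> h ph j; exact: pspan_derive.
Qed.

Lemma pspan_Dj phi j : pspan phi (Dj j phi).
Proof.
have k (x y : C) (s t : 'I_4) : pspan phi (fun w => 2^-1 * (x * partials [:: s] phi w + y * partials [:: t] phi w)).
  by apply: pspanZ; apply: pspanD; apply: pspanZ; exact: pspan_partials.
elim/rbP: j; [have := k 1 (- 'i) 0 1|have := k 1 'i 0 1|have := k 1 (- 'i) 2 3|have := k 1 'i 2 3];
  congr pspan; apply/funext => w; rewrite /Dj /= /dw1 /dw1bar /dw2 /dw2bar /dz /dzbar mul1r mulrC;
  congr (_ / 2); congr (_ + _); exact: mulNr.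
Qed.

Lemma test_Dj Omega phi j : test_function Omega phi -> test_function Omega (Dj j phi).
Proof.
move=> [sp [K [cK KO K0]]]; split.
  exact: (pspan_smooth openT sp (pspan_Dj phi j)).
exists K; split => // w Kw; apply: (@wder_Dj _ phi w (fun=> 0)); apply: wder_near (wder_cst 0 w).
exact: closed_near0 cK K0 Kw.
Qed.

Lemma test_C1 Omega phi : test_function Omega phi -> C1_on setT phi.
Proof. by move=> [sp _]; apply: Ck1_C1; exact: sp. Qed.

Lemma test_parts Omega g phi k : open Omega -> C1_on Omega g -> test_function Omega phi ->
  cintegral Omega (fun w => g w * Dj k phi w) = - cintegral Omega (fun w => Dj k g w * phi w).
Proof.
move=> oO cg tp; have c1 := test_C1 tp; have [_ [K [cK KO K0]]] := tp.
exact: (cintegral_parts_csupp k oO cK KO cg c1 K0).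
Qed.

Lemma test_csupp Omega phi : test_function Omega phi -> exists K, [/\ compact K, K `<=` Omega,
  forall w, ~ K w -> phi w = 0 & forall w, ccontinuous_at phi w].
Proof.
by move=> tp; have c1 := test_C1 tp; have [_ [K [cK KO K0]]] := tp; exists K; split => // w; case: (c1 w I) => -[].
Qed.

Lemma enum4 : enum 'I_4 = [:: 0; 1; 2; 3].
Proof. by apply: (inj_map val_inj); rewrite val_enum_ord. Qed.

Lemma DmultiE (a : 'I_4 -> nat) phi : Dmulti a phi =
  iter (a 0) (Dj 0) (iter (a 1) (Dj 1) (iter (a 2) (Dj 2) (iter (a 3) (Dj 3) phi))).
Proof. by rewrite /Dmulti enum4. Qed.

Lemma mdegE (a : 'I_4 -> nat) : mdeg a = (a 0%R + (a 1%R + (a 2%R + a 3%R)))%N.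
Proof.
rewrite /mdeg !big_ord_recl big_ord0 addn0.
by congr (a _ + (a _ + (a _ + a _)))%N; apply: val_inj.
Qed.

Lemma test_iter Omega phi j n : test_function Omega phi -> test_function Omega (iter n (Dj j) phi).
Proof. by move=> tp; elim: n => //= n; exact: test_Dj. Qed.

Lemma cont_cloc Omega f : open Omega -> (forall w, Omega w -> ccontinuous_at f w) -> cloc_integrable Omega f.
Proof.
move=> oO cf; split; first exact: (cmeasurable_continuous oO cf).
move=> K KO cK; have mK := compact_measurableC2 cK.
have bd (h : C2 R -> R) : (forall w, K w -> {for w, continuous h}) -> exists c : R, forall w, K w -> `|h w| <= c.
  move=> ch; have ck : {within K, continuous h} by apply: continuous_in_subspaceT => w /set_mem; exact: ch.
  have := continuous_compact ck cK.
  move=> /compact_bounded[N [_ hN]]; exists (`|N| + 1) => w Kw.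
  apply: hN; last by exists w.
  by rewrite (le_lt_trans (ler_norm N))// ltrDl.
have [a ha] := bd (Re \o f) (fun w Kw => (cf w (KO w Kw)).1).
have [b hb] := bd (Im \o f) (fun w Kw => (cf w (KO w Kw)).2).
have mf : cmeasurable K f.
  have [m1 m2] := cmeasurable_continuous oO cf; have mO := open_measurableC2 oO.
  by split; [exact: measurable_funS m1|exact: measurable_funS m2].
apply: (@le_lt_trans _ _ (\int[dV]_(w in (K : set (mC2 R))) (a + b)%:E)%E).
  apply: ge0_le_integral => //.
  - by move=> w _; rewrite lee_fin normc_ge0.
  - by apply/measurable_EFinP; exact: measurable_normc.
  - move=> w Kw; rewrite lee_fin; apply: (le_trans (normc_le _)).
    by apply: lerD; [exact: ha|exact: hb].
rewrite integral_cst//; have kf := dV_compact cK.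
rewrite -[X in (_ * X)%E]fineK; last by rewrite ge0_fin_numE.
by rewrite -EFinM ltry.
Qed.

Lemma cloc_integrableB Omega f g : open Omega -> cloc_integrable Omega f -> cloc_integrable Omega g ->
  cloc_integrable Omega (fun w => f w - g w).
Proof.
move=> oO [mf lf] [mg lg]; have mO := open_measurableC2 oO; split; first exact: cmeasurableB.
move=> K KO cK; have mK := compact_measurableC2 cK.
have mS h : cmeasurable Omega h -> cmeasurable K h.
  by move=> [m1 m2]; split; [exact: measurable_funS m1|exact: measurable_funS m2].
have mn h : cmeasurable Omega h -> measurable_fun (K : set (mC2 R)) (fun w => (normc (h w))%:E).
  by move=> mh; apply/measurable_EFinP; apply: measurable_normc; exact: mS.
apply: (@le_lt_trans _ _ (\int[dV]_(w in (K : set (mC2 R))) ((normc (f w))%:E + (normc (g w))%:E))%E); last first.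
  rewrite ge0_integralD//; first exact: lte_add_pinfty (lf K KO cK) (lg K KO cK).
  - by move=> w _; rewrite lee_fin normc_ge0.
  - exact: mn.
  - by move=> w _; rewrite lee_fin normc_ge0.
  - exact: mn.
apply: ge0_le_integral => //.
- by move=> w _; rewrite lee_fin normc_ge0.
- by apply: mn; exact: cmeasurableB.
- by apply: emeasurable_funD; exact: mn.
- by move=> w _; rewrite -EFinD lee_fin normcB.
Qed.

Lemma weak_int Omega f phi : open Omega -> cloc_integrable Omega f -> test_function Omega phi ->
  cintegrable Omega (fun w => f w * phi w).
Proof.
move=> oO lf tp; have [K [cK KO K0 cp]] := test_csupp tp.
exact: (cintegrable_locM oO lf cK KO cp K0).
Qed.

(** Elementary tests are test functions, so the difference annihilates them and [test_vanishing_ae]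
    applies. *)
Lemma weak_unique Omega (a : 'I_4 -> nat) f g1 g2 : open Omega ->
  weak_derivative Omega a f g1 -> weak_derivative Omega a f g2 ->
  {ae dV, forall w : mC2 R, Omega w -> g1 w = g2 w}.
Proof.
move=> oO [l1 h1] [l2 h2]; have lB := cloc_integrableB oO l1 l2.
have mO := open_measurableC2 oO.
have := test_vanishing_ae oO lB; apply: contraPP => nae h.
apply: nae; apply: (@filterS _ _ (ae_filter_ringOfSetsType dV)) (h _) => [w hw Ow|phi ep].
  by apply/eqP; rewrite -subr_eq0; apply/eqP; exact: hw.
have tp := elem_test_function openT ep.
transitivity (cintegral Omega (fun w => g1 w * phi w) - cintegral Omega (fun w => g2 w * phi w)).
  rewrite -cintegralB//; try exact: weak_int.
  by apply: eq_cintegral => w _; rewrite mulrBl.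
have s0 : (-1) ^+ mdeg a != 0 :> C by rewrite expf_neq0// oppr_eq0 oner_eq0.
have e : cintegral Omega (fun w => g1 w * phi w) = cintegral Omega (fun w => g2 w * phi w).
  by apply: (mulfI s0); rewrite -h1// -h2.
by rewrite e subrr.
Qed.

Lemma weakD_spec Omega (a : 'I_4 -> nat) f g : weak_derivative Omega a f g ->
  weak_derivative Omega a f (weakD Omega a f).
Proof. by move=> h; exact: (@xgetPex _ (fun=> 0) _ (ex_intro _ g h)). Qed.

Lemma ae_sqn_eq Omega f g : open Omega -> cmeasurable Omega f -> cmeasurable Omega g ->
  {ae dV, forall w : mC2 R, Omega w -> f w = g w} ->
  (\int[dV]_(w in (Omega : set (mC2 R))) (normc (f w) ^+ 2)%:E =
   \int[dV]_(w in (Omega : set (mC2 R))) (normc (g w) ^+ 2)%:E)%E.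
Proof.
move=> oO mf mg h; have mO := open_measurableC2 oO.
apply: ae_eq_integral => //.
- by apply/measurable_EFinP; exact: measurable_normc_sqr.
- by apply/measurable_EFinP; exact: measurable_normc_sqr.
by apply: (@filterS _ _ (ae_filter_ringOfSetsType dV)) h => w hw Ow; rewrite hw.
Qed.

End TestFunctions.

(** * Sobolev continuity of the Bergman projection *)

Section PartOne.
Context {R : realType}.
Local Notation C := R[i].
Local Notation Cfun := (C2 R -> C).
Local Notation H := (@hartogs R).
Implicit Types (f g G phi : Cfun) (w : C2 R) (M : R) (c : nat -> nat -> C) (a : 'I_4 -> nat).
Let mH := @measurable_hartogs R.
Let oH := @open_hartogs R.

Lemma L2_cloc f : L2 H f -> cloc_integrable H f.
Proof.
move=> lf; split; first by case: lf.
move=> K KH cK; have mK := compact_measurableC2 cK.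
have /integrableP[mn] := integrable_normc mH (L2_mul mH lf (L2_cst 1)).
have e w : normc (f w * 1) = normc (f w) by rewrite mulr1.
under eq_integral do rewrite /= e ger0_norm ?normc_ge0//.
apply: le_lt_trans; apply: ge0_subset_integral => //.
  by move: mn; under eq_fun do rewrite /= e.
by move=> w _; rewrite lee_fin normc_ge0.
Qed.

Lemma hser_step c p q phi : polyb c -> test_function H phi ->
  [/\ cintegral H (fun w => hser c p q w * Dj 0 phi w) = - cintegral H (fun w => hser c p.+1 q w * phi w),
      cintegral H (fun w => hser c p q w * Dj 1 phi w) = 0,
      cintegral H (fun w => hser c p q w * Dj 2 phi w) = - cintegral H (fun w => hser c p q.+1 w * phi w) &
      cintegral H (fun w => hser c p q w * Dj 3 phi w) = 0].
Proof.
move=> pc tp; have [c1 _] := holomorphic_C1 (polyb_holomorphic p q pc).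
have e k w : H w -> Dj k (hser c p q) w = dsum (hser c p.+1 q w) (hser c p q.+1 w) k.
  by move=> Hw; exact: wder_Dj (polyb_wder p q pc Hw).
have h k g : (forall w, H w -> Dj k (hser c p q) w = g w) ->
    cintegral H (fun w => hser c p q w * Dj k phi w) = - cintegral H (fun w => g w * phi w).
  by move=> eg; rewrite (test_parts k oH c1 tp); congr (- _); apply: eq_cintegral => w Hw; rewrite eg.
have z k : (forall w, H w -> Dj k (hser c p q) w = 0) ->
    cintegral H (fun w => hser c p q w * Dj k phi w) = 0.
  move=> eg; rewrite (h k (fun=> 0))// (@eq_cintegral _ _ _ (fun=> 0)) ?cintegral0 ?oppr0// => w _.
  exact: mul0r.
split.
- by apply: h => w Hw; rewrite e// /dsum /dlt /= mul1r mul0r addr0.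
- by apply: z => w Hw; rewrite e// /dsum /dlt /= !mul0r addr0.
- by apply: h => w Hw; rewrite e// /dsum /dlt /= mul1r mul0r add0r.
- by apply: z => w Hw; rewrite e// /dsum /dlt /= !mul0r addr0.
Qed.

Definition hD c a : Cfun := if (a 1 == 0%N) && (a 3 == 0%N) then hser c (a 0) (a 2) else fun=> 0.

Lemma iter_int c p q n phi : polyb c -> test_function H phi ->
  [/\ cintegral H (fun w => hser c p q w * iter n (Dj 0) phi w) = (-1) ^+ n * cintegral H (fun w => hser c (p + n) q w * phi w),
      cintegral H (fun w => hser c p q w * iter n (Dj 1) phi w) = (n == 0%N)%:R * cintegral H (fun w => hser c p q w * phi w),
      cintegral H (fun w => hser c p q w * iter n (Dj 2) phi w) = (-1) ^+ n * cintegral H (fun w => hser c p (q + n) w * phi w) &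
      cintegral H (fun w => hser c p q w * iter n (Dj 3) phi w) = (n == 0%N)%:R * cintegral H (fun w => hser c p q w * phi w)].
Proof.
move=> pc tp; elim: n p q => [|n IH] p q.
  by split; rewrite ?expr0 ?addn0 ?eqxx [RHS]mul1r; reflexivity.
have s j := hser_step p q pc (test_iter j n tp).
have [s0 _ _ _] := s 0; have [_ s1 _ _] := s 1; have [_ _ s2 _] := s 2; have [_ _ _ s3] := s 3.
have [i0 _ _ _] := IH p.+1 q; have [_ _ i2 _] := IH p q.+1.
split.
- by rewrite [LHS]s0 i0 exprS mulN1r mulNr addSnnS.
- by rewrite [LHS]s1 mul0r.
- by rewrite [LHS]s2 i2 exprS mulN1r mulNr addSnnS.
- by rewrite [LHS]s3 mul0r.
Qed.

Lemma hD_continuous c a w : polyb c -> H w -> ccontinuous_at (hD c a) w.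
Proof.
move=> pc Hw; rewrite /hD; case: ifP => _; [exact: polyb_continuous|exact: ccontinuous_cst].
Qed.

(** The sum is holomorphic, so its classical derivatives are weak ones, and those involving a
    conjugate variable vanish. [G] stands for a function such as the projection, known to equal the
    sum on the domain only. *)
Lemma weak_hser c a G : polyb c -> (forall w, H w -> G w = hser c 0 0 w) ->
  weak_derivative H a G (hD c a).
Proof.
move=> pc eG; split; first by apply: cont_cloc => // w Hw; exact: hD_continuous.
move=> phi tp; rewrite (@eq_cintegral _ _ _ (fun w => hser c 0 0 w * Dmulti a phi w)); last first.
  by move=> w Hw; rewrite eG.
have t3 := test_iter 3 (a 3) tp; have t2 := test_iter 2 (a 2) t3; have t1 := test_iter 1 (a 1) t2.
have [e1 _ _ _] := iter_int 0 0 (a 0) pc t1; have [_ e2 _ _] := iter_int (0 + a 0) 0 (a 1) pc t2.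
have [_ _ e3 _] := iter_int (0 + a 0) 0 (a 2) pc t3.
have [_ _ _ e4] := iter_int (0 + a 0) (0 + a 2) (a 3) pc tp.
have {e1 e2 e3 e4}-> : cintegral H (fun w => hser c 0 0 w * Dmulti a phi w) =
    (-1) ^+ a 0 * ((a 1 == 0%N)%:R * ((-1) ^+ a 2 * ((a 3 == 0%N)%:R *
    cintegral H (fun w => hser c (0 + a 0) (0 + a 2) w * phi w)))).
  rewrite DmultiE; apply: (etrans e1); congr (_ * _); apply: (etrans e2); congr (_ * _).
  by apply: (etrans e3); congr (_ * _); exact: e4.
rewrite !add0n mdegE /hD.
case: (a 1 =P 0%N) => [->|_]; last first.
  rewrite mul0r mulr0 (@eq_cintegral _ _ _ (fun=> 0)) ?cintegral0 ?mulr0// => w _.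
  exact: mul0r.
case: (a 3 =P 0%N) => [->|_]; last first.
  rewrite mul0r !mulr0 (@eq_cintegral _ _ _ (fun=> 0)) ?cintegral0 ?mulr0// => w _.
  exact: mul0r.
by rewrite add0n addn0 exprD !mul1r mulrA.
Qed.

Lemma sobolev_term (l : int) f g w :
  normc (w2 w) ^ (2 * l) * normc (f w) ^+ 2 = normc (w2 w ^ l * f w) ^+ 2.
Proof. by rewrite normcM normcXz exprMn; congr (_ * _); rewrite mulrC -exprz_exp. Qed.

Lemma weight_measurable (l : int) g : cmeasurable H g -> cmeasurable H (fun w => w2 w ^ l * g w).
Proof.
move=> mg; apply: cmeasurableM => //; apply: (cmeasurable_continuous oH) => w Hw.
by apply: ccontinuousXz; [exact: hartogs_w2|case: (wder_w2 w)].
Qed.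

(** [weakD] is an arbitrary choice among weak derivatives. By uniqueness almost everywhere the norm
    may be computed with any explicit one. *)
Lemma sobolev_int (l : int) a f g : weak_derivative H a f g ->
  (\int[dV]_(w in (H : set (mC2 R))) (normc (w2 w) ^ (2 * l) * normc (weakD H a f w) ^+ 2)%:E =
   \int[dV]_(w in (H : set (mC2 R))) (normc (w2 w ^ l * g w) ^+ 2)%:E)%E.
Proof.
move=> wg; have wD := weakD_spec wg; have h := weak_unique oH wD wg.
under eq_integral do rewrite (sobolev_term l (weakD H a f) g).
apply: ae_sqn_eq => //.
- by apply: weight_measurable; case: wD => -[].
- by apply: weight_measurable; case: wg => -[].
by apply: (@filterS _ _ (ae_filter_ringOfSetsType dV)) h => w hw Hw; rewrite hw.
Qed.

Lemma elem_iterC i j n phi : elem_test (@Ustar R) H phi ->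
  iter n (Dj i) (Dj j phi) = Dj j (iter n (Dj i) phi).
Proof.
move=> tp; elim: n => // n IH; rewrite !iterS IH.
apply: (elem_test_DjC i j (@open_Ustar R)) (_ : elem_test (@Ustar R) H (iter n (Dj i) phi)).
by elim: (n) => //= k; exact: elem_test_D.
Qed.

Definition incr a (j : 'I_4) : 'I_4 -> nat := fun i => (a i + (i == j))%N.

Lemma mdeg_incr a j : mdeg (incr a j) = (mdeg a).+1.
Proof.
by rewrite !mdegE /incr; elim/rbP: j => /=; rewrite ?addn0 ?addn1 ?addnS ?addSn.
Qed.

(** [Dmulti] applies its operators in a fixed order, so the inner [Dj j] has to be commuted into its
    place; the symmetry of mixed derivatives is at hand for elementary tests. *)
Lemma Dmulti_incr a j phi : elem_test (@Ustar R) H phi -> Dmulti a (Dj j phi) = Dmulti (incr a j) phi.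
Proof.
move=> tp; have it i n psi : elem_test (@Ustar R) H psi -> elem_test (@Ustar R) H (iter n (Dj i) psi).
  by move=> t; elim: n => //= k; exact: elem_test_D.
have t3 := it 3 (a 3) _ tp; have t2 := it 2 (a 2) _ t3; have t1 := it 1 (a 1) _ t2.
rewrite !DmultiE /incr; elim/rbP: j; rewrite !addn0 ?addn1.
- by rewrite (elem_iterC 3 0)// (elem_iterC 2 0)// (elem_iterC 1 0)// -iterSr.
- by rewrite (elem_iterC 3 1)// (elem_iterC 2 1)// -iterSr.
- by rewrite (elem_iterC 3 2)// -iterSr.
- by rewrite -iterSr.
Qed.

(** The definition for [a] tested with [Dj j phi], and the one for [incr a j] tested with [phi],
    have the same left-hand side. This links derivatives of [f] of all orders to the first-order
    steps of [WW]. *)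
Lemma weak_wd a j f g g' : weak_derivative H a f g -> weak_derivative H (incr a j) f g' -> wd j g g'.
Proof.
move=> [_ h] [_ h'] phi tp.
have s0 : (-1) ^+ mdeg a != 0 :> C by rewrite expf_neq0// oppr_eq0 oner_eq0.
apply: (mulfI s0); rewrite -h; last by apply: (elem_test_function (@open_Ustar R)); exact: elem_test_D.
rewrite (Dmulti_incr a j tp) h'; last exact: (elem_test_function (@open_Ustar R)).
by rewrite mdeg_incr exprS mulN1r mulNr mulrN.
Qed.

Definition mzero : 'I_4 -> nat := fun=> 0%N.

Lemma weak_self f : cloc_integrable H f -> weak_derivative H mzero f f.
Proof. by move=> lf; split => // phi tp; rewrite mdegE expr0 mul1r DmultiE. Qed.

Definition multi_of (m : nat) a : {ffun 'I_4 -> 'I_m.+1} := [ffun i => inord (a i)].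

Lemma multi_ofE m a i : (mdeg a <= m)%N -> (multi_of m a i : nat) = a i.
Proof.
move=> am; rewrite ffunE inordK// ltnS (leq_trans _ am)// /mdeg (bigD1 i)//= leq_addr//.
Qed.

Lemma sobolev_ge0 m (l : int) f : (0 <= sobolev_sqnorm H m l f)%E.
Proof.
apply: sume_ge0 => a _; apply: integral_ge0 => w _.
by rewrite lee_fin mulr_ge0 ?sqr_ge0// exprz_ge0// normc_ge0.
Qed.

Lemma WW_intro m M f : L2 H f -> sqnorm H f <= M ->
  (forall n, m = n.+1 -> forall j, exists g, wd j f g /\ WW n M g) -> WW m M f.
Proof. by case: m => [|n] lf sf h; split => //; exact: h. Qed.

Lemma sobolev_weakD m f : (forall a, (mdeg a <= m)%N -> exists g, weak_derivative H a f g) ->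
  (sobolev_sqnorm H m 0 f < +oo)%E -> forall a, (mdeg a <= m)%N ->
  [/\ weak_derivative H a f (weakD H a f), L2 H (weakD H a f) &
      sqnorm H (weakD H a f) <= fine (sobolev_sqnorm H m 0 f)].
Proof.
move=> df fin; set M := fine _.
have ME : sobolev_sqnorm H m 0 f = M%:E by rewrite /M fineK// ge0_fin_numE ?sobolev_ge0.
have sp a : (mdeg a <= m)%N -> weak_derivative H a f (weakD H a f).
  by move=> /df[g]; exact: weakD_spec.
have nn (a : {ffun 'I_4 -> 'I_m.+1}) : (0 <= \int[dV]_(w in (H : set (mC2 R)))
    (normc (w2 w) ^ (2 * 0) * normc (weakD H (fun j => a j) f w) ^+ 2)%:E)%E.
  by apply: integral_ge0 => w _; rewrite lee_fin mulr_ge0 ?sqr_ge0// exprz_ge0// normc_ge0.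
have bd a : (mdeg a <= m)%N -> L2 H (weakD H a f) /\ sqnorm H (weakD H a f) <= M.
  move=> am; apply: (L2_le mH); first by case: (sp a am) => -[].
  rewrite -ME /sobolev_sqnorm (bigD1 (multi_of m a)); last first.
    by rewrite (_ : (fun j => _) = a)//; apply/funext => i; exact: multi_ofE.
  rewrite (_ : (fun j => (multi_of m a j : nat)) = a); last by apply/funext => i; exact: multi_ofE.
  apply: (@le_trans _ _ _ _ _ _ (leeDl _ _)); last by apply: sume_ge0 => b _; exact: nn.
  rewrite le_eqVlt; apply/orP; left; apply/eqP; apply: eq_integral => w _.
  by rewrite mulr0 expr0z mul1r.
by move=> a am; have [l s] := bd a am; split => //; exact: sp.
Qed.

Lemma sobolev_WW m f : cloc_integrable H f ->
  (forall a, (mdeg a <= m)%N -> exists g, weak_derivative H a f g) ->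
  (sobolev_sqnorm H m 0 f < +oo)%E -> WW m (fine (sobolev_sqnorm H m 0 f)) f.
Proof.
move=> lf df fin; set M := fine _.
have sp a : (mdeg a <= m)%N -> weak_derivative H a f (weakD H a f).
  by move=> am; have [] := sobolev_weakD df fin am.
have bd a : (mdeg a <= m)%N -> L2 H (weakD H a f) /\ sqnorm H (weakD H a f) <= M.
  by move=> am; have [] := sobolev_weakD df fin am.
have key n a : (mdeg a + n <= m)%N -> WW n M (weakD H a f).
  elim: n a => [|n IH] a am.
    by rewrite addn0 in am; have [l s] := bd a am; split.
  have am' : (mdeg a <= m)%N by rewrite (leq_trans _ am)// leq_addr.
  have [l s] := bd a am'; split => // j; exists (weakD H (incr a j) f).
  have ai : (mdeg (incr a j) + n <= m)%N by rewrite mdeg_incr addSnnS.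
  split; last exact: IH.
  by apply: (@weak_wd a j f); apply: sp => //; rewrite (leq_trans _ ai)// leq_addr.
have m0 : mdeg mzero = 0%N by rewrite mdegE.
have mle : (mdeg mzero <= m)%N by rewrite m0.
have [l0 s0] := bd mzero mle.
(* The derivative of order zero selected by [weakD] equals [f] only almost everywhere, so the level
   of [f] itself is treated apart from [key]. *)
have e := ae_sqn_eq oH lf.1 l0.1 (weak_unique oH (weak_self lf) (sp mzero mle)).
have [lF sF] : L2 H f /\ sqnorm H f <= M.
  by apply: (L2_le mH lf.1); rewrite e L2_sqn// lee_fin.
apply: WW_intro => // n mn j; exists (weakD H (incr mzero j) f).
have j1 : (mdeg (incr mzero j) + n <= m)%N by rewrite mdeg_incr m0 mn.
split; last exact: key.
apply: (@weak_wd mzero j f); first exact: weak_self.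
by apply: sp; rewrite (leq_trans _ j1)// leq_addr.
Qed.

Lemma bergman_in f : L2 H f -> bergman_space H (bergman_projection H f).
Proof.
by move=> lf; have [] := @xgetPex _ (fun=> 0) _ (ex_intro _ _ (hproj_orthogonal lf)).
Qed.

Lemma sobolev_hproj k : exists2 K : R, 0 <= K & forall M f, WW k M f ->
  forall G, (forall w, H w -> G w = hproj f w) ->
  (sobolev_sqnorm H k (2 * k)%N G <= (K * M)%:E)%E.
Proof.
(* Pairs with sum beyond [k] receive the constant 0 and no estimate; only those within [k] need
   one. *)
have /choice[K hK] : forall x : nat * nat, exists K : R, 0 <= K /\ ((x.1 + x.2 <= k)%N -> forall M f, WW k M f ->
    L2 H (fun w => w2 w ^+ (2 * k) * hser (coef f) x.1 x.2 w) /\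
    sqnorm H (fun w => w2 w ^+ (2 * k) * hser (coef f) x.1 x.2 w) <= K * M).
  move=> [p q] /=; have [pq|_] := leqP (p + q) k; last by exists 0.
  by have [K K0 hK] := @sobolev_estimate R p q k pq; exists K.
exists (\sum_(a : {ffun 'I_4 -> 'I_k.+1} | (mdeg (fun j => a j) <= k)%N) K ((a 0 : nat), (a 2 : nat))).
  by apply: sumr_ge0 => a _; case: (hK ((a 0 : nat), (a 2 : nat))).
move=> M f wf G eG; have [lf _] := WW_L2 wf; have M0 := WW_ge0 wf.
have pc := coef_polyb lf.
rewrite mulr_suml -sumEFin; apply: lee_sum => a ak.
rewrite (sobolev_int _ (weak_hser (fun j => a j : nat) pc eG)).
have [K0 hKa] := hK ((a 0 : nat), (a 2 : nat)).
rewrite /hD; case: ifP => _.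
  have pq : ((a 0%R : nat) + (a 2%R : nat) <= k)%N.
    by rewrite mdegE in ak; rewrite (leq_trans _ ak)//= leq_add2l addnCA leq_addr.
  have [l s] := hKa pq M f wf.
  by rewrite [X in (X <= _)%E](L2_sqn mH l) lee_fin.
rewrite integral0_eq ?lee_fin ?mulr_ge0// => w _.
by rewrite mulr0 normc0 expr0n.
Qed.

Lemma sobolev_norm_lt m (l : int) f (d : R) : 0 < d ->
  (sobolev_norm H m l f < d%:E)%E <-> (sobolev_sqnorm H m l f < (d ^+ 2)%:E)%E.
Proof.
move=> d0; have := sobolev_ge0 m l f; rewrite /sobolev_norm.
case: (sobolev_sqnorm H m l f) => [r r0| _|//].
  rewrite lee_fin in r0; rewrite poweR_EFin powR12_sqrt// !lte_fin.
  have s0 := sqrtr_ge0 r; rewrite -[r in X in _ <-> X]sqr_sqrtr//.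
  by rewrite ltr_sqr ?nnegrE// ltW.
by rewrite poweRyr.
Qed.

Lemma sobolev_norm_lty m (l : int) f :
  (sobolev_norm H m l f < +oo)%E <-> (sobolev_sqnorm H m l f < +oo)%E.
Proof. by split; [apply: lty_poweRy; rewrite invr_eq0|exact: poweR_lty]. Qed.

Lemma sobolev_L2_WW k f : sobolev H (2 * k + 1)%N 0 f ->
  WW k (fine (sobolev_sqnorm H (2 * k + 1)%N 0 f)) f.
Proof.
move=> [lf df /sobolev_norm_lty fin]; apply: WW_leq (sobolev_WW lf df fin).
by rewrite mul2n -addnn -addnA leq_addr.
Qed.

Lemma sobolev_bergman k f : sobolev H (2 * k + 1)%N 0 f ->
  sobolev H k (2 * k)%N (bergman_projection H f) /\ holomorphic H (bergman_projection H f).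
Proof.
move=> sf; have wf := sobolev_L2_WW sf; have [lf _] := WW_L2 wf.
have [lB hB] := bergman_in lf; split => //.
have eB w : H w -> bergman_projection H f w = hproj f w by exact: bergman_eq.
split; first exact: L2_cloc.
  by move=> a _; exists (hD (coef f) a); apply: weak_hser eB; exact: coef_polyb.
apply/sobolev_norm_lty; have [K K0 hK] := sobolev_hproj k.
exact: le_lt_trans (hK _ _ wf _ eB) (ltry _).
Qed.

(** Continuity compares values of the projection at two functions. Additivity, obtained in the limit
    from the coefficients, reduces this to the estimate for one function. *)
Lemma hprojB f g w : L2 H f -> L2 H g -> H w -> hproj (fun w => g w - f w) w = hproj g w - hproj f w.
Proof.
move=> lf lg Hw; have ld := (L2B mH lg lf).1.
have cE (a m : nat) : coef (fun w => g w - f w) a m = coef g a m - coef f a m.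
  by rewrite /coef (innerB mH lg lf (Em_L2 a m)) mulrBl.
have sE N : ser (coef (fun w => g w - f w)) 0 0 N w = ser (coef g) 0 0 N w - ser (coef f) 0 0 N w.
  rewrite /ser -sumrB; apply: eq_bigr => n _; rewrite /layer -sumrB; apply: eq_bigr => a _.
  by rewrite cE mulrBl.
have h1 := polyb_cvg 0 0 (coef_polyb ld) Hw; have h2 := polyb_cvg 0 0 (coef_polyb lg) Hw.
have h3 := polyb_cvg 0 0 (coef_polyb lf) Hw.
have h4 : (fun N => normc (ser (coef (fun w => g w - f w)) 0 0 N w - hproj (fun w => g w - f w) w) +
    (normc (ser (coef g) 0 0 N w - hproj g w) + normc (ser (coef f) 0 0 N w - hproj f w))) @ \oo --> (0 : R).
  rewrite -[X in _ --> X](addr0 (0 : R)); apply: cvgD; first exact: h1.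
  by rewrite -[X in _ --> X](addr0 (0 : R)); exact: cvgD h2 h3.
apply/eqP; rewrite -subr_eq0 -normc_eq0 eq_le normc_ge0 andbT.
apply: (cvgr_to_ge h4); near=> N; rewrite sE.
move: (hproj _ w) (hproj g w) (hproj f w) (ser (coef g) 0 0 N w) (ser (coef f) 0 0 N w) => x y z s t.
rewrite (_ : x - (y - z) = - (s - t - x) + ((s - y) - (t - z))); last by ring.
by rewrite (le_trans (normcD _ _))// normcN lerD// normcB.
Unshelve. all: by end_near.
Qed.

Lemma weak_derivativeB a f g f' g' : cloc_integrable H f -> cloc_integrable H g ->
  weak_derivative H a f f' -> weak_derivative H a g g' ->
  weak_derivative H a (fun w => g w - f w) (fun w => g' w - f' w).
Proof.
move=> lf lg [lf' hf] [lg' hg]; split; first exact: cloc_integrableB.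
move=> phi tp.
have tD : test_function H (Dmulti a phi) by rewrite DmultiE; do 4!apply: test_iter.
transitivity (cintegral H (fun w => g w * Dmulti a phi w) - cintegral H (fun w => f w * Dmulti a phi w)).
  rewrite -cintegralB//; try exact: weak_int.
  by apply: eq_cintegral => w _; rewrite mulrBl.
rewrite hf// hg// -mulrBr -cintegralB//; try exact: weak_int.
by congr (_ * _); apply: eq_cintegral => w _; rewrite mulrBl.
Qed.

Lemma bergman_continuous k : sobolev_continuous H (2 * k + 1)%N 0 k (2 * k)%N (@bergman_projection R H).
Proof.
move=> f sf e e0; have [K K0 hK] := sobolev_hproj k.
(* In squared norms the estimate gives [K (e / (K + 1))^2], which is below [e^2] for every
   [K >= 0]. *)
exists (e / (K + 1)); first by rewrite divr_gt0// ltr_wpDl.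
have d0 : 0 < e / (K + 1) by rewrite divr_gt0// ltr_wpDl.
move=> g sg /(sobolev_norm_lt _ _ _ d0) lt; apply/sobolev_norm_lt => //.
have [lf _] := WW_L2 (sobolev_L2_WW sf); have [lg _] := WW_L2 (sobolev_L2_WW sg).
have [cf df _] := sf; have [cg dg _] := sg.
have sd : sobolev H (2 * k + 1)%N 0 (fun w => g w - f w).
  split; first exact: cloc_integrableB.
    move=> a am; have [f' wf] := df a am; have [g' wg] := dg a am.
    by exists (fun w => g' w - f' w); exact: weak_derivativeB.
  by apply/sobolev_norm_lty; apply: lt_trans lt (ltry _).
have wd := sobolev_L2_WW sd.
apply: le_lt_trans (hK _ _ wd (fun w => bergman_projection H g w - bergman_projection H f w) _) _.
  by move=> w Hw; rewrite !bergman_eq// hprojB.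
rewrite lte_fin; have : fine (sobolev_sqnorm H (2 * k + 1) 0 (fun w => g w - f w)) <= (e / (K + 1)) ^+ 2.
  rewrite -lee_fin fineK ?ltW// ge0_fin_numE ?sobolev_ge0//; exact: lt_trans lt (ltry _).
move=> /(ler_wpM2l K0); move/le_lt_trans; apply.
rewrite (_ : K * _ = e ^+ 2 * (K / (K + 1) ^+ 2)); last by field; rewrite gt_eqF// ltr_wpDl.
have K1 : 0 < (K + 1) ^+ 2 by rewrite exprn_gt0// ltr_wpDl.
rewrite -[X in _ < X]mulr1 ltr_pM2l ?exprn_gt0// ltr_pdivrMr// mul1r; nra.
Qed.

End PartOne.

(** * Smoothness up to the boundary away from the origin *)

Section PartTwo.
Context {R : realType}.
Local Notation C := R[i].
Local Notation Cfun := (C2 R -> C).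
Local Notation H := (@hartogs R).
Implicit Types (f g h : Cfun) (w : C2 R) (M : R) (c : nat -> nat -> C).
Let mH := @measurable_hartogs R.
Let oH := @open_hartogs R.

Lemma closure_hartogs w : closure H w -> normc (w1 w) <= normc (w2 w) <= 1.
Proof.
pose A := [set w : C2 R | normc (w1 w) ^+ 2 <= sig w] `&` [set w : C2 R | sig w <= 1].
have c1 : continuous (fun w : C2 R => normc (w1 w) ^+ 2).
  by move=> v; apply: continuous_normc_sqr; case: (wder_w1 v).
have c2 : continuous (fun w : C2 R => sig w - normc (w1 w) ^+ 2).
  by move=> v; exact: (cvgB (@continuous_sig R v) (c1 v)).
have cA : closed A.
  apply: closedI.
    rewrite (_ : [set _ | _] = (fun w : C2 R => sig w - normc (w1 w) ^+ 2) @^-1` [set x | 0 <= x]).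
      by apply: closed_comp; [exact: in1W|exact: closed_ge].
    by apply/seteqP; split => v; rewrite /preimage /mkset /= subr_ge0.
  have -> : [set w : C2 R | sig w <= 1] = (fun w => sig w) @^-1` [set x | x <= 1] by [].
  by apply: closed_comp; [apply: in1W; exact: continuous_sig|exact: closed_le].
have HA : H `<=` A by move=> v /hartogsE[h1 h2]; split; exact: ltW.
move=> cw; have [h1 h2] : A w by rewrite ((closure_id A).1 cA); exact: (closure_subset HA).
rewrite /mkset /sig in h1 h2; apply/andP; split.
  by rewrite -ler_sqr ?nnegrE ?normc_ge0.
by rewrite -(@expr_le1 _ 2) ?normc_ge0.
Qed.

Lemma compact_closure_hartogs : compact (closure H).
Proof.
pose p : C2 R := ((-1, -1), (-1, -1)); pose q : C2 R := ((1, 1), (1, 1)).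
apply: (@subclosed_compact _ _ (cbox p q)); [exact: closed_closure|exact: compact_cbox|].
move=> w /closure_hartogs/andP[h1 h2]; have h3 := le_trans h1 h2.
have bd (x : C) : normc x <= 1 -> (-1 <= Re x <= 1) /\ (-1 <= Im x <= 1).
  move=> x1; rewrite -!ler_norml; split; [exact: le_trans (normRe_le x) x1|exact: le_trans (normIm_le x) x1].
have [a1 a2] := bd _ h3; have [a3 a4] := bd _ h2.
by apply/cboxP.
Qed.

Lemma smooth_upto_bounded f g : smooth_upto H (closure H) f -> pspan f g ->
  exists B : R, forall w, H w -> normc (g w) <= B.
Proof.
move=> [_ sf] pg; elim: pg => [s|g1 g2 _ [B1 h1] _ [B2 h2]|k g1 _ [B1 h1]].
- have [g' [gr gi e]] := sf s.
  have bd (u : C2 R -> R) : {within closure H, continuous u} -> exists B : R, forall w, closure H w -> `|u w| <= B.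
    move=> cu; have /compact_bounded[N [_ hN]] := continuous_compact cu compact_closure_hartogs.
    exists (`|N| + 1) => w Kw; apply: hN; last by exists w.
    by rewrite (le_lt_trans (ler_norm N))// ltrDl.
  have [a ha] := bd _ gr; have [b hb] := bd _ gi.
  exists (a + b) => w Hw; rewrite -e//; apply: (le_trans (normc_le _)).
  have cw := @subset_closure _ H w Hw.
  by apply: lerD; [exact: ha|exact: hb].
- exists (B1 + B2) => w Hw; apply: (le_trans (normcD _ _)).
  by apply: lerD; [exact: h1|exact: h2].
- exists (normc k * B1) => w Hw; rewrite normcM ler_wpM2l ?normc_ge0//; exact: h1.
Qed.

Lemma pspan_DjE f g k : smooth_on H f -> pspan f g ->
  exists2 g', pspan f g' & forall w, H w -> Dj k g w = g' w.
Proof.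
move=> sf pg; have d j := pspan_derive j sf pg.
have [d0 p0 e0] := d 0; have [d1 p1 e1] := d 1; have [d2 p2 e2] := d 2; have [d3 p3 e3] := d 3.
have E j (x : Cfun) : (forall w, H w -> cis_derive w (real_basis j) g (x w)) ->
    forall w, H w -> cderive (real_basis j) g w = x w.
  by move=> h w Hw; exact: cis_derive_cderive (h w Hw).
have K (x : C) (s t : Cfun) : pspan f s -> pspan f t -> pspan f (fun w => 2^-1 * (s w + x * t w)).
  by move=> ps pt; apply: pspanZ; apply: pspanD => //; exact: pspanZ.
elim/rbP: k.
- exists (fun w => 2^-1 * (d0 w + (- 'i) * d1 w)); first exact: K.
  move=> w Hw; rewrite -[LHS]/((cderive (real_basis 0) g w - 'i * cderive (real_basis 1) g w) / 2).
  by rewrite (E 0 _ e0)// (E 1 _ e1)// mulrC; congr (_ * (_ + _)); rewrite mulNr.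
- exists (fun w => 2^-1 * (d0 w + 'i * d1 w)); first exact: K.
  move=> w Hw; rewrite -[LHS]/((cderive (real_basis 0) g w + 'i * cderive (real_basis 1) g w) / 2).
  by rewrite (E 0 _ e0)// (E 1 _ e1)// mulrC.
- exists (fun w => 2^-1 * (d2 w + (- 'i) * d3 w)); first exact: K.
  move=> w Hw; rewrite -[LHS]/((cderive (real_basis 2) g w - 'i * cderive (real_basis 3) g w) / 2).
  by rewrite (E 2 _ e2)// (E 3 _ e3)// mulrC; congr (_ * (_ + _)); rewrite mulNr.
- exists (fun w => 2^-1 * (d2 w + 'i * d3 w)); first exact: K.
  move=> w Hw; rewrite -[LHS]/((cderive (real_basis 2) g w + 'i * cderive (real_basis 3) g w) / 2).
  by rewrite (E 2 _ e2)// (E 3 _ e3)// mulrC.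
Qed.

(** The closure is compact, so all derivatives are bounded, hence square integrable on the bounded
    domain. Integration by parts makes the classical derivatives weak ones. *)
Lemma smooth_upto_WW f k : smooth_upto H (closure H) f -> exists M, WW k M f.
Proof.
move=> su; have [sf _] := su.
suff key n g : pspan f g -> exists M, WW n M g by exact: (key k f (pspan_partials f [::])).
elim: n g => [|n IH] g pg.
  have [B hB] := smooth_upto_bounded su pg.
  have mg : cmeasurable H g by apply: (cmeasurable_continuous oH) => w; exact: pspan_continuous sf pg.
  by have [l s] := L2_bounded mg hB; exists (B ^+ 2 * sqnorm H (fun=> 1)); split.
have [M0 w0] := IH g pg; have [l0 s0] := WW_L2 w0.
have c1 : C1_on H g by apply: Ck1_C1; exact: (pspan_smooth oH sf pg (fun w _ => erefl)).
have /choice[M hM] : forall j : 'I_4, exists M, 0 <= M /\ exists g', wd j g g' /\ WW n M g'.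
  move=> j; have [g' pg' e] := pspan_DjE j sf pg; have [M wM] := IH g' pg'.
  exists M; split; first exact: WW_ge0 wM.
  exists g'; split => // phi tp.
  rewrite (cintegral_parts j oH (@open_Ustar R) c1 tp); congr (- _).
  by apply: eq_cintegral => w Hw; rewrite e.
have MG j : M j <= \sum_j M j.
  by rewrite (bigD1 j)//= lerDl sumr_ge0// => i _; case: (hM i).
exists (M0 + \sum_j M j); apply: WW_intro => //.
  by rewrite (le_trans s0)// lerDl sumr_ge0// => i _; case: (hM i).
move=> n' [<-] j; have [_ [g' [dg wg]]] := hM j; exists g'; split => //.
apply: WW_le wg; rewrite (le_trans (MG j))// lerDr; exact: WW_ge0 w0.
Qed.

Inductive hspan c : Cfun -> Prop :=
| hspan_hser p q : hspan c (hser c p q)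
| hspanD f g : hspan c f -> hspan c g -> hspan c (fun w => f w + g w)
| hspanZ k f : hspan c f -> hspan c (fun w => k * f w).

Lemma hspan_continuous c f w : polyb c -> hspan c f -> H w -> ccontinuous_at f w.
Proof.
move=> pc hf Hw; elim: hf => [p q|g h _ cg _ ch|k g _ cg]; first exact: polyb_continuous.
  exact: ccontinuousD.
by apply: ccontinuousM => //; exact: ccontinuous_cst.
Qed.

Lemma hspan_derive c f j : polyb c -> hspan c f ->
  exists2 g, hspan c g & forall w, H w -> cis_derive w (real_basis j) f (g w).
Proof.
move=> pc; elim=> [p q|g h _ [g' pg dg] _ [h' ph dh]|k g _ [g' pg dg]].
- exists (fun w => rb j (dlt 0) * hser c p.+1 q w + rb j (dlt 2) * hser c p q.+1 w).
    by apply: hspanD; apply: hspanZ; exact: hspan_hser.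
  by move=> w Hw; rewrite -rb_dsum; case: (polyb_wder p q pc Hw).
- exists (fun w => g' w + h' w); first exact: hspanD.
  by move=> w Hw; apply: cis_deriveD; [exact: dg|exact: dh].
- exists (fun w => k * g' w); first exact: hspanZ.
  move=> w Hw; have := cis_deriveM (cis_derive_cst w (real_basis j) k) (dg w Hw).
  by rewrite mul0r addr0.
Qed.

(** On the closed domain [w2 = 0] forces [w = 0]. Near any other point of it the closed domain lies
    in a set [region 1 eps], where rapidly decreasing coefficients give uniform convergence of
    continuous partial sums. *)
Lemma hspan_boundary c f w : rapid c 1 -> hspan c f -> (closure H `\ 0) w ->
  (Re \o f) @ within (closure H `\ 0) (nbhs w) --> Re (f w) /\
  (Im \o f) @ within (closure H `\ 0) (nbhs w) --> Im (f w).
Proof.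
move=> rc hf [cw w0]; set F := within _ _.
elim: hf => [p q|g h _ [gr gi] _ [hr hi]|k g _ [gr gi]]; last first.
- rewrite ReM ImM; split.
    rewrite (_ : Re \o _ = (fun v => Re k * (Re \o g) v - Im k * (Im \o g) v)).
      by apply: cvgB; (apply: cvgM; first exact: cvg_cst).
    by apply/funext => v; rewrite /= ReM.
  rewrite (_ : Im \o _ = (fun v => Re k * (Im \o g) v + Im k * (Re \o g) v)).
    by apply: cvgD; (apply: cvgM; first exact: cvg_cst).
  by apply/funext => v; rewrite /= ImM.
- rewrite ReD ImD; split.
    rewrite (_ : Re \o _ = (fun v => (Re \o g) v + (Re \o h) v)); first exact: cvgD.
    by apply/funext => v; rewrite /= ReD.
  rewrite (_ : Im \o _ = (fun v => (Im \o g) v + (Im \o h) v)); first exact: cvgD.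
  by apply/funext => v; rewrite /= ImD.
have /andP[h1 h2] := closure_hartogs cw.
have w20 : w2 w != 0.
  apply: contra_notN w0 => /eqP z; rewrite z normc0 in h1.
  have /eqP : normc (w1 w) = 0 by apply/eqP; rewrite eq_le h1 normc_ge0.
  rewrite normc_eq0 => /eqP z1; apply: C2_eq.
  - exact: (congr1 (fun x => Re x) z1).
  - exact: (congr1 (fun x => Im x) z1).
  - exact: (congr1 (fun x => Re x) z).
  - exact: (congr1 (fun x => Im x) z).
have s0 : 0 < normc (w2 w) by exact: normc_gt0.
pose eps := normc (w2 w) / 2; have e0 : 0 < eps by rewrite divr_gt0.
have es : eps ^+ 2 < sig w by rewrite /sig /eps; nra.
have reg v : closure H v -> eps ^+ 2 < sig v -> region 1 eps v.
  move=> /closure_hartogs/andP[k1 k2] k3; split; first by rewrite mul1r.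
  by rewrite k2 andbT -ler_sqr ?nnegrE ?normc_ge0 ?(ltW e0)//; exact: ltW.
have n3 : \forall v \near w, eps ^+ 2 < sig v by exact: (cvgr_gt _ (@continuous_sig R w) _ es).
have cs N := (wder_ser c p q N w20).1.
have wF (u : C2 R -> R) : {for w, continuous u} -> u @ F --> u w.
  by move=> cu; apply: cvg_trans cu; apply: cvg_app; exact: cvg_within.
apply: (hser_cvg ltr01 (lexx 1) e0 rc (reg w cw es)).
- by rewrite /F near_withinE; apply: filterS n3 => v k3 [cv _]; exact: reg.
- by move=> N; apply: wF; exact: (cs N).1.
- by move=> N; apply: wF; exact: (cs N).2.
Qed.

Lemma smooth_bergman f : smooth_upto H (closure H) f ->
  smooth_upto H (closure H `\ 0) (bergman_projection H f) /\ holomorphic H (bergman_projection H f).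
Proof.
move=> su; have wf k := smooth_upto_WW k su.
have rc := rapid_coef wf; have [M0 w0] := wf 0; have [lf _] := WW_L2 w0.
have pc := coef_polyb lf; have [_ hB] := bergman_in lf; split => //.
have eB w : H w -> bergman_projection H f w = hser (coef f) 0 0 w by exact: bergman_eq.
have dj g : hspan (coef f) g -> forall j, exists2 g', hspan (coef f) g' &
    forall w, H w -> cis_derive w (real_basis j) g (g' w).
  by move=> hg j; exact: hspan_derive.
split.
  apply: (smooth_class oH _ dj (hspan_hser (coef f) 0 0) eB).
  by move=> g hg w; exact: (hspan_continuous pc hg).
move=> s; have [h hh e] := partials_class oH dj s (hspan_hser (coef f) 0 0) eB.
(* The differentiated series also converges at the boundary points other than the origin, so it is
   itself the required extension. *)
exists h; split.
- by apply/subspace_continuousP => w Aw; case: (hspan_boundary rc hh Aw).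
- by apply/subspace_continuousP => w Aw; case: (hspan_boundary rc hh Aw).
- by move=> w Hw; rewrite e.
Qed.

End PartTwo.

(** * A compactly supported smooth function whose projection is not in [W^1] *)

Section PartThree.
Context {R : realType}.
Local Notation C := R[i].
Local Notation Cfun := (C2 R -> C).
Local Notation H := (@hartogs R).
Let mH := @measurable_hartogs R.
Let oH := @open_hartogs R.

Let f3 : Cfun := fun w => mono 0 (-1) w * chi (cut 2) (cut 2) w.

Let f3_elem : elem_test (@Ustar R) H f3.
Proof. by apply: elem_testM (elem_mono _ _) (chi_test _ _); exact: csupp01_cut. Qed.

Let f3_inner (a m : nat) : L2inner H f3 (Em a m) =
  cintegral H (Xf a%:Z (m%:Z - 1 - a%:Z) 0 (-1) (cut 2) (cut 2)).
Proof.
apply: eq_cintegral => w _; rewrite /f3 /Xf [RHS]mulrAC; congr (_ * _).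
exact: conj_Em.
Qed.

(** The cut-off is invariant under rotations, so by [Xf_orth] only the basis function with the
    exponents [0] and [-1] of [f3] itself is seen. *)
Let f3_coef0 (a m : nat) : (a, m) != (0, 0)%N -> coef f3 a m = 0.
Proof.
move=> ne; rewrite /coef f3_inner Xf_orth ?mul0r//; try exact: csupp01_cut.
apply: contra ne => /eqP[e1 e2]; rewrite xpair_eqE.
have a0 : a = 0%N by case: (a) e1.
by rewrite a0 eqxx /=; move: e2; rewrite a0 subr0 => /eqP; rewrite eq_sym subr_eq addNr => /eqP[->].
Qed.

Let f3_coef : coef f3 0 0 != 0.
Proof.
rewrite /coef f3_inner mulf_eq0 invr_eq0 (negbTE (sqnC_neq0 _ _)) orbF.
have c0 : csupp01 (@cut R 2) by exact: csupp01_cut.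
have i0 : 0 < I01 (@cut R 2) by exact: I01_gt0.
rewrite -[0%:Z]/(0 : int) (_ : 0 - 1 - 0 = -1 :> int)// norm_law// (_ : 0 - 1 + 1 = 0 :> int)//.
under [X in I01 X * _]eq_fun do rewrite expr0z mul1r.
under [X in _ * I01 X]eq_fun do rewrite expr0z mul1r.
by rewrite -normc_eq0 normc_real normr_eq0 gt_eqF// mulr_gt0 ?KH_gt0// mulr_gt0.
Qed.

(** Only the layer of degree zero contributes, so that the partial sums are constant from the first
    one on. *)
Let f3_hser w : H w -> hser (coef f3) 0 1 w = coef f3 0 0 * - (w2 w ^ (-2)).
Proof.
move=> Hw; have lf := elem_test_L2 f3_elem.
have h := polyb_cvg 0 1 (coef_polyb lf) Hw.
have e N : ser (coef f3) 0 1 N.+1 w = coef f3 0 0 * - (w2 w ^ (-2)).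
  rewrite /ser big_ord_recl big1 ?addr0 => [|n _]; last first.
    rewrite /layer big1// => a _; rewrite f3_coef0 ?mul0r// xpair_eqE negb_and.
    by case: (nat_of_ord a =P 0%N) => //= ->; rewrite subn0.
  rewrite /layer big_ord_recl big_ord0 addr0; congr (_ * _).
  by rewrite /tm /ffz big_ord_recl big_ord0 /= expr0 ffactn0 !subr0 !mul1r mulr1 mulrN1z mulN1r.
have h2 : (fun N => normc (ser (coef f3) 0 1 N.+1 w - hser (coef f3) 0 1 w)) @ \oo --> (0 : R).
  by have := (cvg_shiftS (fun N => normc (ser (coef f3) 0 1 N w - hser (coef f3) 0 1 w))) => ->.
have h3 : (fun N : nat => normc (ser (coef f3) 0 1 N.+1 w - hser (coef f3) 0 1 w)) @ \oo -->
    normc (coef f3 0 0 * - (w2 w ^ (-2)) - hser (coef f3) 0 1 w).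
  by under eq_fun do rewrite e; exact: cvg_cst.
have z : normc (coef f3 0 0 * - (w2 w ^ (-2)) - hser (coef f3) 0 1 w) = 0.
  exact: (cvg_unique (@norm_hausdorff _ _) h3 h2).
by move/eqP: z; rewrite normc_eq0 subr_eq0 => /eqP.
Qed.

(** For the exponents [0] and [-2] the norm law involves the cut-off integrals of [x^-1], which are
    unbounded. They would be bounded through the squared norm, because the cut-offs are at most
    1. *)
Lemma mono02_not_L2 : ~ L2 H (mono 0 (-2) : Cfun).
Proof.
move=> l; have c0 : csupp01 (@cut R 2) by exact: csupp01_cut.
have i0 : 0 < I01 (@cut R 2) by exact: I01_gt0.
have [n] := @I01_exprz_unbounded R (-1) (sqnorm H (mono 0 (-2) : Cfun) / (KH * I01 (@cut R 2))) isT.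
rewrite ltr_pdivrMr ?mulr_gt0 ?KH_gt0// ltNge => /negP; apply.
have cn : csupp01 (@cut R n) by exact: csupp01_cut.
have := norm_lawR 0 (-2) c0 cn; rewrite (_ : 0 - 2 + 1 = -1 :> int)//.
under [X in I01 X * _]eq_fun do rewrite expr0z mul1r.
rewrite mulrA mulrC => <-.
have tX : elem_test (@Ustar R) H (Xf 0 (-2) 0 (-2) (cut 2) (cut n)) by exact: Xf_test.
have [iX _] : cintegrable H (Xf 0 (-2) 0 (-2) (cut 2) (cut n) : Cfun).
  by have := L2_mul mH (L2_cst 1) (elem_test_L2 tX); under eq_fun do rewrite mul1r.
apply: le_Rintegral => //; last first.
- move=> w Hw; rewrite ler_piMr ?sqr_ge0//.
  exact: (mulr_ile1 (cut_ge0 _ _) (cut_ge0 _ _) (cut_le1 _ _) (cut_le1 _ _)).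
- exact: L2_integrable.
rewrite (_ : (fun w => _) = Re \o Xf 0 (-2) 0 (-2) (cut 2) (cut n))//.
by apply/funext => w; rewrite [RHS]/(Re (Xf _ _ _ _ _ _ w)) Xf_real.
Qed.

Lemma bergman_not_W1 : exists2 f : Cfun, test_function H f & ~ sobolev H 1 0 (bergman_projection H f).
Proof.
exists f3; first exact: (elem_test_function (@open_Ustar R)).
have lf := elem_test_L2 f3_elem.
move=> [cB dB /sobolev_norm_lty fin].
pose a2 : 'I_4 -> nat := incr mzero 2.
have a21 : (mdeg a2 <= 1)%N by rewrite mdeg_incr mdegE.
have [wD lD _] := sobolev_weakD dB fin a21.
have wh : weak_derivative H a2 (bergman_projection H f3) (hD (coef f3) a2).
  by apply: weak_hser; [exact: coef_polyb|move=> w Hw; exact: bergman_eq].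
have mh : cmeasurable H (hD (coef f3) a2) by case: wh => -[].
have e := ae_sqn_eq oH lD.1 mh (weak_unique oH wD wh).
have lh : L2 H (hD (coef f3) a2) by split => //; rewrite -e; case: lD.
apply: mono02_not_L2; apply: (eq_L2 _ (L2Z mH (- (coef f3 0 0)^-1) lh).1) => w Hw.
have e2 : hD (coef f3) a2 w = coef f3 0 0 * - (w2 w ^ (-2)) by exact: f3_hser Hw.
by rewrite e2 /mono expr0z mul1r mulNr mulrN mulrN opprK mulrA mulVf ?mul1r//; exact: f3_coef.
Qed.

End PartThree.

Theorem theorem2p3 (R : realType) :
  let H : set (C2 R) := hartogs in
  let B : (C2 R -> R[i]) -> (C2 R -> R[i]) := bergman_projection H in
  [/\ (forall k : nat,
         (forall f : C2 R -> R[i], sobolev H (2 * k + 1)%N 0 f ->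
            sobolev H k (2 * k)%N (B f) /\ holomorphic H (B f)) /\
         sobolev_continuous H (2 * k + 1)%N 0 k (2 * k)%N B),
      (forall f : C2 R -> R[i], smooth_upto H (closure H) f ->
         smooth_upto H (closure H `\ 0) (B f) /\ holomorphic H (B f)) &
      ~ (forall f : C2 R -> R[i], test_function H f ->
           sobolev H 1 0 (B f) /\ holomorphic H (B f))].
Proof.
move=> H B; split.
- move=> k; split; last exact: bergman_continuous.
  by move=> f; exact: sobolev_bergman.
- by move=> f; exact: smooth_bergman.
- move=> h; have [f tf nf] := @bergman_not_W1 R; apply: nf; exact: (h f tf).1.
Qed.
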